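(* Let $u_0\in H_0^1(\Omega)$, $u_1\in L^2(\Omega)$, $f\in H^{-\gamma_0}(0,T;L^2(\Omega))$, and let $U\in M_{h,\tau}$ be the solution of the discrete problem: $U(0)=R_hu_0$ and $$\langle \mathrm D_{0+}^{\gamma}(U-U(0)-t\Pi_hu_1),V\rangle_{H^{\gamma_0}(0,T;L^2(\Omega))}+\int_0^T\!\!\int_\Omega \nabla U\cdot\nabla V\,dx\,dt=\langle f,V\rangle_{H^{\gamma_0}(0,T;L^2(\Omega))}\quad\text{for all }V\in W_{h,\tau}.$$ Then there is a constant $C>0$ depending only on $\gamma$, $T$, $m$, $n$ and the shape regularity of $\mathcal K_h$ such that for each $1\le j\le J$ $$|U'|_{H^{\gamma_0}(0,t_j;L^2(\Omega))}+\|U(t_j)\|_{H_0^1(\Omega)}\le C\Big(\|u_0\|_{H_0^1(\Omega)}+t_j^{1/2-\gamma_0}\|u_1\|_{L^2(\Omega)}+\|f\|_{H^{-\gamma_0}(0,t_j;L^2(\Omega))}\Big).$$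
   Context: Parameters: $1<\gamma<2$, $\gamma_0=(\gamma-1)/2\in(0,1/2)$, $T>0$; $\Omega\subset\mathbb R^d$ ($d=2,3$) is a polygon/polyhedron; $m,n\in\mathbb N_{>0}$; $\|v\|_{H_0^1(\Omega)}=\|\nabla v\|_{L^2(\Omega)}$. Time grid: for $\sigma\ge1$, $J\in\mathbb N_{>0}$, $t_j=(j/J)^\sigma T$ ($0\le j\le J$), $\tau_j=t_j-t_{j-1}$, $I_j=(t_{j-1},t_j)$, $\tau=\tau_J$. Discrete spaces: $\mathcal K_h$ is a triangulation of $\Omega$ by $d$-simplexes of maximal diameter $h$. $S_h=\{v_h\in H_0^1(\Omega): v_h|_K\in P_n(K)\ \forall K\in\mathcal K_h\}$, $\Sigma_h=\{v_h\in H^1(\Omega): v_h|_K\in P_n(K)\ \forall K\in\mathcal K_h\}$, $M_{h,\tau}=\{V\in H^1(0,T;S_h): V|_{I_j}\in P_m(I_j;S_h),\ 1\le j\le J\}$, $W_{h,\tau}=\{V\in L^2(0,T;S_h): V|_{I_j}\in P_{m-1}(I_j;S_h),\ 1\le j\le J\}$, where $P_k(I;X)$ denotes $X$-valued polynomials of degree $\le k$. $\Pi_h$ is the $L^2(\Omega)$-orthogonal projection onto $\Sigma_h$; $R_h:H_0^1(\Omega)\to S_h$ is the Ritz projection, $\int_\Omega\nabla(v-R_hv)\cdot\nabla v_h=0$ for all $v_h\in S_h$. Fractional norms: for $0<\alpha<1/2$, an interval $\mathcal O$ and scalar $v\in H^\alpha(\mathcal O)$, $|v|_{H^\alpha(\mathcal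 O)}=\big(\int_{\mathbb R}|\xi|^{2\alpha}|\mathcal F(v\chi_{\mathcal O})(\xi)|^2d\xi\big)^{1/2}$, with $\mathcal F$ the Fourier transform on $L^2(\mathbb R)$ and $v\chi_{\mathcal O}$ the extension by zero. For a separable Hilbert space $X$ with orthonormal basis $(e_k)$, $H^\alpha(\mathcal O;X)$ consists of $v\in L^2(\mathcal O;X)$ with $\sum_k\|(v,e_k)_X\|_{H^\alpha(\mathcal O)}^2<\infty$, and $|v|_{H^\alpha(\mathcal O;X)}=\big(\sum_k|(v,e_k)_X|_{H^\alpha(\mathcal O)}^2\big)^{1/2}$. $H^{-\gamma_0}(\mathcal O;X)$ is the dual of $H^{\gamma_0}(\mathcal O;X)$ endowed with $|\cdot|_{H^{\gamma_0}(\mathcal O;X)}$, with the dual norm; $\langle\cdot,\cdot\rangle_{H^{\gamma_0}(\mathcal O;X)}$ is the duality pairing. For $f\in H^{-\gamma_0}(0,T;X)$ its restriction to $(0,t_j)$ acts on $v\in H^{\gamma_0}(0,t_j;X)$ through the extension of $v$ by zero to $(0,T)$. Fractional derivatives (Riemann–Liouville): $(\mathrm I_{a+}^\alpha v)(t)=\frac1{\Gamma(\alpha)}\int_a^t(t-s)^{\alpha-1}v(s)ds$, $(\mathrm I_{b-}^\alpha v)(t)=\frac1{\Gamma(\alpha)}\int_t^b(s-t)^{\alpha-1}v(s)ds$; for $k-1<\alpha<k$, $\mathrm D_{a+}^\alpha=\mathrm D^k\mathrm I_{a+}^{k-\alpha}$, $\mathrm D_{b-}^\alpha=(-1)^k\mathrm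 D^k\mathrm I_{b-}^{k-\alpha}$, with $\mathrm D$ the distributional derivative. Here $\mathrm D_{0+}^\gamma(U-U(0)-t\Pi_hu_1)=\mathrm D_{0+}^{2\gamma_0}(U'-\Pi_hu_1)$, and $\mathrm D_{0+}^{2\gamma_0}$ maps $H^{\gamma_0}(0,T;L^2(\Omega))$ into its dual via $\langle\mathrm D_{0+}^{2\gamma_0}v,w\rangle_{H^{\gamma_0}(0,T;L^2(\Omega))}=\int_0^T(\mathrm D_{0+}^{\gamma_0}v,\mathrm D_{T-}^{\gamma_0}w)_{L^2(\Omega)}dt$. *)

(* Defs.v *)
From HB Require Import structures.
From mathcomp Require Import all_boot all_order all_algebra.
From mathcomp Require Import all_classical all_reals all_analysis.
Set Implicit Arguments.
Unset Strict Implicit.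
Unset Printing Implicit Defensive.
Import Order.TTheory GRing.Theory Num.Theory.
Import numFieldNormedType.Exports.
Local Open Scope classical_set_scope.
Local Open Scope ring_scope.

Section MeasurableRow.
Context {R : realType} {n : nat}.

(* Points of R^n are row vectors, with the Borel (product) sigma-algebra, i.e. the
   one generated by the coordinate maps. *)
Definition row_coord (i : 'I_n) (x : 'rV[R]_n) : measurableTypeR R := x 0 i.

Let row_set0 : g_sigma_preimage row_coord set0.
Proof. exact: sigma_algebra0. Qed.

Let row_setC A : g_sigma_preimage row_coord A -> g_sigma_preimage row_coord (~` A).
Proof. exact: sigma_algebraC. Qed.

Let row_bigcup (F : _^nat) : (forall i, g_sigma_preimage row_coord (F i)) ->
  g_sigma_preimage row_coord (\bigcup_i (F i)).
Proof. exact: sigma_algebra_bigcup. Qed.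

Definition row_display : measure_display. Proof. exact: default_measure_display. Qed.

HB.instance Definition _ := @isMeasurable.Build row_display
  'rV[R]_n (g_sigma_preimage row_coord) row_set0 row_setC row_bigcup.
End MeasurableRow.

Lemma measurable_row_coord (R : realType) n (i : 'I_n) :
  measurable_fun [set: 'rV[R]_n] (@row_coord R n i).
Proof.
move=> _ Y mY; rewrite setTI; apply: sub_sigma_algebra => /=.
rewrite -bigcup_seq/=; exists i => /=; first by rewrite mem_index_enum.
by exists Y => //; rewrite setTI.
Qed.

Lemma measurable_fun_rowP d (T : measurableType d) (R : realType) n (f : T -> 'rV[R]_n) :
  (forall i, measurable_fun [set: T] (row_coord i \o f)) -> measurable_fun [set: T] f.
Proof.
move=> mf.
suff H : g_sigma_preimage (fun i => row_coord i \o f) `<=` measurable.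
  move=> _ A mA; apply: H; rewrite g_sigma_preimage_comp; exists A => //.
apply: smallest_sub; first exact: sigma_algebra_measurable.
case: n => [|n] in f mf *; first by rewrite big_ord0.
rewrite -bigcup_mkord_ord; apply: bigcup_sub => i Ii.
by move=> A [B mB <-]; exact: mf.
Qed.

Section LebesgueRow.
Context {R : realType}.

Definition cons_row n (p : measurableTypeR R * 'rV[R]_n) : 'rV[R]_n.+1 :=
  \row_i oapp (fun j => p.2 0 j) p.1 (unlift ord0 i).

Definition uncons_row n (x : 'rV[R]_n.+1) : measurableTypeR R * 'rV[R]_n :=
  (x 0 ord0, \row_j x 0 (lift ord0 j)).

Lemma cons_rowK n : cancel (@cons_row n) (@uncons_row n).
Proof.
move=> [a x]; rewrite /uncons_row mxE unlift_none /=; congr pair.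
by apply/rowP => j; rewrite !mxE liftK.
Qed.

Lemma measurable_cons_row n : measurable_fun setT (@cons_row n).
Proof.
apply: measurable_fun_rowP => i; rewrite /row_coord.
case: (unliftP ord0 i) => [j|] ->.
- rewrite (_ : _ \o _ = row_coord j \o snd).
    exact: (measurableT_comp (@measurable_row_coord R n j)).
  by apply/funext => p /=; rewrite mxE liftK.
- rewrite (_ : _ \o _ = fst) //.
  by apply/funext => p /=; rewrite mxE unlift_none.
Qed.

Lemma measurable_uncons_row n : measurable_fun setT (@uncons_row n).
Proof.
apply/measurable_fun_pairP; split.
- exact: (@measurable_row_coord R n.+1 ord0).
- apply: measurable_fun_rowP => j.
  rewrite (_ : _ \o _ = row_coord (lift ord0 j)); first exact: measurable_row_coord.
  by apply/funext => x /=; rewrite /row_coord mxE.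
Qed.

Section lebesgue_row_step.
Variables (n : nat) (mu : {sigma_finite_measure set 'rV[R]_n -> \bar R}).

Definition lebesgue_row_step : set 'rV[R]_n.+1 -> \bar R :=
  pushforward (@lebesgue_measure R \x mu)%E (@cons_row n).

Let step0 : lebesgue_row_step set0 = 0%E.
Proof. by rewrite /lebesgue_row_step /pushforward preimage_set0 measure0. Qed.

Let step_ge0 A : (0 <= lebesgue_row_step A)%E.
Proof. by rewrite /lebesgue_row_step /pushforward; apply: (@measure_ge0 _ _ _ (@lebesgue_measure R \x mu)%E). Qed.

Let step_sigma_additive : semi_sigma_additive lebesgue_row_step.
Proof.
move=> F mF tF mUF; rewrite /lebesgue_row_step /pushforward preimage_bigcup.
have mpre A : measurable A -> measurable (@cons_row n @^-1` A).
  by move=> mA; rewrite -[X in measurable X]setTI; exact: measurable_cons_row.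
apply: (@measure_semi_sigma_additive _ _ _ (@lebesgue_measure R \x mu)%E).
- by move=> k; exact: mpre.
- apply/trivIsetP => /= i j _ _ ij; rewrite -preimage_setI.
  by move/trivIsetP : tF => /(_ _ _ _ _ ij) ->//; rewrite preimage_set0.
- by rewrite -preimage_bigcup; exact: mpre.
Qed.

HB.instance Definition _ := isMeasure.Build _ _ _ lebesgue_row_step
  step0 step_ge0 step_sigma_additive.

Let step_sigma_finite : sigma_finite setT lebesgue_row_step.
Proof.
have /sigma_finiteP[F [TF ndF Foo]] := sigma_finiteT (@lebesgue_measure R).
have /sigma_finiteP[G [TG ndG Goo]] := sigma_finiteT mu.
exists (fun k => @uncons_row n @^-1` (F k `*` G k)).
  rewrite -preimage_bigcup predeqE => x; split => // _.
  have : [set: R] (uncons_row x).1 by [].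
  have : [set: 'rV[R]_n] (uncons_row x).2 by [].
  rewrite TF TG => -[k _ Gk] [l _ Fl]; exists (maxn l k) => //; split.
  - by move: Fl; exact/subsetPset/ndF/leq_maxl.
  - by move: Gk; exact/subsetPset/ndG/leq_maxr.
move=> k; have [mF Fk] := Foo k; have [mG Gk] := Goo k; split.
  rewrite -[X in measurable X]setTI; apply: measurable_uncons_row => //.
  exact: measurableX.
rewrite /lebesgue_row_step /pushforward.
rewrite (_ : _ @^-1` _ = F k `*` G k); last first.
  by rewrite -comp_preimage (_ : _ \o _ = id) //; apply/funext/cons_rowK.
by rewrite product_measure1E// lte_mul_pinfty// ge0_fin_numE.
Qed.

HB.instance Definition _ := Measure_isSigmaFinite.Build _ _ _
  lebesgue_row_step step_sigma_finite.

End lebesgue_row_step.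

(* Iterated product of the Lebesgue measure of R. *)
Fixpoint lebesgue_row n : {sigma_finite_measure set 'rV[R]_n -> \bar R} :=
  if n is n'.+1 return {sigma_finite_measure set 'rV[R]_n -> \bar R}
  then lebesgue_row_step (lebesgue_row n') else dirac (0 : 'rV[R]_0).

End LebesgueRow.

(* Elements of L^2(Omega) and of its subspaces are represented by functions
   'rV[R]_d -> R, of which only the class modulo equality almost everywhere
   on Omega matters. *)

Section SpaceDomain.
Context {R : realType} {d : nat}.
Local Notation E := 'rV[R]_d.
Local Notation leb := (lebesgue_row d).
Implicit Types (Om : set E) (v w g phi : E -> R).

Definition L2 Om : set (E -> R) :=
  [set v : E -> R | measurable_fun Om v /\ (\int[leb]_(x in Om) ((v x) ^+ 2)%:E < +oo)%E].

Definition ipL2 Om v w : R := \int[leb]_(x in Om) (v x * w x).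

Definition normL2 Om v : R := Num.sqrt (ipL2 Om v v).

Definition eqL2 Om v w : Prop := {ae leb, forall x, Om x -> v x = w x}.

Definition pderiv (i : 'I_d) (f : E -> R) : E -> R :=
  fun x => 'D_(delta_mx 0 i) f x.

(* C^oo: every iterated partial derivative is differentiable everywhere. *)
Definition smooth (f : E -> R) : Prop :=
  forall (s : seq 'I_d) (x : E), differentiable (foldr pderiv f s) x.

Definition test_fun Om : set (E -> R) :=
  [set phi : E -> R | [/\ smooth phi, compact (closure [set x | phi x != 0])
                & closure [set x | phi x != 0] `<=` Om]].

Definition weak_pderiv Om (i : 'I_d) v g : Prop :=
  L2 Om g /\
  forall phi, test_fun Om phi -> ipL2 Om v (pderiv i phi) = - ipL2 Om g phi.

(* A representative of the weak i-th partial derivative of v (unique almost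
   everywhere on Om), if v has one in L^2. *)
Definition wpderiv Om (i : 'I_d) v : E -> R :=
  xget (fun=> 0) [set g : E -> R | weak_pderiv Om i v g].

Definition H1 Om : set (E -> R) :=
  [set v : E -> R | L2 Om v /\ forall i, exists g, weak_pderiv Om i v g].

(* Closure of the test functions for the H^1 norm. *)
Definition H10 Om : set (E -> R) :=
  [set v : E -> R | H1 Om v /\ forall eps : R, 0 < eps -> exists phi,
    [/\ test_fun Om phi, normL2 Om (v \- phi) < eps
      & forall i, normL2 Om (wpderiv Om i v \- pderiv i phi) < eps]].

Definition ipgrad Om v w : R :=
  \sum_(i < d) ipL2 Om (wpderiv Om i v) (wpderiv Om i w).

Definition normH10 Om v : R := Num.sqrt (ipgrad Om v v).

Definition orthonormal_basis_L2 Om (e : nat -> E -> R) : Prop :=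
  [/\ forall k, L2 Om (e k),
      forall k l, ipL2 Om (e k) (e l) = (k == l)%:R
    & forall v, L2 Om v -> forall eps : R, 0 < eps -> exists (N : nat) (c : nat -> R),
        normL2 Om (fun x => v x - \sum_(k < N) c k * e k x) < eps].

End SpaceDomain.

Section Mesh.
Context {R : realType} {d : nat}.
Local Notation E := 'rV[R]_d.
Local Notation leb := (lebesgue_row d).

Definition eucl (x : E) : R := Num.sqrt (\sum_i x 0 i ^+ 2).

(* A simplex is given by its d + 1 vertices, the rows of K. *)
Implicit Types (K L : 'M[R]_(d.+1, d)) (S : {set 'I_d.+1}).

Definition nondegenerate K : bool :=
  row_free (\matrix_(i < d) (row (lift ord0 i) K - row ord0 K)).

(* The closed convex hull of the vertices with index in S (empty if S is). *)
Definition face K S : set E :=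
  [set x | exists lam : 'I_d.+1 -> R,
    [/\ forall i, 0 <= lam i, forall i, i \notin S -> lam i = 0,
        \sum_i lam i = 1 & x = \sum_i lam i *: row i K]].

Definition simplex K : set E := face K [set: 'I_d.+1].

Definition diam K : R :=
  sup [set r | exists x y, [/\ simplex K x, simplex K y & r = eucl (x - y)]].

Definition inradius K : R :=
  sup [set r | 0 <= r /\
    exists c, forall x, eucl (x - c) <= r -> simplex K x].

Implicit Types (Om : set E) (Ks : seq 'M[R]_(d.+1, d)).

Definition simplicial_cover Om Ks : Prop :=
  (forall K, K \in Ks -> nondegenerate K) /\
  closure Om = \bigcup_(K in [set` Ks]) simplex K.

(* Bounded polygonal (polyhedral) domains. *)
Definition polytopal_domain Om : Prop :=
  [/\ open Om, Om !=set0, connected Om, interior (closure Om) = Om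
    & exists Ks, simplicial_cover Om Ks].

(* Conforming: two simplices meet in a (possibly empty) common face. *)
Definition triangulation Om Ks : Prop :=
  simplicial_cover Om Ks /\
  forall K L, K \in Ks -> L \in Ks -> exists S S' : {set 'I_d.+1},
    simplex K `&` simplex L = face K S /\ face K S = face L S'.

(* rho bounds the ratio of the diameter of each simplex to that of its
   largest inscribed ball. *)
Definition shape_regular (rho : R) Ks : Prop :=
  forall K, K \in Ks -> diam K <= rho * (2 * inradius K).

Implicit Types v w p : E -> R.

Definition poly_fun (n : nat) p : Prop :=
  exists c : {ffun 'I_d -> 'I_n.+1} -> R,
    p = fun x => \sum_(a : {ffun 'I_d -> 'I_n.+1} | (\sum_i a i <= n)%N)
                   c a * \prod_i x 0 i ^+ a i.

Definition piecewise_poly Ks (n : nat) v : Prop :=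
  forall K, K \in Ks -> exists2 p, poly_fun n p & eqL2 (simplex K) v p.

Definition fe_space0 Om Ks (n : nat) : set (E -> R) :=
  [set v : E -> R | H10 Om v /\ piecewise_poly Ks n v].

Definition fe_space Om Ks (n : nat) : set (E -> R) :=
  [set v : E -> R | H1 Om v /\ piecewise_poly Ks n v].

Definition Ritz_projection Om Ks (n : nat) (Rh : (E -> R) -> E -> R) : Prop :=
  forall v, H10 Om v -> fe_space0 Om Ks n (Rh v) /\
    forall w, fe_space0 Om Ks n w -> ipgrad Om (v \- Rh v) w = 0.

Definition L2_projection Om Ks (n : nat) (Pih : (E -> R) -> E -> R) : Prop :=
  forall v, L2 Om v -> fe_space Om Ks n (Pih v) /\
    forall w, fe_space Om Ks n w -> ipL2 Om (v \- Pih v) w = 0.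

End Mesh.

Section ScalarTime.
Context {R : realType}.
Local Notation mu := (@lebesgue_measure R).
Implicit Types (O : set R) (v w g phi : R -> R) (a b alpha : R).

(* Square of the Sobolev-Slobodeckij norm of H^alpha(O), 0 < alpha < 1; the
   integrand vanishes for s = t since 0^-1 = 0. *)
Definition sobolev_norm2 alpha O v : \bar R :=
  (\int[mu]_(t in O) ((v t) ^+ 2)%:E +
   \int[mu]_(s in O) \int[mu]_(t in O)
     ((v s - v t) ^+ 2 / `|s - t| `^ (1 + 2 * alpha))%:E)%E.

(* Real and imaginary part of the (unitary) Fourier transform of the extension
   by zero of v, for v in L^2(O) and O bounded: such an extension is in L^1, so
   that the transform is given by the integral. *)
Definition fourier_re O v (xi : R) : R :=
  (Num.sqrt (2 * pi))^-1 * \int[mu]_(t in O) (v t * cos (xi * t)).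

Definition fourier_im O v (xi : R) : R :=
  - (Num.sqrt (2 * pi))^-1 * \int[mu]_(t in O) (v t * sin (xi * t)).

Definition fourier_norm2 alpha O v : \bar R :=
  (\int[mu]_xi (`|xi| `^ (2 * alpha) *
     (fourier_re O v xi ^+ 2 + fourier_im O v xi ^+ 2))%:E)%E.

Definition Gamma (alpha : R) : R :=
  \int[mu]_(s in `]0, +oo[) (s `^ (alpha - 1) * expR (- s)).

(* Riemann-Liouville integrals, left-sided from a and right-sided to b. *)
Definition RL_left alpha a v (t : R) : R :=
  (Gamma alpha)^-1 * \int[mu]_(s in `]a, t[) ((t - s) `^ (alpha - 1) * v s).

Definition RL_right alpha b v (t : R) : R :=
  (Gamma alpha)^-1 * \int[mu]_(s in `]t, b[) ((s - t) `^ (alpha - 1) * v s).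

Definition test_fun1 a b : set (R -> R) :=
  [set phi : R -> R | [/\ forall (k : nat) (t : R), derivable (derive1n k phi) t 1,
                  compact (closure [set t | phi t != 0])
                & closure [set t | phi t != 0] `<=` `]a, b[%classic]].

Definition distr_deriv a b w g : Prop :=
  forall phi, test_fun1 a b phi ->
    \int[mu]_(t in `]a, b[) (w t * derive1 phi t) =
    - \int[mu]_(t in `]a, b[) (g t * phi t).

End ScalarTime.

Section VectorTime.
Context {R : realType} {d : nat}.
Local Notation E := 'rV[R]_d.
Local Notation leb := (lebesgue_row d).
Local Notation mu := (@lebesgue_measure R).
Variable Om : set E.
Implicit Types (O : set R) (v w V W : R -> E -> R) (a b alpha T : R).

Definition simple_vfun v : Prop :=
  exists (N : nat) (A : 'I_N -> set R) (g : 'I_N -> E -> R),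
    [/\ forall i, measurable (A i), forall i, L2 Om (g i)
      & v = fun t x => \sum_i \1_(A i) t * g i x].

Definition strongly_measurable O v : Prop :=
  exists s : nat -> R -> E -> R, (forall k, simple_vfun (s k)) /\
    {ae mu, forall t, O t ->
      (fun k => normL2 Om (v t \- s k t)) @ \oo --> (0 : R)}.

(* The Bochner space L^2(O; L^2(Om)). *)
Definition L2t O : set (R -> E -> R) :=
  [set v : R -> E -> R | [/\ {ae mu, forall t, O t -> L2 Om (v t)}, strongly_measurable O v
              & (\int[mu]_(t in O) ((normL2 Om (v t)) ^+ 2)%:E < +oo)%E]].

(* H^alpha(O; L^2(Om)) and |.|_{H^alpha(O; L^2(Om))}, by means of an orthonormal
   basis e of L^2(Om). *)
Definition Ht alpha O (e : nat -> E -> R) : set (R -> E -> R) :=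
  [set v : R -> E -> R | L2t O v /\
    (\sum_(k <oo) sobolev_norm2 alpha O (fun t => ipL2 Om (v t) (e k)) < +oo)%E].

Definition normHt alpha O (e : nat -> E -> R) v : \bar R :=
  ((\sum_(k <oo) fourier_norm2 alpha O (fun t => ipL2 Om (v t) (e k)))
    `^ (2^-1))%E.

(* F belongs to the dual H^{-alpha}(O; L^2(Om)); the values of F outside of
   H^alpha(O; L^2(Om)) are irrelevant. *)
Definition dualHt alpha O (e : nat -> E -> R) (F : (R -> E -> R) -> R) : Prop :=
  (forall (c : R) v w, Ht alpha O e v -> Ht alpha O e w ->
     F (fun t x => c * v t x + w t x) = c * F v + F w) /\
  exists M : R, forall v, Ht alpha O e v ->
    (`|F v|%:E <= M%:E * normHt alpha O e v)%E.

(* The norm in H^{-alpha}(O; L^2(Om)) of the restriction of F to O. *)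
Definition dual_normHt alpha O (e : nat -> E -> R) (F : (R -> E -> R) -> R)
    : \bar R :=
  ereal_sup [set `|F (fun t x => \1_O t * v t x)|%:E |
    v in [set v : R -> E -> R | Ht alpha O e v /\ (normHt alpha O e v <= 1)%E]].

(* W is the L^2(0, b - a; L^2(Om)) distributional derivative of V on (a, b); the
   identity between L^2(Om)-valued integrals is tested against L^2(Om). *)
Definition weak_tderiv a b V W : Prop :=
  L2t `]a, b[ W /\
  forall g, L2 Om g ->
    distr_deriv a b (fun t => ipL2 Om (V t) g) (fun t => ipL2 Om (W t) g).

Definition tderiv a b V : R -> E -> R :=
  xget (fun _ _ => 0) [set W : R -> E -> R | weak_tderiv a b V W].

(* D_{a+}^alpha v and D_{b-}^alpha v on (a, b), for 0 < alpha < 1 and v such that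
   they are in L^2(a, b; L^2(Om)): (distributional) derivatives of the
   Riemann-Liouville integrals of order 1 - alpha. *)
Definition fracD_left alpha a b v : R -> E -> R :=
  xget (fun _ _ => 0) [set w : R -> E -> R | L2t `]a, b[ w /\
    forall g, L2 Om g ->
      distr_deriv a b (RL_left (1 - alpha) a (fun t => ipL2 Om (v t) g))
        (fun t => ipL2 Om (w t) g)].

Definition fracD_right alpha a b v : R -> E -> R :=
  xget (fun _ _ => 0) [set w : R -> E -> R | L2t `]a, b[ w /\
    forall g, L2 Om g ->
      distr_deriv a b (RL_right (1 - alpha) b (fun t => ipL2 Om (v t) g))
        (fun t => - ipL2 Om (w t) g)].

(* The duality pairing < D_{0+}^{2 alpha} v, w > on (0, T). *)
Definition fracD_pairing alpha T v w : R :=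
  \int[mu]_(t in `]0, T[)
    ipL2 Om (fracD_left alpha 0 T v t) (fracD_right alpha 0 T w t).

End VectorTime.

Section Discrete.
Context {R : realType} {d : nat}.
Local Notation E := 'rV[R]_d.
Local Notation mu := (@lebesgue_measure R).

Definition tgrid (T sigma : R) (J j : nat) : R := (j%:R / J%:R) `^ sigma * T.

Definition tcell (T sigma : R) (J j : nat) : set R :=
  `]tgrid T sigma J j.-1, tgrid T sigma J j[%classic.

Variables (Om : set E) (Ks : seq 'M[R]_(d.+1, d)) (n m : nat).
Variables (T sigma : R) (J : nat).
Implicit Types V W U : R -> E -> R.

Local Notation Sh := (fe_space0 Om Ks n).

(* The restriction of V to O belongs to P_k(O; S_h). *)
Definition tpoly (k : nat) (O : set R) V : Prop :=
  exists c : 'I_k.+1 -> E -> R, (forall i, Sh (c i)) /\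
    {ae mu, forall t, O t ->
      eqL2 Om (V t) (fun x => \sum_(i < k.+1) t ^+ i * c i x)}.

Definition piecewise_tpoly (k : nat) V : Prop :=
  forall j, (1 <= j <= J)%N -> tpoly k (tcell T sigma J j) V.

(* L^2(0, T; S_h); all norms on S_h are equivalent. *)
Definition L2tSh : set (R -> E -> R) :=
  [set V : R -> E -> R | L2t Om `]0, T[ V /\ {ae mu, forall t, `]0, T[%classic t -> Sh (V t)}].

(* H^1(0, T; S_h), every element being represented by its representative that is
   continuous on [0, T]. *)
Definition H1tSh : set (R -> E -> R) :=
  [set V : R -> E -> R | [/\ L2tSh V,
    exists W, L2tSh W /\ weak_tderiv Om 0 T V W,
    forall t, 0 <= t <= T -> Sh (V t)
  & forall t, 0 <= t <= T -> forall eps : R, 0 < eps ->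
      exists2 delta : R, 0 < delta &
        forall s, 0 <= s <= T -> `|s - t| < delta ->
          normL2 Om (V s \- V t) < eps]].

Definition trial_space : set (R -> E -> R) :=
  [set V : R -> E -> R | H1tSh V /\ piecewise_tpoly m V].

Definition test_space : set (R -> E -> R) :=
  [set V : R -> E -> R | L2tSh V /\ piecewise_tpoly m.-1 V].

(* D_{0+}^gamma (U - U(0) - t Pi_h u_1) is D_{0+}^{2 gamma_0} (U' - Pi_h u_1),
   with gamma_0 = (gamma - 1) / 2. *)
Definition discrete_solution (gamma : R) (Rh Pih : (E -> R) -> E -> R)
    (u0 u1 : E -> R) (F : (R -> E -> R) -> R) U : Prop :=
  [/\ trial_space U, eqL2 Om (U 0) (Rh u0)
    & forall V, test_space V ->
        fracD_pairing Om ((gamma - 1) / 2) T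
          (fun t x => tderiv Om 0 T U t x - Pih u1 x) V +
        \int[mu]_(t in `]0, T[) ipgrad Om (U t) (V t) = F V].

End Discrete.

(* Main.v *)
Require Import Defs.
From HB Require Import structures.
From mathcomp Require Import all_boot all_order all_algebra.
From mathcomp Require Import all_classical all_reals all_analysis.
From mathcomp Require Import measurable_realfun ring lra.
Import Order.TTheory GRing.Theory Num.Theory.
Import numFieldNormedType.Exports.
Set Implicit Arguments.
Unset Strict Implicit.
Unset Printing Implicit Defensive.
Local Open Scope classical_set_scope.
Local Open Scope ring_scope.

(** The velocity U' of a discrete solution is a piecewise polynomial, hence a
    function of bounded variation in time, and the estimate follows from testing
    the discrete equation with the truncated velocity V, equal to U' on
    ]0, t_j[ and to 0 afterwards. This V is an admissible test function because
    the test space is discontinuous in time and one degree lower.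

    - The stiffness term is the integral of half the derivative of
      ||grad U||^2 over ]0, t_j[, by the fundamental theorem of calculus on each
      cell (integral_ipgrad_truncated).
    - The fractional term is coercive (fracD_pairing_coercive): the derivatives
      of order al = gamma_0 of a jump sum t |-> int_{a <= t} q dnu are, up to the
      factor 1 / Gamma(1 - al), the potentials int q(a) (t - a)_+^(-al) dnu(a)
      and - int q(a) (a - t)_+^(-al) dnu(a). The values of U' after t_j do not
      enter the pairing with V, because the first potential only depends on the
      past and the second one vanishes after t_j.
    - When q dnu has total mass 0, three quantities are multiples of, or bounded
      by a multiple of, the one energy - intint q(a) q(b) |a - b|^(1 - 2 al): the
      pairing of the two potentials (a Beta integral), the squared L^2 norm of
      the second potential, and the squared Fourier norm of order al. The last
      two are instances of one isometry principle (isometry_superposition),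
      which replaces Plancherel's theorem.
    - Functions with values in L^2(Omega) are treated by finite sums
      sum_p phi_p(t) g_p(x). Parseval's identity for an orthonormal basis writes
      the Gram form of such a sum as a series of scalar energies, so that the
      scalar identities carry over (gram_form_cvg).
    - The initial velocity contributes the kernel t^(-al) of a constant, of
      which the square has integral t_j^(1 - 2 al) / (1 - 2 al) up to t_j; this is
      where the weight of u_1 comes from, and Young's inequality absorbs the
      other factor into the energy (initial_velocity_le).
    - The load is bounded by the dual norm times the norm of V, by homogeneity
      (dual_normHt_truncated).

    The weak and the fractional derivatives are defined by choosing
    representatives; the lemma of du Bois-Reymond, in time and in space, shows
    that the choice is immaterial (weak_solution_unique, weak_pderiv_unique). *)

(** * Almost everywhere equality under the integral *)

(** With these two instances almost everywhere statements combine as filters. *)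
Global Instance ae_lebesgue_filter (R : realType) :
  Filter (nbhs (almost_everywhere (@lebesgue_measure R))).
Proof. exact: (ae_filter_ringOfSetsType (@lebesgue_measure R)). Qed.

Global Instance ae_lebesgue_row_filter (R : realType) d :
  Filter (nbhs (almost_everywhere (@lebesgue_row R d))).
Proof. exact: (ae_filter_ringOfSetsType (@lebesgue_row R d)). Qed.

Section IntegralAeEq.
Context d (T : measurableType d) {R : realType}.
Variable m : {measure set T -> \bar R}.
Import HBNNSimple.

Let nnintegral_ae_le (f g : T -> \bar R) (N : set T) : measurable N -> m N = 0 ->
  (forall x, 0 <= f x)%E -> (forall x, 0 <= g x)%E -> (forall x, ~ N x -> f x = g x) ->
  (\int[m]_x f x <= \int[m]_x g x)%E.
Proof.
move=> mN N0 f0 g0 fg; rewrite !ge0_integralTE//; apply: ge_ereal_sup => _ [h hf <-].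
apply: ereal_sup_ubound; exists (proj_nnsfun h (measurableC mN)) => [x|].
  rewrite /= mindicE; have [xN|xN] := pselect (N x).
    by rewrite memNset ?mulr0//; exact.
  by rewrite mem_set// mulr1 -fg.
rewrite -!integralT_nnsfun; apply: ge0_ae_eq_integral => //.
- by apply/measurable_EFinP.
- by apply/measurable_EFinP.
- by move=> x _; rewrite lee_fin.
- by move=> x _; rewrite lee_fin.
exists N; split => // x /= H; apply: contrapT => xN; apply: H => _.
by rewrite mindicE mem_set// mulr1.
Qed.

(** Neither function has to be measurable: representatives of Bochner classes
    need not be Borel. *)
Lemma integral_ae_eq_any (D : set T) (f g : T -> \bar R) :
  {ae m, forall x, D x -> f x = g x} ->
  (\int[m]_(x in D) f x = \int[m]_(x in D) g x)%E.
Proof.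
move=> [N [mN N0 fgN]].
have E x : ~ N x -> (f \_ D) x = (g \_ D) x.
  move=> xN; rewrite !patchE; case: ifPn => // /[!inE] xD.
  by apply: contrapT => fgx; apply: xN; apply: fgN => /= /(_ xD).
rewrite integral_mkcond [RHS]integral_mkcond integralE [RHS]integralE.
congr (_ - _)%E; apply/eqP; rewrite eq_le; apply/andP; split;
  apply: (nnintegral_ae_le mN N0) => // x xN.
- by rewrite !funeposE E.
- by rewrite !funeposE E.
- by rewrite !funenegE E.
- by rewrite !funenegE E.
Qed.

Lemma Rintegral_ae_eq_any (D : set T) (f g : T -> R) :
  {ae m, forall x, D x -> f x = g x} ->
  \int[m]_(x in D) f x = \int[m]_(x in D) g x.
Proof.
move=> fg; congr fine; apply: integral_ae_eq_any.
by apply: filterS fg => x h xD; rewrite h.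
Qed.

Lemma integrable_ae_eq (D : set T) (f g : T -> R) : measurable D ->
  measurable_fun D g -> {ae m, forall x, D x -> f x = g x} ->
  m.-integrable D (fun x => (f x)%:E) -> m.-integrable D (fun x => (g x)%:E).
Proof.
move=> mD mg fg /integrableP[_ fi]; apply/integrableP; split.
  exact/measurable_EFinP.
apply: le_lt_trans fi; rewrite le_eqVlt; apply/orP; left; apply/eqP.
by apply: integral_ae_eq_any; apply: filterS fg => x h xD; rewrite h.
Qed.

End IntegralAeEq.

Lemma ae_lebesgue_neq (R : realType) (c : R) :
  {ae @lebesgue_measure R, forall x, x != c}.
Proof.
exists [set c]; split => //; first by rewrite lebesgue_measure_set1.
by move=> x /= /negP; rewrite negbK => /eqP.
Qed.

(** * Changes of variables and the fundamental theorem of calculus *)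

Section AffineChange.
Context {R : realType}.
Local Notation mu := (@lebesgue_measure R).

Lemma ge0_integral_affine (a b : R) (f : R -> \bar R) : 0 < b ->
  measurable_fun [set: R] f -> (forall x, 0 <= f x)%E ->
  (b%:E * \int[mu]_x f (a + b * x)%R = \int[mu]_x f x)%E.
Proof.
move=> b0 mf f0.
pose phi : measurableTypeR R -> measurableTypeR R := fun x => a + b * x.
have mphi : measurable_fun setT phi.
  by apply: measurable_funD => //; exact: measurable_funM.
pose nb : {nonneg R} := NngNum (ltW b0).
pose m := mscale nb (pushforward mu phi).
have mE : forall A, measurable A -> mu A = m mphi A.
  move=> A mA; apply: (@lebesgue_measure_unique R (m mphi)) => // _ [[x y] _ <-].
  rewrite /m /mscale/= /pushforward.
  have phiE : `](x - a) / b, (y - a) / b]%classic = phi @^-1` `]x, y]%classic.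
    apply/seteqP; split=> z /=; rewrite /phi !in_itv/=.
    - by rewrite ltr_pdivrMr// ler_pdivlMr// => /andP[h1 h2]; apply/andP; split; lra.
    - by move=> /andP[h1 h2]; rewrite ltr_pdivrMr// ler_pdivlMr//; apply/andP; split; lra.
  pose I : set R := `](x - a) / b, (y - a) / b]%classic.
  transitivity (b%:E * mu I)%E; last by rewrite /I phiE.
  rewrite /I.
  rewrite !lebesgue_measure_itv/= !lte_fin ltr_pM2r ?invr_gt0// ltrD2r.
  case: ifPn => _; last by rewrite mule0.
  by rewrite -EFinB -EFinM; congr EFin; field; rewrite gt_eqF.
transitivity (\int[m mphi]_x f x)%E; last first.
  by apply: eq_measure_integral => A mA _; exact/esym/mE.
rewrite ge0_integral_mscale//.
by rewrite ge0_integral_pushforward.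
Qed.

Lemma ge0_integral_reflect (a : R) (f : R -> \bar R) :
  measurable_fun [set: R] f -> (forall x, 0 <= f x)%E ->
  (\int[mu]_x f (a - x)%R = \int[mu]_x f x)%E.
Proof.
move=> mf f0.
have mN : measurable_fun setT (-%R : measurableTypeR R -> measurableTypeR R) by [].
pose g x := f (a + 1 * x).
have mg : measurable_fun setT g.
  apply: measurableT_comp => //.
  by apply: measurable_funD => //; exact: measurable_funM.
transitivity (\int[mu]_x g x)%E; last first.
  by rewrite -(@ge0_integral_affine a 1 f)// mul1e.
transitivity (\int[pushforward mu (-%R : measurableTypeR R -> measurableTypeR R)]_x g x)%E.
  rewrite ge0_integral_pushforward//; last by move=> x _; exact: f0.
  by apply: eq_integral => x _; rewrite /g /= mul1r.
by apply: eq_measure_integral => A mA _; exact: lebesgue_measureN.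
Qed.

Lemma derivable_continuous (F : R -> R) x : derivable F x 1 -> {for x, continuous F}.
Proof. by move=> /derivable1_diffP /differentiable_continuous. Qed.

Lemma integral_derive (F f : R -> R) (a b : R) : a <= b ->
  (forall x, a <= x <= b -> is_derive x 1 F (f x)) ->
  (forall x, a <= x <= b -> {for x, continuous f}) ->
  (\int[mu]_(x in `[a, b]) (f x)%:E = (F b - F a)%:E)%E.
Proof.
rewrite le_eqVlt => /predU1P[<-|ab] dF cf.
  by rewrite set_itv1 integral_set1 subrr.
rewrite (@continuous_FTC2 _ _ F)//.
- apply: continuous_in_subspaceT => x /[!inE]/=.
  by rewrite in_itv/= => h; exact: cf.
- split.
  + move=> x /[!in_itv]/= /andP[ax xb].
    by have [] := dF x; rewrite ?ltW.
  + apply: cvg_at_right_filter; apply: derivable_continuous.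
    by have [] := dF a; rewrite ?lexx ?ltW.
  + apply: cvg_at_left_filter; apply: derivable_continuous.
    by have [] := dF b; rewrite ?lexx ?ltW.
- move=> x /[!in_itv]/= /andP[ax xb].
  by rewrite derive1E; have [|_ ->] := dF x; rewrite ?ltW.
Qed.

End AffineChange.

(** * Truncated powers *)

Section PowerKernel.
Context {R : realType}.
Local Notation mu := (@lebesgue_measure R).
Implicit Types p x h : R.

(** The truncated power x_+^(-p), the convolution kernel of the fractional
    integral of order 1 - p. *)
Definition kpow p x : R := if 0 < x then x `^ (- p) else 0.

Lemma kpow_ge0 p x : 0 <= kpow p x.
Proof. by rewrite /kpow; case: ifP => // _; exact: powR_ge0. Qed.

Lemma kpow0 p x : x <= 0 -> kpow p x = 0.
Proof. by rewrite /kpow leNgt => /negbTE ->. Qed.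

Lemma measurable_kpow p : measurable_fun [set: R] (kpow p).
Proof.
apply: (@measurable_fun_ifT _ _ _ _ (fun x : R => x `^ (- p)) (fun=> 0) (fun x => 0 < x)).
- exact: measurable_fun_ltr.
- exact: measurable_powR.
- exact: measurable_cst.
Qed.

Lemma kpowM p h x : 0 < h -> kpow p (h * x) = h `^ (- p) * kpow p x.
Proof.
move=> h0; rewrite /kpow pmulr_rgt0//; case: ifPn => x0; last by rewrite mulr0.
by rewrite powRM// ltW.
Qed.

Lemma kpow_sqr p x : kpow p x ^+ 2 = kpow (2 * p) x.
Proof.
rewrite /kpow; case: ifPn => x0; last by rewrite expr0n.
rewrite expr2 -powRD; last by rewrite (gt_eqF x0) implybT.
by congr (_ `^ _); ring.
Qed.

Lemma integral_powR_itv p (a b : R) : 0 < a -> a < b -> p != 1 ->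
  (\int[mu]_(x in `[a, b]) (x `^ (- p))%:E =
    ((b `^ (1 - p) - a `^ (1 - p)) / (1 - p))%:E)%E.
Proof.
move=> a0 ab p1; have p1' : 1 - p != 0 by rewrite subr_eq0 eq_sym.
have dF (x : R) : 0 < x ->
    is_derive x 1 (fun x : R => x `^ (1 - p) / (1 - p)) (x `^ (- p)).
  move=> x0; have := @is_derive1_powR R (1 - p) x x0 => h.
  rewrite (_ : (fun x : R => _) = (fun x : R => (1 - p)^-1 *: x `^ (1 - p))); last first.
    by apply/funext => y; rewrite mulrC.
  have -> : x `^ (- p) = (1 - p)^-1 *: ((1 - p) * x `^ (1 - p - 1)).
    rewrite /GRing.scale/= mulrA mulVf// mul1r; congr (_ `^ _); ring.
  exact: is_deriveZ.
rewrite mulrBl.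
apply: (@integral_derive _ (fun x => x `^ (1 - p) / (1 - p))).
- exact: ltW.
- by move=> x /andP[ax _]; apply: dF; rewrite (lt_le_trans a0).
- move=> x /andP[ax _]; have x0 : 0 < x by rewrite (lt_le_trans a0).
  by apply: derivable_continuous; have [] := @is_derive1_powR R (- p) x x0.
Qed.

Lemma integral_kpow_lty p (b : R) : p < 1 ->
  (\int[mu]_(x in `]-oo, b]) (kpow p x)%:E < +oo)%E.
Proof.
move=> p1; have q0 : 0 < 1 - p by rewrite subr_gt0.
pose c := Num.max b 2.
have mk : measurable_fun [set: R] (EFin \o kpow p).
  by apply/measurable_EFinP; exact: measurable_kpow.
apply: (@le_lt_trans _ _ (\int[mu]_(x in `]-oo, c]) (kpow p x)%:E)%E).
  apply: ge0_subset_integral => //.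
  - exact: measurable_funTS.
  - by move=> x _; rewrite lee_fin kpow_ge0.
  - by apply: subset_itvl; rewrite bnd_simp le_max lexx.
pose g n x := (kpow p x * ((n.+1%:R^-1 <= x)%R : nat)%:R)%:E : \bar R.
have g0 n x : (0 <= g n x)%E by rewrite lee_fin mulr_ge0 ?kpow_ge0.
have mg n : measurable_fun `]-oo, c]%classic (g n).
  apply/measurable_EFinP; apply: measurable_funM.
    by apply: measurable_funTS; exact: measurable_kpow.
  apply: measurable_funTS.
  have -> : (fun x : R => ((n.+1%:R^-1 <= x)%R : nat)%:R : R) = \1_(`[n.+1%:R^-1, +oo[%classic).
    by apply/funext => x; rewrite indicE mem_setE in_itv/= andbT.
  exact: measurable_indic.
have gE : (\int[mu]_(x in `]-oo, c]) (kpow p x)%:E =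
    \int[mu]_(x in `]-oo, c]) limn (g ^~ x))%E.
  apply: eq_integral => x _; apply/esym/cvg_lim => //.
  apply: cvg_near_cst.
  have [x0|x0] := ltP 0 x; last first.
    by apply: nearW => n; rewrite /g kpow0// mul0r.
  near=> n; rewrite /g.
  suff -> : n.+1%:R^-1 <= x by rewrite mulr1.
  by apply/ltW; near: n; exact: (near_infty_natSinv_lt (PosNum x0)).
rewrite gE monotone_convergence//; last first.
  move=> x _ m n mn; rewrite lee_fin ler_wpM2l ?kpow_ge0// ler_nat.
  case: (boolP (_ <= x)) => // h; rewrite (le_trans _ h)// lef_pV2 ?posrE//.
  by rewrite ler_nat.
apply: (@le_lt_trans _ _ ((c `^ (1 - p) / (1 - p))%:E)); last by rewrite ltry.
apply: lime_le.
  apply: ereal_nondecreasing_is_cvgn => m n mn; apply: ge0_le_integral => //; do ?exact: mg.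
  move=> x _; rewrite lee_fin ler_wpM2l ?kpow_ge0// ler_nat.
  case: (boolP (_ <= x)) => // h; rewrite (le_trans _ h)// lef_pV2 ?posrE//.
  by rewrite ler_nat.
apply: nearW => n.
have c2 : 2 <= c by rewrite le_max lexx orbT.
have n1 : n.+1%:R^-1 < c.
  apply: (@le_lt_trans _ _ 1); first by rewrite invf_le1 ?ler1n.
  by rewrite (lt_le_trans _ c2)// ltr1n.
pose de : R := n.+1%:R^-1.
have -> : (\int[mu]_(x in `]-oo, c]) g n x =
    \int[mu]_(x in `[de, c]) (x `^ (- p))%:E)%E.
  rewrite integral_mkcond [RHS]integral_mkcond; apply: eq_integral => x _.
  rewrite !patchE !mem_setE !in_itv/= /g /de.
  case: (leP n.+1%:R^-1 x) => h; last by rewrite /= mulr0; case: ifP.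
  by rewrite /= mulr1 /kpow (lt_le_trans _ h)// invr_gt0 ltr0n.
rewrite integral_powR_itv//; [|by rewrite invr_gt0|by rewrite lt_eqF].
by rewrite lee_fin ler_pM2r ?invr_gt0// gerDl oppr_le0 powR_ge0.
Unshelve. all: by end_near. Qed.

End PowerKernel.

(** * Integrals of real functions and Fubini theorems *)

Section RealIntegrable.
Context d (X : measurableType d) {R : realType}.
Variables (m : {measure set X -> \bar R}) (D : set X).
Hypothesis mD : measurable D.
Implicit Types f g : X -> R.

Lemma integrable_addR f g : m.-integrable D (fun x => (f x)%:E) ->
  m.-integrable D (fun x => (g x)%:E) -> m.-integrable D (fun x => (f x + g x)%:E).
Proof. by move=> fi gi; have := integrableD mD fi gi; apply: eq_integrable. Qed.

Lemma integrable_subR f g : m.-integrable D (fun x => (f x)%:E) ->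
  m.-integrable D (fun x => (g x)%:E) -> m.-integrable D (fun x => (f x - g x)%:E).
Proof. by move=> fi gi; have := integrableB mD fi gi; apply: eq_integrable. Qed.

Lemma integrable_scaleR (c : R) f : m.-integrable D (fun x => (f x)%:E) ->
  m.-integrable D (fun x => (c * f x)%:E).
Proof. by move=> fi; have := integrableZl mD c fi; apply: eq_integrable. Qed.

Lemma integrable_sumR (I : Type) (s : seq I) (f : I -> X -> R) :
  (forall i, m.-integrable D (fun x => (f i x)%:E)) ->
  m.-integrable D (fun x => (\sum_(i <- s) f i x)%:E).
Proof.
move=> fi; elim: s => [|i s IH].
  by under eq_fun do rewrite big_nil; exact: integrable0.
by under eq_fun do rewrite big_cons; exact: integrable_addR.
Qed.

Lemma Rintegral_sum (I : Type) (s : seq I) (f : I -> X -> R) :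
  (forall i, m.-integrable D (fun x => (f i x)%:E)) ->
  \int[m]_(x in D) (\sum_(i <- s) f i x) = \sum_(i <- s) \int[m]_(x in D) f i x.
Proof.
move=> fi; elim: s => [|i s IH].
  by under eq_Rintegral do rewrite big_nil; rewrite big_nil Rintegral_cst// mul0r.
under eq_Rintegral do rewrite big_cons.
rewrite big_cons RintegralD; [by rewrite IH|exact: mD|exact: fi|exact: integrable_sumR].
Qed.

End RealIntegrable.

Section FubiniReal.
Context d1 d2 (X : measurableType d1) (Y : measurableType d2) {R : realType}.
Variables (m1 : {sigma_finite_measure set X -> \bar R})
          (m2 : {sigma_finite_measure set Y -> \bar R}).

Lemma measurable_Rintegral_param (u : X * Y -> R) : measurable_fun setT u ->
  measurable_fun [set: Y] (fun y => \int[m1]_x u (x, y)).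
Proof.
move=> mu; apply: measurableT_comp => //=.
have mEu : measurable_fun [set: X * Y] (EFin \o u) by exact/measurable_EFinP.
rewrite (_ : (fun y => _) = (fun y => \int[m1]_x ((EFin \o u)^\+ (x, y))) \-
    (fun y => \int[m1]_x ((EFin \o u)^\- (x, y))))%E; last first.
  apply/funext => y /=; rewrite integralE; congr (_ - _)%E;
  by apply: eq_integral => x _; rewrite ?funeposE ?funenegE.
apply: emeasurable_funB.
- apply: (@measurable_fun_fubini_tonelli_G _ _ _ _ _ m1 ((EFin \o u)^\+)%E) => //.
  exact: measurable_funepos.
- apply: (@measurable_fun_fubini_tonelli_G _ _ _ _ _ m1 ((EFin \o u)^\-)%E) => //.
  exact: measurable_funeneg.
Qed.

Lemma measurable_Rintegral_param1 (u : X * Y -> R) : measurable_fun setT u ->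
  measurable_fun [set: X] (fun x => \int[m2]_y u (x, y)).
Proof.
move=> mu; apply: measurableT_comp => //=.
have mEu : measurable_fun [set: X * Y] (EFin \o u) by exact/measurable_EFinP.
rewrite (_ : (fun x => _) = (fun x => \int[m2]_y ((EFin \o u)^\+ (x, y))) \-
    (fun x => \int[m2]_y ((EFin \o u)^\- (x, y))))%E; last first.
  apply/funext => x /=; rewrite integralE; congr (_ - _)%E;
  by apply: eq_integral => y _; rewrite ?funeposE ?funenegE.
apply: emeasurable_funB.
- apply: (@measurable_fun_fubini_tonelli_F _ _ _ _ _ m2 ((EFin \o u)^\+)%E) => //.
  exact: measurable_funepos.
- apply: (@measurable_fun_fubini_tonelli_F _ _ _ _ _ m2 ((EFin \o u)^\-)%E) => //.
  exact: measurable_funeneg.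
Qed.

Lemma integrable_tensor (f : X -> R) (g : Y -> R) :
  m1.-integrable setT (EFin \o f) -> m2.-integrable setT (EFin \o g) ->
  (m1 \x m2)%E.-integrable setT (fun z => (f z.1 * g z.2)%:E).
Proof.
move=> fi gi.
have /measurable_EFinP mf := measurable_int _ fi.
have /measurable_EFinP mg := measurable_int _ gi.
have mh : measurable_fun [set: X * Y] (fun z => (f z.1 * g z.2)%:E).
  apply/measurable_EFinP; apply: measurable_funM; exact: measurableT_comp.
apply/(integrable12ltyP m1 m2 mh).
have /integrableP[_ fl] := fi; have /integrableP[_ gl] := gi.
have -> : (\int[m1]_x \int[m2]_y `|(f (x, y).1 * g (x, y).2)%:E| =
   \int[m1]_x (`|(f x)%:E| * \int[m2]_y `|(g y)%:E|))%E.
  apply: eq_integral => x _.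
  rewrite -ge0_integralZl//.
  - by apply: eq_integral => y _; rewrite -abseM -EFinM.
  - by apply: measurableT_comp => //; exact/measurable_EFinP.
rewrite ge0_integralZr//; last 2 first.
- by apply: measurableT_comp => //; exact/measurable_EFinP.
- exact: integral_ge0.
apply: lte_mul_pinfty => //; first exact: integral_ge0.
by rewrite ge0_fin_numE//; exact: integral_ge0.
Qed.

Lemma Rintegral_tensor (f : X -> R) (g : Y -> R) :
  m1.-integrable setT (EFin \o f) -> m2.-integrable setT (EFin \o g) ->
  \int[(m1 \x m2)%E]_z (f z.1 * g z.2) = (\int[m1]_x f x) * (\int[m2]_y g y).
Proof.
move=> fi gi; rewrite /Rintegral.
rewrite -(integral12_prod_meas1 (integrable_tensor fi gi)).
rewrite /fubini_F/=.
have -> : (\int[m1]_x \int[m2]_y (f x * g y)%:E =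
    \int[m1]_x ((f x)%:E * \int[m2]_y (g y)%:E))%E.
  apply: eq_integral => x _; under eq_integral do rewrite EFinM.
  by rewrite integralZl.
have gfin : (\int[m2]_y (g y)%:E \is a fin_num)%E by exact: integrable_fin_num gi.
rewrite -(fineK gfin) integralZr// fineM//.
exact: integrable_fin_num fi.
Qed.

Lemma integrable_Rintegral_param (f : X * Y -> R) :
  (m1 \x m2)%E.-integrable setT (EFin \o f) ->
  m2.-integrable setT (fun y => (\int[m1]_x f (x, y))%:E).
Proof.
move=> fi; have mf := measurable_int _ fi.
have mr : measurable_fun setT f by exact/measurable_EFinP.
apply/integrableP; split.
  by apply/measurable_EFinP; exact: measurable_Rintegral_param.
apply: le_lt_trans ((integrable21ltyP _ _ mf).1 fi).
apply: ge0_le_integral => //.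
- by apply: measurableT_comp => //; apply/measurable_EFinP; exact: measurable_Rintegral_param.
- apply: (@measurable_fun_fubini_tonelli_G _ _ _ _ _ m1 (fun z => `|(f z)%:E|)%E) => //.
  exact: measurableT_comp.
- move=> y _; apply: (@le_trans _ _ `|\int[m1]_x (f (x, y))%:E|%E).
    rewrite /Rintegral; move: (\int[_]_z _)%E => [r| |] //=.
    by rewrite normr0 leey. by rewrite normr0 leey.
  apply: le_abse_integral => //.
  exact: (measurableT_comp mf (measurable_pair2 y)).
Qed.

Lemma Rintegral_Fubini (f : X * Y -> R) :
  (m1 \x m2)%E.-integrable setT (EFin \o f) ->
  \int[m1]_x \int[m2]_y f (x, y) = \int[m2]_y \int[m1]_x f (x, y).
Proof.
move=> fi.
transitivity (fine (\int[m1]_x \int[m2]_y (f (x, y))%:E)%E).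
  congr fine; apply: ae_eq_integral => //.
  - apply/measurable_EFinP; apply: measurableT_comp => //.
    exact: (measurable_fubini_F fi).
  - exact: (measurable_fubini_F fi).
  - have := ae_integrable1 fi; apply: filterS => x h _.
    by rewrite /Rintegral fineK//; exact: integrable_fin_num h.
rewrite (Fubini fi).
congr fine; apply: ae_eq_integral => //.
- exact: (measurable_fubini_G fi).
- apply/measurable_EFinP; apply: measurableT_comp => //.
  exact: (measurable_fubini_G fi).
- have := ae_integrable2 fi; apply: filterS => x h _.
  by rewrite /Rintegral fineK//; exact: integrable_fin_num h.
Qed.

End FubiniReal.

Section ProductSquare.
Context d (X : measurableType d) {R : realType}.
Variable mu : {sigma_finite_measure set X -> \bar R}.

Definition square_measure : set (X * X)%type -> \bar R := (mu \x mu)%E.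

HB.instance Definition _ := Measure.copy square_measure (mu \x mu)%E.

Let sigma_finite_square : sigma_finite setT square_measure.
Proof.
have /sigma_finiteP[F [TF ndF Foo]] := sigma_finiteT mu.
exists (fun n => F n `*` F n).
  rewrite -setXTT [in LHS]TF predeqE => -[x y]; split.
    move=> [/= [n _ Fnx] [k _ Fky]]; exists (maxn n k) => //; split.
    - by move: x Fnx; exact/subsetPset/ndF/leq_maxl.
    - by move: y Fky; exact/subsetPset/ndF/leq_maxr.
  by move=> [n _ []/= ? ?]; split; exists n.
move=> k; have [mF Fk] := Foo k.
split; first exact: measurableX.
by rewrite /square_measure product_measure1E// lte_mul_pinfty// ge0_fin_numE.
Qed.

HB.instance Definition _ := Measure_isSigmaFinite.Build _ _ _ square_measure
  sigma_finite_square.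

Lemma integrable_square_swap (f : X * X -> R) : square_measure.-integrable setT (fun z => (f z)%:E) ->
  square_measure.-integrable setT (fun z => (f (z.2, z.1))%:E).
Proof.
move=> fi; have mf := measurable_int _ fi.
have mf' : measurable_fun setT (fun z : X * X => (f (z.2, z.1))%:E).
  have ms : measurable_fun setT (fun z : X * X => (z.2, z.1)).
    by apply/measurable_fun_pairP; split; [exact: measurable_snd|exact: measurable_fst].
  exact: (measurableT_comp mf ms).
apply/(integrable12ltyP mu mu mf').
exact: (integrable21ltyP mu mu mf).1 fi.
Qed.

Lemma Rintegral_square_swap (f : X * X -> R) : square_measure.-integrable setT (fun z => (f z)%:E) ->
  \int[square_measure]_z f (z.2, z.1) = \int[square_measure]_z f z.
Proof.
move=> fi; have fi' := integrable_square_swap fi; rewrite /Rintegral; congr fine.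
transitivity (\int[mu]_x \int[mu]_y (f (y, x))%:E)%E.
  exact/esym/(integral12_prod_meas1 fi').
exact: (integral21_prod_meas1 fi).
Qed.

Lemma square_measure_lty : (mu setT < +oo)%E -> (square_measure setT < +oo)%E.
Proof.
move=> fin; rewrite /square_measure -setXTT product_measure1E//.
by rewrite lte_mul_pinfty// ge0_fin_numE.
Qed.

End ProductSquare.

Section BilinearFubini.
Context d1 d2 (X : measurableType d1) (Y : measurableType d2) {R : realType}.
Variables (mu : {sigma_finite_measure set X -> \bar R})
          (rho : {sigma_finite_measure set Y -> \bar R}).
Hypothesis mu_fin : (mu setT < +oo)%E.

Let muT : mu setT \is a fin_num.
Proof. by rewrite ge0_fin_numE. Qed.

Lemma integral_cst_lty (K : R) : (\int[mu]_x K%:E < +oo)%E.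
Proof.
rewrite integral_cst//.
by rewrite ltey_eq fin_numM.
Qed.

(** By Tonelli, u is square integrable jointly, hence in almost every section.
    The singular kernels are covered, being unbounded but uniformly square
    integrable in y. *)
Lemma ae_integrable_section (u : X * Y -> R) (K : R) :
  measurable_fun setT u ->
  (forall x, \int[rho]_y (u (x, y) ^+ 2)%:E <= K%:E)%E ->
  {ae rho, forall y, mu.-integrable setT (fun x => (u (x, y))%:E)}.
Proof.
move=> mu_ uK.
have mu2 : measurable_fun [set: X * Y] (fun z => (u z ^+ 2)%:E).
  by apply/measurable_EFinP; exact: measurable_funX.
have ui : (mu \x rho)%E.-integrable setT (fun z => (u z ^+ 2)%:E).
  apply/(integrable12ltyP mu rho mu2).
  apply: (@le_lt_trans _ _ (\int[mu]_x K%:E)%E).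
    apply: ge0_le_integral => //.
    - by move=> x _; apply: integral_ge0.
    - apply: (@measurable_fun_fubini_tonelli_F _ _ _ _ _ rho (fun z => `|(u z ^+ 2)%:E|)%E) => //.
      exact: measurableT_comp.
    - move=> x _; apply: le_trans (uK x); rewrite le_eqVlt; apply/orP; left; apply/eqP.
      by apply: eq_integral => y _; rewrite gee0_abs// lee_fin sqr_ge0.
  exact: integral_cst_lty.
have := ae_integrable2 ui; apply: filterS => y h.
apply: (@le_integrable _ _ _ _ _ _ _ (fun x => (1 + u (x, y) ^+ 2)%:E)) => //.
- by apply/measurable_EFinP; apply: measurableT_comp.
- move=> x _ /=; rewrite lee_fin [leRHS]ger0_norm; last by rewrite addr_ge0// sqr_ge0.
  have [h1|h1] := leP (`|u (x, y)|) 1.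
    by rewrite (le_trans h1)// lerDl sqr_ge0.
  rewrite -real_normK ?num_real//; move: (`|u (x, y)|) h1 => w h1; nra.
- rewrite (_ : (fun x => _) = (fun x => 1%:E + (u (x, y) ^+ 2)%:E)%E)//.
  apply: integrableD => //.
  apply/integrableP; split => //; exact: (integral_cst_lty `|1|).
Qed.

(** Fubini after expanding the product; Cauchy-Schwarz in y and the finiteness
    of mu make u v jointly integrable. *)
Lemma bilinear_Fubini (u v : X * Y -> R) (K : R) :
  measurable_fun setT u -> measurable_fun setT v ->
  (forall x, \int[rho]_y (u (x, y) ^+ 2)%:E <= K%:E)%E ->
  (forall x, \int[rho]_y (v (x, y) ^+ 2)%:E <= K%:E)%E ->
  [/\ rho.-integrable setT
        (fun y => ((\int[mu]_x u (x, y)) * (\int[mu]_x v (x, y)))%:E),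
      (square_measure mu).-integrable setT
        (fun z => (\int[rho]_y (u (z.1, y) * v (z.2, y)))%:E)
    & \int[rho]_y ((\int[mu]_x u (x, y)) * (\int[mu]_x v (x, y))) =
      \int[square_measure mu]_z (\int[rho]_y (u (z.1, y) * v (z.2, y)))].
Proof.
move=> mu_ mv_ uK vK.
pose H := fun w : (X * X) * Y => u (w.1.1, w.2) * v (w.1.2, w.2).
have mH : measurable_fun setT H.
  apply: measurable_funM; apply: measurableT_comp => //.
  - apply/measurable_fun_pairP; split; last exact: measurable_snd.
    exact: (measurableT_comp measurable_fst measurable_fst).
  - apply/measurable_fun_pairP; split; last exact: measurable_snd.
    exact: (measurableT_comp measurable_snd measurable_fst).
have mEH : measurable_fun setT (EFin \o H) by exact/measurable_EFinP.
have mu2 x : measurable_fun [set: Y] (fun y => (u (x, y) ^+ 2)%:E).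
  by apply/measurable_EFinP; apply: measurable_funX; apply: measurableT_comp => //; exact: measurable_pair1.
have mv2 x : measurable_fun [set: Y] (fun y => (v (x, y) ^+ 2)%:E).
  by apply/measurable_EFinP; apply: measurable_funX; apply: measurableT_comp => //; exact: measurable_pair1.
have HK z : (\int[rho]_y `|(H (z, y))%:E| <= (K + K)%:E)%E.
  apply: (@le_trans _ _ (\int[rho]_y ((u (z.1, y) ^+ 2)%:E + (v (z.2, y) ^+ 2)%:E))%E).
    apply: ge0_le_integral => //.
    - apply: measurableT_comp => //; apply/measurable_EFinP.
      have := measurableT_comp mH (measurable_pair1 z); exact.
    - exact: emeasurable_funD.
    - move=> y _; rewrite /H/= lee_fin normrM.
      rewrite -(real_normK (num_real (u _))) -(real_normK (num_real (v _))).
      move: `|u _| `|v _| (normr_ge0 (u (z.1, y))) (normr_ge0 (v (z.2, y))) => p q p0 q0.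
      nra.
  rewrite ge0_integralD//; last 2 first.
  - by move=> y _; rewrite lee_fin sqr_ge0.
  - by move=> y _; rewrite lee_fin sqr_ge0.
  by rewrite EFinD leeD.
have Hi : (square_measure mu \x rho)%E.-integrable setT (EFin \o H).
  apply/(integrable12ltyP _ _ mEH).
  apply: (@le_lt_trans _ _ (\int[(square_measure mu)]_z (K + K)%:E)%E).
    apply: ge0_le_integral => //.
    - by move=> x _; apply: integral_ge0.
    - apply: (@measurable_fun_fubini_tonelli_F _ _ _ _ _ rho (fun z => `|(H z)%:E|)%E) => //.
      exact: measurableT_comp.
    - by move=> z _; exact: HK.
  rewrite integral_cst//= ltey_eq fin_numM//= ge0_fin_numE ?square_measure_lty//.
have aeE : {ae rho, forall y, setT y ->
   (\int[(square_measure mu)]_z H (z, y)) = (\int[mu]_x u (x, y)) * (\int[mu]_x v (x, y))}.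
  have := ae_integrable_section mv_ vK; have := ae_integrable_section mu_ uK.
  apply: filterS2 => y hu hv _.
  exact: (Rintegral_tensor hu hv).
have mprod : measurable_fun [set: Y] (fun y => ((\int[mu]_x u (x, y)) * (\int[mu]_x v (x, y)))).
  by apply: measurable_funM; exact: measurable_Rintegral_param.
have mHint : measurable_fun [set: Y] (fun y => \int[(square_measure mu)]_z H (z, y)).
  exact: measurable_Rintegral_param.
split.
  apply: integrable_ae_eq (integrable_Rintegral_param Hi) => //.
  apply: eq_integrable (integrable_fubini_F Hi) => // z _.
  rewrite /fubini_F /Rintegral fineK//=.
  rewrite fin_num_abs (le_lt_trans _ (le_lt_trans (HK z) (ltry _)))//.
  apply: le_abse_integral => //; apply/measurable_EFinP.
  by have := measurableT_comp mH (measurable_pair1 z); exact.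
rewrite [RHS](_ : _ = \int[(square_measure mu)]_z \int[rho]_y H (z, y))//.
rewrite (Rintegral_Fubini Hi).
congr fine; apply: ae_eq_integral => //.
- exact/measurable_EFinP.
- exact/measurable_EFinP.
- by move: aeE; apply: filterS => y h _; rewrite h.
Qed.

End BilinearFubini.

(** * Integrals of the singular kernels *)

Section KernelConstants.
Context {R : realType}.
Local Notation mu := (@lebesgue_measure R).
Implicit Types a h : R.

Lemma integral_powR_tail_lty (q : R) : 1 < q ->
  (\int[mu]_(x in `[1%R, +oo[) (x `^ (- q))%:E < +oo)%E.
Proof.
move=> q1; pose F (n : nat) : set R := `[1, n.+2%:R]%classic.
have FU : `[1, +oo[%classic = \bigcup_n F n.
  apply/seteqP; split => x /=; rewrite in_itv/= ?andbT.
    move=> x1; exists (Num.bound x) => //=; rewrite /F/= in_itv/= x1/=.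
    rewrite (le_trans (ltW (archi_boundP _)))//; first by rewrite (le_trans ler01).
    by rewrite ler_nat -addn2 leq_addr.
  by move=> [n _]; rewrite /F/= !in_itv/= => /andP[].
have mp : measurable_fun [set: R] (fun x : R => (x `^ (- q))%:E).
  by apply/measurable_EFinP; exact: measurable_powR.
rewrite FU.
have c := @ge0_nondecreasing_set_cvg_integral _ (measurableTypeR R) R F (fun x : R => (x `^ (- q))%:E) mu.
apply: (@le_lt_trans _ _ ((q - 1)^-1%:E)); last exact: ltry.
rewrite -(cvg_lim _ (c _ _ _ _))//; last 4 first.
- move=> m n mn; apply/subsetPset => x; rewrite /F/= !in_itv/= => /andP[-> h].
  by rewrite (le_trans h)// ler_nat !ltnS.
- by move=> n; exact: measurable_itv.
- by move=> n; exact: measurable_funTS.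
- by move=> n x _; rewrite lee_fin powR_ge0.
apply: lime_le.
  apply: ereal_nondecreasing_is_cvgn; apply: ge0_nondecreasing_set_nondecreasing_integral => //.
  - move=> m n mn; apply/subsetPset => x; rewrite /F/= !in_itv/= => /andP[-> h].
    by rewrite (le_trans h)// ler_nat !ltnS.
  - by move=> n; exact: measurable_itv.
  - by move=> n; exact: measurable_funTS.
  - by move=> n x _; rewrite lee_fin powR_ge0.
apply: nearW => n.
rewrite integral_powR_itv//; last by rewrite gt_eqF.
- rewrite powR1 lee_fin; set X := _ `^ _.
  rewrite -(opprB q 1) invrN mulrN -mulNr opprB -[leRHS]mul1r ler_pM2r ?invr_gt0 ?subr_gt0//.
  by rewrite gerBl powR_ge0.
- by rewrite ltr1n.
Qed.

Lemma onem_cos_le (x : R) : 1 - cos x <= `|x|.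
Proof.
wlog x0 : x / 0 <= x.
  move=> H; have [/H//|x0] := leP 0 x.
  by rewrite -cosN -normrN; apply: H; rewrite oppr_ge0 ltW.
rewrite ger0_norm//.
have [->|xn0] := eqVneq x 0; first by rewrite cos0 subrr.
have xp : 0 < x by rewrite lt_def xn0.
have [c _] := @MVT _ cos (fun x => - sin x) 0 x xp (fun z _ => is_derive_cos z)
   (continuous_subspaceT (@continuous_cos R)).
rewrite cos0 subr0 => E.
have -> : 1 - cos x = sin c * x by rewrite -opprB E; ring.
by rewrite -[leRHS]mul1r ler_wpM2r// sin_le1.
Qed.

Lemma measurable_cos : measurable_fun [set: R] (@cos R).
Proof. by apply: continuous_measurable_fun; exact: continuous_cos. Qed.

Lemma measurable_sin : measurable_fun [set: R] (@sin R).
Proof. by apply: continuous_measurable_fun; exact: continuous_sin. Qed.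

Lemma measurable_kpow_comp d (T : measurableType d) (p : R) (f : T -> R) :
  measurable_fun setT f -> measurable_fun setT (fun x => kpow p (f x)).
Proof. by move=> mf; apply: measurableT_comp => //; exact: measurable_kpow. Qed.

Lemma integral_kpow_window p (c : R) : p < 1 ->
  (\int[mu]_t (kpow p t * \1_(`]-oo, c]%classic) t)%:E < +oo)%E.
Proof.
move=> p1; have := @integral_kpow_lty R p c p1.
rewrite integral_mkcond; congr (_ < _)%E; apply: eq_integral => t _.
by rewrite patchE indicE; case: ifP => _; rewrite ?mulr1 ?mulr0.
Qed.

Lemma integral_indic_oo (a b : R) : a <= b ->
  (\int[mu]_t (\1_(`]a, b[%classic) t)%:E = (b - a)%:E)%E.
Proof.
move=> ab; rewrite integral_indic// setIT; transitivity (mu `]a, b[%classic) => //.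
rewrite lebesgue_measure_itv/= lte_fin; case: ltP => [_|ba]; first by rewrite EFinB.
by rewrite (@le_anti _ _ a b) ?subrr// ab ba.
Qed.

Section exponent.
Variable al : R.
Hypotheses (al0 : 0 < al) (al1 : 2 * al < 1).

Let mK (p : R) d (T : measurableType d) (f : T -> R) :
  measurable_fun setT f -> measurable_fun setT (fun x => (kpow p (f x))%:E).
Proof. by move=> mf; apply/measurable_EFinP; exact: measurable_kpow_comp. Qed.

(** Euler's Beta integral B(1 - al, 1 - al). *)
Definition beta_const : R := fine (\int[mu]_t (kpow al t * kpow al (1 - t))%:E).

Let beta_fin : (\int[mu]_t (kpow al t * kpow al (1 - t))%:E < +oo)%E.
Proof.
pose g t : R := kpow (2 * al) t * \1_(`]-oo, 1%R]%classic) t.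
have mg : measurable_fun [set: R] (fun t => (g t)%:E).
  apply/measurable_EFinP; apply: measurable_funM; first exact: measurable_kpow.
  exact: measurable_indic.
have g0 t : 0 <= g t by rewrite mulr_ge0 ?kpow_ge0.
have glt : (\int[mu]_t (g t)%:E < +oo)%E by exact: integral_kpow_window.
have mg1 : measurable_fun [set: R] (fun t => (g (1 - t))%:E).
  apply: (measurableT_comp mg); exact: measurable_funB.
apply: (@le_lt_trans _ _ (\int[mu]_t ((g t)%:E + (g (1 - t))%:E))%E).
  apply: ge0_le_integral => //.
  - by move=> t _; rewrite lee_fin mulr_ge0 ?kpow_ge0.
  - apply/measurable_EFinP; apply: measurable_funM; first exact: measurable_kpow.
    by apply: measurable_kpow_comp; exact: measurable_funB.
  - exact: emeasurable_funD.
  - move=> t _; rewrite -EFinD lee_fin.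
    have [t0|t0] := leP t 0; first by rewrite (kpow0 _ t0) mul0r addr_ge0.
    have [t1|t1] := leP 1 t.
      by rewrite [kpow al (1 - t)]kpow0 ?subr_le0// mulr0 addr_ge0.
    rewrite /g -!kpow_sqr !indicE !mem_setE !in_itv/= (ltW t1) gerBl (ltW t0) !mulr1.
    move: (kpow al t) (kpow al (1 - t)) (kpow_ge0 al t) (kpow_ge0 al (1 - t)) => x y x0 y0.
    nra.
rewrite ge0_integralD//; last 2 first.
- by move=> t _; rewrite lee_fin.
- by move=> t _; rewrite lee_fin.
rewrite (ge0_integral_reflect 1 mg)//; first exact: lte_add_pinfty.
Qed.

(** Translation and scaling; both sides vanish for b <= a. *)
Lemma integral_beta_kernel a b :
  (\int[mu]_t (kpow al (t - a) * kpow al (b - t))%:E =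
   (beta_const * kpow (2 * al - 1) (b - a))%:E)%E.
Proof.
have [ba|ab] := leP b a.
  rewrite [kpow (_ - 1) _]kpow0 ?subr_le0// mulr0.
  apply: integral0_eq => t _; have [ta|ta] := leP t a.
    by rewrite [kpow al (t - a)]kpow0 ?mul0r// subr_le0.
  by rewrite [kpow al (b - t)]kpow0 ?mulr0// subr_le0 (le_trans ba)// ltW.
have h0 : 0 < b - a by rewrite subr_gt0.
rewrite -(@ge0_integral_affine _ a (b - a))//; last 2 first.
- apply/measurable_EFinP; apply: measurable_funM; apply: measurable_kpow_comp;
  exact: measurable_funB.
- by move=> t; rewrite lee_fin mulr_ge0 ?kpow_ge0.
have E t : (kpow al (a + (b - a) * t - a) * kpow al (b - (a + (b - a) * t)))%:E =
    (((b - a) `^ (- al) * (b - a) `^ (- al))%:E * (kpow al t * kpow al (1 - t))%:E)%E.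
  rewrite (_ : a + _ - a = (b - a) * t); last by ring.
  rewrite (_ : b - (a + _) = (b - a) * (1 - t)); last by ring.
  by rewrite !kpowM// -EFinM; congr EFin; ring.
under eq_integral do rewrite E.
rewrite ge0_integralZl//; last 3 first.
- apply/measurable_EFinP; apply: measurable_funM; first exact: measurable_kpow.
  by apply: measurable_kpow_comp; exact: measurable_funB.
- by move=> t _; rewrite lee_fin mulr_ge0 ?kpow_ge0.
- by rewrite lee_fin mulr_ge0 ?powR_ge0.
rewrite -[X in (_ * (_ * X))%E]fineK; last first.
  by rewrite ge0_fin_numE//; apply: integral_ge0 => t _; rewrite lee_fin mulr_ge0 ?kpow_ge0.
rewrite -!EFinM -/beta_const /kpow h0; congr EFin.
rewrite mulrA [RHS]mulrC; congr (_ * _).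
rewrite -powRD; last by rewrite (gt_eqF h0) implybT.
rewrite -{1}(powRr1 (ltW h0)) -powRD; last by rewrite (gt_eqF h0) implybT.
by congr (_ `^ _); ring.
Qed.

Let kpow_ge1 (x : R) : 0 < x -> x < 1 -> 1 <= kpow al x.
Proof.
move=> x0 x1; rewrite /kpow x0 powRN invf_ge1 ?powR_gt0//.
by rewrite -[leRHS](@powRr0 _ x) ger_powR ?x0 ?ltW.
Qed.

Lemma beta_const_gt0 : 0 < beta_const.
Proof.
apply: fine_gt0; rewrite beta_fin andbT.
apply: (@lt_le_trans _ _ 1%:E); first by rewrite lte_fin.
have : (\int[mu]_t (\1_(`]0%R, 1%R[%classic) t)%:E <=
   \int[mu]_t (kpow al t * kpow al (1 - t))%:E)%E.
  apply: ge0_le_integral => //.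
  - by apply/measurable_EFinP; exact: measurable_indic.
  - apply/measurable_EFinP; apply: measurable_funM; first exact: measurable_kpow.
    by apply: measurable_kpow_comp; exact: measurable_funB.
  - move=> t _; rewrite lee_fin indicE mem_setE in_itv/=.
    case: (boolP (_ && _)) => [/andP[t0 t1]|_]; last by rewrite mulr_ge0 ?kpow_ge0.
    by rewrite -[leLHS]mulr1; apply: ler_pM => //; apply: kpow_ge1; lra.
by rewrite integral_indic_oo// subr0.
Qed.

(** The square of the L^2 distance of x_+^(-al) to its unit translate. *)
Definition increment_const : R :=
  fine (\int[mu]_t ((kpow al t - kpow al (t - 1)) ^+ 2)%:E).

Let mincr : measurable_fun [set: R] (fun t => ((kpow al t - kpow al (t - 1)) ^+ 2)%:E).
Proof.
apply/measurable_EFinP; apply: measurable_funX; apply: measurable_funB.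
  exact: measurable_kpow.
by apply: measurable_kpow_comp; exact: measurable_funB.
Qed.

Let powR_increment_le (t : R) : 2 < t ->
  (t `^ (- al) - (t - 1) `^ (- al)) ^+ 2 <= (t - 1) ^- 2.
Proof.
move=> t2; have t0 : 0 < t by lra.
have t1 : 1 < t - 1 by lra.
have s0 : 0 < t - 1 by lra.
set s := t - 1.
(* concavity of the power gives (s / t)^al >= s / t *)
have h1 : t `^ (- al) <= s `^ (- al).
  rewrite !powRN lef_pV2 ?posrE ?powR_gt0// ge0_ler_powR ?nnegrE ?(ltW s0) ?(ltW al0) ?(ltW t0)//.
  by rewrite gerBl.
have h2 : s `^ (- al) * (s / t) <= t `^ (- al).
  have st : 0 < s / t <= 1 by rewrite divr_gt0//= ler_pdivrMr// mul1r /s; lra.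
  have -> : t `^ (- al) = s `^ (- al) * (s / t) `^ al.
    rewrite powRM ?invr_ge0 ?ltW// mulrA -powRD; last by rewrite (gt_eqF s0) implybT.
    by rewrite addNr powRr0 mul1r -powR_inv1 ?ltW// -powRrM mulN1r.
  rewrite ler_wpM2l ?powR_ge0//.
  rewrite -{1}(@powRr1 _ (s / t)); last by lra.
  by rewrite ger_powR//; move: al0 al1; lra.
have h3 : s `^ (- al) <= 1.
  by rewrite -[leRHS](powRr0 s) ler_powR ?(ltW t1)// oppr_le0 ltW.
have h4 : s / t = 1 - t^-1 by rewrite /s; field; lra.
have h5 : t^-1 <= s^-1 by rewrite lef_pV2 ?posrE// /s; lra.
have h6 : 0 < t^-1 by rewrite invr_gt0.
rewrite -sqrrN opprB -exprVn ler_sqr ?nnegrE ?subr_ge0//; last by rewrite invr_ge0 ltW.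
move: h2; rewrite h4 => h2; have := powR_gt0 (- al) s0; rewrite -/s => h7.
nra.
Qed.

Let incr_fin : (\int[mu]_t ((kpow al t - kpow al (t - 1)) ^+ 2)%:E < +oo)%E.
Proof.
pose g t : R := 2 * (kpow (2 * al) t * \1_(`]-oo, 2%R]%classic) t).
pose w t : R := \1_(`[1%R, +oo[%classic) t * t `^ (- 2).
have mg : measurable_fun [set: R] (fun t => (g t)%:E).
  apply/measurable_EFinP; apply: measurable_funM => //.
  apply: measurable_funM; first exact: measurable_kpow.
  exact: measurable_indic.
have mw : measurable_fun [set: R] (fun t => (w t)%:E).
  apply/measurable_EFinP; apply: measurable_funM; first exact: measurable_indic.
  exact: measurable_powR.
have g0 t : 0 <= g t by rewrite !mulr_ge0 ?kpow_ge0.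
have w0 t : 0 <= w t by rewrite !mulr_ge0 ?powR_ge0.
have glt : (\int[mu]_t (g t)%:E < +oo)%E.
  rewrite /g; under eq_integral do rewrite EFinM.
  rewrite ge0_integralZl//.
  - by rewrite lte_mul_pinfty//; exact: integral_kpow_window.
  - apply/measurable_EFinP.
    by apply: measurable_funM; [exact: measurable_kpow|exact: measurable_indic].
  - by move=> t _; rewrite lee_fin mulr_ge0 ?kpow_ge0.
have wlt : (\int[mu]_t (w t)%:E < +oo)%E.
  have := @integral_powR_tail_lty 2 (ltr1n _ 2).
  rewrite integral_mkcond; congr (_ < _)%E; apply: eq_integral => t _.
  by rewrite patchE /w indicE; case: ifP => _; rewrite ?mul1r ?mul0r.
have shift (f : R -> R) : measurable_fun [set: R] (fun t => (f t)%:E) ->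
    (forall t, 0 <= f t) -> (\int[mu]_t (f t)%:E < +oo)%E ->
    measurable_fun [set: R] (fun t => (f (- 1 + 1 * t))%:E) /\
    (\int[mu]_t (f (- 1 + 1 * t))%:E < +oo)%E.
  move=> mf f0 flt; split.
    by apply: (measurableT_comp mf); apply: measurable_funD.
  have := @ge0_integral_affine _ (- 1) 1 (fun t => (f t)%:E) ltr01 mf.
  by rewrite mul1e => ->.
have [mg1 glt1] := shift g mg g0 glt; have [mw1 wlt1] := shift w mw w0 wlt.
apply: (@le_lt_trans _ _ (\int[mu]_t ((g t)%:E + ((g (- 1 + 1 * t))%:E + (w (- 1 + 1 * t))%:E)))%E).
  apply: ge0_le_integral => //.
  - by move=> t _; rewrite lee_fin sqr_ge0.
  - by apply: emeasurable_funD => //; exact: emeasurable_funD.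
  - move=> t _; rewrite -!EFinD lee_fin mul1r [- 1 + t]addrC.
    have [t0|t0] := leP t 0.
      by rewrite !kpow0 ?subrr ?expr0n ?addr_ge0//; lra.
    have [t2|t2] := leP t 2.
      rewrite -[leLHS]addr0 addrA lerD//.
      rewrite /g -!kpow_sqr !indicE !mem_setE !in_itv/= t2 !mulr1.
      have -> : t - 1 <= 2 by lra.
      rewrite /= mulr1; move: (kpow al t) (kpow al (t - 1)) => x y.
      by have := sqr_ge0 (x + y); rewrite sqrrD sqrrB; lra.
    rewrite addrA -[leLHS]add0r lerD ?addr_ge0//.
    rewrite /w indicE mem_setE in_itv/= andbT.
    have t1 : 1 < t - 1 by lra.
    rewrite (ltW t1) mul1r /kpow t0; have s0 : 0 < t - 1 by lra.
    by rewrite s0 powR_invn ?(ltW s0)// powR_increment_le.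
rewrite ge0_integralD//; last 3 first.
- by move=> t _; rewrite lee_fin.
- by move=> t _; rewrite -EFinD lee_fin addr_ge0.
- exact: emeasurable_funD.
rewrite ge0_integralD//; last 2 first.
- by move=> t _; rewrite lee_fin.
- by move=> t _; rewrite lee_fin.
by apply: lte_add_pinfty => //; exact: lte_add_pinfty.
Qed.

Lemma increment_const_gt0 : 0 < increment_const.
Proof.
apply: fine_gt0; rewrite incr_fin andbT.
apply: (@lt_le_trans _ _ 1%:E); first by rewrite lte_fin.
have : (\int[mu]_t (\1_(`]0%R, 1%R[%classic) t)%:E <=
   \int[mu]_t ((kpow al t - kpow al (t - 1)) ^+ 2)%:E)%E.
  apply: ge0_le_integral => //.
  - by apply/measurable_EFinP; exact: measurable_indic.
  - move=> t _; rewrite lee_fin indicE mem_setE in_itv/=.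
    case: (boolP (_ && _)) => [/andP[t0 t1]|_]; last by rewrite sqr_ge0.
    rewrite [kpow al (t - 1)]kpow0; last by lra.
    by rewrite subr0 exprn_ege1// kpow_ge1.
by rewrite integral_indic_oo// subr0.
Qed.

(** Translation and scaling. *)
Lemma integral_increment a b :
  (\int[mu]_t ((kpow al (a - t) - kpow al (b - t)) ^+ 2)%:E =
   (increment_const * `|a - b| `^ (1 - 2 * al))%:E)%E.
Proof.
wlog ba : a b / b <= a.
  move=> H; have [|/ltW ab] := leP b a; first exact: H.
  have := H b a ab; rewrite distrC => <-; apply: eq_integral => t _.
  by rewrite -sqrrN opprB.
move: ba; rewrite le_eqVlt => /predU1P[->|ab].
  rewrite subrr normr0 powR0; last by rewrite subr_eq0 gt_eqF.
  rewrite mulr0; apply: integral0_eq => t _.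
  by rewrite subrr expr0n.
have h0 : 0 < a - b by rewrite subr_gt0.
pose F s : \bar R := ((kpow al s - kpow al (s - (a - b))) ^+ 2)%:E.
have mF : measurable_fun [set: R] F.
  apply/measurable_EFinP; apply: measurable_funX; apply: measurable_funB.
    exact: measurable_kpow.
  by apply: measurable_kpow_comp; exact: measurable_funB.
have F0 s : (0 <= F s)%E by rewrite lee_fin sqr_ge0.
transitivity (\int[mu]_s F s)%E.
  transitivity (\int[mu]_t F (a - t)%R)%E; last exact: ge0_integral_reflect.
  apply: eq_integral => t _; rewrite /F; congr ((_ - kpow al _) ^+ 2)%:E; ring.
rewrite -(@ge0_integral_affine _ 0 (a - b))//.
have E t : F (0 + (a - b) * t) = (((a - b) `^ (- al) ^+ 2)%:E *
    ((kpow al t - kpow al (t - 1)) ^+ 2)%:E)%E.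
  rewrite /F add0r (_ : (a - b) * t - _ = (a - b) * (t - 1)); last by ring.
  by rewrite !kpowM// -EFinM; congr EFin; ring.
under eq_integral do rewrite E.
rewrite ge0_integralZl//; last 2 first.
- by move=> t _; rewrite lee_fin sqr_ge0.
- by rewrite lee_fin sqr_ge0.
rewrite -[X in (_ * (_ * X))%E]fineK; last first.
  rewrite ge0_fin_numE; first exact: incr_fin.
  by apply: integral_ge0 => t _; rewrite lee_fin sqr_ge0.
rewrite -!EFinM -/increment_const gtr0_norm//; congr EFin.
rewrite mulrA [RHS]mulrC; congr (_ * _).
rewrite expr2 -powRD; last by rewrite (gt_eqF h0) implybT.
rewrite -{1}(powRr1 (ltW h0)) -powRD; last by rewrite (gt_eqF h0) implybT.
by congr (_ `^ _); ring.
Qed.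

(** The constant of the representation
    |h|^(1 - 2 al) = c int (1 - cos (xi h)) |xi|^(2 al - 2) d xi. *)
Definition fourier_const : R :=
  fine (\int[mu]_x (`|x| `^ (2 * al - 2) * (1 - cos x))%:E).

Let f x : R := `|x| `^ (2 * al - 2) * (1 - cos x).

Let f0 x : 0 <= f x.
Proof. by rewrite mulr_ge0 ?powR_ge0// subr_ge0 cos_le1. Qed.

Let mf : measurable_fun [set: R] (fun x => (f x)%:E).
Proof.
apply/measurable_EFinP; apply: measurable_funM.
  apply: (measurableT_comp (@measurable_powR R (2 * al - 2))).
  exact: continuous_measurable_fun (@norm_continuous _ R).
by apply: measurable_funB => //; exact: measurable_cos.
Qed.

Let fourier_fin : (\int[mu]_x (f x)%:E < +oo)%E.
Proof.
pose g x : R := kpow (1 - 2 * al) x * \1_(`]-oo, 1%R]%classic) x.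
pose w x : R := 2 * (\1_(`[1%R, +oo[%classic) x * x `^ (- (2 - 2 * al))).
have mg : measurable_fun [set: R] (fun t => (g t)%:E).
  apply/measurable_EFinP; apply: measurable_funM; first exact: measurable_kpow.
  exact: measurable_indic.
have mw : measurable_fun [set: R] (fun t => (w t)%:E).
  apply/measurable_EFinP; apply: measurable_funM => //.
  apply: measurable_funM; first exact: measurable_indic.
  exact: measurable_powR.
have g0 t : 0 <= g t by rewrite !mulr_ge0 ?kpow_ge0.
have w0 t : 0 <= w t by rewrite !mulr_ge0 ?powR_ge0.
have glt : (\int[mu]_t (g t)%:E < +oo)%E by apply: integral_kpow_window; rewrite gtrBl mulr_gt0.
have wlt : (\int[mu]_t (w t)%:E < +oo)%E.
  rewrite /w; under eq_integral do rewrite EFinM.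
  rewrite ge0_integralZl//; last 2 first.
  - by apply/measurable_EFinP; apply: measurable_funM; [exact: measurable_indic|exact: measurable_powR].
  - by move=> t _; rewrite lee_fin mulr_ge0 ?powR_ge0.
  rewrite lte_mul_pinfty//.
  have q1 : 1 < 2 - 2 * al by move: al1; lra.
  have := integral_powR_tail_lty q1; rewrite [X in (X < _)%E -> _]integral_mkcond.
  congr (_ < _)%E; apply: eq_integral => t _.
  by rewrite patchE indicE; case: ifP => _; rewrite ?mul1r ?mul0r.
pose G x := ((g x)%:E + (w x)%:E)%E.
have mG : measurable_fun [set: R] G by exact: emeasurable_funD.
have G0 x : (0 <= G x)%E by rewrite /G -EFinD lee_fin addr_ge0.
have Glt : (\int[mu]_t G t < +oo)%E.
  by rewrite /G ge0_integralD//; [rewrite lte_add_pinfty|move=> t _; rewrite lee_fin..].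
have mGN : measurable_fun [set: R] (fun x => G (0 - x)).
  by apply: (measurableT_comp mG); exact: measurable_funB.
have fG x : 0 < x -> ((f x)%:E <= G x)%E.
  move=> x0; rewrite /G -EFinD lee_fin /f gtr0_norm//.
  have [x1|x1] := leP x 1.
    rewrite -[leLHS]addr0 lerD// /g indicE mem_setE in_itv/= x1 mulr1 /kpow x0.
    have -> : - (1 - 2 * al) = (2 * al - 2) + 1 by ring.
    rewrite [x `^ (_ + 1)]powRD; last by rewrite (gt_eqF x0) implybT.
    rewrite powRr1 ?(ltW x0)// ler_wpM2l ?powR_ge0//.
    by have := onem_cos_le x; rewrite gtr0_norm.
  rewrite -[leLHS]add0r lerD// /w indicE mem_setE in_itv/= andbT (ltW x1) mul1r opprB.
  rewrite mulrC ler_wpM2r ?powR_ge0//.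
  by have := cos_geN1 x; lra.
apply: (@le_lt_trans _ _ (\int[mu]_x (G x + G (0 - x)%R))%E).
  apply: ge0_le_integral => //.
  - by move=> x _; rewrite lee_fin.
  - exact: emeasurable_funD.
  - move=> x _; have [x0|x0|->] := ltgtP x 0.
    + rewrite -[leLHS]add0e leeD//.
      have -> : f x = f (0 - x) by rewrite sub0r /f normrN cosN.
      by apply: fG; rewrite sub0r oppr_gt0.
    + by rewrite -[leLHS]adde0 leeD// fG.
    + by rewrite /f cos0 subrr mulr0 adde_ge0.
rewrite ge0_integralD// ge0_integral_reflect//.
by rewrite lte_add_pinfty.
Qed.

(** Scaling. *)
Lemma integral_onem_cos h :
  (\int[mu]_x (`|x| `^ (2 * al - 2) * (1 - cos (x * h)))%:E =
   (fourier_const * `|h| `^ (1 - 2 * al))%:E)%E.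
Proof.
have [->|hn0] := eqVneq h 0.
  rewrite normr0 powR0 ?mulr0; last by rewrite subr_eq0 gt_eqF.
  by apply: integral0_eq => t _; rewrite mulr0 cos0 subrr mulr0.
have h0 : 0 < `|h| by rewrite normr_gt0.
have hi0 : 0 < `|h|^-1 by rewrite invr_gt0.
pose F x : \bar R := (`|x| `^ (2 * al - 2) * (1 - cos (x * h)))%:E.
have mF : measurable_fun [set: R] F.
  apply/measurable_EFinP; apply: measurable_funM.
    apply: (measurableT_comp (@measurable_powR R (2 * al - 2))).
    exact: continuous_measurable_fun (@norm_continuous _ R).
  apply: measurable_funB => //; apply: (measurableT_comp measurable_cos).
  exact: measurable_funM.
have F0 x : (0 <= F x)%E by rewrite lee_fin mulr_ge0 ?powR_ge0// subr_ge0 cos_le1.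
rewrite -(@ge0_integral_affine _ 0 `|h|^-1 F)//.
have E x : F (0 + `|h|^-1 * x) = ((`|h| `^ (2 - 2 * al))%:E * (f x)%:E)%E.
  rewrite /F add0r -EFinM; congr EFin; rewrite /f normrM (gtr0_norm hi0).
  rewrite powRM ?invr_ge0//.
  rewrite -powR_inv1; last by rewrite normr_ge0.
  rewrite -powRrM mulrA; congr (_ `^ _ * _ * _); first by ring.
  congr (1 - _); rewrite mulrAC.
  have [hp|hp] := ltP 0 h.
    by rewrite powR_inv1 ?normr_ge0// gtr0_norm// mulVf ?mul1r.
  rewrite powR_inv1 ?normr_ge0// ler0_norm//.
  by rewrite invrN mulNr mulVf// mulN1r cosN.
under eq_integral do rewrite E.
rewrite ge0_integralZl//; last by move=> t _; rewrite lee_fin.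
rewrite -[X in (_ * (_ * X))%E]fineK; last first.
  rewrite ge0_fin_numE; first exact: fourier_fin.
  by apply: integral_ge0 => t _; rewrite lee_fin.
rewrite -!EFinM -/fourier_const; congr EFin.
rewrite mulrA [RHS]mulrC; congr (_ * _).
rewrite -powR_inv1; last by rewrite normr_ge0.
rewrite -powRD; last by rewrite (gt_eqF h0) implybT.
by congr (_ `^ _); ring.
Qed.

End exponent.

End KernelConstants.

(** * Functions of bounded variation and their fractional derivatives *)

Section Densities.
Context {R : realType}.
Local Notation mu := (@lebesgue_measure R).
Local Notation MR := (measurableTypeR R).
Variable nu : {sigma_finite_measure set MR -> \bar R}.
Hypothesis nu_fin : (nu setT < +oo)%E.

(** The signed measures q dnu of which the distribution functions are the
    functions of bounded variation studied here. *)
Definition is_density (T : R) (q : R -> R) : Prop :=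
  [/\ measurable_fun [set: MR] q, exists M : R, forall a, `|q a| <= M
    & forall a, ~~ (0 <= a <= T) -> q a = 0].

Lemma integrable_bounded_section d (Y : measurableType d)
    (rho : {sigma_finite_measure set Y -> \bar R}) (u : MR * Y -> R) (K : R) :
  measurable_fun setT u ->
  (forall a, \int[rho]_y `|(u (a, y))%:E| <= K%:E)%E ->
  (nu \x rho)%E.-integrable setT (EFin \o u).
Proof.
move=> mu_ uK.
have mEu : measurable_fun setT (EFin \o u) by exact/measurable_EFinP.
apply/(integrable12ltyP _ _ mEu).
apply: (@le_lt_trans _ _ (\int[nu]_z K%:E)%E); last exact: integral_cst_lty.
apply: ge0_le_integral => //.
- by move=> x _; apply: integral_ge0.
- apply: (@measurable_fun_fubini_tonelli_F _ _ _ _ _ rho (fun z => `|(u z)%:E|)%E) => //.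
  exact: measurableT_comp.
- by move=> z _; exact: uK.
Qed.

Lemma integrable_bounded (f : R -> R) (M : R) : measurable_fun [set: MR] f ->
  (forall a, `|f a| <= M) -> nu.-integrable setT (EFin \o f).
Proof.
move=> mf fM; apply: measurable_bounded_integrable => //.
by exists M; split; [exact: num_real|move=> x xM a _; rewrite /= (le_trans (fM a))// ltW].
Qed.

Lemma integrable_density T q : is_density T q -> nu.-integrable setT (EFin \o q).
Proof. by move=> [mq [M qM] _]; exact: integrable_bounded mq qM. Qed.

(** The isometry principle behind every identity below: if a ↦ f (a, .) embeds
    the line in L^2 with squared distances gg, then for q dnu of total mass 0
    the squared norm of the superposition of the f (a, .) is a double integral
    of gg alone, by polarisation. *)
Lemma isometry_superposition d (Y : measurableType d)
    (rho : {sigma_finite_measure set Y -> \bar R}) (f : MR * Y -> R)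
    (gg : R -> R -> R) (a0 : R) (q : R -> R) (M G : R) :
  measurable_fun setT f ->
  (forall a b, \int[rho]_y ((f (a, y) - f (b, y)) ^+ 2)%:E = (gg a b)%:E)%E ->
  measurable_fun [set: MR] q -> (forall a, `|q a| <= M) ->
  (forall a, q a != 0 -> gg a a0 <= G) ->
  \int[nu]_a q a = 0 ->
  [/\ rho.-integrable setT
        (fun y => ((\int[nu]_a (q a * (f (a, y) - f (a0, y)))) ^+ 2)%:E),
      (square_measure nu).-integrable setT
        (fun z => (q z.1 * q z.2 * gg z.1 z.2)%:E)
    & \int[rho]_y ((\int[nu]_a (q a * (f (a, y) - f (a0, y)))) ^+ 2) =
      - 2^-1 * \int[square_measure nu]_z (q z.1 * q z.2 * gg z.1 z.2)].
Proof.
move=> mf fgg mq qM qG q0.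
pose F a y := f (a, y) - f (a0, y).
pose u := fun w : MR * Y => q w.1 * (f w - f (a0, w.2)).
have M0 : 0 <= M by exact: le_trans (qM 0).
have gg0 a b : 0 <= gg a b.
  by rewrite -lee_fin -fgg; apply: integral_ge0 => y _; rewrite lee_fin sqr_ge0.
have mfa a : measurable_fun setT (fun y => f (a, y)).
  exact: (measurableT_comp mf (measurable_pair1 a)).
have mu_ : measurable_fun setT u.
  apply: measurable_funM; first exact: (measurableT_comp mq measurable_fst).
  apply: measurable_funB => //.
  exact: (measurableT_comp (mfa a0) measurable_snd).
have m2 a b : measurable_fun setT (fun y => ((f (a, y) - f (b, y)) ^+ 2)%:E).
  by apply/measurable_EFinP; apply: measurable_funX; exact: measurable_funB.
have i2 a b : rho.-integrable setT (fun y => ((f (a, y) - f (b, y)) ^+ 2)%:E).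
  apply/integrableP; split => //.
  rewrite (_ : (\int[rho]_y _)%E = (gg a b)%:E) ?ltry// -fgg.
  by apply: eq_integral => y _; rewrite /= ger0_norm// sqr_ge0.
have uK a : (\int[rho]_y (u (a, y) ^+ 2)%:E <= (M ^+ 2 * Num.max G 0)%:E)%E.
  rewrite /u /F /=.
  under eq_integral do rewrite exprMn EFinM.
  rewrite ge0_integralZl//; last 2 first.
  - by move=> y _; rewrite lee_fin sqr_ge0.
  - by rewrite lee_fin sqr_ge0.
  rewrite fgg -EFinM lee_fin.
  have [->|qa] := eqVneq (q a) 0; first by rewrite expr0n mul0r mulr_ge0 ?sqr_ge0// le_max lexx orbT.
  apply: ler_pM => //; first exact: sqr_ge0.
    by rewrite -real_normK ?num_real// ler_sqr ?nnegrE.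
  by rewrite le_max qG.
have [i1 iH0 E1] := bilinear_Fubini nu_fin mu_ mu_ uK uK.
have iq : nu.-integrable setT (EFin \o q) by exact: integrable_bounded mq qM.
pose h a := q a * gg a a0.
have mgg : measurable_fun [set: MR] (fun a => gg a a0).
  have -> : (fun a => gg a a0) = (fun a => \int[rho]_y ((f (a, y) - f (a0, y)) ^+ 2)).
    by apply/funext => a; rewrite /Rintegral fgg.
  apply: (@measurable_Rintegral_param1 _ _ _ _ _ rho (fun w => (f w - f (a0, w.2)) ^+ 2)).
  apply: measurable_funX; apply: measurable_funB => //.
  exact: (measurableT_comp (mfa a0) measurable_snd).
have ih : nu.-integrable setT (EFin \o h).
  apply: (@integrable_bounded h (M * Num.max G 0)).
    exact: measurable_funM.
  move=> a; rewrite /h normrM; have [->|qa] := eqVneq (q a) 0.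
    by rewrite normr0 mul0r mulr_ge0// le_max lexx orbT.
  by apply: ler_pM => //; rewrite ger0_norm// le_max qG.
have E2 z : \int[rho]_y (u (z.1, y) * u (z.2, y)) =
    2^-1 * (h z.1 * q z.2) + 2^-1 * (q z.1 * h z.2) - 2^-1 * (q z.1 * q z.2 * gg z.1 z.2).
  transitivity (q z.1 * q z.2 * 2^-1 * \int[rho]_y ((f (z.1, y) - f (a0, y)) ^+ 2 +
      (f (z.2, y) - f (a0, y)) ^+ 2 - (f (z.1, y) - f (z.2, y)) ^+ 2)).
    rewrite -RintegralZl//; last first.
      by apply: integrable_subR; [|apply: integrable_addR; [|exact: i2|exact: i2]|exact: i2].
    by apply: eq_Rintegral => y _; rewrite /u /=; field.
  rewrite RintegralB; [|by []|by apply: integrable_addR; [|exact: i2|exact: i2]|exact: i2].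
  rewrite RintegralD; [|by []|exact: i2|exact: i2].
  rewrite /Rintegral !fgg /=.
  by rewrite /h; field.
have iT1 := integrable_tensor ih iq; have iT2 := integrable_tensor iq ih.
have T1 : \int[square_measure nu]_z (h z.1 * q z.2) = 0.
  by rewrite (Rintegral_tensor ih iq) q0 mulr0.
have T2 : \int[square_measure nu]_z (q z.1 * h z.2) = 0.
  by rewrite (Rintegral_tensor iq ih) q0 mul0r.
pose H z := \int[rho]_y (u (z.1, y) * u (z.2, y)).
have iH : (square_measure nu).-integrable setT (EFin \o H) by [].
have EG : (fun z => (q z.1 * q z.2 * gg z.1 z.2)%:E) = (fun z : MR * MR =>
    (h z.1 * q z.2 + q z.1 * h z.2 + (- 2) * H z)%:E).
  by apply/funext => z; congr EFin; rewrite /H E2; field.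
have iG : (square_measure nu).-integrable setT (fun z => (q z.1 * q z.2 * gg z.1 z.2)%:E).
  rewrite EG; apply: integrable_addR => //; first exact: integrable_addR.
  exact: integrable_scaleR.
split.
- have : rho.-integrable setT (fun y => ((\int[nu]_x u (x, y)) * (\int[nu]_x u (x, y)))%:E) by [].
  by apply: eq_integrable.
- exact: iG.
- transitivity (\int[square_measure nu]_z H z); first exact: E1.
  have -> : \int[square_measure nu]_z H z = \int[square_measure nu]_z
     (2^-1 * (h z.1 * q z.2 + q z.1 * h z.2 - q z.1 * q z.2 * gg z.1 z.2)).
    by apply: eq_Rintegral => z _; rewrite /H E2; ring.
  have iT : (square_measure nu).-integrable setT (EFin \o (fun z => h z.1 * q z.2 + q z.1 * h z.2)).
    exact: integrable_addR.
  rewrite RintegralZl//; last exact: integrable_subR.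
  by rewrite RintegralB// RintegralD// T1 T2 add0r sub0r; ring.
Qed.

End Densities.

(** * The energy of a fractional derivative *)

Section FractionalEnergy.
Context {R : realType}.
Local Notation mu := (@lebesgue_measure R).
Local Notation MR := (measurableTypeR R).
Variable nu : {sigma_finite_measure set MR -> \bar R}.
Hypothesis nu_fin : (nu setT < +oo)%E.
Variable al : R.
Hypotheses (al0 : 0 < al) (al1 : 2 * al < 1).

(** The distribution function of q dnu; the atoms of nu are its jumps. *)
Definition jump_sum (q : R -> R) (t : R) : R :=
  \int[nu]_a (q a * \1_(`]-oo, t]%classic) a).

(** Differentiating jump_sum q under a convolution replaces it by q dnu: up to
    the factor 1 / Gamma(1 - al), frac_plus and frac_minus are the left and right
    fractional derivatives of jump_sum q. *)
Definition frac_plus (q : R -> R) (t : R) : R :=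
  \int[nu]_a (q a * kpow al (t - a)).

Definition frac_minus (q : R -> R) (t : R) : R :=
  - \int[nu]_a (q a * kpow al (a - t)).

(** The energy of q dnu for the kernel - |a - b|^(1 - 2 al), which is positive
    on measures of total mass 0. *)
Definition riesz_energy (q : R -> R) : R :=
  - \int[square_measure nu]_z (q z.1 * q z.2 * `|z.1 - z.2| `^ (1 - 2 * al)).

Let mkD (f : MR * MR -> R) : measurable_fun setT f ->
  measurable_fun setT (fun w => kpow al (f w)).
Proof. exact: measurable_kpow_comp. Qed.

(** The isometry principle for the translates of the kernel. *)
Lemma frac_minus_energy (T : R) (q : R -> R) : is_density T q ->
  \int[nu]_a q a = 0 ->
  mu.-integrable `]0, T[%classic (fun t => (frac_minus q t ^+ 2)%:E) /\
  \int[mu]_(t in `]0, T[) (frac_minus q t ^+ 2) <=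
    increment_const al / 2 * riesz_energy q.
Proof.
move=> [mq [M qM] qT] q0.
pose f := fun w : MR * MR => kpow al (w.1 - w.2).
have mf : measurable_fun setT f.
  by apply: mkD; apply: measurable_funB; [exact: measurable_fst|exact: measurable_snd].
have fgg a b : (\int[mu]_y ((f (a, y) - f (b, y)) ^+ 2)%:E =
    (increment_const al * `|a - b| `^ (1 - 2 * al))%:E)%E.
  exact: integral_increment.
have c0 : 0 <= increment_const al by rewrite ltW// increment_const_gt0.
have qG a : q a != 0 -> increment_const al * `|a - 0| `^ (1 - 2 * al) <=
    increment_const al * T `^ (1 - 2 * al).
  move=> qa; have : 0 <= a <= T.
    by apply: contraT => /qT h; rewrite h eqxx in qa.
  move=> /andP[a0 aT]; rewrite ler_wpM2l// subr0 ger0_norm//.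
  by rewrite ge0_ler_powR ?nnegrE ?subr_ge0 ?(ltW al1)// (le_trans a0).
have [i1 i2 E] := isometry_superposition nu_fin mf fgg mq qM qG q0.
have fE t : `]0, T[%classic t ->
    (\int[nu]_a (q a * (f (a, t) - f (0, t)))) ^+ 2 = frac_minus q t ^+ 2.
  rewrite /= in_itv/= => /andP[t0 tT]; rewrite /frac_minus sqrrN; congr (_ ^+ 2).
  apply: eq_Rintegral => a _; rewrite /f/= [kpow al (0 - t)]kpow0 ?subr0//.
  by rewrite sub0r oppr_le0 ltW.
have iS : mu.-integrable `]0, T[%classic
    (fun t => ((\int[nu]_a (q a * (f (a, t) - f (0, t)))) ^+ 2)%:E).
  exact: integrableS i1.
split.
  by apply: eq_integrable iS => // t /[!inE] tD; rewrite fE.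
rewrite (_ : _ / 2 * _ = \int[mu]_t ((\int[nu]_a (q a * (f (a, t) - f (0, t)))) ^+ 2)).
  have -> : \int[mu]_(t in `]0, T[) (frac_minus q t ^+ 2) = \int[mu]_(t in `]0, T[)
      ((\int[nu]_a (q a * (f (a, t) - f (0, t)))) ^+ 2).
    by apply: eq_Rintegral => t /[!inE] tD; rewrite fE.
  rewrite /Rintegral fine_le//.
  - exact: integrable_fin_num iS.
  - exact: integrable_fin_num i1.
  apply: ge0_subset_integral => //; first exact: measurable_int i1.
  by move=> t _; rewrite lee_fin sqr_ge0.
rewrite E /riesz_energy mulrN -mulNr.
have -> : (fun z : MR * MR => q z.1 * q z.2 * (increment_const al * `|z.1 - z.2| `^ (1 - 2 * al))) =
   (fun z => increment_const al * (q z.1 * q z.2 * `|z.1 - z.2| `^ (1 - 2 * al))).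
  by apply/funext => z; ring.
have c00 : increment_const al != 0 by rewrite gt_eqF// increment_const_gt0.
rewrite RintegralZl//; first by field.
have -> : (EFin \o (fun z : MR * MR => q z.1 * q z.2 * `|z.1 - z.2| `^ (1 - 2 * al))) =
  (fun z => ((increment_const al)^-1)%:E * (q z.1 * q z.2 * (increment_const al * `|z.1 - z.2| `^ (1 - 2 * al)))%:E)%E.
  by apply/funext => z /=; rewrite -EFinM; congr EFin; field.
exact: integrableZl.
Qed.

Lemma riesz_energy_ge0 (T : R) (q : R -> R) : is_density T q ->
  \int[nu]_a q a = 0 -> 0 <= riesz_energy q.
Proof.
move=> dq q0; have [_] := frac_minus_energy dq q0.
have c0 := increment_const_gt0 al0 al1.
set I := (X in X <= _) => h; have : 0 <= I by apply: Rintegral_ge0 => t _; exact: sqr_ge0.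
by move=> /le_trans/(_ h); rewrite pmulr_rge0// divr_gt0.
Qed.

Lemma integrable_riesz (T : R) (q : R -> R) : is_density T q ->
  (square_measure nu).-integrable setT
    (fun z => (q z.1 * q z.2 * `|z.1 - z.2| `^ (1 - 2 * al))%:E).
Proof.
move=> [mq [M qM] qT].
have sfin := square_measure_lty nu_fin.
apply: (@measurable_bounded_integrable _ _ _ (square_measure nu)
   (fun z => q z.1 * q z.2 * `|z.1 - z.2| `^ (1 - 2 * al))) => //.
  apply: measurable_funM; first apply: measurable_funM.
  - exact: (measurableT_comp mq measurable_fst).
  - exact: (measurableT_comp mq measurable_snd).
  - apply: (measurableT_comp (@measurable_powR R (1 - 2 * al))).
    apply: measurableT_comp => //.
    by apply: measurable_funB; [exact: measurable_fst|exact: measurable_snd].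
exists (M * M * `|T| `^ (1 - 2 * al)); split; first exact: num_real.
move=> x xM z _; apply/ltW; apply: le_lt_trans xM => /=.
have M0 : 0 <= M by exact: le_trans (qM 0).
rewrite normrM normrM.
have [->|qa] := eqVneq (q z.1) 0; first by rewrite normr0 !mul0r !mulr_ge0 ?powR_ge0.
have [->|qb] := eqVneq (q z.2) 0; first by rewrite normr0 mulr0 mul0r !mulr_ge0 ?powR_ge0.
have /andP[a0 aT] : 0 <= z.1 <= T by apply: contraT => /qT h; rewrite h eqxx in qa.
have /andP[b0 bT] : 0 <= z.2 <= T by apply: contraT => /qT h; rewrite h eqxx in qb.
apply: ler_pM; rewrite ?mulr_ge0//; first by rewrite ler_pM.
rewrite ger0_norm ?powR_ge0// ge0_ler_powR ?nnegrE ?subr_ge0 ?(ltW al1)//.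
have T0 := le_trans a0 aT; rewrite (ger0_norm T0) ler_norml.
by apply/andP; split; lra.
Qed.

(** For each pair of jump locations the two kernels have a Beta integral, and
    symmetrising in the pair gives the energy. *)
Lemma frac_plus_minus_energy (T b : R) (q : R -> R) : b <= T -> is_density b q ->
  mu.-integrable `]0, T[%classic (fun t => (frac_plus q t * frac_minus q t)%:E) /\
  \int[mu]_(t in `]0, T[) (frac_plus q t * frac_minus q t) =
    beta_const al / 2 * riesz_energy q.
Proof.
move=> bT dq; have [mq [M qM] qb] := dq.
pose I := \1_(`]0, T[%classic) : R -> R.
have mI : measurable_fun [set: MR] I by exact: measurable_indic.
pose u := fun w : MR * MR => q w.1 * (kpow al (w.2 - w.1) * I w.2).
pose v := fun w : MR * MR => q w.1 * (kpow al (w.1 - w.2) * I w.2).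
have mI2 : measurable_fun setT (fun w : MR * MR => I w.2).
  exact: (measurableT_comp mI measurable_snd).
have mq2 : measurable_fun setT (fun w : MR * MR => q w.1).
  exact: (measurableT_comp mq measurable_fst).
have mu_ : measurable_fun setT u.
  apply: measurable_funM => //; apply: measurable_funM => //; apply: mkD.
  by apply: measurable_funB; [exact: measurable_snd|exact: measurable_fst].
have mv_ : measurable_fun setT v.
  apply: measurable_funM => //; apply: measurable_funM => //; apply: mkD.
  by apply: measurable_funB; [exact: measurable_fst|exact: measurable_snd].
pose W := (\int[mu]_t (kpow (2 * al) t * \1_(`]-oo, T]%classic) t)%:E)%E.
have Wlt : (W < +oo)%E by exact: integral_kpow_window.
have W0 : (0 <= W)%E by apply: integral_ge0 => t _; rewrite lee_fin mulr_ge0 ?kpow_ge0.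
have mW : measurable_fun [set: R] (fun t => (kpow (2 * al) t * \1_(`]-oo, T]%classic) t)%:E).
  by apply/measurable_EFinP; apply: measurable_funM; [exact: measurable_kpow|exact: measurable_indic].
have M0 : 0 <= M by exact: le_trans (qM 0).
pose K := M ^+ 2 * fine W.
have q2 a : q a ^+ 2 <= M ^+ 2.
  by rewrite -real_normK ?num_real// ler_sqr ?nnegrE.
have KW : (K%:E = (M ^+ 2)%:E * W)%E by rewrite EFinM fineK// ge0_fin_numE.
have Iplus (t a : R) : 0 <= a -> I t ^+ 2 <= \1_(`]-oo, T]%classic) (t - a).
  move=> a0; rewrite /I !indicE !mem_setE !in_itv/=.
  case: (boolP (_ && _)) => [/andP[t0 tT]|_]; last by rewrite expr0n.
  by rewrite (_ : t - a <= T) ?expr1n//; lra.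
have Iminus (t a : R) : a <= b -> I t ^+ 2 <= \1_(`]-oo, T]%classic) (a - t).
  move=> ab; rewrite /I !indicE !mem_setE !in_itv/=.
  case: (boolP (_ && _)) => [/andP[t0 tT]|_]; last by rewrite expr0n.
  by rewrite (_ : a - t <= T) ?expr1n//; lra.
have uK a : (\int[mu]_t (u (a, t) ^+ 2)%:E <= K%:E)%E.
  have [qa|qa] := eqVneq (q a) 0.
    rewrite integral0_eq ?KW ?mule_ge0 ?lee_fin ?sqr_ge0// => t _; by rewrite /u/= qa mul0r expr0n.
  have /andP[a0 ab] : 0 <= a <= b by apply: contraT => /qb h; rewrite h eqxx in qa.
  rewrite KW.
  have -> : W = (\int[mu]_t (kpow (2 * al) (- a + 1 * t) * \1_(`]-oo, T]%classic) (- a + 1 * t))%:E)%E.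
    by rewrite /W -(ge0_integral_affine (- a) ltr01 mW) ?mul1e// => t; rewrite lee_fin mulr_ge0 ?kpow_ge0.
  rewrite -ge0_integralZl//; last 3 first.
  - by apply: (measurableT_comp mW); apply: measurable_funD.
  - by move=> t _; rewrite lee_fin mulr_ge0 ?kpow_ge0.
  - by rewrite lee_fin sqr_ge0.
  apply: ge0_le_integral => //.
  - by move=> t _; rewrite lee_fin sqr_ge0.
  - apply/measurable_EFinP; apply: measurable_funX.
    exact: (measurableT_comp mu_ (measurable_pair1 a)).
  - by apply: measurable_funeM; apply: (measurableT_comp mW); apply: measurable_funD.
  - move=> t _; rewrite -EFinM lee_fin /u/= mul1r addrC exprMn exprMn kpow_sqr.
    apply: ler_pM => //; rewrite ?sqr_ge0 ?mulr_ge0 ?kpow_ge0 ?sqr_ge0//.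
    apply: ler_wpM2l; first exact: kpow_ge0.
    by rewrite addrC; exact: Iplus.
have vK a : (\int[mu]_t (v (a, t) ^+ 2)%:E <= K%:E)%E.
  have [qa|qa] := eqVneq (q a) 0.
    rewrite integral0_eq ?KW ?mule_ge0 ?lee_fin ?sqr_ge0// => t _; by rewrite /v/= qa mul0r expr0n.
  have /andP[a0 ab] : 0 <= a <= b by apply: contraT => /qb h; rewrite h eqxx in qa.
  rewrite KW.
  have -> : W = (\int[mu]_t (kpow (2 * al) (a - t) * \1_(`]-oo, T]%classic) (a - t))%:E)%E.
    by rewrite /W -(ge0_integral_reflect a mW)// => t; rewrite lee_fin mulr_ge0 ?kpow_ge0.
  rewrite -ge0_integralZl//; last 3 first.
  - by apply: (measurableT_comp mW); apply: measurable_funB.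
  - by move=> t _; rewrite lee_fin mulr_ge0 ?kpow_ge0.
  - by rewrite lee_fin sqr_ge0.
  apply: ge0_le_integral => //.
  - by move=> t _; rewrite lee_fin sqr_ge0.
  - apply/measurable_EFinP; apply: measurable_funX.
    exact: (measurableT_comp mv_ (measurable_pair1 a)).
  - by apply: measurable_funeM; apply: (measurableT_comp mW); apply: measurable_funB.
  - move=> t _; rewrite -EFinM lee_fin /v/= exprMn exprMn kpow_sqr.
    apply: ler_pM => //; rewrite ?sqr_ge0 ?mulr_ge0 ?kpow_ge0 ?sqr_ge0//.
    apply: ler_wpM2l; first exact: kpow_ge0.
    exact: Iminus.
have [i1 i2 E] := bilinear_Fubini nu_fin mu_ mv_ uK vK.
have prodE t : (frac_plus q t * frac_minus q t) * I t =
    - ((\int[nu]_a u (a, t)) * (\int[nu]_a v (a, t))).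
  rewrite /I indicE; case: (boolP (t \in _)) => tI.
    rewrite /= mulr1n mulr1 /frac_plus /frac_minus mulrN; congr (- (_ * _)).
      by apply: eq_Rintegral => a _; rewrite /u /I/= indicE tI /= mulr1n mulr1.
    by apply: eq_Rintegral => a _; rewrite /v /I/= indicE tI /= mulr1n mulr1.
  rewrite /= mulr0n mulr0 [X in X * _](_ : _ = 0) ?mul0r ?oppr0//.
  under eq_Rintegral do rewrite /u /I/= indicE (negbTE tI) /= mulr0n !mulr0.
  by rewrite Rintegral_cst// mul0r.
have patE : (fun t => frac_plus q t * frac_minus q t) \_ `]0, T[%classic =
    (fun t => (- 1) * ((\int[nu]_a u (a, t)) * (\int[nu]_a v (a, t)))).
  by apply/funext => t; rewrite mulN1r -prodE patchE /I indicE; case: ifP => _; rewrite ?mulr1 ?mulr0.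
split.
  apply/integrable_mkcond => //.
  have := integrable_scaleR measurableT (- 1) i1; apply: eq_integrable => // t _.
  have := congr1 (fun f => f t) patE; rewrite !patchE; case: ifP => _ /=.
    by move=> ->.
  by move=> <-.
rewrite Rintegral_mkcond patE RintegralZl// E.
pose kk (z : MR * MR) := kpow (2 * al - 1) (z.2 - z.1).
have uvE (x z t : R) : q x * (kpow al (t - x) * I t) * (q z * (kpow al (z - t) * I t)) =
    q x * q z * (kpow al (t - x) * kpow al (z - t)).
  have [qa|qa] := eqVneq (q x) 0; first by rewrite qa; ring.
  have [qc|qc] := eqVneq (q z) 0; first by rewrite qc; ring.
  have /andP[a0 ab] : 0 <= x <= b by apply: contraT => /qb h; rewrite h eqxx in qa.
  have /andP[c0 cb] : 0 <= z <= b by apply: contraT => /qb h; rewrite h eqxx in qc.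
  have [h1|h1] := leP (t - x) 0; first by rewrite (kpow0 _ h1); ring.
  have [h2|h2] := leP (z - t) 0; first by rewrite (kpow0 _ h2); ring.
  have -> : I t = 1.
    rewrite /I indicE mem_setE in_itv/= (_ : 0 < t < T)//.
    by move: a0 cb h1 h2 bT; clear; move=> *; apply/andP; split; lra.
  by ring.
have E2 z : \int[mu]_t (u (z.1, t) * v (z.2, t)) = beta_const al * (q z.1 * q z.2 * kk z).
  rewrite /u /v/=.
  under eq_Rintegral do rewrite uvE.
  have kfin := integral_beta_kernel al1 z.1 z.2.
  rewrite RintegralZl//; last first.
    apply/integrableP; split.
      apply/measurable_EFinP; apply: measurable_funM; apply: measurable_kpow_comp;
      exact: measurable_funB.
    rewrite (_ : (\int[mu]_t _)%E = (beta_const al * kk z)%:E) ?ltry// -kfin.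
    by apply: eq_integral => t _; rewrite /= ger0_norm// mulr_ge0 ?kpow_ge0.
  by rewrite /Rintegral kfin /= /kk; ring.
have B0 : beta_const al != 0 by rewrite gt_eqF// beta_const_gt0.
have ikk : (square_measure nu).-integrable setT (fun z => (q z.1 * q z.2 * kk z)%:E).
  have := integrable_scaleR measurableT (beta_const al)^-1 i2; apply: eq_integrable => // z _.
  by rewrite E2; congr EFin; field.
under eq_Rintegral do rewrite E2.
rewrite RintegralZl// /riesz_energy.
have -> : \int[square_measure nu]_z (q z.1 * q z.2 * `|z.1 - z.2| `^ (1 - 2 * al)) =
   \int[square_measure nu]_z (q z.1 * q z.2 * kk z + q z.2 * q z.1 * kk (z.2, z.1)).
  apply: eq_Rintegral => z _; rewrite [q z.2 * q z.1]mulrC -mulrDr; congr (_ * _).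
  rewrite /kk/= /kpow opprB.
  have [h|h|h] := ltgtP z.1 z.2.
  - rewrite subr_gt0 h subr_gt0 ltNge (ltW h)/= addr0 ltr0_norm ?subr_lt0// opprB//.
  - rewrite subr_gt0 ltNge (ltW h)/= subr_gt0 h add0r gtr0_norm ?subr_gt0//.
  - by rewrite h subrr ltxx addr0 normr0 powR0// subr_eq0 gt_eqF.
rewrite RintegralD//; last exact: (integrable_square_swap ikk).
by rewrite (Rintegral_square_swap ikk); field.
Qed.

End FractionalEnergy.

(** * The Fourier norm of a jump sum *)

Section FractionalDistributions.
Context {R : realType}.
Local Notation mu := (@lebesgue_measure R).
Local Notation MR := (measurableTypeR R).
Variable nu : {sigma_finite_measure set MR -> \bar R}.
Hypothesis nu_fin : (nu setT < +oo)%E.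
Variable al : R.
Hypotheses (al0 : 0 < al) (al1 : 2 * al < 1).
Local Notation jump_sum := (jump_sum nu).
Local Notation frac_plus := (frac_plus nu al).
Local Notation frac_minus := (frac_minus nu al).

Let mH : measurable_fun setT (fun w : MR * MR => \1_(`]-oo, w.2]%classic) w.1 : R).
Proof.
rewrite (_ : (fun _ => _) = (fun w : MR * MR => if w.1 <= w.2 then 1 else 0)); last first.
  by apply/funext => w; rewrite indicE mem_setE in_itv/=; case: ifP.
apply: (@measurable_fun_ifT _ _ _ _ (fun _ : MR * MR => 1 : R) (fun _ : MR * MR => 0 : R) (fun w : MR * MR => w.1 <= w.2)) => //.
by apply: measurable_fun_ler; [exact: measurable_fst|exact: measurable_snd].
Qed.

Let mq1 (q : R -> R) : measurable_fun [set: MR] q ->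
  measurable_fun setT (fun w : MR * MR => q w.1).
Proof. by move=> mq; exact: (measurableT_comp mq measurable_fst). Qed.

Lemma measurable_jump_sum T q : is_density T q -> measurable_fun [set: MR] (jump_sum q).
Proof.
move=> [mq _ _].
apply: (@measurable_Rintegral_param _ _ _ _ _ nu
  (fun w : MR * MR => q w.1 * \1_(`]-oo, w.2]%classic) w.1)).
by apply: measurable_funM => //; exact: mq1.
Qed.

Lemma jump_sum_bounded T q : is_density T q ->
  exists M : R, forall t, `|jump_sum q t| <= M.
Proof.
move=> [mq [M qM] _]; exists (M * fine (nu setT)) => t.
have b a : `|q a * \1_(`]-oo, t]%classic) a| <= M.
  rewrite normrM indicE; case: (_ \in _); first by rewrite /= normr1 mulr1.
  by rewrite /= normr0 mulr0 (le_trans _ (qM 0)).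
have m1 : measurable_fun [set: MR] (fun a => q a * \1_(`]-oo, t]%classic) a).
  by apply: measurable_funM => //; exact: measurable_indic.
apply: le_trans (le_normr_Rintegral _ (integrable_bounded nu_fin m1 b)) _ => //.
rewrite -Rintegral_cst//; apply: le_Rintegral => //.
- apply: (integrable_bounded nu_fin (M := M)); first exact: measurableT_comp.
  by move=> a; rewrite normr_id.
- apply: (integrable_bounded nu_fin (M := `|M|)) => //.
Qed.

(** The Fourier transform only sees the density: an integration by parts turns
    the transform of the primitive into that of q dnu divided by xi. *)
Lemma fourier_jump_sum (b : R) (q : R -> R) (g G : R -> R -> R) (xi : R) :
  is_density b q -> \int[nu]_a q a = 0 -> 0 < b ->
  (forall x : R, is_derive x 1 (G xi) (g xi x)) -> continuous (g xi) ->
  \int[mu]_(t in `]0, b[) (jump_sum q t * g xi t) =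
  - \int[nu]_a (q a * (G xi a - G xi 0)).
Proof.
move=> dq q0 b0 dG cg; have [mq [M qM] qb] := dq.
have mg : measurable_fun [set: MR] (g xi) by exact: continuous_measurable_fun.
have M0 : 0 <= M by exact: le_trans (qM 0).
have [Cg gC] : exists C : R, forall t, 0 <= t <= b -> `|g xi t| <= C.
  have h : {within `[0, b], continuous (fun t => `|g xi t|)}.
    apply: continuous_subspaceT => x; apply: continuous_comp; first exact: cg.
    exact: norm_continuous.
  have [c _ hc] := EVT_max (ltW b0) h.
  by exists `|g xi c| => t tb; apply: hc; rewrite in_itv.
have C0 : 0 <= Cg by apply: le_trans (normr_ge0 (g xi 0)) (gC 0 _); rewrite lexx ltW.
pose D := `]0, b[%classic : set R.
pose I := \1_D : R -> R.
have mI : measurable_fun [set: MR] I by apply: measurable_indic; exact: measurable_itv.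
pose u := fun w : MR * MR => q w.1 * \1_(`]-oo, w.2]%classic) w.1 * (g xi w.2 * I w.2).
have mu_ : measurable_fun setT u.
  apply: measurable_funM; first by apply: measurable_funM => //; exact: mq1.
  by apply: (@measurableT_comp _ _ _ _ _ _ (fun t => g xi t * I t)) => //; exact: measurable_funM.
have gI t : `|g xi t * I t| <= Cg * I t.
  rewrite normrM /I indicE; case: (boolP (t \in D)) => tD; last by rewrite /= normr0 !mulr0.
  rewrite /= normr1 !mulr1; apply: gC; move: tD; rewrite /D mem_setE in_itv/= => /andP[h1 h2].
  by rewrite !ltW.
have IC : (\int[mu]_t (Cg * I t)%:E = (Cg * b)%:E)%E.
  under eq_integral do rewrite EFinM.
  rewrite ge0_integralZl//; [|exact/measurable_EFinP|by move=> t _; rewrite lee_fin].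
  by rewrite /I /D (integral_indic_oo (ltW b0)) subr0 EFinM.
have iu : (nu \x mu)%E.-integrable setT (EFin \o u).
  apply: (integrable_bounded_section nu_fin (K := M * (Cg * b))) => // a.
  rewrite EFinM -IC -ge0_integralZl//; last 2 first.
  - by apply/measurable_EFinP; exact: measurable_funM.
  - by move=> t _; rewrite lee_fin (le_trans (normr_ge0 _) (gI t)).
  apply: ge0_le_integral => //.
  - apply: measurableT_comp => //; apply/measurable_EFinP.
    exact: (measurableT_comp mu_ (measurable_pair1 a)).
  - by apply: measurable_funeM; apply/measurable_EFinP; exact: measurable_funM.
  - move=> t _; rewrite -EFinM lee_fin /u/= normrM; apply: ler_pM => //.
    rewrite normrM indicE; case: (_ \in _); first by rewrite /= normr1 mulr1.
    by rewrite /= normr0 mulr0.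
transitivity (\int[mu]_t \int[nu]_a u (a, t)).
  rewrite Rintegral_mkcond; apply: eq_Rintegral => t _; rewrite patchE.
  have It : I t = (t \in D)%:R by rewrite /I indicE.
  move: It; rewrite -/D; case: (t \in D) => It; last first.
    rewrite (_ : (fun a => u (a, t)) = fun=> 0); first by rewrite Rintegral_cst// mul0r.
    by apply/funext => a; rewrite /u/= It mulr0n !mulr0.
  rewrite (_ : (fun a => u (a, t)) = fun a => q a * \1_(`]-oo, t]%classic) a * g xi t); last first.
    by apply/funext => a; rewrite /u/= It mulr1n mulr1.
  rewrite RintegralZr//.
  apply: (integrable_bounded nu_fin (M := M)).
    by apply: measurable_funM => //; exact: measurable_indic.
  move=> a; rewrite normrM indicE; case: (_ \in _); first by rewrite /= normr1 mulr1.
  by rewrite /= normr0 mulr0.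
rewrite -(Rintegral_Fubini iu).
transitivity (\int[nu]_a (q a * (G xi b - G xi a))).
  apply: eq_Rintegral => a _.
  have [qa|qa] := eqVneq (q a) 0.
    by under eq_Rintegral do rewrite /u/= qa !mul0r; rewrite Rintegral_cst// qa !mul0r.
  have /andP[a0 ab] : 0 <= a <= b by apply: contraT => /qb h; rewrite h eqxx in qa.
  transitivity (\int[mu]_(t in `[a, b]) (q a * g xi t)).
    rewrite [RHS]Rintegral_mkcond; apply: Rintegral_ae_eq_any.
    have := ae_lebesgue_neq b; have := ae_lebesgue_neq (0 : R); apply: filterS2 => t t0 tb _.
    rewrite patchE /u /I /D /= !indicE !mem_setE !in_itv/=.
    have [at_|at_] := leP a t; last by rewrite /= mulr0 mul0r.
    have tp : 0 < t by rewrite lt_neqAle eq_sym t0 (le_trans a0).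
    rewrite tp /= mulr1; have [tb'|tb'] := leP t b.
      by rewrite lt_neqAle tb tb' mulr1.
    by rewrite ltNge (ltW tb')/= !mulr0.
  have ig : mu.-integrable `[a, b] (EFin \o g xi).
    apply: continuous_compact_integrable; first exact: segment_compact.
    by apply: continuous_subspaceT => x; exact: cg.
  rewrite RintegralZl//; congr (_ * _).
  by rewrite /Rintegral (integral_derive ab (fun x _ => dG x) (fun x _ => cg x)).
have [CG GC] : exists C : R, forall t, 0 <= t <= b -> `|G xi t - G xi 0| <= C.
  have h : {within `[0, b], continuous (fun t => `|G xi t - G xi 0|)}.
    apply: continuous_subspaceT => x; apply: cvg_norm; apply: cvgB; last exact: cvg_cst.
    by apply: derivable_continuous; have [] := dG x.
  have [c _ hc] := EVT_max (ltW b0) h.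
  by exists `|G xi c - G xi 0| => t tb; apply: hc; rewrite in_itv.
have mG : measurable_fun [set: MR] (G xi).
  apply: continuous_measurable_fun => x.
  by apply: derivable_continuous; have [] := dG x.
have iq := integrable_density nu_fin dq.
have iqG : nu.-integrable setT (fun a => (q a * (G xi a - G xi 0))%:E).
  apply: (integrable_bounded nu_fin (M := M * CG)).
    by apply: measurable_funM => //; exact: measurable_funB.
  move=> a; rewrite normrM.
  have CG0 : 0 <= CG by apply: le_trans (normr_ge0 _) (GC 0 _); rewrite lexx ltW.
  have [qa|qa] := eqVneq (q a) 0; first by rewrite qa normr0 mul0r mulr_ge0.
  apply: ler_pM => //; apply: GC.
  by apply: contraT => /qb h; rewrite h eqxx in qa.
have -> : (fun a => q a * (G xi b - G xi a)) =
   (fun a => (G xi b - G xi 0) * q a - q a * (G xi a - G xi 0)).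
  by apply/funext => a; ring.
rewrite RintegralB//; last exact: integrable_scaleR.
by rewrite RintegralZl// q0 mulr0 sub0r.
Qed.

Let wave (s : bool) (x : R) : R := if s then cos x else sin x.

Let fs (s : bool) (w : MR * MR) : R := `|w.2| `^ (al - 1) * wave s (w.2 * w.1).

Let m_fs s : measurable_fun setT (fs s).
Proof.
apply: measurable_funM.
  apply: (@measurableT_comp _ _ _ _ _ _ (fun x : MR => `|x| `^ (al - 1))); last exact: measurable_snd.
  apply: (measurableT_comp (@measurable_powR R (al - 1))).
  exact: continuous_measurable_fun (@norm_continuous _ R).
have mM : measurable_fun setT (fun w : MR * MR => w.2 * w.1).
  by apply: measurable_funM; [exact: measurable_snd|exact: measurable_fst].
by rewrite /wave; case: s; [exact: (measurableT_comp (@measurable_cos R) mM)|exact: (measurableT_comp (@measurable_sin R) mM)].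
Qed.

Let powR_sqr (x r : R) : (x `^ r) ^+ 2 = x `^ (2 * r).
Proof. by rewrite mulrC powRrM powR_mulrn ?powR_ge0. Qed.

Let fs_sum (a b x : R) :
  (fs true (a, x) - fs true (b, x)) ^+ 2 + (fs false (a, x) - fs false (b, x)) ^+ 2 =
  2 * (`|x| `^ (2 * al - 2) * (1 - cos (x * (a - b)))).
Proof.
rewrite /fs /wave /= -!mulrBr !exprMn powR_sqr -mulrDr.
have -> : 2 * (al - 1) = 2 * al - 2 by ring.
rewrite mulrCA; congr (_ * _).
rewrite [x * (a - b)]mulrBr cosB; set A := x * a; set B := x * b.
have hA := cos2Dsin2 A; have hB := cos2Dsin2 B.
transitivity ((cos A ^+ 2 + sin A ^+ 2) + (cos B ^+ 2 + sin B ^+ 2) - 2 * (cos A * cos B + sin A * sin B)); first by ring.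
by rewrite hA hB; ring.
Qed.

Let fs_int (a b : R) :
  (\int[mu]_x ((fs true (a, x) - fs true (b, x)) ^+ 2)%:E +
   \int[mu]_x ((fs false (a, x) - fs false (b, x)) ^+ 2)%:E =
   (2 * (fourier_const al * `|a - b| `^ (1 - 2 * al)))%:E)%E.
Proof.
have m2 s : measurable_fun setT (fun x : MR => ((fs s (a, x) - fs s (b, x)) ^+ 2)%:E).
  apply/measurable_EFinP; apply: measurable_funX; apply: measurable_funB.
  - exact: (measurableT_comp (m_fs s) (measurable_pair1 a)).
  - exact: (measurableT_comp (m_fs s) (measurable_pair1 b)).
rewrite -ge0_integralD//; [|by move=> x _; rewrite lee_fin sqr_ge0|by move=> x _; rewrite lee_fin sqr_ge0].
rewrite EFinM -(integral_onem_cos al0 al1) -ge0_integralZl//.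
- by apply: eq_integral => x _; rewrite -EFinD fs_sum EFinM.
- apply/measurable_EFinP; apply: measurable_funM.
    apply: (measurableT_comp (@measurable_powR R (2 * al - 2))).
    exact: continuous_measurable_fun (@norm_continuous _ R).
  apply: measurable_funB => //; apply: (measurableT_comp (@measurable_cos R)).
  exact: measurable_funM.
Qed.

Let gg (s : bool) (a b : R) : R := fine (\int[mu]_x ((fs s (a, x) - fs s (b, x)) ^+ 2)%:E).

Let fs_fin s (a b : R) :
  (\int[mu]_x ((fs s (a, x) - fs s (b, x)) ^+ 2)%:E = (gg s a b)%:E)%E.
Proof.
rewrite /gg fineK//.
have p s' : (0 <= \int[mu]_x ((fs s' (a, x) - fs s' (b, x)) ^+ 2)%:E)%E.
  by apply: integral_ge0 => x _; rewrite lee_fin sqr_ge0.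
rewrite ge0_fin_numE//; apply: (@le_lt_trans _ _ ((2 * (fourier_const al * `|a - b| `^ (1 - 2 * al)))%:E)); last exact: ltry.
by rewrite -fs_int; case: s; [rewrite leeDl|rewrite leeDr].
Qed.

Let gg_sum (a b : R) : gg true a b + gg false a b = 2 * (fourier_const al * `|a - b| `^ (1 - 2 * al)).
Proof. by have := fs_int a b; rewrite !fs_fin -EFinD => -[]. Qed.

Let gg_ge0 s (a b : R) : 0 <= gg s a b.
Proof. by apply: fine_ge0; apply: integral_ge0 => x _; rewrite lee_fin sqr_ge0. Qed.

Let cancel_half (p c I : R) : p * (- 2^-1 * (2 * c * I)) = p * c * - I.
Proof. by field. Qed.

(** The isometry principle for the waves |xi|^(al - 1) exp(i xi a), split into
    their cosine and sine parts: the squared distance of two of them is a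
    multiple of |a - b|^(1 - 2 al). *)
Lemma fourier_norm2_jump_sum (b : R) (q : R -> R) : 0 < b ->
  is_density b q -> \int[nu]_a q a = 0 ->
  (fourier_norm2 al `]0%R, b[ (jump_sum q) =
   ((2 * pi)^-1 * fourier_const al * riesz_energy nu al q)%:E)%E.
Proof.
move=> b0 dq q0; have [mq [M qM] qb] := dq.
have qG s (a : R) : q a != 0 -> gg s a 0 <= 2 * (fourier_const al * b `^ (1 - 2 * al)).
  move=> qa; have /andP[a0 ab] : 0 <= a <= b by apply: contraT => /qb h; rewrite h eqxx in qa.
  apply: (@le_trans _ _ (gg true a 0 + gg false a 0)).
    by case: s; rewrite ?lerDl ?lerDr.
  have c0 : 0 <= fourier_const al.
    apply: fine_ge0; apply: integral_ge0 => x _.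
    by rewrite lee_fin mulr_ge0 ?powR_ge0// subr_ge0 cos_le1.
  rewrite gg_sum ler_wpM2l// ler_wpM2l// subr0 ger0_norm//.
  by rewrite ge0_ler_powR ?nnegrE ?subr_ge0 ?(ltW al1)// ltW.
pose S s x := \int[nu]_a (q a * (fs s (a, x) - fs s (0, x))).
have IS s := isometry_superposition nu_fin (m_fs s) (fs_fin s) mq qM (qG s) q0.
have [i1 j1 E1] := IS true; have [i2 j2 E2] := IS false.
have sq2 : (Num.sqrt (2 * pi))^-1 ^+ 2 = (2 * pi : R)^-1.
  by rewrite exprVn sqr_sqrtr// mulr_ge0// pi_ge0.
have key (xi : R) : xi != 0 ->
    `|xi| `^ (2 * al) * (fourier_re `]0, b[ (jump_sum q) xi ^+ 2 +
      fourier_im `]0, b[ (jump_sum q) xi ^+ 2) =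
    (2 * pi)^-1 * (S true xi ^+ 2 + S false xi ^+ 2).
  move=> xi0.
  have ib (h : R -> R) (K : R) : measurable_fun [set: MR] h -> (forall a, `|h a| <= K) ->
      nu.-integrable setT (fun a => (q a * h a)%:E).
    move=> mh hK; apply: (integrable_bounded nu_fin (M := M * K)).
      exact: measurable_funM.
    by move=> a; rewrite normrM ler_pM.
  have mwave s : measurable_fun [set: MR] (fun a => wave s (xi * a) - wave s (xi * 0)).
    apply: measurable_funB => //; rewrite /wave; case: s.
      by apply: (measurableT_comp (@measurable_cos R)); exact: measurable_funM.
    by apply: (measurableT_comp (@measurable_sin R)); exact: measurable_funM.
  have bwave s a : `|wave s (xi * a) - wave s (xi * 0)| <= 2.
    apply: (le_trans (ler_normB _ _)); rewrite /wave (_ : 2 = 1 + 1 :> R)//.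
    by case: s; rewrite lerD ?cos_max ?sin_max.
  have iw s := ib _ _ (mwave s) (bwave s).
  have SE s : S s xi ^+ 2 = `|xi| `^ (2 * al) * (\int[nu]_a (q a * (wave s (xi * a) - wave s (xi * 0))) / xi) ^+ 2.
    have -> : S s xi = `|xi| `^ (al - 1) * \int[nu]_a (q a * (wave s (xi * a) - wave s (xi * 0))).
      rewrite -(@RintegralZl _ _ _ _ _ _ (`|xi| `^ (al - 1)) measurableT (iw s)).
      by apply: eq_Rintegral => a _; rewrite /fs/=; ring.
    have xp : 0 < `|xi| by rewrite normr_gt0.
    have P : (`|xi| `^ (al - 1)) ^+ 2 = `|xi| `^ (2 * al) * xi^-1 ^+ 2.
      rewrite powR_sqr (_ : 2 * (al - 1) = 2 * al + (- 2)); last by ring.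
      rewrite powRD; last by rewrite (gt_eqF xp) implybT.
      by rewrite powR_invn// exprVn real_normK ?num_real.
    by rewrite exprMn P exprMn; ring.
  have dlin (x : R) : is_derive x 1 (fun x => xi * x) xi.
    have := @is_deriveZ R R R id xi x 1 1 (is_derive_id x 1).
    by rewrite /GRing.scale/= mulr1.
  have dsin (x : R) : is_derive x 1 (fun x : R => sin (xi * x) / xi) (cos (xi * x)).
    have h := is_derive1_comp (is_derive_sin (xi * x)) (dlin x).
    have := is_deriveZ xi^-1 h; rewrite /GRing.scale/=.
    rewrite (_ : xi^-1 * _ = cos (xi * x)); last by field.
    by congr is_derive; apply/funext => y; rewrite mulrC.
  have dcos (x : R) : is_derive x 1 (fun x : R => - cos (xi * x) / xi) (sin (xi * x)).
    have h := is_derive1_comp (is_derive_cos (xi * x)) (dlin x).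
    have := is_deriveZ (- xi^-1) h; rewrite /GRing.scale/=.
    rewrite (_ : - xi^-1 * _ = sin (xi * x)); last by field.
    by congr is_derive; apply/funext => y; transitivity (- xi^-1 * cos (xi * y)); [by []|ring].
  have ccos : continuous (fun x : R => cos (xi * x)).
    move=> x; apply: continuous_comp; last exact: continuous_cos.
    exact: mulrl_continuous.
  have csin : continuous (fun x : R => sin (xi * x)).
    move=> x; apply: continuous_comp; last exact: continuous_sin.
    exact: mulrl_continuous.
  have R1 := @fourier_jump_sum b q (fun xi x => cos (xi * x)) (fun xi x => sin (xi * x) / xi) xi dq q0 b0 dsin ccos.
  have R2 := @fourier_jump_sum b q (fun xi x => sin (xi * x)) (fun xi x => - cos (xi * x) / xi) xi dq q0 b0 dcos csin.
  rewrite /fourier_re /fourier_im R1 R2.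
  have -> : \int[nu]_a (q a * (sin (xi * a) / xi - sin (xi * 0) / xi)) =
      \int[nu]_a (q a * (wave false (xi * a) - wave false (xi * 0))) / xi.
    rewrite -(@RintegralZr _ _ _ _ _ _ xi^-1 measurableT (iw false)).
    by apply: eq_Rintegral => a _; rewrite /wave; ring.
  have -> : \int[nu]_a (q a * (- cos (xi * a) / xi - - cos (xi * 0) / xi)) =
      - (\int[nu]_a (q a * (wave true (xi * a) - wave true (xi * 0))) / xi).
    rewrite -[RHS]mulrN -(@RintegralZr _ _ _ _ _ _ (- xi^-1) measurableT (iw true)).
    by apply: eq_Rintegral => a _; rewrite /wave; ring.
  by rewrite !SE -sq2; ring.
rewrite /fourier_norm2.
have -> : (\int[mu]_xi (`|xi| `^ (2 * al) * (fourier_re `]0, b[ (jump_sum q) xi ^+ 2 +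
      fourier_im `]0, b[ (jump_sum q) xi ^+ 2))%:E =
   \int[mu]_xi ((2 * pi)^-1 * (S true xi ^+ 2 + S false xi ^+ 2))%:E)%E.
  apply: integral_ae_eq_any; have := ae_lebesgue_neq (0 : R); apply: filterS => xi xi0 _.
  by rewrite key.
have iS : mu.-integrable setT (fun x => (S true x ^+ 2 + S false x ^+ 2)%:E).
  exact: integrable_addR.
have iS2 := integrable_scaleR measurableT ((2 * pi)^-1) iS.
rewrite -[LHS]fineK; last exact: integrable_fin_num iS2.
congr EFin; rewrite -[LHS]/(Rintegral mu setT _).
rewrite RintegralZl// RintegralD//.
rewrite [X in X + _]E1 [X in _ + X]E2 -mulrDr -RintegralD//.
have -> : \int[square_measure nu]_z (q z.1 * q z.2 * gg true z.1 z.2 + q z.1 * q z.2 * gg false z.1 z.2) =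
   \int[square_measure nu]_z (2 * fourier_const al * (q z.1 * q z.2 * `|z.1 - z.2| `^ (1 - 2 * al))).
  by apply: eq_Rintegral => z _; rewrite -mulrDr gg_sum; ring.
rewrite RintegralZl//; last exact: (integrable_riesz nu_fin al1 dq).
exact: cancel_half.
Qed.

End FractionalDistributions.

(** * Riemann-Liouville derivatives as distributions *)

Section RiemannLiouville.
Context {R : realType}.
Local Notation mu := (@lebesgue_measure R).
Local Notation MR := (measurableTypeR R).
Variable nu : {sigma_finite_measure set MR -> \bar R}.
Hypothesis nu_fin : (nu setT < +oo)%E.
Variable al : R.
Hypotheses (al0 : 0 < al) (al1 : 2 * al < 1).
Local Notation jump_sum := (jump_sum nu).
Local Notation frac_plus := (frac_plus nu al).
Local Notation frac_minus := (frac_minus nu al).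

Lemma superposition_Fubini (k : MR * MR -> R) (K : R) (T : R) (q : R -> R) :
  is_density T q -> measurable_fun setT k -> (forall z, 0 <= k z) ->
  (forall a : R, 0 <= a <= T -> (\int[mu]_s (k (a, s))%:E <= K%:E)%E) ->
  mu.-integrable setT (fun s => (\int[nu]_a (q a * k (a, s)))%:E) /\
  \int[mu]_s \int[nu]_a (q a * k (a, s)) = \int[nu]_a (q a * \int[mu]_s k (a, s)).
Proof.
move=> [mq [M qM] qT] mk k0 kK.
have M0 : 0 <= M by exact: le_trans (qM 0).
pose u := fun w : MR * MR => q w.1 * k w.
have mu_ : measurable_fun setT u.
  apply: measurable_funM => //; exact: (measurableT_comp mq measurable_fst).
have mks a : measurable_fun [set: MR] (fun s => (k (a, s))%:E).
  by apply/measurable_EFinP; exact: (measurableT_comp mk (measurable_pair1 a)).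
have iu : (nu \x mu)%E.-integrable setT (EFin \o u).
  apply: (integrable_bounded_section nu_fin (K := M * `|K|)) => // a.
  rewrite EFinM; have [qa|qa] := eqVneq (q a) 0.
    rewrite integral0_eq; first by rewrite -EFinM lee_fin mulr_ge0.
    by move=> s _; rewrite /u/= qa mul0r normr0.
  have aT : 0 <= a <= T by apply: contraT => /qT h; rewrite h eqxx in qa.
  under eq_integral do rewrite /u /= normrM (ger0_norm (k0 _)) EFinM.
  rewrite ge0_integralZl//; last by move=> s _; rewrite lee_fin.
  apply: lee_pmul; rewrite ?lee_fin//.
    by apply: integral_ge0 => s _; rewrite lee_fin.
  by apply: (le_trans (kK _ aT)); rewrite lee_fin ler_norm.
split; first exact: integrable_Rintegral_param iu.
rewrite -(Rintegral_Fubini iu); apply: eq_Rintegral => a _; rewrite /u/=.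
have [qa|qa] := eqVneq (q a) 0.
  rewrite qa mul0r; under eq_Rintegral do rewrite mul0r.
  by rewrite Rintegral_cst// mul0r.
rewrite RintegralZl//; apply/integrableP; split; first exact: mks.
have aT : 0 <= a <= T by apply: contraT => /qT h; rewrite h eqxx in qa.
apply: le_lt_trans (ltry K); apply: le_trans (kK a aT).
rewrite le_eqVlt; apply/orP; left; apply/eqP; apply: eq_integral => s _.
by rewrite gee0_abs// lee_fin.
Qed.

Let mind (a : R) : measurable_fun [set: R] (fun s => \1_(`]-oo, a]%classic) s : R).
Proof. exact: measurable_indic. Qed.

Let al_lt1 : al < 1.
Proof. by move: al0 al1; lra. Qed.

Let window (c : R) : R := fine (\int[mu]_x (kpow al x * \1_(`]-oo, c]%classic) x)%:E)%E.

Let windowE c : (\int[mu]_x (kpow al x * \1_(`]-oo, c]%classic) x)%:E = (window c)%:E)%E.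
Proof.
rewrite fineK// ge0_fin_numE ?integral_kpow_window//.
by apply: integral_ge0 => t _; rewrite lee_fin mulr_ge0 ?kpow_ge0.
Qed.

Let mwin (a c : R) :
  measurable_fun [set: R] (fun s => (kpow al (s - a) * \1_(`]-oo, c]%classic) s)%:E).
Proof.
apply/measurable_EFinP; apply: measurable_funM => //.
by apply: measurable_kpow_comp; exact: measurable_funB.
Qed.

Let window_bound (a c : R) : 0 <= a ->
  (\int[mu]_s (kpow al (s - a) * \1_(`]-oo, c]%classic) s)%:E <= (window c)%:E)%E.
Proof.
move=> a0; rewrite -windowE.
have := @ge0_integral_affine R a 1 (fun s => (kpow al (s - a) * \1_(`]-oo, c]%classic) s)%:E) ltr01 (mwin a c).
rewrite mul1e => <-; last by move=> s; rewrite lee_fin mulr_ge0 ?kpow_ge0.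
apply: ge0_le_integral => //.
- by move=> s _; rewrite lee_fin mulr_ge0 ?kpow_ge0.
- apply/measurable_EFinP; apply: measurable_funM.
    by apply: measurable_kpow_comp; apply: measurable_funB => //; apply: measurable_funD => //; exact: measurable_funM.
  by apply: (measurableT_comp (mind c)); apply: measurable_funD => //; exact: measurable_funM.
- apply/measurable_EFinP; apply: measurable_funM => //; exact: measurable_kpow.
- move=> x _; rewrite lee_fin mul1r addrAC subrr add0r ler_wpM2l ?kpow_ge0//.
  rewrite !indicE !mem_setE !in_itv/= ler_nat.
  case: (leP (a + x) c) => // h; rewrite (_ : x <= c)//.
  by apply: le_trans h; rewrite lerDr.
Qed.

Let window_mono (t a b s : R) : a <= b ->
  kpow al (s - t) * \1_(`]-oo, a]%classic) s <= kpow al (s - t) * \1_(`]-oo, b]%classic) s.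
Proof.
move=> ab; rewrite ler_wpM2l ?kpow_ge0// !indicE !mem_setE !in_itv/= ler_nat.
by case: (leP s a) => // h; rewrite (le_trans h ab).
Qed.

Let mker1 (f : MR * MR -> R) (I : R -> R) : measurable_fun setT f ->
  measurable_fun [set: MR] I -> measurable_fun setT (fun w : MR * MR => kpow al (f w) * I w.2).
Proof.
move=> mf mI; apply: measurable_funM; first exact: measurable_kpow_comp.
exact: (measurableT_comp mI measurable_snd).
Qed.

Let msub : measurable_fun setT (fun w : MR * MR => w.2 - w.1).
Proof. by apply: measurable_funB; [exact: measurable_snd|exact: measurable_fst]. Qed.

Let msub' : measurable_fun setT (fun w : MR * MR => w.1 - w.2).
Proof. by apply: measurable_funB; [exact: measurable_fst|exact: measurable_snd]. Qed.

Let moo (a b : R) : measurable_fun [set: MR] (\1_(`]a, b[%classic) : R -> R).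
Proof. by apply: measurable_indic; exact: measurable_itv. Qed.

Let plus_window (a t : R) : 0 <= a ->
  (\int[mu]_s (kpow al (s - a) * \1_(`]0%R, t[%classic) s)%:E =
   \int[mu]_s (kpow al (s - a) * \1_(`]-oo, t]%classic) s)%:E)%E.
Proof.
move=> a0; apply: integral_ae_eq_any; have := ae_lebesgue_neq t; apply: filterS => s st _.
have [sa|sa] := leP s a; first by rewrite kpow0 ?subr_le0// !mul0r.
congr (_ * _)%:E; rewrite !indicE !mem_setE !in_itv/= (le_lt_trans a0 sa)/=.
by rewrite lt_neqAle st.
Qed.

Let left_window (a t : R) : 0 <= a ->
  (\int[mu]_s (kpow al (t - s) * \1_(`]-oo, s]%classic) a * \1_(`]0%R, t[%classic) s)%:E =
   \int[mu]_s (kpow al (s - a) * \1_(`]-oo, t]%classic) s)%:E)%E.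
Proof.
move=> a0; rewrite -(ge0_integral_reflect (a + t) (mwin a t)); last first.
  by move=> s; rewrite lee_fin mulr_ge0 ?kpow_ge0.
apply: integral_ae_eq_any; have := ae_lebesgue_neq (0 : R); apply: filterS => s s0 _.
rewrite (_ : a + t - s - a = t - s); last by ring.
have [ts|ts] := leP t s; first by rewrite kpow0 ?subr_le0// !mul0r.
rewrite -mulrA; congr (_ * _)%:E; rewrite !indicE !mem_setE !in_itv/= ts andbT.
rewrite (_ : (a + t - s <= t) = (a <= s)); last by apply/idP/idP; lra.
have [as_|_] := leP a s; last by rewrite mul0r.
by rewrite lt_neqAle eq_sym s0 (le_trans a0 as_) mulr1.
Qed.

Let minus_window (a t T : R) : a <= T ->
  (\int[mu]_s (kpow al (a - s) * \1_(`]t, T[%classic) s)%:E =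
   \int[mu]_s (kpow al (s - t) * \1_(`]-oo, a]%classic) s)%:E)%E.
Proof.
move=> aT; rewrite -(ge0_integral_reflect (a + t) (mwin t a)); last first.
  by move=> s; rewrite lee_fin mulr_ge0 ?kpow_ge0.
apply: integral_ae_eq_any; have := ae_lebesgue_neq t; apply: filterS => s st _.
rewrite (_ : a + t - s - t = a - s); last by ring.
have [as_|as_] := leP a s; first by rewrite kpow0 ?subr_le0// !mul0r.
congr (_ * _)%:E; rewrite !indicE !mem_setE !in_itv/= (lt_le_trans as_ aT) andbT.
rewrite (_ : (a + t - s <= a) = (t <= s)); last by apply/idP/idP; lra.
by rewrite lt_neqAle eq_sym st.
Qed.

Let right_window (a t T : R) : a <= T ->
  (\int[mu]_s (kpow al (s - t) * (1 - \1_(`]-oo, s]%classic) a) * \1_(`]t, T[%classic) s)%:E =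
   \int[mu]_s (kpow al (s - t) * \1_(`]-oo, a]%classic) s)%:E)%E.
Proof.
move=> aT; apply: integral_ae_eq_any; have := ae_lebesgue_neq a; apply: filterS => s sa _.
have [ts|ts] := leP s t; first by rewrite kpow0 ?subr_le0// !mul0r.
rewrite -mulrA; congr (_ * _)%:E; rewrite !indicE !mem_setE !in_itv/= ts/=.
have [as_|as_] := leP a s; first by rewrite subrr mul0r leNgt lt_neqAle as_ eq_sym sa.
by rewrite subr0 mul1r (ltW as_) (lt_le_trans as_ aT).
Qed.

Let restrict_section (D : set R) (g : R -> R -> R) (h : R -> R) : measurable D ->
  (forall s, h s = \int[nu]_a g a s) ->
  \int[mu]_(s in D) h s = \int[mu]_s \int[nu]_a (g a s * \1_D s).
Proof.
move=> mD hE; rewrite Rintegral_mkcond; apply: eq_Rintegral => s _.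
rewrite patchE indicE; case: ifPn => sD.
  by rewrite hE; apply: eq_Rintegral => a _; rewrite mulr1.
under eq_Rintegral do rewrite mulr0.
by rewrite Rintegral_cst// mul0r.
Qed.

Lemma integral_frac_plus T t q : is_density T q ->
  mu.-integrable `]0, t[%classic (fun s => (frac_plus q s)%:E) /\
  \int[mu]_(s in `]0, t[) frac_plus q s =
  \int[nu]_a (q a * \int[mu]_s (kpow al (s - a) * \1_(`]-oo, t]%classic) s)).
Proof.
move=> dq; have mD : measurable (`]0, t[%classic : set MR) by exact: measurable_itv.
have [] := @superposition_Fubini (fun w => kpow al (w.2 - w.1) * \1_(`]0, t[%classic) w.2) (window t) T q dq.
- exact: mker1.
- by move=> z; rewrite mulr_ge0 ?kpow_ge0.
- by move=> a /andP[a0 _]; rewrite plus_window// window_bound.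
move=> /= i1 E1; split.
  apply/integrable_mkcond => //; apply: eq_integrable i1 => // s _.
  rewrite patchE indicE; case: ifPn => sD; congr EFin.
    by apply: eq_Rintegral => a _; rewrite mulr1.
  under eq_Rintegral do rewrite mulr0 mulr0.
  by rewrite Rintegral_cst// mul0r.
rewrite (@restrict_section `]0, t[%classic (fun a s => q a * kpow al (s - a)) (frac_plus q) mD (fun s => erefl)).
under eq_Rintegral do under eq_Rintegral do rewrite -mulrA.
rewrite E1; apply: eq_Rintegral => a _.
have [qa|qa] := eqVneq (q a) 0; first by rewrite qa !mul0r.
have [_ _ qT] := dq.
have /andP[a0 _] : 0 <= a <= T by apply: contraT => /qT h; rewrite h eqxx in qa.
by congr (_ * fine _); exact: plus_window.
Qed.

(** Both Riemann-Liouville integrals of a function of bounded variation are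
    primitives: exchanging the order of integration leaves, for each jump
    location a, the same integral of the kernel up to a reflection. *)
Lemma RL_left_jump_sum T t q : is_density T q -> 0 < t ->
  RL_left (1 - al) 0 (jump_sum q) t =
  (Gamma (1 - al))^-1 * \int[mu]_(s in `]0, t[) frac_plus q s.
Proof.
move=> dq t0; rewrite /RL_left; congr (_ * _).
have [_ ->] := integral_frac_plus t dq.
have mD : measurable (`]0, t[%classic : set MR) by exact: measurable_itv.
have mH : measurable_fun setT (fun w : MR * MR => \1_(`]-oo, w.2]%classic) w.1 : R).
  rewrite (_ : (fun _ => _) = (fun w : MR * MR => if w.1 <= w.2 then 1 else 0)); last first.
    by apply/funext => w; rewrite indicE mem_setE in_itv/=; case: ifP.
  apply: (@measurable_fun_ifT _ _ _ _ (fun _ : MR * MR => 1 : R) (fun _ : MR * MR => 0 : R) (fun w : MR * MR => w.1 <= w.2)) => //.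
  by apply: measurable_fun_ler; [exact: measurable_fst|exact: measurable_snd].
have [] := @superposition_Fubini (fun w => kpow al (t - w.2) * \1_(`]-oo, w.2]%classic) w.1 * \1_(`]0, t[%classic) w.2) (window t) T q dq.
- apply: measurable_funM.
    apply: measurable_funM => //; apply: measurable_kpow_comp.
    apply: measurable_funB => //; exact: measurable_snd.
  exact: (measurableT_comp (moo 0 t) measurable_snd).
- by move=> z; rewrite !mulr_ge0 ?kpow_ge0.
- by move=> a /andP[a0 _]; rewrite /= left_window// window_bound.
move=> /= i1 E1.
transitivity (\int[mu]_(s in `]0, t[) (kpow al (t - s) * jump_sum q s)).
  apply: eq_Rintegral => s; rewrite mem_setE in_itv/= => /andP[s0 st].
  by rewrite /kpow subr_gt0 st (_ : 1 - al - 1 = - al)//; ring.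
have [mq [M qM] qT] := dq.
have M0 : 0 <= M by exact: le_trans (qM 0).
have jE (s : R) : kpow al (t - s) * jump_sum q s =
    \int[nu]_a (kpow al (t - s) * (q a * \1_(`]-oo, s]%classic) a)).
  rewrite -RintegralZl//.
  apply: (integrable_bounded nu_fin (M := M)).
    by apply: measurable_funM => //; exact: measurable_indic.
  move=> a; rewrite normrM indicE; case: (_ \in _); first by rewrite /= normr1 mulr1.
  by rewrite /= normr0 mulr0.
rewrite (@restrict_section `]0, t[%classic (fun a s => kpow al (t - s) * (q a * \1_(`]-oo, s]%classic) a)) (fun s => kpow al (t - s) * jump_sum q s) mD jE).
transitivity (\int[mu]_s \int[nu]_a
   (q a * (kpow al (t - s) * \1_(`]-oo, s]%classic) a * \1_(`]0, t[%classic) s))).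
  by apply: eq_Rintegral => s _; apply: eq_Rintegral => a _; ring.
rewrite E1; apply: eq_Rintegral => a _.
have [qa|qa] := eqVneq (q a) 0; first by rewrite qa !mul0r.
have /andP[a0 _] : 0 <= a <= T by apply: contraT => /qT h; rewrite h eqxx in qa.
by congr (_ * fine _); exact: left_window.
Qed.

Lemma integral_frac_minus b T t q : is_density b q -> b <= T -> 0 <= t ->
  mu.-integrable `]t, T[%classic (fun s => (frac_minus q s)%:E) /\
  \int[mu]_(s in `]t, T[) frac_minus q s =
  - \int[nu]_a (q a * \int[mu]_s (kpow al (s - t) * \1_(`]-oo, a]%classic) s)).
Proof.
move=> dq bT t0; have mD : measurable (`]t, T[%classic : set MR) by exact: measurable_itv.
have [] := @superposition_Fubini (fun w => kpow al (w.1 - w.2) * \1_(`]t, T[%classic) w.2) (window b) b q dq.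
- exact: mker1.
- by move=> z; rewrite mulr_ge0 ?kpow_ge0.
- move=> a /andP[a0 ab]; rewrite minus_window ?(le_trans ab)//.
  apply: le_trans (window_bound b t0); apply: ge0_le_integral => //.
  + by move=> s _; rewrite lee_fin mulr_ge0 ?kpow_ge0.
  + exact: mwin.
  + exact: mwin.
  + move=> s _; rewrite lee_fin; exact: window_mono.
move=> /= i1 E1; split.
  apply/integrable_mkcond => //.
  apply: (eq_integrable _ _ _ _ (integrable_scaleR measurableT (-1) i1)) => // s _.
  rewrite patchE indicE mulN1r; case: ifPn => sD; congr EFin.
    by rewrite /frac_minus; congr (- _); apply: eq_Rintegral => a _; rewrite mulr1.
  under eq_Rintegral do rewrite mulr0 mulr0.
  by rewrite Rintegral_cst// mul0r oppr0.
have -> : \int[mu]_(s in `]t, T[) frac_minus q s =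
    \int[mu]_s (-1 * \int[nu]_a (q a * (kpow al (a - s) * \1_(`]t, T[%classic) s))).
  rewrite Rintegral_mkcond; apply: eq_Rintegral => s _.
  rewrite patchE indicE mulN1r; case: ifPn => sD.
    by rewrite /frac_minus; congr (- _); apply: eq_Rintegral => a _; rewrite mulr1.
  under eq_Rintegral do rewrite mulr0 mulr0.
  by rewrite Rintegral_cst// mul0r oppr0.
apply: (etrans (@RintegralZl _ _ _ mu setT _ (-1) measurableT i1)).
rewrite mulN1r; congr (- _); apply: (etrans E1); apply: eq_Rintegral => a _.
have [qa|qa] := eqVneq (q a) 0; first by rewrite qa !mul0r.
have [_ _ qb] := dq.
have /andP[_ ab] : 0 <= a <= b by apply: contraT => /qb h; rewrite h eqxx in qa.
by congr (_ * fine _); apply: minus_window; exact: le_trans bT.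
Qed.

Lemma RL_right_jump_sum b T t q : is_density b q -> b <= T -> 0 <= t ->
  \int[nu]_a q a = 0 ->
  RL_right (1 - al) T (jump_sum q) t =
  (Gamma (1 - al))^-1 * \int[mu]_(s in `]t, T[) frac_minus q s.
Proof.
move=> dq bT t0 q0; rewrite /RL_right; congr (_ * _).
have [_ ->] := integral_frac_minus dq bT t0.
have mD : measurable (`]t, T[%classic : set MR) by exact: measurable_itv.
have mH : measurable_fun setT (fun w : MR * MR => 1 - \1_(`]-oo, w.2]%classic) w.1 : R).
  rewrite (_ : (fun _ => _) = (fun w : MR * MR => if w.1 <= w.2 then 0 else 1)); last first.
    by apply/funext => w; rewrite indicE mem_setE in_itv/=; case: ifP => _; rewrite ?subrr ?subr0.
  apply: (@measurable_fun_ifT _ _ _ _ (fun _ : MR * MR => 0 : R) (fun _ : MR * MR => 1 : R) (fun w : MR * MR => w.1 <= w.2)) => //.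
  by apply: measurable_fun_ler; [exact: measurable_fst|exact: measurable_snd].
have ind01 (a s : R) : 0 <= 1 - \1_(`]-oo, s]%classic) a :> R.
  by rewrite indicE; case: (_ \in _); rewrite /= ?subrr ?subr0.
have [] := @superposition_Fubini (fun w => kpow al (w.2 - t) * (1 - \1_(`]-oo, w.2]%classic) w.1) * \1_(`]t, T[%classic) w.2) (window b) b q dq.
- apply: measurable_funM.
    apply: measurable_funM => //; apply: measurable_kpow_comp.
    apply: measurable_funB => //; exact: measurable_snd.
  exact: (measurableT_comp (moo t T) measurable_snd).
- by move=> z; rewrite !mulr_ge0 ?kpow_ge0.
- move=> a /andP[a0 ab]; rewrite /= right_window ?(le_trans ab)//.
  apply: le_trans (window_bound b t0); apply: ge0_le_integral => //.
  + by move=> s _; rewrite lee_fin mulr_ge0 ?kpow_ge0.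
  + exact: mwin.
  + exact: mwin.
  + move=> s _; rewrite lee_fin; exact: window_mono.
move=> /= i1 E1.
have [mq [M qM] qb] := dq.
have M0 : 0 <= M by exact: le_trans (qM 0).
have ji (s : R) : nu.-integrable setT (EFin \o (fun a => q a * \1_(`]-oo, s]%classic) a)).
  apply: (integrable_bounded nu_fin (M := M)).
    by apply: measurable_funM => //; exact: measurable_indic.
  move=> a; rewrite normrM indicE; case: (_ \in _); first by rewrite /= normr1 mulr1.
  by rewrite /= normr0 mulr0.
have jE (s : R) : jump_sum q s = - \int[nu]_a (q a * (1 - \1_(`]-oo, s]%classic) a)).
  under eq_Rintegral do rewrite mulrBr mulr1.
  by rewrite RintegralB//; [rewrite q0 sub0r opprK|exact: integrable_density dq].
have -> : \int[mu]_(s in `]t, T[) ((s - t) `^ (1 - al - 1) * jump_sum q s) =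
    \int[mu]_s (-1 * \int[nu]_a (q a * (kpow al (s - t) * (1 - \1_(`]-oo, s]%classic) a) * \1_(`]t, T[%classic) s))).
  rewrite Rintegral_mkcond; apply: eq_Rintegral => s _.
  rewrite patchE mulN1r; case: ifPn => sD.
    rewrite jE mulrN; congr (- _).
    rewrite (_ : (s - t) `^ (1 - al - 1) = kpow al (s - t)); last first.
      move: sD; rewrite mem_setE in_itv/= => /andP[ts _].
      by rewrite /kpow subr_gt0 ts (_ : 1 - al - 1 = - al)//; ring.
    rewrite -RintegralZl//; last first.
      under eq_fun do rewrite /comp mulrBr mulr1.
      exact: (integrable_subR measurableT (integrable_density nu_fin dq) (ji s)).
    have -> : \1_(`]t, T[%classic) s = 1 :> R by rewrite indicE sD.
    by apply: eq_Rintegral => a _; ring.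
  under eq_Rintegral do rewrite [X in _ * (_ * X)]indicE (negbTE sD) !mulr0.
  by rewrite Rintegral_cst// mul0r oppr0.
apply: (etrans (@RintegralZl _ _ _ mu setT _ (-1) measurableT i1)).
rewrite mulN1r; congr (- _); apply: (etrans E1); apply: eq_Rintegral => a _.
have [qa|qa] := eqVneq (q a) 0; first by rewrite qa !mul0r.
have /andP[_ ab] : 0 <= a <= b by apply: contraT => /qb h; rewrite h eqxx in qa.
by congr (_ * fine _); apply: right_window; exact: le_trans bT.
Qed.

End RiemannLiouville.

Section Primitive.
Context {R : realType}.
Local Notation mu := (@lebesgue_measure R).
Local Notation MR := (measurableTypeR R).

Lemma test_fun1_derive a b (phi : R -> R) : test_fun1 a b phi ->
  [/\ forall t : R, is_derive t 1 phi (derive1 phi t), continuous (derive1 phi) &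
      forall t, ~~ (a < t < b) -> phi t = 0].
Proof.
move=> [dphi _ sphi]; split.
- move=> t; rewrite derive1E; apply/derivableP; exact: (dphi 0%N).
- move=> t; apply: derivable_continuous; exact: (dphi 1%N).
- move=> t tab; apply: contrapT => /eqP pt.
  have : `]a, b[%classic t by apply: sphi; apply: subset_closure.
  by rewrite /= in_itv/= (negbTE tab).
Qed.

(** Fubini on the triangle s < t; the constant c integrates to 0 against the
    derivative of a test function. *)
Lemma distr_deriv_primitive (T c : R) (w W : R -> R) : 0 < T ->
  mu.-integrable `]0, T[%classic (fun t => (w t)%:E) ->
  (forall t, 0 < t < T -> W t = c + \int[mu]_(s in `]0, t[) w s) ->
  distr_deriv 0 T W w.
Proof.
move=> T0 wi WE phi tphi; have [dphi cphi' phi0] := test_fun1_derive tphi.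
pose D : set R := `]0, T[%classic.
have mD : measurable (D : set MR) by exact: measurable_itv.
have iphi (a b : R) : mu.-integrable `[a, b] (EFin \o derive1 phi).
  apply: continuous_compact_integrable; first exact: segment_compact.
  by apply: continuous_subspaceT => x; exact: cphi'.
have iphiD : mu.-integrable D (EFin \o derive1 phi).
  by apply: integrableS (iphi 0 T) => //; apply: subset_itv; rewrite bnd_simp.
have Iphi (a b : R) : a <= b -> \int[mu]_(t in `[a, b]) derive1 phi t = phi b - phi a.
  move=> ab; rewrite /Rintegral.
  by rewrite (integral_derive ab (fun x _ => dphi x) (fun x _ => cphi' x)).
have phiT : phi T = 0 by apply: phi0; rewrite ltxx andbF.
have phi00 : phi 0 = 0 by apply: phi0; rewrite ltxx.
have wphi : mu.-integrable D (EFin \o (fun s => w s * phi s)).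
    have [C phiC] : exists C : R, forall t, `|phi t| <= C.
      have h : {within `[0, T], continuous (fun t => `|phi t|)}.
        apply: continuous_subspaceT => x; apply: continuous_comp; last exact: norm_continuous.
        by apply: derivable_continuous; have [] := dphi x.
      have [a _ ha] := EVT_max (ltW T0) h.
      exists `|phi a| => t; have [tT|tT] := boolP (0 <= t <= T).
        by apply: ha; rewrite in_itv.
      by rewrite phi0 ?normr0//; apply: contra tT => /andP[? ?]; rewrite !ltW.
    have iw := integrable_scaleR mD C wi.
    apply: (le_integrable mD _ _ iw).
      apply/measurable_EFinP; apply: measurable_funM.
        by have := measurable_int _ wi; move/measurable_EFinP.
      apply: measurable_funTS; apply: continuous_measurable_fun => x.
      by apply: derivable_continuous; have [] := dphi x.
    move=> s _; rewrite /= lee_fin !normrM mulrC ler_pM//.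
    by rewrite (le_trans (phiC s))// ler_norm.
pose w' := w \_ D; pose p' := (derive1 phi) \_ D.
have w'i : mu.-integrable setT (EFin \o w').
  by have /(integrable_mkcond _ mD) := wi; apply: eq_integrable => // s _; rewrite /= /w' !patchE; case: ifP.
have p'i : mu.-integrable setT (EFin \o p').
  by have /(integrable_mkcond _ mD) := iphiD; apply: eq_integrable => // s _; rewrite /= /p' !patchE; case: ifP.
pose u := fun z : MR * MR => w' z.1 * p' z.2 * (if z.1 < z.2 then 1 else 0).
have mH : measurable_fun setT (fun z : MR * MR => if z.1 < z.2 then 1 else 0 : R).
  apply: (@measurable_fun_ifT _ _ _ _ (fun _ : MR * MR => 1 : R) (fun _ : MR * MR => 0 : R) (fun w : MR * MR => w.1 < w.2)) => //.
  by apply: measurable_fun_ltr; [exact: measurable_fst|exact: measurable_snd].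
have ti := integrable_tensor w'i p'i.
have ui : (mu \x mu)%E.-integrable setT (EFin \o u).
  have mti := measurable_int _ ti; apply: (le_integrable measurableT _ _ ti).
    apply/measurable_EFinP; apply: measurable_funM => //.
    by move/measurable_EFinP: mti.
  move=> z _; rewrite lee_fin /u normrM; case: ifP => _; rewrite ?normr1 ?mulr1//.
  by rewrite normr0 mulr0.
have Lpt (t : R) : \int[mu]_s u (s, t) = ((fun t => (W t - c) * derive1 phi t) \_ D) t.
  rewrite patchE; case: ifPn => tD; last first.
    under eq_Rintegral do rewrite /u/= /p' patchE (negbTE tD) mulr0 mul0r.
    by rewrite Rintegral_cst// mul0r.
  have tD' := tD; move: tD'; rewrite mem_setE in_itv/= => tT.
  have /andP[t0 tT'] := tT.
  rewrite (WE t tT) addrAC subrr add0r.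
  have wit : mu.-integrable `]0, t[%classic (EFin \o w).
    by apply: integrableS wi => //; apply: subset_itv; rewrite bnd_simp// ltW.
  rewrite -(@RintegralZr _ _ _ _ _ _ (derive1 phi t) _ wit); last exact: measurable_itv.
  rewrite [RHS]Rintegral_mkcond; apply: eq_Rintegral => s _.
  rewrite /u/= /p' /w' !patchE tD !mem_setE !in_itv/=.
  have [st|ts] := ltP s t; last by rewrite andbF mulr0.
  rewrite (lt_trans st tT') !andbT mulr1.
  by case: ifP => _ //; rewrite mul0r.
have L : \int[mu]_t \int[mu]_s u (s, t) = \int[mu]_(t in D) ((W t - c) * derive1 phi t).
  by rewrite [RHS]Rintegral_mkcond; apply: eq_Rintegral => t _; exact: Lpt.
have Rr : \int[mu]_s \int[mu]_t u (s, t) = - \int[mu]_(s in D) (w s * phi s).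
  rewrite -[RHS]mulN1r -(@RintegralZl _ _ _ _ _ _ (-1) mD wphi).
  rewrite [RHS]Rintegral_mkcond; apply: eq_Rintegral => s _; rewrite patchE.
  case: ifPn => sD; last first.
    under eq_Rintegral do rewrite /u/= /w' patchE (negbTE sD) !mul0r.
    by rewrite Rintegral_cst// mul0r.
  have sD' := sD; move: sD'; rewrite mem_setE in_itv/= => /andP[s0 sT].
  transitivity (\int[mu]_(t in `[s, T]) (w s * derive1 phi t)); last first.
    by rewrite RintegralZl// Iphi ?(ltW sT)// phiT sub0r mulN1r mulrN.
  rewrite [RHS]Rintegral_mkcond; apply: Rintegral_ae_eq_any.
  have := ae_lebesgue_neq s; have := ae_lebesgue_neq T; apply: filterS2 => t tT ts _.
  rewrite /u/= /w' /p' !patchE sD !mem_setE !in_itv/=.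
  have [st|st] := ltP s t; last first.
    by rewrite mulr0 leNgt lt_neqAle ts st.
  rewrite (lt_trans s0 st) (ltW st) /= mulr1 lt_neqAle tT/=.
  by case: ifP => _ //; rewrite mulr0.
rewrite -/D -Rr (Rintegral_Fubini ui) L.
have cphi : \int[mu]_(t in D) (c * derive1 phi t) = 0.
  rewrite RintegralZl// (_ : Rintegral _ _ _ = 0) ?mulr0//.
  have := Iphi 0 T (ltW T0); rewrite phiT phi00 subrr => <-.
  rewrite [LHS]Rintegral_mkcond [RHS]Rintegral_mkcond; apply: Rintegral_ae_eq_any.
  have := ae_lebesgue_neq (0 : R); have := ae_lebesgue_neq T; apply: filterS2 => t tT ts _.
  by rewrite !patchE !mem_setE !in_itv/= !lt_neqAle tT eq_sym ts.
have Li : mu.-integrable D (fun t => ((W t - c) * derive1 phi t)%:E).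
  have ii := integrable_Rintegral_param ui.
  apply/(integrable_mkcond _ mD); apply: eq_integrable ii => // t _.
  by rewrite Lpt !patchE; case: ifP.
transitivity (\int[mu]_(t in D) ((W t - c) * derive1 phi t + c * derive1 phi t)).
  by apply: eq_Rintegral => t _; ring.
rewrite RintegralD//; first by rewrite cphi addr0.
exact: (integrable_scaleR mD c iphiD).
Qed.

End Primitive.

(** * Bounded variation and Sobolev regularity *)

Section GammaConstant.
Context {R : realType}.
Local Notation mu := (@lebesgue_measure R).
Variable al : R.
Hypotheses (al0 : 0 < al) (al1 : 2 * al < 1).

Let g (s : R) : R := s `^ (1 - al - 1) * expR (- s).

Let mg (D : set R) : measurable D -> measurable_fun D (EFin \o g).
Proof.
move=> mD; apply/measurable_EFinP; apply: measurable_funTS; apply: measurable_funM.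
  exact: measurable_powR.
apply: (measurableT_comp (@measurable_expR R)); apply: (@measurableT_comp _ _ _ _ _ _ (fun x : R => - x)) => //; exact: oppr_measurable.
Qed.

Let g0 s : 0 <= g s.
Proof. by rewrite mulr_ge0 ?powR_ge0 ?expR_ge0. Qed.

Let exp_tail (s : R) : 1 <= s -> expR (- s) <= 4 * s `^ (- 2).
Proof.
move=> s1; have s0 : 0 < s by rewrite (lt_le_trans ltr01).
rewrite powRN powR_mulrn ?(ltW s0)// expRN ler_pdivlMr ?exprn_gt0// mulrC.
rewrite ler_pdivrMr ?expR_gt0//.
have h : s / 2 <= expR (s / 2) by apply: le_trans (expR_ge1Dx _); rewrite lerDr.
have -> : expR s = expR (s / 2) ^+ 2 by rewrite expr2 -expRD; congr expR; field.
have s20 : 0 <= s / 2 by rewrite divr_ge0// ltW.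
move: (expR _) h s20 => y h s20; nra.
Qed.

Let powR_le1 (x : R) : 0 < x -> x <= 1 -> x `^ al <= 1.
Proof. by move=> x0 x1; rewrite -[leRHS](@powRr0 _ x) ger_powR ?x0 ?x1 ?ltW. Qed.

Lemma Gamma_gt0 : 0 < Gamma (1 - al).
Proof.
have al_lt1 : al < 1 by move: al0 al1; lra.
rewrite /Gamma /Rintegral; apply: fine_gt0; apply/andP; split.
  apply: (@lt_le_trans _ _ (\int[mu]_(x in `]0%R, 1%R]) (expR (-1))%:E)%E).
    rewrite integral_cst//= lebesgue_measure_itv/= lte_fin ltr01 oppr0 adde0 mule1.
    by rewrite lte_fin expR_gt0.
  apply: (@le_trans _ _ (\int[mu]_(x in `]0%R, 1%R]) (g x)%:E)%E).
    apply: ge0_le_integral => //.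
    - exact: mg.
    - move=> x; rewrite /= in_itv/= => /andP[x0 x1]; rewrite lee_fin /g.
      rewrite -[leLHS]mul1r; apply: ler_pM; rewrite ?expR_ge0 ?ler_expR ?lerN2//.
      rewrite (_ : 1 - al - 1 = - al); last by ring.
      rewrite powRN invf_ge1 ?powR_gt0//.
      exact: powR_le1.
  apply: ge0_subset_integral => //.
  - exact: mg.
  - by move=> x _; rewrite lee_fin.
  - by apply: subset_itvl; rewrite bnd_simp.
pose h (s : R) := kpow al s * \1_(`]-oo, 1]%classic) s + 4 * (s `^ (- 2) * \1_(`[1, +oo[%classic) s).
have mh1 : measurable_fun [set: R] (fun s => (kpow al s * \1_(`]-oo, 1]%classic) s)%:E).
  by apply/measurable_EFinP; apply: measurable_funM => //; exact: measurable_kpow.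
have mh2 : measurable_fun [set: R] (fun s => (s `^ (- 2) * \1_(`[1, +oo[%classic) s)%:E).
  by apply/measurable_EFinP; apply: measurable_funM => //; exact: measurable_powR.
have h10 (s : R) : 0 <= kpow al s * \1_(`]-oo, 1]%classic) s by rewrite mulr_ge0 ?kpow_ge0.
have h20 (s : R) : 0 <= s `^ (- 2) * \1_(`[1, +oo[%classic) s by rewrite mulr_ge0 ?powR_ge0.
apply: (@le_lt_trans _ _ (\int[mu]_(s in `]0%R, +oo[) (h s)%:E)%E).
  apply: ge0_le_integral => //.
  - by move=> x _; rewrite lee_fin; exact: g0.
  - exact: mg.
  - apply: measurable_funTS; apply/measurable_EFinP; apply: measurable_funD.
      by move/measurable_EFinP: mh1.
    by apply: measurable_funM => //; move/measurable_EFinP: mh2.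
  - move=> s; rewrite /= in_itv/= andbT => s0; rewrite lee_fin /g /h.
    rewrite (_ : 1 - al - 1 = - al); last by ring.
    have [s1|s1] := leP s 1.
      apply: ler_wpDr; first by rewrite mulr_ge0.
      rewrite /kpow s0 indicE mem_setE in_itv/= s1 mulr1 -[leRHS]mulr1 ler_wpM2l ?powR_ge0//.
      by rewrite -[leRHS]expR0 ler_expR oppr_le0 ltW.
    apply: ler_wpDl => //.
    rewrite indicE mem_setE in_itv/= (ltW s1) mulr1.
    apply: le_trans (exp_tail (ltW s1)); rewrite -[leRHS]mul1r ler_wpM2r ?expR_ge0//.
    by rewrite -[leRHS](@powRr0 _ s) ler_powR ?(ltW s1)// oppr_le0 ltW.
apply: (@le_lt_trans _ _ (\int[mu]_s (h s)%:E)%E).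
  apply: ge0_subset_integral => //.
  - apply/measurable_EFinP; apply: measurable_funD.
      by move/measurable_EFinP: mh1.
    by apply: measurable_funM => //; move/measurable_EFinP: mh2.
  - by move=> x _; rewrite lee_fin; exact: (addr_ge0 (h10 x) (mulr_ge0 (ler0n R 4) (h20 x))).
under eq_integral do rewrite /h EFinD (EFinM 4).
rewrite ge0_integralD//; last 3 first.
- by move=> s _; rewrite lee_fin.
- by move=> s _; rewrite mule_ge0 ?lee_fin.
- exact: measurable_funeM.
rewrite ge0_integralZl//; last by move=> s _; rewrite lee_fin.
apply: lte_add_pinfty; first exact: integral_kpow_window.
apply: lte_mul_pinfty; rewrite ?lee_fin//.
have := @integral_powR_tail_lty R 2 (ltr1n R 2).
rewrite [X in (X < _)%E -> _]integral_mkcond; congr (_ < _)%E; apply: eq_integral => t _.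
by rewrite patchE indicE; case: ifP => _; rewrite ?mulr1 ?mulr0.
Qed.

End GammaConstant.

Section SobolevBound.
Context {R : realType}.
Local Notation mu := (@lebesgue_measure R).
Local Notation MR := (measurableTypeR R).
Variable al : R.
Hypotheses (al0 : 0 < al) (al1 : 2 * al < 1).

Lemma sobolev_norm2_ae (O : set R) (v w : R -> R) :
  {ae mu, forall t, O t -> v t = w t} -> sobolev_norm2 al O v = sobolev_norm2 al O w.
Proof.
move=> vw; rewrite /sobolev_norm2; congr (_ + _)%E.
  by apply: integral_ae_eq_any; apply: filterS vw => t h Ot; rewrite h.
have vw' := vw; apply: integral_ae_eq_any; apply: filterS vw => s hs Os.
apply: integral_ae_eq_any; apply: filterS vw' => t h Ot.
by rewrite hs// h.
Qed.

Lemma fourier_norm2_ae (O : set R) (v w : R -> R) :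
  {ae mu, forall t, O t -> v t = w t} -> fourier_norm2 al O v = fourier_norm2 al O w.
Proof.
move=> vw; rewrite /fourier_norm2; apply: eq_integral => xi _.
congr (_ * (_ ^+ 2 + _ ^+ 2))%:E; congr (_ * _); apply: Rintegral_ae_eq_any;
  by apply: filterS vw => t h Ot; rewrite h.
Qed.

Let window (c : R) : R := fine (\int[mu]_x (kpow (2 * al) x * \1_(`]-oo, c]%classic) x)%:E)%E.

Let windowE c : (\int[mu]_x (kpow (2 * al) x * \1_(`]-oo, c]%classic) x)%:E = (window c)%:E)%E.
Proof.
rewrite fineK// ge0_fin_numE ?integral_kpow_window//.
by apply: integral_ge0 => t _; rewrite lee_fin mulr_ge0 ?kpow_ge0.
Qed.

Let two_sided_window (b c : R) : 0 <= c ->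
  (\int[mu]_h (c%:E * ((kpow (2 * al) h * \1_(`]-oo, b]%classic) h)%:E +
                      (kpow (2 * al) (0 - h) * \1_(`]-oo, b]%classic) (0 - h))%:E)) =
   (c * (2 * window b))%:E)%E.
Proof.
move=> c0; pose K h := kpow (2 * al) h * \1_(`]-oo, b]%classic) h.
have mK : measurable_fun [set: R] (fun h => (K h)%:E).
  by apply/measurable_EFinP; apply: measurable_funM => //; exact: measurable_kpow.
have mKN : measurable_fun [set: R] (fun h => (K (0 - h))%:E).
  by apply: (measurableT_comp mK); exact: measurable_funB.
have K0 h : 0 <= K h by rewrite mulr_ge0 ?kpow_ge0.
rewrite ge0_integralZl//; last 2 first.
- exact: (emeasurable_funD mK mKN).
- by move=> h _; rewrite adde_ge0// lee_fin; exact: K0.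
rewrite ge0_integralD//; last 2 first.
- by move=> h _; rewrite lee_fin; exact: K0.
- by move=> h _; rewrite lee_fin; exact: (K0 (0 - h)).
rewrite (ge0_integral_reflect 0 mK); last by move=> h; rewrite lee_fin.
by rewrite windowE -EFinD -EFinM mulr_natl mulr2n.
Qed.

Let weighted_square (i j x d K : R) : 0 <= i -> i <= 1 -> 0 <= j -> j <= 1 -> 0 <= d ->
  `|x| <= K -> i * j * (x ^+ 2 / d) <= K / d * `|x|.
Proof.
move=> i0 i1 j0 j1 d0 xK; rewrite mulrA [leRHS]mulrAC ler_wpM2r ?invr_ge0//.
rewrite -(real_normK (num_real x)).
have ij : i * j <= 1 by rewrite -[leRHS]mulr1 ler_pM.
move: (i * j) (mulr_ge0 i0 j0) ij (`|x|) (normr_ge0 x) xK => z z0 z1 y y0 yK.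
clear -z0 z1 y0 yK; nra.
Qed.

(** A bounded function of bounded variation is in H^al for al < 1/2: its
    increments over h have integral O(|h|), and |h|^(-2 al) is integrable. *)
Lemma sobolev_norm2_BV (b A B : R) (v : R -> R) : 0 < b ->
  measurable_fun [set: MR] v -> (forall t, `|v t| <= A) ->
  (forall h : R, (\int[mu]_s `|v s - v (s + h)|%:E <= (B * `|h|)%:E)%E) ->
  (sobolev_norm2 al `]0%R, b[%classic v <= (A ^+ 2 * b + 4 * A * B * window b)%:E)%E.
Proof.
move=> b0 mv vA vB; have A0 : 0 <= A by exact: le_trans (vA 0).
have mvh (h : R) : measurable_fun [set: MR] (fun s => v (s + h)).
  by apply: (measurableT_comp mv); exact: measurable_funD.
have mdh (h : R) : measurable_fun [set: MR] (fun s => `|v s - v (s + h)|%:E).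
  by apply/measurable_EFinP; apply: measurableT_comp => //; exact: measurable_funB.
have B0 : 0 <= B.
  have := vB 1; rewrite normr1 mulr1 -lee_fin; apply: le_trans.
  by apply: integral_ge0 => s _; rewrite lee_fin.
have mD : measurable (`]0, b[%classic : set MR) by exact: measurable_itv.
rewrite EFinD /sobolev_norm2; apply: leeD.
  apply: (@le_trans _ _ (\int[mu]_(t in `]0%R, b[) (A ^+ 2)%:E)%E).
    apply: ge0_le_integral => //.
    - by move=> t _; rewrite lee_fin sqr_ge0.
    - apply/measurable_EFinP; apply: measurable_funTS; exact: measurable_funX.
    - by move=> t _; rewrite lee_fin -(real_normK (num_real (v t))) lerXn2r ?nnegrE.
  by rewrite integral_cst//= lebesgue_measure_itv/= lte_fin b0 oppr0 adde0 -EFinM.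
pose I := \1_(`]0, b[%classic) : R -> R.
have mI : measurable_fun [set: MR] I by apply: measurable_indic.
have I01 t : 0 <= I t <= 1 by rewrite /I indicE; case: (_ \in _); rewrite ?lexx ler01.
pose F := fun w : MR * MR =>
  (I w.1 * I (w.1 + w.2) * ((v w.1 - v (w.1 + w.2)) ^+ 2 / `|w.2| `^ (1 + 2 * al)))%:E.
have mF : measurable_fun setT F.
  have m1 : measurable_fun setT (fun w : MR * MR => w.1) by exact: measurable_fst.
  have m2 : measurable_fun setT (fun w : MR * MR => w.2) by exact: measurable_snd.
  have m3 : measurable_fun setT (fun w : MR * MR => w.1 + w.2) by exact: measurable_funD.
  apply/measurable_EFinP; apply: measurable_funM.
    apply: measurable_funM; first exact: (measurableT_comp mI m1).
    exact: (measurableT_comp mI m3).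
  apply: measurable_funM.
    apply: measurable_funX; apply: measurable_funB; first exact: (measurableT_comp mv m1).
    exact: (measurableT_comp mv m3).
  apply: (@measurableT_comp _ _ _ _ _ _ (fun x : R => (`|x| `^ (1 + 2 * al))^-1) _ _ _ m2).
  under eq_fun do rewrite -powRN.
  apply: (measurableT_comp (measurable_powR _)); exact: normr_measurable.
have F0 w : (0 <= F w)%E.
  rewrite lee_fin mulr_ge0 ?divr_ge0 ?sqr_ge0 ?powR_ge0//.
  by apply: mulr_ge0; [have /andP[] := I01 w.1|have /andP[] := I01 (w.1 + w.2)].
have E1 : (\int[mu]_(s in `]0%R, b[) \int[mu]_(t in `]0%R, b[)
     ((v s - v t) ^+ 2 / `|s - t| `^ (1 + 2 * al))%:E = \int[mu]_s \int[mu]_h F (s, h))%E.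
  rewrite integral_mkcond; apply: eq_integral => s _; rewrite patchE.
  case: ifPn => sD; last first.
    by rewrite integral0_eq// => h _; rewrite /F/= /I indicE (negbTE sD) !mul0r.
  pose f (t : R) := (I t * ((v s - v t) ^+ 2 / `|s - t| `^ (1 + 2 * al)))%:E.
  have mf : measurable_fun [set: R] f.
    apply/measurable_EFinP; apply: measurable_funM => //; apply: measurable_funM.
      by apply: measurable_funX; exact: measurable_funB.
    under eq_fun do rewrite -powRN.
    apply: (measurableT_comp (measurable_powR _)); apply: (measurableT_comp (@normr_measurable R setT)).
    exact: measurable_funB.
  have f0 t : (0 <= f t)%E.
    rewrite lee_fin mulr_ge0 ?divr_ge0 ?sqr_ge0 ?powR_ge0//.
  transitivity (\int[mu]_t f t)%E.
    rewrite integral_mkcond; apply: eq_integral => t _; rewrite patchE /f /I indicE.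
    by case: ifP => _; rewrite ?mul1r ?mul0r.
  have := @ge0_integral_affine R s 1 f ltr01 mf f0; rewrite mul1e => <-.
  apply: eq_integral => h _; rewrite /f /F /= mul1r [I s]indicE sD mul1r.
  by rewrite (_ : `|s - (s + h)| = `|h|)// opprD addrA subrr sub0r normrN.
rewrite E1 (fubini_tonelli _ mF F0).
pose K h := kpow (2 * al) h * \1_(`]-oo, b]%classic) h.
have mK : measurable_fun [set: R] (fun h => (K h)%:E).
  by apply/measurable_EFinP; apply: measurable_funM => //; exact: measurable_kpow.
have mKN : measurable_fun [set: R] (fun h => (K (0 - h))%:E).
  by apply: (measurableT_comp mK); exact: measurable_funB.
have K0 h : 0 <= K h by rewrite mulr_ge0 ?kpow_ge0.
apply: (@le_trans _ _ (\int[mu]_h ((2 * A * B)%:E * ((K h)%:E + (K (0 - h))%:E)))%E); last first.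
  rewrite two_sided_window ?mulr_ge0// lee_fin le_eqVlt; apply/orP; left; apply/eqP.
  by ring.
apply: ge0_le_integral => //.
- by move=> h _; apply: integral_ge0 => s _.
- exact: (measurable_fun_fubini_tonelli_G _ mF F0).
- by apply: measurable_funeM; exact: emeasurable_funD.
move=> h _; rewrite -EFinD -EFinM.
have rhs0 : 0 <= 2 * A * B * (K h + K (0 - h)) by rewrite !mulr_ge0// addr_ge0.
have [->|h0] := eqVneq h 0.
  rewrite integral0_eq ?lee_fin// ?subrr.
    by rewrite !mulr_ge0// addr_ge0.
  by move=> s _; rewrite /F/= addr0 subrr expr0n/= mul0r mulr0.
have [hb|hb] := ltP b `|h|.
  rewrite integral0_eq ?lee_fin// => s _; rewrite /F/= /I !indicE !mem_setE !in_itv/=.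
  have [/andP[s0 sb]|_] := boolP (0 < s < b); last by rewrite !mul0r.
  have [/andP[s1 s2]|_] := boolP (0 < s + h < b); last by rewrite mulr0 mul0r.
  have : `|h| < b by rewrite ltr_norml; apply/andP; split; lra.
  by rewrite ltNge (ltW hb).
have hp : 0 < `|h| by rewrite normr_gt0.
apply: (@le_trans _ _ (\int[mu]_s ((2 * A / `|h| `^ (1 + 2 * al))%:E * `|v s - v (s + h)|%:E))%E).
  apply: ge0_le_integral => //.
  - exact: (measurableT_comp mF (measurable_pair2 h)).
  - exact: measurable_funeM.
  move=> s _; rewrite /F/= -EFinM lee_fin.
  have /andP[i0 i1] := I01 s; have /andP[j0 j1] := I01 (s + h).
  apply: (weighted_square i0 i1 j0 j1 (powR_ge0 _ _)).
  by rewrite (le_trans (ler_normB _ _))// mulr_natl mulr2n lerD.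
rewrite ge0_integralZl//; last by rewrite lee_fin divr_ge0 ?mulr_ge0 ?powR_ge0.
apply: (@le_trans _ _ ((2 * A / `|h| `^ (1 + 2 * al))%:E * (B * `|h|)%:E)%E).
  by apply: lee_wpmul2l; rewrite ?lee_fin ?divr_ge0 ?mulr_ge0 ?powR_ge0.
rewrite -EFinM lee_fin.
have -> : 2 * A / `|h| `^ (1 + 2 * al) * (B * `|h|) = 2 * A * B * `|h| `^ (- (2 * al)).
  rewrite powRD; last by rewrite (gt_eqF hp) implybT.
  rewrite powRr1 ?(ltW hp)// powRN; field.
  by rewrite !gt_eqF ?powR_gt0.
rewrite ler_wpM2l ?mulr_ge0// /K /kpow sub0r oppr_gt0 !indicE !mem_setE !in_itv/=.
have [hh|hh|hh] := ltgtP 0 h; last by rewrite hh eqxx in h0.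
  by move: hb; rewrite gtr0_norm// => ->; rewrite mulr1 mul0r addr0.
by move: hb; rewrite ltr0_norm// => ->; rewrite mulr1 mul0r add0r.
Qed.

Let co_measure (a b : R) : a <= b ->
  (\int[mu]_s (\1_(`[a, b[%classic) s)%:E = (b - a)%:E)%E.
Proof.
move=> ab; rewrite integral_indic//= setIT.
transitivity (mu `[a, b[%classic) => //.
rewrite lebesgue_measure_itv/= lte_fin; case: ltP => [_|ba]; first by rewrite EFinB.
by rewrite (@le_anti _ _ a b) ?subrr// ab ba.
Qed.

Variable nu : {sigma_finite_measure set MR -> \bar R}.
Hypothesis nu_fin : (nu setT < +oo)%E.

(** The increment of a jump sum over an interval is at most M times the
    nu-measure of that interval, which integrates over all translates to its
    length times nu(R). *)
Lemma sobolev_jump_sum (b : R) : 0 < b -> exists2 C : R, 0 <= C &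
  forall T q M, is_density T q -> (forall a, `|q a| <= M) ->
  (sobolev_norm2 al `]0%R, b[%classic (jump_sum nu q) <= (C * M ^+ 2)%:E)%E.
Proof.
move=> b0; pose N := fine (nu setT).
have NE : nu setT = N%:E by rewrite fineK// ge0_fin_numE.
have N0 : 0 <= N by rewrite fine_ge0.
have W0 : 0 <= window b.
  by rewrite fine_ge0//; apply: integral_ge0 => t _; rewrite lee_fin mulr_ge0 ?kpow_ge0.
exists (N ^+ 2 * b + 4 * N * N * window b).
  by rewrite addr_ge0// !mulr_ge0// ltW.
move=> T q M dq qM; have M0 : 0 <= M by exact: le_trans (qM 0).
have [mq _ _] := dq.
have ibnd (f : R -> R) K : measurable_fun [set: MR] f -> (forall a, `|f a| <= K) ->
    `|\int[nu]_a f a| <= K * N.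
  move=> mf fK; have fi := integrable_bounded nu_fin mf fK.
  rewrite (le_trans (le_normr_Rintegral _ _))//.
  have K0 : 0 <= K by exact: le_trans (fK 0).
  apply: (@le_trans _ _ (\int[nu]_a K)).
    apply: le_Rintegral => //.
    - by apply: (integrable_bounded nu_fin (M := K)); [exact: measurableT_comp|move=> a; rewrite normr_id].
    - by apply: (integrable_bounded nu_fin (M := K)) => // a; rewrite ger0_norm.
  by rewrite Rintegral_cst.
have mi (t : R) : measurable_fun [set: MR] (fun a => \1_(`]-oo, t]%classic) a : R).
  exact: measurable_indic.
have := @sobolev_norm2_BV b (M * N) (M * N) (jump_sum nu q) b0 (measurable_jump_sum nu dq).
have -> : (M * N) ^+ 2 * b + 4 * (M * N) * (M * N) * window b =
   (N ^+ 2 * b + 4 * N * N * window b) * M ^+ 2 by ring.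
apply.
- move=> t; apply: ibnd; first exact: measurable_funM.
  move=> a; rewrite normrM indicE; case: (_ \in _); first by rewrite /= normr1 mulr1.
  by rewrite /= normr0 mulr0.
move=> h.
pose u := fun w : MR * MR => `|\1_(`]-oo, w.2]%classic) w.1 - \1_(`]-oo, w.2 + h]%classic) w.1| : R.
have mH (f : MR * MR -> R) : measurable_fun setT f ->
    measurable_fun setT (fun w : MR * MR => \1_(`]-oo, f w]%classic) w.1 : R).
  move=> mf.
  rewrite (_ : (fun _ => _) = (fun w : MR * MR => if w.1 <= f w then 1 else 0)); last first.
    by apply/funext => w; rewrite indicE mem_setE in_itv/=; case: ifP.
  apply: (@measurable_fun_ifT _ _ _ _ (fun _ : MR * MR => 1 : R) (fun _ : MR * MR => 0 : R) (fun w : MR * MR => w.1 <= f w)) => //.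
  by apply: measurable_fun_ler => //; exact: measurable_fst.
have mu_ : measurable_fun setT (fun w => (u w)%:E).
  apply/measurable_EFinP; apply: measurableT_comp => //; apply: measurable_funB.
    by apply: mH; exact: measurable_snd.
  by apply: mH; apply: measurable_funD => //; exact: measurable_snd.
have u0 w : (0 <= (u w)%:E)%E by rewrite lee_fin /u normr_ge0.
apply: (@le_trans _ _ (\int[mu]_s (M%:E * \int[nu]_a (u (a, s))%:E))%E).
  apply: ge0_le_integral => //.
  - apply/measurable_EFinP; apply: measurableT_comp => //.
    have mj := measurable_jump_sum nu dq.
    by apply: measurable_funB => //; apply: (measurableT_comp mj); exact: measurable_funD.
  - by apply: measurable_funeM; exact: (measurable_fun_fubini_tonelli_G _ mu_ u0).
  - move=> s _; rewrite /jump_sum.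
    have ji (t : R) : nu.-integrable setT (EFin \o (fun a => q a * \1_(`]-oo, t]%classic) a)).
      apply: (integrable_bounded nu_fin (M := M)); first exact: measurable_funM.
      move=> a; rewrite normrM indicE; case: (_ \in _); first by rewrite /= normr1 mulr1.
      by rewrite /= normr0 mulr0.
    rewrite -(@RintegralB _ _ _ nu setT _ _ measurableT (ji s) (ji (s + h))).
    have iB := integrable_subR measurableT (ji s) (ji (s + h)).
    apply: (@le_trans _ _ (\int[nu]_a `|(q a * \1_(`]-oo, s]%classic) a - q a * \1_(`]-oo, (s + h)%R]%classic) a)%:E|)%E).
      rewrite /Rintegral -[leLHS]abse_EFin fineK; last exact: integrable_fin_num iB.
      by apply: le_abse_integral => //; exact: measurable_int iB.
    rewrite -ge0_integralZl//; last exact: (measurableT_comp mu_ (measurable_pair2 s)).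
    apply: ge0_le_integral => //.
    + by apply: measurableT_comp => //; exact: measurable_int iB.
    + by apply: measurable_funeM; exact: (measurableT_comp mu_ (measurable_pair2 s)).
    + by move=> a _; rewrite -EFinM lee_fin -mulrBr normrM ler_wpM2r.
rewrite ge0_integralZl//; last 2 first.
- exact: (measurable_fun_fubini_tonelli_G _ mu_ u0).
- by move=> s _; apply: integral_ge0.
rewrite -(fubini_tonelli _ mu_ u0).
have E (a : R) : (\int[mu]_s (u (a, s))%:E = `|h|%:E)%E.
  rewrite /u/=; have [hh|hh] := leP 0 h.
    rewrite (_ : (fun s : R => _) = (fun s : R => (\1_(`[(a - h), a[%classic) s)%:E)); last first.
      apply/funext => s; rewrite !indicE !mem_setE !in_itv/= lerBlDr.
      have [as_|as_] := leP a s.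
        have -> : a <= s + h by rewrite (le_trans as_)// lerDl.
        by rewrite andbF subrr normr0.
      by rewrite sub0r normrN andbT; case: (_ <= _); rewrite ?normr1 ?normr0.
    rewrite co_measure ?gerBl// ger0_norm//.
    by congr EFin; ring.
  rewrite (_ : (fun s : R => _) = (fun s : R => (\1_(`[a, (a - h)[%classic) s)%:E)); last first.
    apply/funext => s; rewrite !indicE !mem_setE !in_itv/= ltrBrDr.
    have [as_|as_] := leP a (s + h).
      have -> : a <= s by rewrite (le_trans as_)// gerDl ltW.
      by rewrite subrr normr0.
    by rewrite subr0 andbT; case: (_ <= _); rewrite ?normr1 ?normr0.
  rewrite co_measure ?ltr0_norm//; first by congr EFin; ring.
  by rewrite lerBrDr gerDl ltW.
under eq_integral do rewrite E.
have -> : (\int[nu]_(_ in setT) `|h|%:E = (`|h| * N)%:E)%E.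
  by rewrite (integral_cst nu measurableT) EFinM -NE.
by rewrite -EFinM lee_fin -mulrA [N * _]mulrC.
Qed.

End SobolevBound.

(** * Linear combinations of densities *)

Section LinearCombinations.
Context {R : realType}.
Local Notation mu := (@lebesgue_measure R).
Local Notation MR := (measurableTypeR R).
Variable nu : {sigma_finite_measure set MR -> \bar R}.
Hypothesis nu_fin : (nu setT < +oo)%E.
Variable al : R.
Hypotheses (al0 : 0 < al) (al1 : 2 * al < 1).
Local Notation jump_sum := (jump_sum nu).
Local Notation frac_plus := (frac_plus nu al).
Local Notation frac_minus := (frac_minus nu al).

Let window (c : R) : R := fine (\int[mu]_x (kpow (2 * al) x * \1_(`]-oo, c]%classic) x)%:E)%E.

Let windowE c : (\int[mu]_x (kpow (2 * al) x * \1_(`]-oo, c]%classic) x)%:E = (window c)%:E)%E.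
Proof.
rewrite fineK// ge0_fin_numE ?integral_kpow_window//.
by apply: integral_ge0 => t _; rewrite lee_fin mulr_ge0 ?kpow_ge0.
Qed.

Let window_ge0 c : 0 <= window c.
Proof. by rewrite fine_ge0//; apply: integral_ge0 => t _; rewrite lee_fin mulr_ge0 ?kpow_ge0. Qed.

Let mK (c : R) : measurable_fun [set: R] (fun x => (kpow (2 * al) x * \1_(`]-oo, c]%classic) x)%:E).
Proof. by apply/measurable_EFinP; apply: measurable_funM => //; exact: measurable_kpow. Qed.

Let K0 (c x : R) : (0 <= (kpow (2 * al) x * \1_(`]-oo, c]%classic) x)%:E)%E.
Proof. by rewrite lee_fin mulr_ge0 ?kpow_ge0. Qed.

Let moo (a b : R) : measurable_fun [set: MR] (\1_(`]a, b[%classic) : R -> R).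
Proof. by apply: measurable_indic; exact: measurable_itv. Qed.

Let plus_window (a T : R) : 0 <= a ->
  (\int[mu]_t ((kpow al (t - a) * \1_(`]0%R, T[%classic) t) ^+ 2)%:E <= (window T)%:E)%E.
Proof.
move=> a0; rewrite -windowE.
have := @ge0_integral_affine R (- a) 1 _ ltr01 (mK T) (K0 T); rewrite mul1e => <-.
apply: ge0_le_integral => //.
- by move=> t _; rewrite lee_fin sqr_ge0.
- apply/measurable_EFinP; apply: measurable_funX; apply: measurable_funM => //.
  by apply: measurable_kpow_comp; exact: measurable_funB.
- apply: (measurableT_comp (mK T)); apply: measurable_funD => //; exact: measurable_funM.
- move=> t _; rewrite lee_fin exprMn kpow_sqr mul1r addrC ler_wpM2l ?kpow_ge0//.
  rewrite !indicE !mem_setE !in_itv/=.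
  have [/andP[t0 tT]|_] := boolP (0 < t < T); last by rewrite expr0n.
  have h : - a + t <= T by rewrite addrC lerBlDr (le_trans (ltW tT))// lerDl.
  by rewrite h expr1n.
Qed.

Let minus_window (a T : R) : a <= T ->
  (\int[mu]_t ((kpow al (a - t) * \1_(`]0%R, T[%classic) t) ^+ 2)%:E <= (window T)%:E)%E.
Proof.
move=> aT; rewrite -windowE -(ge0_integral_reflect a (mK T) (K0 T)).
apply: ge0_le_integral => //.
- by move=> t _; rewrite lee_fin sqr_ge0.
- apply/measurable_EFinP; apply: measurable_funX; apply: measurable_funM => //.
  by apply: measurable_kpow_comp; exact: measurable_funB.
- by apply: (measurableT_comp (mK T)); exact: measurable_funB.
- move=> t _; rewrite lee_fin exprMn kpow_sqr ler_wpM2l ?kpow_ge0//.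
  rewrite !indicE !mem_setE !in_itv/=.
  have [/andP[t0 tT]|_] := boolP (0 < t < T); last by rewrite expr0n.
  have h : a - t <= T by rewrite lerBlDr (le_trans aT)// lerDl ltW.
  by rewrite h expr1n.
Qed.

Let ker_plus T (q : R -> R) (w : MR * MR) : R :=
  q w.1 * (kpow al (w.2 - w.1) * \1_(`]0, T[%classic) w.2).

Let ker_minus T (q : R -> R) (w : MR * MR) : R :=
  q w.1 * (kpow al (w.1 - w.2) * \1_(`]0, T[%classic) w.2).

Let mker_plus T q : is_density T q -> measurable_fun setT (ker_plus T q).
Proof.
move=> [mq _ _]; apply: measurable_funM; first exact: (measurableT_comp mq measurable_fst).
apply: measurable_funM; last exact: (measurableT_comp (moo 0 T) measurable_snd).
by apply: measurable_kpow_comp; apply: measurable_funB; [exact: measurable_snd|exact: measurable_fst].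
Qed.

Let mker_minus T q : is_density T q -> measurable_fun setT (ker_minus T q).
Proof.
move=> [mq _ _]; apply: measurable_funM; first exact: (measurableT_comp mq measurable_fst).
apply: measurable_funM; last exact: (measurableT_comp (moo 0 T) measurable_snd).
by apply: measurable_kpow_comp; apply: measurable_funB; [exact: measurable_fst|exact: measurable_snd].
Qed.

Let scaled_window (q : R) (M : R) (f : R -> R) (W : R) : `|q| <= M -> 0 <= W ->
  measurable_fun [set: MR] f ->
  (q != 0 -> (\int[mu]_t ((f t) ^+ 2)%:E <= W%:E)%E) ->
  (\int[mu]_t ((q * f t) ^+ 2)%:E <= (M ^+ 2 * W)%:E)%E.
Proof.
move=> qM W0 mf fW.
have [q0|q0] := eqVneq q 0.
  rewrite integral0_eq; first by rewrite lee_fin mulr_ge0// sqr_ge0.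
  by move=> t _; rewrite q0 mul0r expr0n.
under eq_integral do rewrite exprMn EFinM.
rewrite ge0_integralZl//; last 3 first.
- by apply/measurable_EFinP; exact: measurable_funX.
- by move=> t _; rewrite lee_fin sqr_ge0.
- by rewrite lee_fin sqr_ge0.
rewrite (EFinM (M ^+ 2) W); apply: lee_pmul; rewrite ?lee_fin ?sqr_ge0//.
- by apply: integral_ge0 => t _; rewrite lee_fin sqr_ge0.
- rewrite -(real_normK (num_real q)) lerXn2r ?nnegrE//; exact: le_trans qM.
- exact: fW.
Qed.

Let kerK_plus T q : is_density T q -> exists K : R, forall a,
  (\int[mu]_t (ker_plus T q (a, t) ^+ 2)%:E <= K%:E)%E.
Proof.
move=> [mq [M qM] qT]; exists (M ^+ 2 * window T) => a.
apply: (@scaled_window (q a) M (fun t => kpow al (t - a) * \1_(`]0, T[%classic) t)) => //.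
  apply: measurable_funM => //.
  by apply: measurable_kpow_comp; exact: measurable_funB.
move=> qa; apply: plus_window.
have /andP[] : 0 <= a <= T by apply: contraT => /qT h; rewrite h eqxx in qa.
by [].
Qed.

Let kerK_minus T q : is_density T q -> exists K : R, forall a,
  (\int[mu]_t (ker_minus T q (a, t) ^+ 2)%:E <= K%:E)%E.
Proof.
move=> [mq [M qM] qT]; exists (M ^+ 2 * window T) => a.
apply: (@scaled_window (q a) M (fun t => kpow al (a - t) * \1_(`]0, T[%classic) t)) => //.
  apply: measurable_funM => //.
  by apply: measurable_kpow_comp; exact: measurable_funB.
move=> qa; apply: minus_window.
have /andP[] : 0 <= a <= T by apply: contraT => /qT h; rewrite h eqxx in qa.
by [].
Qed.

Lemma measurable_frac_plus T q : is_density T q -> measurable_fun [set: MR] (frac_plus q).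
Proof.
move=> [mq _ _]; apply: (@measurable_Rintegral_param _ _ _ _ _ nu (fun w : MR * MR => q w.1 * kpow al (w.2 - w.1))).
apply: measurable_funM; first exact: (measurableT_comp mq measurable_fst).
by apply: measurable_kpow_comp; apply: measurable_funB; [exact: measurable_snd|exact: measurable_fst].
Qed.

Lemma measurable_frac_minus T q : is_density T q -> measurable_fun [set: MR] (frac_minus q).
Proof.
move=> [mq _ _]; apply: measurableT_comp => //.
apply: (@measurable_Rintegral_param _ _ _ _ _ nu (fun w : MR * MR => q w.1 * kpow al (w.1 - w.2))).
apply: measurable_funM; first exact: (measurableT_comp mq measurable_fst).
by apply: measurable_kpow_comp; apply: measurable_funB; [exact: measurable_fst|exact: measurable_snd].
Qed.

Let restrict_itv (T t : R) (f : R -> R) (g : R -> R) : `]0, T[%classic t ->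
  (forall a, g a = f a * \1_(`]0, T[%classic) t) -> \int[nu]_a f a = \int[nu]_a g a.
Proof.
move=> tT gE; apply: eq_Rintegral => a _.
by rewrite gE indicE mem_set ?mulr1.
Qed.

Lemma integrable_frac_plus_sqr T q : is_density T q ->
  mu.-integrable `]0, T[%classic (fun t => (frac_plus q t ^+ 2)%:E).
Proof.
move=> dq; have [K hK] := kerK_plus dq.
have mD : measurable (`]0, T[%classic : set MR) by exact: measurable_itv.
have [i _ _] := bilinear_Fubini nu_fin (mker_plus dq) (mker_plus dq) hK hK.
have := integrableS measurableT mD (@subsetT _ _) i.
apply: eq_integrable => // t /set_mem tT; congr EFin; rewrite -expr2; congr (_ ^+ 2).
by apply/esym; apply: (restrict_itv tT) => a; rewrite /ker_plus/= mulrA.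
Qed.

Lemma integrable_frac_minus_sqr T q : is_density T q ->
  mu.-integrable `]0, T[%classic (fun t => (frac_minus q t ^+ 2)%:E).
Proof.
move=> dq; have [K hK] := kerK_minus dq.
have mD : measurable (`]0, T[%classic : set MR) by exact: measurable_itv.
have [i _ _] := bilinear_Fubini nu_fin (mker_minus dq) (mker_minus dq) hK hK.
have := integrableS measurableT mD (@subsetT _ _) i.
apply: eq_integrable => // t /set_mem tT; congr EFin; rewrite -expr2 -[LHS]sqrrN; congr (_ ^+ 2).
rewrite /frac_minus; congr (- _).
by apply/esym; apply: (restrict_itv tT) => a; rewrite /ker_minus/= mulrA.
Qed.

Let ae_integrable_plus T q : is_density T q ->
  {ae mu, forall t, `]0, T[%classic t -> nu.-integrable setT (fun a => (q a * kpow al (t - a))%:E)}.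
Proof.
move=> dq; have [K hK] := kerK_plus dq.
have := ae_integrable_section nu_fin (mker_plus dq) hK; apply: filterS => t i tT.
apply: eq_integrable i => // a _; rewrite /ker_plus/= indicE mem_set// mulr1.
by [].
Qed.

Let ae_integrable_minus T q : is_density T q ->
  {ae mu, forall t, `]0, T[%classic t -> nu.-integrable setT (fun a => (q a * kpow al (a - t))%:E)}.
Proof.
move=> dq; have [K hK] := kerK_minus dq.
have := ae_integrable_section nu_fin (mker_minus dq) hK; apply: filterS => t i tT.
apply: eq_integrable i => // a _; rewrite /ker_minus/= indicE mem_set// mulr1.
by [].
Qed.

Variables (I : finType) (q : I -> R -> R) (T : R).
Hypothesis dq : forall p, is_density T (q p).

Definition comb (x : I -> R) (a : R) : R := \sum_p x p * q p a.

Lemma is_density_comb x : is_density T (comb x).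
Proof.
split.
- apply: measurable_sum => p; apply: measurable_funM => //.
  by have [] := dq p.
- have /choice[M hM] : forall p, exists M : R, forall a, `|q p a| <= M by move=> p; have [] := dq p.
  exists (\sum_p `|x p| * M p) => a; apply: le_trans (ler_norm_sum _ _ _) _.
  by apply: ler_sum => p _; rewrite normrM ler_wpM2l.
- move=> a aT; apply: big1 => p _; have [_ _ ->//] := dq p.
  by rewrite mulr0.
Qed.

Lemma mass_comb x : (forall p, \int[nu]_a q p a = 0) -> \int[nu]_a comb x a = 0.
Proof.
move=> q0; rewrite Rintegral_sum//; last first.
  by move=> p; apply: integrable_scaleR => //; exact: integrable_density (dq p).
by apply: big1 => p _; rewrite RintegralZl ?q0 ?mulr0//; exact: integrable_density (dq p).
Qed.

Let Rintegral_comb x (k : R -> R) : (forall p, nu.-integrable setT (fun a => (q p a * k a)%:E)) ->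
  \int[nu]_a (comb x a * k a) = \sum_p x p * \int[nu]_a (q p a * k a).
Proof.
move=> ik; under eq_Rintegral do rewrite /comb mulr_suml.
apply: (etrans (@Rintegral_sum _ _ _ nu setT measurableT I (index_enum I) (fun p a => x p * q p a * k a) _)).
  move=> p; have := integrable_scaleR measurableT (x p) (ik p).
  by under eq_fun do rewrite mulrA.
apply: eq_bigr => p _; rewrite -RintegralZl//; last exact: ik.
by apply: eq_Rintegral => a _; rewrite mulrA.
Qed.

Lemma jump_sum_comb x t : jump_sum (comb x) t = \sum_p x p * jump_sum (q p) t.
Proof.
apply: Rintegral_comb => p; have [mq [M qM] _] := dq p.
have M0 : 0 <= M by exact: le_trans (qM 0).
apply: (integrable_bounded nu_fin (M := M)).
  by apply: measurable_funM => //; exact: measurable_indic.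
move=> a; rewrite normrM indicE; case: (_ \in _); first by rewrite /= normr1 mulr1.
by rewrite /= normr0 mulr0.
Qed.

Let ae_all (P : I -> R -> Prop) : (forall p, {ae mu, forall t, P p t}) ->
  {ae mu, forall t, forall p, P p t}.
Proof.
move=> H; have : {ae mu, forall t, forall p, p \in enum I -> P p t}.
  elim: (enum I) => [|p s IH]; first by apply: aeW => t p; rewrite in_nil.
  apply: filterS2 (H p) IH => t h1 h2 p'; rewrite in_cons => /orP[/eqP->//|]; exact: h2.
by apply: filterS => t h p; apply: h; rewrite mem_enum.
Qed.

(** Linearity only holds where the singular integrals converge, which is almost
    everywhere. *)
Lemma frac_plus_comb x : {ae mu, forall t, `]0, T[%classic t ->
  frac_plus (comb x) t = \sum_p x p * frac_plus (q p) t}.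
Proof.
have := ae_all (fun p => ae_integrable_plus (dq p)); apply: filterS => t h tT.
by apply: Rintegral_comb => p; exact: h.
Qed.

Lemma frac_minus_comb x : {ae mu, forall t, `]0, T[%classic t ->
  frac_minus (comb x) t = \sum_p x p * frac_minus (q p) t}.
Proof.
have := ae_all (fun p => ae_integrable_minus (dq p)); apply: filterS => t h tT.
rewrite /frac_minus (@Rintegral_comb x (fun a => kpow al (a - t))); last by move=> p; exact: h.
by rewrite -sumrN; apply: eq_bigr => p _; rewrite mulrN.
Qed.

End LinearCombinations.

(** * The Hilbert space L^2(Omega) *)

Section SquareIntegrable.
Context {R : realType} {d : nat}.
Local Notation E := 'rV[R]_d.
Local Notation leb := (@lebesgue_row R d).
Variable Om : set E.
Hypothesis mOm : measurable Om.
Implicit Types (u v w : E -> R).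

Lemma eqL2_refl v : eqL2 Om v v.
Proof. exact: aeW. Qed.

Lemma eqL2_sym v w : eqL2 Om v w -> eqL2 Om w v.
Proof. by apply: filterS => x h /h. Qed.

Lemma ipL2_ae v v' w w' : eqL2 Om v v' -> eqL2 Om w w' -> ipL2 Om v w = ipL2 Om v' w'.
Proof.
move=> vv' ww'; apply: Rintegral_ae_eq_any.
by apply: filterS2 vv' ww' => x h k Ox; rewrite h// k.
Qed.

Lemma normL2_ae v w : eqL2 Om v w -> normL2 Om v = normL2 Om w.
Proof. by move=> vw; rewrite /normL2 (ipL2_ae vw vw). Qed.

Lemma ipL2C v w : ipL2 Om v w = ipL2 Om w v.
Proof. by apply: eq_Rintegral => x _; rewrite mulrC. Qed.

Lemma L2_sqr_integrable v : L2 Om v -> leb.-integrable Om (fun x => (v x ^+ 2)%:E).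
Proof.
move=> [mv iv]; apply/integrableP; split.
  by apply/measurable_EFinP; exact: measurable_funX.
apply: le_lt_trans iv; rewrite le_eqVlt; apply/orP; left; apply/eqP.
by apply: eq_integral => x _; rewrite /= ger0_norm// sqr_ge0.
Qed.

Lemma integrable_mulL2 v w : L2 Om v -> L2 Om w -> leb.-integrable Om (fun x => (v x * w x)%:E).
Proof.
move=> Lv Lw; have i := integrable_addR mOm (L2_sqr_integrable Lv) (L2_sqr_integrable Lw).
apply: (le_integrable mOm _ _ i).
  by apply/measurable_EFinP; apply: measurable_funM; [case: Lv|case: Lw].
move=> x _; rewrite lee_fin normrM [leRHS]ger0_norm ?addr_ge0 ?sqr_ge0//.
rewrite -(real_normK (num_real (v x))) -(real_normK (num_real (w x))).
by move: (`|v x|) (`|w x|) => a b; nra.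
Qed.

Lemma L2_0 : L2 Om (fun=> 0).
Proof.
split; first exact: measurable_cst.
under eq_integral do rewrite expr0n/=.
by rewrite integral0.
Qed.

Lemma L2_lin (a b : R) v w : L2 Om v -> L2 Om w -> L2 Om (fun x => a * v x + b * w x).
Proof.
move=> Lv Lw; have [mv _] := Lv; have [mw _] := Lw; split.
  by apply: measurable_funD; apply: measurable_funM => //; exact: measurable_cst.
have i := integrable_scaleR mOm 2 (integrable_addR mOm
  (integrable_scaleR mOm (a ^+ 2) (L2_sqr_integrable Lv))
  (integrable_scaleR mOm (b ^+ 2) (L2_sqr_integrable Lw))).
apply: le_lt_trans (integrable_lty mOm i); apply: ge0_le_integral => //.
- by move=> x _; rewrite lee_fin sqr_ge0.
- apply/measurable_EFinP; apply: measurable_funX.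
  by apply: measurable_funD; apply: measurable_funM => //; exact: measurable_cst.
- exact: measurable_int i.
- move=> x _; rewrite lee_fin -!exprMn; move: (a * v x) (b * w x) => p q.
  by rewrite -subr_ge0 (_ : _ - _ = (p - q) ^+ 2) ?sqr_ge0//; ring.
Qed.

Lemma L2D v w : L2 Om v -> L2 Om w -> L2 Om (fun x => v x + w x).
Proof.
by move=> Lv Lw; have := L2_lin 1 1 Lv Lw; under eq_fun do rewrite !mul1r.
Qed.

Lemma L2B v w : L2 Om v -> L2 Om w -> L2 Om (fun x => v x - w x).
Proof.
by move=> Lv Lw; have := L2_lin 1 (-1) Lv Lw; under eq_fun do rewrite mul1r mulN1r.
Qed.

Lemma L2Z (a : R) v : L2 Om v -> L2 Om (fun x => a * v x).
Proof.
by move=> Lv; have := L2_lin a 0 Lv Lv; under eq_fun do rewrite mul0r addr0.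
Qed.

Lemma L2_sum (I : Type) (s : seq I) (c : I -> R) (g : I -> E -> R) :
  (forall i, L2 Om (g i)) -> L2 Om (fun x => \sum_(i <- s) c i * g i x).
Proof.
move=> Lg; elim: s => [|i s IH].
  by under eq_fun do rewrite big_nil; exact: L2_0.
under eq_fun do rewrite big_cons.
by apply: L2D => //; exact: L2Z.
Qed.

Lemma ipL2_linl (a b : R) u v w : L2 Om u -> L2 Om v -> L2 Om w ->
  ipL2 Om (fun x => a * u x + b * v x) w = a * ipL2 Om u w + b * ipL2 Om v w.
Proof.
move=> Lu Lv Lw; have iu := integrable_mulL2 Lu Lw; have iv := integrable_mulL2 Lv Lw.
rewrite /ipL2 -(RintegralZl a mOm iu) -(RintegralZl b mOm iv).
rewrite -RintegralD//; [|exact: integrable_scaleR|exact: integrable_scaleR].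
by apply: eq_Rintegral => x _; ring.
Qed.

Lemma ipL2Dl u v w : L2 Om u -> L2 Om v -> L2 Om w ->
  ipL2 Om (fun x => u x + v x) w = ipL2 Om u w + ipL2 Om v w.
Proof.
move=> Lu Lv Lw; have := ipL2_linl 1 1 Lu Lv Lw; rewrite !mul1r => <-.
by under [in RHS]eq_fun do rewrite !mul1r.
Qed.

Lemma ipL2Bl u v w : L2 Om u -> L2 Om v -> L2 Om w ->
  ipL2 Om (fun x => u x - v x) w = ipL2 Om u w - ipL2 Om v w.
Proof.
move=> Lu Lv Lw; have := ipL2_linl 1 (-1) Lu Lv Lw; rewrite !mul1r mulN1r => <-.
by under [in RHS]eq_fun do rewrite mul1r mulN1r.
Qed.

Lemma ipL2Zl (a : R) u w : L2 Om u -> L2 Om w ->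
  ipL2 Om (fun x => a * u x) w = a * ipL2 Om u w.
Proof.
move=> Lu Lw; have := ipL2_linl a 0 Lu Lu Lw; rewrite mul0r addr0 => <-.
by under [in RHS]eq_fun do rewrite mul0r addr0.
Qed.

Lemma ipL2_0l w : ipL2 Om (fun=> 0) w = 0.
Proof. by rewrite /ipL2; under eq_Rintegral do rewrite mul0r; rewrite Rintegral_cst// mul0r. Qed.

Lemma ipL2_suml (I : Type) (s : seq I) (c : I -> R) (g : I -> E -> R) w :
  (forall i, L2 Om (g i)) -> L2 Om w ->
  ipL2 Om (fun x => \sum_(i <- s) c i * g i x) w = \sum_(i <- s) c i * ipL2 Om (g i) w.
Proof.
move=> Lg Lw; elim: s => [|i s IH].
  by rewrite big_nil; under eq_fun do rewrite big_nil; rewrite ipL2_0l.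
rewrite big_cons; under eq_fun do rewrite big_cons.
rewrite ipL2Dl//; [|exact: L2Z|exact: L2_sum].
by rewrite ipL2Zl// IH.
Qed.

Lemma ipL2_sum2 (I : finType) (c c' : I -> R) (g g' : I -> E -> R) :
  (forall i, L2 Om (g i)) -> (forall i, L2 Om (g' i)) ->
  ipL2 Om (fun x => \sum_i c i * g i x) (fun x => \sum_i c' i * g' i x) =
  \sum_i \sum_j c i * c' j * ipL2 Om (g i) (g' j).
Proof.
move=> Lg Lg'; rewrite ipL2_suml//; last exact: L2_sum.
apply: eq_bigr => i _; rewrite ipL2C ipL2_suml// mulr_sumr.
by apply: eq_bigr => j _; rewrite ipL2C mulrA.
Qed.

Lemma ipL2_ge0 v : 0 <= ipL2 Om v v.
Proof. by apply: Rintegral_ge0 => x _; rewrite -expr2 sqr_ge0. Qed.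

Lemma normL2_ge0 v : 0 <= normL2 Om v.
Proof. exact: sqrtr_ge0. Qed.

Lemma normL2_sqr v : normL2 Om v ^+ 2 = ipL2 Om v v.
Proof. by rewrite sqr_sqrtr// ipL2_ge0. Qed.

Lemma ipL2_CS v w : L2 Om v -> L2 Om w -> `|ipL2 Om v w| <= normL2 Om v * normL2 Om w.
Proof.
move=> Lv Lw; rewrite -sqrtrM ?ipL2_ge0// -sqrtr_sqr ler_wsqrtr//.
have H (a b : R) : 0 <= a ^+ 2 * ipL2 Om v v + 2 * a * b * ipL2 Om v w + b ^+ 2 * ipL2 Om w w.
  have := ipL2_ge0 (fun x => a * v x + b * w x).
  have L := L2_lin a b Lv Lw.
  rewrite (ipL2_linl a b Lv Lw L) [ipL2 _ v _]ipL2C [ipL2 _ w _]ipL2C.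
  rewrite (ipL2_linl a b Lv Lw Lv) (ipL2_linl a b Lv Lw Lw) (ipL2C w v).
  by congr (0 <= _); ring.
have vv := ipL2_ge0 v; have ww := ipL2_ge0 w.
have := H (ipL2 Om w w) (- ipL2 Om v w); have := H (ipL2 Om v w) (- ipL2 Om v v).
have := H 1 1; have := H 1 (-1).
move: vv ww; move: (ipL2 Om v v) (ipL2 Om w w) (ipL2 Om v w) => p q r p0 q0 h1 h2 h3 h4.
have h3' : 0 <= p * (p * q - r ^+ 2) by move: h3; congr (0 <= _); ring.
have h4' : 0 <= q * (p * q - r ^+ 2) by move: h4; congr (0 <= _); ring.
rewrite -subr_ge0.
have [pp|pp] := ltP 0 p; first by move: h3'; rewrite pmulr_rge0.
have [qq|qq] := ltP 0 q; first by move: h4'; rewrite pmulr_rge0.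
have -> : p = 0 by apply/eqP; rewrite eq_le pp p0.
rewrite mul0r sub0r oppr_ge0; have : r = 0 by lra.
by move=> ->; rewrite expr0n.
Qed.

Lemma normL2_triangle v w : L2 Om v -> L2 Om w ->
  normL2 Om (fun x => v x + w x) <= normL2 Om v + normL2 Om w.
Proof.
move=> Lv Lw; have L := L2D Lv Lw.
rewrite -(ler_pXn2r (ltn0Sn 1)) ?nnegrE ?addr_ge0 ?normL2_ge0// normL2_sqr.
rewrite (ipL2Dl Lv Lw L) [ipL2 _ v _]ipL2C [ipL2 _ w _]ipL2C.
rewrite (ipL2Dl Lv Lw Lv) (ipL2Dl Lv Lw Lw) (ipL2C w v).
have := le_trans (ler_norm _) (ipL2_CS Lv Lw).
rewrite -!normL2_sqr; lra.
Qed.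

Lemma normL2Z (a : R) v : L2 Om v -> normL2 Om (fun x => a * v x) = `|a| * normL2 Om v.
Proof.
move=> Lv; rewrite /normL2 ipL2Zl//; last exact: L2Z.
rewrite ipL2C ipL2Zl// mulrA -expr2 sqrtrM ?sqr_ge0//.
by rewrite sqrtr_sqr.
Qed.

Lemma ipL2_eq0 v : L2 Om v -> ipL2 Om v v = 0 -> eqL2 Om v (fun=> 0).
Proof.
move=> Lv v0; have [mv _] := Lv.
have i := L2_sqr_integrable Lv.
have E0 : (\int[leb]_(x in Om) `|(v x ^+ 2)%:E| = 0)%E.
  transitivity (\int[leb]_(x in Om) (v x ^+ 2)%:E)%E.
    by apply: eq_integral => x _; rewrite gee0_abs// lee_fin sqr_ge0.
  rewrite -[LHS]fineK; last exact: integrable_fin_num i.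
  congr EFin; rewrite -[RHS]v0; congr fine.
have := (ae_eq_integral_abs leb mOm (measurable_int _ i)).1 E0.
apply: filterS => x h Ox; move: (h Ox) => /eqP; rewrite eqe sqrf_eq0.
by move/eqP.
Qed.

Lemma eqL2_normB v w : L2 Om v -> L2 Om w -> normL2 Om (fun x => v x - w x) = 0 -> eqL2 Om v w.
Proof.
move=> Lv Lw vw0; have := @ipL2_eq0 _ (L2B Lv Lw).
rewrite -normL2_sqr vw0 expr0n => /(_ erefl); apply: filterS => x h Ox.
by apply/eqP; rewrite -subr_eq0; apply/eqP; exact: h.
Qed.

End SquareIntegrable.

(** * Parseval's identity for quadratic forms *)

Lemma nneseries_EFin (R : realType) (u : nat -> R) (l : R) : (forall k, 0 <= u k) ->
  (fun K => \sum_(k < K) u k) @ \oo --> l -> (\sum_(k <oo) (u k)%:E = l%:E)%E.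
Proof.
move=> u0 ul; apply/cvg_lim => //.
rewrite (_ : (fun n => _) = EFin \o (fun K => \sum_(k < K) u k)).
  by apply: cvg_EFin => //; exact: nearW.
by apply/funext => K /=; rewrite big_mkord sumEFin.
Qed.

Section Parseval.
Context {R : realType} {d : nat}.
Local Notation E := 'rV[R]_d.
Variable Om : set E.
Hypothesis mOm : measurable Om.
Variable e : nat -> E -> R.
Hypothesis He : orthonormal_basis_L2 Om e.
Implicit Types (u v w : E -> R).

Let Le k : L2 Om (e k). Proof. by case: He. Qed.

Let residual v (K : nat) (c : nat -> R) : L2 Om v ->
  ipL2 Om (fun x => v x - \sum_(k < K) c k * e k x) (fun x => v x - \sum_(k < K) c k * e k x) =
  ipL2 Om v v - \sum_(k < K) ipL2 Om v (e k) ^+ 2 + \sum_(k < K) (c k - ipL2 Om v (e k)) ^+ 2.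
Proof.
move=> Lv; have Lc : L2 Om (fun x => \sum_(k < K) c k * e k x) by exact: L2_sum.
have LB := L2B mOm Lv Lc.
rewrite (ipL2Bl mOm Lv Lc LB) [ipL2 _ v _]ipL2C [ipL2 _ (fun x => \sum_(k < K) _) _]ipL2C.
rewrite (ipL2Bl mOm Lv Lc Lv) (ipL2Bl mOm Lv Lc Lc) [ipL2 _ v (fun x => \sum_(k < K) _)]ipL2C.
have -> : ipL2 Om (fun x => \sum_(k < K) c k * e k x) v = \sum_(k < K) c k * ipL2 Om v (e k).
  by rewrite ipL2_suml//; apply: eq_bigr => k _; rewrite ipL2C.
have -> : ipL2 Om (fun x => \sum_(k < K) c k * e k x) (fun x => \sum_(k < K) c k * e k x) =
    \sum_(k < K) c k ^+ 2.
  rewrite ipL2_suml//; apply: eq_bigr => k _; rewrite ipL2C ipL2_suml//.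
  rewrite (bigD1 k)//= big1; last first.
    move=> l lk; have [_ -> _] := He; rewrite (_ : (_ == _) = false) ?mulr0//.
    by apply/negbTE.
  by have [_ -> _] := He; rewrite eqxx mulr1 addr0 expr2.
have -> : \sum_(k < K) (c k - ipL2 Om v (e k)) ^+ 2 = \sum_(k < K) c k ^+ 2
     - (\sum_(k < K) c k * ipL2 Om v (e k)) *+ 2 + \sum_(k < K) ipL2 Om v (e k) ^+ 2.
  rewrite -sumrMnl -sumrB -big_split/=.
  by apply: eq_bigr => k _; rewrite sqrrB.
by ring.
Qed.

Lemma bessel v K : L2 Om v -> \sum_(k < K) ipL2 Om v (e k) ^+ 2 <= ipL2 Om v v.
Proof.
move=> Lv; rewrite -subr_ge0.
have := residual K (fun k => ipL2 Om v (e k)) Lv.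
rewrite [X in _ + X]big1 ?addr0; last by move=> k _; rewrite subrr expr0n.
by move=> <-; exact: ipL2_ge0.
Qed.

Let parseval_sqr v : L2 Om v ->
  (fun K => \sum_(k < K) ipL2 Om v (e k) ^+ 2) @ \oo --> ipL2 Om v v.
Proof.
move=> Lv; apply/cvgrPdist_lt => eps eps0.
have [_ _ /(_ v Lv)] := He.
have se0 : 0 < Num.sqrt eps by rewrite sqrtr_gt0.
move=> /(_ _ se0)[N [c hN]].
exists N => //= K NK.
rewrite ger0_norm; last by rewrite subr_ge0 bessel.
have : normL2 Om (fun x => v x - \sum_(k < N) c k * e k x) ^+ 2 < eps.
  by rewrite -[ltRHS](sqr_sqrtr (ltW eps0)) ltrXn2r// ?nnegrE ?normL2_ge0// ltW.
rewrite normL2_sqr residual//; apply: le_lt_trans.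
have : \sum_(k < N) ipL2 Om v (e k) ^+ 2 <= \sum_(k < K) ipL2 Om v (e k) ^+ 2.
  rewrite -!(big_mkord xpredT (fun k => ipL2 Om v (e k) ^+ 2)).
  rewrite [leRHS](big_cat_nat (n := N))//= lerDl.
  by apply: sumr_ge0 => k _; exact: sqr_ge0.
have : 0 <= \sum_(k < N) (c k - ipL2 Om v (e k)) ^+ 2.
  by apply: sumr_ge0 => k _; exact: sqr_ge0.
by move: (\sum_(k < N) _) (\sum_(k < N) _) (\sum_(k < K) _) => p q r; lra.
Qed.

Lemma parseval v w : L2 Om v -> L2 Om w ->
  (fun K => \sum_(k < K) ipL2 Om v (e k) * ipL2 Om w (e k)) @ \oo --> ipL2 Om v w.
Proof.
move=> Lv Lw; have Lp := L2D mOm Lv Lw.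
have cp := parseval_sqr Lp; have cv := parseval_sqr Lv; have cw := parseval_sqr Lw.
have : (fun K => (\sum_(k < K) ipL2 Om (fun x => v x + w x) (e k) ^+ 2
     - \sum_(k < K) ipL2 Om v (e k) ^+ 2 - \sum_(k < K) ipL2 Om w (e k) ^+ 2) / 2) @ \oo -->
    (ipL2 Om (fun x => v x + w x) (fun x => v x + w x) - ipL2 Om v v - ipL2 Om w w) / 2.
  by apply: cvgMr_tmp; apply: cvgB => //; exact: cvgB.
have -> : (ipL2 Om (fun x => v x + w x) (fun x => v x + w x) - ipL2 Om v v - ipL2 Om w w) / 2 =
    ipL2 Om v w.
  rewrite (ipL2Dl mOm Lv Lw Lp) [ipL2 _ v _]ipL2C [ipL2 _ w _]ipL2C.
  by rewrite (ipL2Dl mOm Lv Lw Lv) (ipL2Dl mOm Lv Lw Lw) (ipL2C Om v w); field.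
apply: cvg_trans; apply: near_eq_cvg; apply: nearW => K.
rewrite /= -!sumrB mulr_suml; apply: eq_bigr => k _.
by rewrite ipL2Dl//; field.
Qed.

Lemma basis_eq0 v : L2 Om v -> (forall k, ipL2 Om v (e k) = 0) -> ipL2 Om v v = 0.
Proof.
move=> Lv v0; have := parseval Lv Lv; rewrite (_ : (fun K => _) = cst 0); last first.
  by apply/funext => K; rewrite big1// => k _; rewrite v0 mul0r.
by move=> h; have := cvg_unique _ h (cvg_cst 0); exact.
Qed.

Variables (I : finType) (g : I -> E -> R).
Hypothesis Lg : forall i, L2 Om (g i).

(** The value at the Gram matrix of g of a quadratic form. *)
Definition gram_form (A : I -> I -> R) : R := \sum_i \sum_j A i j * ipL2 Om (g i) (g j).

Definition quad_form (A : I -> I -> R) (x : I -> R) : R := \sum_i \sum_j A i j * (x i * x j).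

(** Expanding along e diagonalises the Gram matrix into rank-one pieces, so that
    a vector-valued inequality between quadratic forms follows from the
    scalar one. *)
Lemma gram_form_cvg (A : I -> I -> R) :
  (fun K => \sum_(k < K) quad_form A (fun i => ipL2 Om (g i) (e k))) @ \oo --> gram_form A.
Proof.
rewrite /gram_form.
have : (fun K => \sum_i \sum_j A i j * \sum_(k < K) ipL2 Om (g i) (e k) * ipL2 Om (g j) (e k)) @ \oo -->
    \sum_i \sum_j A i j * ipL2 Om (g i) (g j).
  apply: cvg_big => [|i _]; first exact: add_continuous.
  apply: cvg_big => [|j _]; first exact: add_continuous.
  by apply: cvgMl_tmp; exact: parseval.
apply: cvg_trans; apply: near_eq_cvg; apply: nearW => K.
rewrite /quad_form [RHS]exchange_big; apply: eq_bigr => i _.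
rewrite [RHS]exchange_big; apply: eq_bigr => j _.
by rewrite mulr_sumr.
Qed.

Lemma gram_form_le (A B : I -> I -> R) :
  (forall x, quad_form A x <= quad_form B x) -> gram_form A <= gram_form B.
Proof.
move=> AB; have := ler_cvg_to (@gram_form_cvg A) (@gram_form_cvg B); apply.
by apply: nearW => K; apply: ler_sum.
Qed.

Lemma gram_form_series (A : I -> I -> R) : (forall x, 0 <= quad_form A x) ->
  (\sum_(k <oo) (quad_form A (fun i => ipL2 Om (g i) (e k)))%:E = (gram_form A)%:E)%E.
Proof. by move=> A0; apply: nneseries_EFin => //; exact: gram_form_cvg. Qed.

End Parseval.

(** * Smooth bumps and the lemma of du Bois-Reymond *)

Section PiSystem.
Context {R : realType} d (X : measurableType d) (m : {measure set X -> \bar R}).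

(** By Dynkin's lemma the integral of h vanishes over every measurable set. *)
Lemma pi_system_eq0 (G : set (set X)) (h : X -> R) :
  @measurable _ X = <<s G >> -> setI_closed G ->
  m.-integrable setT (fun x => (h x)%:E) ->
  (\int[m]_x (h x)%:E = 0)%E ->
  (forall A, G A -> (\int[m]_(x in A) (h x)%:E = 0)%E) ->
  {ae m, forall x, h x = 0}.
Proof.
move=> GE GI hi hT hG.
have iS (S : set X) : measurable S -> m.-integrable S (fun x => (h x)%:E).
  by move=> mS; apply: integrableS hi.
have key (S : set X) : measurable S -> (\int[m]_(x in S) (h x)%:E = 0)%E.
  rewrite [X in X S -> _]GE.
  apply: (@dynkin_induction _ X G (fun S => (\int[m]_(x in S) (h x)%:E = 0)%E)) => //.
  - move=> B mB B0; have mC := measurableC mB.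
    have := @integral_setU _ _ _ m B (~` B) (fun x => (h x)%:E) mB mC.
    rewrite setUCr hT B0 add0e => <- //.
      by have := measurable_int _ hi.
    by apply/disj_setPS => x [].
  - move=> F mF tF F0; rewrite integral_bigcup//; last first.
      by apply: iS; exact: bigcupT_measurable.
    by apply: eseries0 => k _ _; exact: F0.
have := @integral_ae_eq _ X R m setT measurableT (cst 0%E) (fun x => (h x)%:E) hi (measurable_cst _).
have H : forall E : set X, E `<=` setT -> measurable E ->
    (\int[m]_(x in E) (h x)%:E = \int[m]_(x in E) cst 0%E x)%E.
  by move=> E _ mE; rewrite key// integral0.
by move=> /(_ H); apply: filterS => x /(_ I) [].
Qed.

End PiSystem.

Lemma itv_shrink (R : realDomainType) (a b c d e t : R) : a <= c -> d <= b ->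
  c + e <= t <= d - e -> 0 < e -> a < t < b.
Proof. by move=> ac db /andP[h1 h2] e0; apply/andP; split; lra. Qed.

Section Bump.
Context {R : realType}.
Implicit Types (p : {poly R}) (x y c d : R).

(** p(1/x) exp(-1/x) extended by zero to x <= 0. *)
Definition flat p x : R := if 0 < x then p.[x^-1] * expR (- x^-1) else 0.

Let poly_exp_bounded p (a : R) : 0 < a ->
  exists2 C, 0 <= C & forall y, 0 <= y -> `|p.[y]| * expR (- (a * y)) <= C.
Proof.
elim/poly_ind: p a => [|p c IH] a a0.
  by exists 0 => // y _; rewrite horner0 normr0 mul0r.
have a2 : 0 < a / 2 by rewrite divr_gt0.
have [C C0 HC] := IH _ a2.
exists (C * (a / 2)^-1 + `|c|).
  by rewrite addr_ge0// mulr_ge0// invr_ge0 ltW.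
move=> y y0; rewrite hornerMXaddC.
have e0 : 0 < expR (- (a / 2 * y)) by exact: expR_gt0.
have e1 : expR (- (a / 2 * y)) <= 1.
  by rewrite -[leRHS]expR0 ler_expR oppr_le0 mulr_ge0 ?(ltW a2).
have ye : y * expR (- (a / 2 * y)) <= (a / 2)^-1.
  rewrite expRN ler_pdivrMr ?expR_gt0// -ler_pdivrMl ?invr_gt0// invrK.
  by apply: le_trans (expR_ge1Dx _); rewrite lerDr.
have -> : expR (- (a * y)) = expR (- (a / 2 * y)) * expR (- (a / 2 * y)).
  by rewrite -expRD; congr expR; field.
apply: (@le_trans _ _ ((`|p.[y]| * y + `|c|) * (expR (- (a / 2 * y)) * expR (- (a / 2 * y))))).
  rewrite ler_wpM2r ?mulr_ge0 ?(ltW e0)//.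
  by rewrite (le_trans (ler_normD _ _))// normrM (ger0_norm y0).
have h := HC y y0.
have p0 := normr_ge0 p.[y]; have c0 := normr_ge0 c.
rewrite mulrDl; apply: lerD.
  rewrite (_ : _ * (_ * _) = (`|p.[y]| * expR (- (a / 2 * y))) * (y * expR (- (a / 2 * y)))); last by ring.
  by apply: ler_pM => //; rewrite mulr_ge0 ?(ltW e0).
rewrite -[leRHS]mulr1 ler_wpM2l//.
by rewrite -[leRHS]mulr1 ler_pM ?(ltW e0).
Qed.

Let flat_bound p : exists2 C, 0 < C & forall x, `|flat p x| <= C * `|x|.
Proof.
have [C C0 HC] := poly_exp_bounded (p * 'X) ltr01.
exists (C + 1); first by rewrite ltr_wpDl.
move=> x; rewrite /flat; case: ifPn => x0; last first.
  by rewrite normr0 mulr_ge0// addr_ge0.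
have := HC x^-1; rewrite invr_ge0 (ltW x0) => /(_ isT).
rewrite hornerMX mul1r normrM (ger0_norm (x := x^-1)) ?invr_ge0 ?(ltW x0)//.
rewrite mulrAC ler_pdivrMr// normrM (ger0_norm (expR_ge0 _)) => h.
rewrite (le_trans h)// (gtr0_norm x0) ler_wpM2r ?(ltW x0)//.
by rewrite lerDl.
Qed.

Lemma flat_derive p x : is_derive x 1 (flat p) (flat ('X^2 * (p - p^`())) x).
Proof.
have [x0|x0|x0] := ltgtP 0 x.
- rewrite {2}/flat x0.
  have dV : is_derive x 1 (fun y : R => y^-1) (- x ^- 2 *: 1).
    by apply: is_deriveV; rewrite gt_eqF.
  have dp := is_derive1_comp (is_derive_poly p x^-1) dV.
  have de := @is_derive1_comp _ expR (fun y : R => - y^-1) x _ _ (is_derive_expR (- x^-1)) (is_deriveN dV).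
  have := is_deriveM dp de; rewrite /GRing.scale/= => h.
  apply: (@near_eq_is_derive _ _ _ (fun y : R => p.[y^-1] * expR (- y^-1))).
    near=> y; rewrite /flat; have -> // : 0 < y.
    by near: y; exact: lt_nbhsr.
  apply: is_derive_eq h _.
  rewrite hornerM hornerXn hornerD hornerN exprVn.
  by field; rewrite gt_eqF.
- rewrite {2}/flat ltNge (ltW x0)/=.
  apply: (@near_eq_is_derive _ _ _ (cst 0)).
  near=> y; rewrite /flat ltNge; have -> // : y <= 0.
  by apply: ltW; near: y; exact: lt_nbhsl.
- rewrite -x0 {2}/flat ltxx.
  have cv : h^-1 *: ((flat p \o shift 0) (h *: 1) - flat p 0) @[h --> 0^'] --> (0 : R).
    have [C C0 HC] := flat_bound (p * 'X).
    apply/cvgr0Pnorm_lt => eps e0; near=> h.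
    have h0 : h != 0 by near: h; exact: nbhs_dnbhs_neq.
    have hC : `|h| < eps / C by near: h; apply: dnbhs0_lt; rewrite divr_gt0.
    rewrite /= /GRing.scale/= mulr1 addr0 {2}/flat ltxx subr0.
    have -> : h^-1 * flat p h = flat (p * 'X) h.
      by rewrite /flat; case: ifP => _; rewrite ?mulr0// hornerMX; ring.
    by rewrite (le_lt_trans (HC h))// mulrC -ltr_pdivlMr.
  apply: DeriveDef; first by apply/cvg_ex; exists 0.
  exact: cvg_lim cv.
Unshelve. all: by end_near.
Qed.

(** The algebra generated by the functions flat composed with affine maps;
    being closed under differentiation it consists of smooth functions. *)
Inductive flat_alg : (R -> R) -> Prop :=
| FlatAlgGen p (r c : R) : flat_alg (fun x => flat p (r * (x - c)))
| FlatAlgAdd f g : flat_alg f -> flat_alg g -> flat_alg (fun x => f x + g x)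
| FlatAlgMul f g : flat_alg f -> flat_alg g -> flat_alg (fun x => f x * g x).

Lemma flat_alg_derive f : flat_alg f ->
  exists2 g, flat_alg g & forall x : R, is_derive x 1 f (g x).
Proof.
elim=> [p r c|f1 f2 _ [g1 G1 D1] _ [g2 G2 D2]|f1 f2 F1 [g1 G1 D1] F2 [g2 G2 D2]].
- exists (fun x => flat (r *: ('X^2 * (p - p^`()))) (r * (x - c))); first exact: FlatAlgGen.
  move=> x; have da : is_derive x 1 (fun x : R => r * (x - c)) r.
    have := @is_deriveZ R R R (fun x : R => x - c) r x 1 1.
    rewrite /GRing.scale/= mulr1; apply.
    have := is_deriveB (is_derive_id x (1 : R)) (is_derive_cst (c : R) x (1 : R)).
    by rewrite subr0.
  have := @is_derive1_comp _ (flat p) (fun x : R => r * (x - c)) x _ r (flat_derive p (r * (x - c))) da.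
  move=> h; apply: is_derive_eq h _; rewrite /flat; case: ifP => _; last by rewrite mul0r.
  by rewrite hornerZ; ring.
- exists (fun x => g1 x + g2 x); first exact: FlatAlgAdd.
  by move=> x; exact: is_deriveD.
- exists (fun x => f1 x * g2 x + f2 x * g1 x).
    by apply: FlatAlgAdd; exact: FlatAlgMul.
  by move=> x; exact: is_deriveM.
Qed.

Lemma flat_alg_smooth f : flat_alg f -> forall (k : nat) (t : R), derivable (derive1n k f) t 1.
Proof.
move=> Ff k; elim: k f Ff => [|k IH] f Ff t.
  by have [g _ D] := flat_alg_derive Ff; have [] := D t.
rewrite derive1Sn; apply: IH; have [g Gg D] := flat_alg_derive Ff.
rewrite (_ : derive1 f = g)//; apply/funext => x; rewrite derive1E.
by have [_ ->] := D x.
Qed.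

(** Supported in [c + 1/(n+1), d - 1/(n+1)], and converging to the indicator of
    ]c, d[: inside, both exponents go to 0. *)
Definition bump (n : nat) c d x : R :=
  flat 1 (n.+1%:R * (x - (c + n.+1%:R^-1))) * flat 1 (- n.+1%:R * (x - (d - n.+1%:R^-1))).

Lemma flat_alg_bump n c d : flat_alg (bump n c d).
Proof. by apply: FlatAlgMul; exact: FlatAlgGen. Qed.

Let flat1_bounds x : 0 <= flat 1 x <= 1.
Proof.
rewrite /flat; case: ifPn => x0; last by rewrite lexx ler01.
rewrite hornerC mul1r expR_ge0 -[leRHS]expR0 ler_expR oppr_le0 invr_ge0.
exact: ltW.
Qed.

Lemma bump_ge0 n c d x : 0 <= bump n c d x.
Proof. by rewrite mulr_ge0//; [case/andP: (flat1_bounds (n.+1%:R * (x - (c + n.+1%:R^-1))))|case/andP: (flat1_bounds (- n.+1%:R * (x - (d - n.+1%:R^-1))))]. Qed.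

Lemma bump_le1 n c d x : bump n c d x <= 1.
Proof.
rewrite -[leRHS]mulr1 /bump.
have /andP[a0 a1] := flat1_bounds (n.+1%:R * (x - (c + n.+1%:R^-1))).
have /andP[b0 b1] := flat1_bounds (- n.+1%:R * (x - (d - n.+1%:R^-1))).
exact: ler_pM.
Qed.

Lemma bump_support n c d x : bump n c d x != 0 -> c + n.+1%:R^-1 <= x <= d - n.+1%:R^-1.
Proof.
have n0 : 0 < n.+1%:R :> R by rewrite ltr0n.
rewrite mulf_eq0 negb_or /flat => /andP[].
case: ifPn => [h _|]; last by rewrite eqxx.
case: ifPn => [h' _|]; last by rewrite eqxx.
move: h h'; rewrite pmulr_rgt0// subr_gt0 mulNr oppr_gt0 pmulr_rlt0// subr_lt0.
by move=> /ltW -> /ltW ->.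
Qed.

Let flat1_cvg (u : nat -> R) : u @ \oo --> +oo -> flat 1 (u n) @[n --> \oo] --> (1 : R).
Proof.
move=> uoo; have up : \forall n \near \oo, 0 < u n by exact: (cvgryPgt u).1.
have cV : (fun n => (u n)^-1) @ \oo --> (0 : R).
  by apply/(gtr0_cvgV0 up).
have cE : expR (- (u n)^-1) @[n --> \oo] --> expR (- 0).
  by apply: continuous_cvg; [exact: continuous_expR|exact: cvgN].
rewrite oppr0 expR0 in cE; apply: cvg_trans cE; apply: near_eq_cvg.
near=> n; rewrite /flat; have -> : 0 < u n by near: n; exact: up.
by rewrite hornerC mul1r.
Unshelve. all: by end_near.
Qed.

Lemma bump_cvg c d x : c < x < d -> bump n c d x @[n --> \oo] --> (1 : R).
Proof.
move=> /andP[cx xd].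
have lin (a : R) : 0 < a -> (fun n => n.+1%:R * a - 1) @ \oo --> +oo.
  move=> a0; apply/cvgryPge => A; near=> n.
  rewrite lerBrDr -ler_pdivrMr//; apply: (@le_trans _ _ n%:R); last by rewrite ler_nat.
  by near: n; exact: nbhs_infty_ger.
rewrite -[X in _ --> X]mulr1; apply: cvgM; apply: flat1_cvg.
- rewrite (_ : (fun n => _) = (fun n => n.+1%:R * (x - c) - 1)); first by apply: lin; rewrite subr_gt0.
  by apply/funext => n; field.
- rewrite (_ : (fun n => _) = (fun n => n.+1%:R * (d - x) - 1)); first by apply: lin; rewrite subr_gt0.
  by apply/funext => n; field.
Unshelve. all: by end_near.
Qed.

Lemma test_fun1_bump n a b c d : a <= c -> d <= b -> test_fun1 a b (bump n c d).
Proof.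
move=> ac db.
have n0 : 0 < n.+1%:R^-1 :> R by rewrite invr_gt0 ltr0n.
have sub : closure [set t | bump n c d t != 0] `<=` `[c + n.+1%:R^-1, d - n.+1%:R^-1]%classic.
  have clI : closed (`[c + n.+1%:R^-1, d - n.+1%:R^-1]%classic : set R) by exact: itv_closed.
  rewrite [X in _ `<=` X](closure_id _).1//.
  by apply: closure_subset => t /= /bump_support; rewrite in_itv.
split.
- exact/flat_alg_smooth/flat_alg_bump.
- exact: (subclosed_compact (@closed_closure _ _) (@segment_compact _ _ _) sub).
- apply: (subset_trans sub) => t; rewrite /= !in_itv/= => h.
  exact: itv_shrink ac db h n0.
Qed.

End Bump.

Section DuBoisReymond.
Context {R : realType}.
Local Notation mu := (@lebesgue_measure R).
Local Notation MR := (measurableTypeR R).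

(** The bumps converge to the indicators of the open intervals, a pi-system that
    generates the Borel sets. *)
Lemma du_bois_reymond (T : R) (h : R -> R) :
  mu.-integrable `]0, T[%classic (fun t => (h t)%:E) ->
  (forall phi, test_fun1 0 T phi -> \int[mu]_(t in `]0, T[) (h t * phi t) = 0) ->
  {ae mu, forall t, `]0, T[%classic t -> h t = 0}.
Proof.
move=> hi h0; pose D : set R := `]0, T[%classic.
have mD : measurable (D : set MR) by exact: measurable_itv.
have mh : measurable_fun (D : set MR) h.
  by apply/measurable_EFinP; exact: measurable_int hi.
have mb n c d : measurable_fun (D : set MR) (bump n c d).
  apply: measurable_funTS; apply: continuous_measurable_fun => x.
  have [g _ dg] := flat_alg_derive (flat_alg_bump n c d).
  by apply: derivable_continuous; have [] := dg x.
have key c d : 0 <= c -> d <= T -> (\int[mu]_(t in D) (h t * \1_(`]c, d[%classic) t)%:E = 0)%E.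
  move=> c0 dT.
  pose f_ n (t : R) := (h t * bump n c d t)%:E.
  have [] := @dominated_convergence _ _ R mu D mD f_
     (fun t => (h t * \1_(`]c, d[%classic) t)%:E) (fun t => `|h t|%:E).
  - by move=> n; apply/measurable_EFinP; exact: measurable_funM.
  - by apply/measurable_EFinP; apply: measurable_funM => //; exact: measurable_indic.
  - apply: aeW => t _; apply: cvg_EFin; first exact: nearW.
    apply: cvgMl_tmp; rewrite indicE mem_setE in_itv/=.
    have [cd|cd] := boolP (c < t < d); first exact: bump_cvg.
    apply: cvg_near_cst; apply: nearW => n; apply/eqP; apply: contraNT cd => /bump_support.
    have n0 : 0 < n.+1%:R^-1 :> R by rewrite invr_gt0 ltr0n.
    by move=> tn; exact: (itv_shrink (lexx _) (lexx _) tn n0).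
  - exact: integrable_norm hi.
  - apply: aeW => t n _; rewrite lee_fin normrM -[leRHS]mulr1 ler_wpM2l//.
    by rewrite ger0_norm ?bump_ge0 ?bump_le1.
  move=> _ _; rewrite (_ : [sequence (\int[mu]_(x in D) f_ n x)%E]_n = cst 0%E).
    by move/cvg_lim => <- //; rewrite lim_cst.
  apply/funext => n /=; have := h0 _ (test_fun1_bump n c0 dT).
  rewrite /Rintegral => /eqP; rewrite -eqe fineK; first by move/eqP.
  apply: (@integrable_fin_num _ _ _ mu D); first exact: mD.
  apply: (le_integrable mD _ _ hi).
    by apply/measurable_EFinP; exact: measurable_funM.
  move=> t _; rewrite lee_fin normrM -[leRHS]mulr1 ler_wpM2l//.
  by rewrite ger0_norm ?bump_ge0 ?bump_le1.
have h'i : mu.-integrable setT (fun t => ((h \_ D) t)%:E).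
  by have /(integrable_mkcond _ mD) := hi; apply: eq_integrable => // s _; rewrite /= !patchE; case: ifP.
have := @pi_system_eq0 R _ MR mu (@RGenOpens.G R) (h \_ D) (RGenOpens.measurableE R) _ h'i.
have GI : setI_closed (@RGenOpens.G R).
  move=> A B [a [b ->]] [c [d ->]]; exists (Num.max a c), (Num.min b d).
  apply/seteqP; split => t; rewrite /= !in_itv/= gt_max lt_min.
    by move=> [/andP[-> ->] /andP[-> ->]].
  by move=> /andP[/andP[-> ->] /andP[-> ->]].
have cut c d : (\int[mu]_(t in `]c, d[) ((h \_ D) t)%:E = 0)%E.
  have := key (Num.max 0 c) (Num.min T d).
  rewrite le_max lexx ge_min lexx => /(_ isT isT) <-.
  rewrite integral_mkcond [RHS]integral_mkcond; apply: eq_integral => t _.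
  rewrite !patchE !indicE /D !mem_setE !in_itv/= gt_max lt_min.
  by case: (0 < t); case: (c < t); case: (t < d); case: (t < T); rewrite /= ?mulr1 ?mulr0.
move=> /(_ GI) H; have {H} : {ae mu, forall x, (h \_ D) x = 0}.
  apply: H; last by move=> A [x [y ->]]; exact: cut.
  rewrite -(cut 0 T) [RHS]integral_mkcond; apply: eq_integral => t _.
  by rewrite !patchE -/D; case: ifP.
by apply: filterS => t; rewrite patchE => + tD; rewrite mem_set.
Qed.

End DuBoisReymond.

(** * Test functions of several variables *)

Section Boxes.
Context {R : realType} {d : nat}.
Local Notation E := 'rV[R]_d.
Local Notation leb := (@lebesgue_row R d).

Definition box (a b : 'I_d -> R) : set E := [set x | forall i, a i < x 0 i < b i].

Lemma measurable_box a b : measurable (box a b).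
Proof.
have -> : box a b = \bigcap_(i in [set: 'I_d]) (row_coord i @^-1` `]a i, b i[%classic).
  apply/seteqP; split => x /= h.
    by move=> i _; rewrite /= in_itv/=; exact: h.
  by move=> i; have := h i Logic.I; rewrite /= in_itv.
apply: fin_bigcap_measurable => // i _.
by rewrite -[X in measurable X]setTI; apply: measurable_row_coord.
Qed.

Lemma box_setI a b a' b' : box a b `&` box a' b' =
  box (fun i => Num.max (a i) (a' i)) (fun i => Num.min (b i) (b' i)).
Proof.
apply/seteqP; split => x /=.
  move=> [h h'] i; have /andP[h1 h2] := h i; have /andP[h3 h4] := h' i.
  by rewrite gt_max lt_min h1 h2 h3 h4.
by move=> h; split => i; have := h i; rewrite gt_max lt_min => /andP[/andP[h1 h2] /andP[h3 h4]]; apply/andP.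
Qed.

(** Rational corners, so that countably many boxes cover an open set. *)
Lemma open_coord (Om : set E) x : open Om -> Om x ->
  exists a b : 'rV[rat]_d, box (fun i => ratr (a 0 i)) (fun i => ratr (b 0 i)) x /\
    box (fun i => ratr (a 0 i)) (fun i => ratr (b 0 i)) `<=` Om.
Proof.
move=> oOm xOm; have : nbhs x Om by exact: open_nbhs_nbhs.
move=> [P HP HPOm].
have /choice[c hc] : forall i : 'I_d, exists c : rat * rat,
    (ratr c.1 < x 0 i < (ratr c.2 : R)) /\ forall y : R, ratr c.1 < y < ratr c.2 -> P 0 i y.
  move=> i; have /nbhs_ballP[e e0 he] := HP 0 i.
  have [p hp] : exists p : rat, (ratr p : R) \in `](x 0 i - e), (x 0 i)[ by apply: rat_in_itvoo; rewrite ltrBlDr ltrDl.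
  have [q hq] : exists q : rat, (ratr q : R) \in `](x 0 i), (x 0 i + e)[ by apply: rat_in_itvoo; rewrite ltrDl.
  move: hp hq; rewrite !in_itv/= => /andP[p1 p2] /andP[q1 q2].
  exists (p, q) => /=; split; first by rewrite p2 q1.
  move=> y /andP[py yq]; apply: he; rewrite -ball_normE /ball_ /= ltr_distl.
  by apply/andP; split; move: p1 p2 q1 q2 py yq; lra.
exists (\row_i (c i).1), (\row_i (c i).2); split.
  by move=> i; rewrite !mxE; have [] := hc i.
move=> y hy; apply: HPOm => /= i j; rewrite ord1.
by have [_ h] := hc j; apply: h; have := hy j; rewrite !mxE.
Qed.

Lemma open_bigcup_box (Om : set E) : open Om ->
  exists2 F : ('rV[rat]_d * 'rV[rat]_d) -> set E, Om = \bigcup_p F p &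
    forall p, F p = set0 \/ exists2 ab, F p = box ab.1 ab.2 & box ab.1 ab.2 `<=` Om.
Proof.
move=> oOm; pose B (p : 'rV[rat]_d * 'rV[rat]_d) : set E :=
  box (fun i => ratr (p.1 0 i)) (fun i => ratr (p.2 0 i)).
exists (fun p => [set x | B p `<=` Om /\ B p x]).
  apply/seteqP; split => x.
    move=> Ox; have [a [b [h1 h2]]] := open_coord oOm Ox.
    by exists (a, b).
  by move=> [p _ [h1 h2]]; exact: h1.
move=> p; have [h|h] := pselect (B p `<=` Om); [right|left].
  exists (fun i => ratr (p.1 0 i), fun i => ratr (p.2 0 i)) => //=.
  by apply/seteqP; split => x //= [].
by apply/seteqP; split => x //= [].
Qed.

Lemma measurable_open (Om : set E) : open Om -> measurable Om.
Proof.
move=> oOm; have [F -> hF] := open_bigcup_box oOm.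
apply: countable_bigcupT_measurable; first exact: countableP.
by move=> p; have [->|[ab -> _]] := hF p; [exact: measurable0|exact: measurable_box].
Qed.

Lemma measurable_continuous (f : E -> R) : continuous f -> measurable_fun [set: E] f.
Proof.
move=> cf; apply: (measurability _ (RGenOpens.measurableE R)) => _ [_ [x [y ->]] <-].
rewrite setTI; apply: measurable_open.
by move/continuousP: cf; apply; exact: interval_open.
Qed.

End Boxes.

Lemma lebesgue_box_lty {R : realType} d (a b : 'I_d -> R) : (lebesgue_row d (box a b) < +oo)%E.
Proof.
elim: d a b => [|d IH] a b.
  rewrite /= /dirac /= indicE; case: (_ \in _); exact: ltry.
have -> : lebesgue_row d.+1 (box a b) = (@lebesgue_measure R \x lebesgue_row d)%E
    (`]a ord0, b ord0[%classic `*` box (fun i => a (lift ord0 i)) (fun i => b (lift ord0 i))).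
  rewrite /= /lebesgue_row_step /pushforward; congr (_ _).
  apply/seteqP; split => -[t x] /=; rewrite in_itv/=.
    move=> h; split; first by have := h ord0; rewrite mxE unlift_none.
    by move=> i; have := h (lift ord0 i); rewrite mxE liftK.
  by move=> [h h'] i; rewrite mxE; case: (unliftP ord0 i) => [j ->|->]//=.
rewrite product_measure1E//; last exact: measurable_box.
apply: lte_mul_pinfty => //.
have mE := @lebesgue_measure_itv R `]a ord0, b ord0[.
by rewrite ge0_fin_numE// [X in (X < _)%E]mE /=; case: ifP => _; exact: ltry.
Qed.

Section SmoothRow.
Context {R : realType} {d : nat}.
Local Notation E := 'rV[R]_d.
Local Notation leb := (@lebesgue_row R d).

Let derive_coord (f : R -> R) (i j : 'I_d) (x : E) :
  (forall t, derivable f t 1) ->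
  'D_(delta_mx 0 j) (fun y : E => f (y 0 i)) x = (i == j)%:R * derive1 f (x 0 i).
Proof.
move=> df; rewrite derive1E /derive.
have [->|ij] := eqVneq i j.
  rewrite /= mulr1n mul1r.
  rewrite (_ : (fun h : R => h^-1 *: (((fun y : E => f (y 0 j)) \o shift x) (h *: delta_mx 0 j) - f (x 0 j))) =
    (fun h : R => h^-1 *: ((f \o shift (x 0 j)) (h *: 1) - f (x 0 j))))//.
  apply/funext => h /=.
  by rewrite !mxE !eqxx/= mulr1 /GRing.scale/= mulr1.
rewrite /= mulr0n mul0r (_ : (fun h : R => _) = cst 0) ?lim_cst//.
apply/funext => h /=; rewrite !mxE (negbTE ij) andbF mulr0 add0r subrr.
by rewrite /GRing.scale/= mulr0.
Qed.

Let differentiable_coord_comp (f : R -> R) (i : 'I_d) (x : E) :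
  (forall t, derivable f t 1) -> differentiable (fun y : E => f (y 0 i)) x.
Proof.
move=> df; apply: (@differentiable_comp _ _ _ _ (fun y : E => y 0 i) f).
  exact: differentiable_coord.
exact/derivable1_diffP.
Qed.

(** Closed under partial differentiation, like the one-variable algebra, and
    hence made of smooth functions. *)
Inductive row_alg : (E -> R) -> Prop :=
| RowAlgCst (c : R) : row_alg (cst c)
| RowAlgCoord f i : flat_alg f -> row_alg (fun x => f (x 0 i))
| RowAlgAdd f g : row_alg f -> row_alg g -> row_alg (f + g)
| RowAlgMul f g : row_alg f -> row_alg g -> row_alg (f * g).

Let row_alg_differentiable f x : row_alg f -> differentiable f x.
Proof.
elim=> [c|f1 i F1|f1 f2 _ D1 _ D2|f1 f2 _ D1 _ D2].
- exact: differentiable_cst.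
- apply: differentiable_coord_comp => t; have [g _ D] := flat_alg_derive F1.
  by have [] := D t.
- exact: differentiableD.
- exact: differentiableM.
Qed.

Let row_alg_pderiv f j : row_alg f -> row_alg (pderiv j f).
Proof.
elim=> [c|f1 i F1|f1 f2 F1 D1 F2 D2|f1 f2 F1 D1 F2 D2].
- rewrite (_ : pderiv j _ = cst 0); first exact: RowAlgCst.
  by apply/funext => x; rewrite /pderiv derive_cst.
- have [g Gg D] := flat_alg_derive F1.
  rewrite (_ : pderiv j _ = cst (i == j)%:R * (fun x : E => g (x 0 i))).
    by apply: RowAlgMul; [exact: RowAlgCst|exact: RowAlgCoord].
  apply/funext => x; rewrite /pderiv derive_coord; last by move=> t; have [] := D t.
  by congr (_ * _); rewrite derive1E; have [_ ->] := D (x 0 i).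
- rewrite (_ : pderiv j _ = pderiv j f1 + pderiv j f2); first exact: RowAlgAdd.
  apply/funext => x; rewrite /pderiv deriveD//; apply: diff_derivable;
  exact: row_alg_differentiable.
- rewrite (_ : pderiv j _ = f1 * pderiv j f2 + f2 * pderiv j f1).
    by apply: RowAlgAdd; exact: RowAlgMul.
  apply/funext => x; rewrite /pderiv deriveM//; apply: diff_derivable;
  exact: row_alg_differentiable.
Qed.

Lemma row_alg_smooth f : row_alg f -> smooth f.
Proof.
move=> Ff s x; apply: row_alg_differentiable.
by elim: s => //= i s IH; exact: row_alg_pderiv.
Qed.

Definition box_bump (n : nat) (a b : 'I_d -> R) (x : E) : R :=
  \prod_i bump n (a i) (b i) (x 0 i).

Lemma row_alg_box_bump n a b : row_alg (box_bump n a b).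
Proof.
rewrite /box_bump; elim: (index_enum _) => [|i s IH].
  rewrite (_ : (fun x => _) = cst 1); first exact: RowAlgCst.
  by apply/funext => x; rewrite big_nil.
rewrite (_ : (fun x => _) = (fun x : E => bump n (a i) (b i) (x 0 i)) *
   (fun x : E => \prod_(j <- s) bump n (a j) (b j) (x 0 j))).
  apply: RowAlgMul => //; apply: RowAlgCoord; exact: flat_alg_bump.
by apply/funext => x; rewrite big_cons.
Qed.

Lemma box_bump_ge0 n a b x : 0 <= box_bump n a b x.
Proof. by apply: prodr_ge0 => i _; exact: bump_ge0. Qed.

Lemma box_bump_le1 n a b x : box_bump n a b x <= 1.
Proof.
apply: (@le_trans _ _ (\prod_(i < d) 1)); last by rewrite big1.
by apply: ler_prod => i _; rewrite bump_ge0 bump_le1.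
Qed.

Lemma box_bump_support n a b x : box_bump n a b x != 0 ->
  forall i, a i + n.+1%:R^-1 <= x 0 i <= b i - n.+1%:R^-1.
Proof. by move=> /prodf_neq0 h i; apply: bump_support; exact: h. Qed.

Lemma box_bump_cvg a b x : box_bump n a b x @[n --> \oo] --> (\1_(box a b) x : R).
Proof.
rewrite indicE; case: (boolP (x \in box a b)) => [/set_mem xab|xab].
  have -> : true%:R = \prod_(i < d) (1 : R) by rewrite big1.
  apply: cvg_big => [|i _]; first exact: mul_continuous.
  by apply: bump_cvg; exact: xab.
apply: cvg_near_cst; apply: nearW => n; apply/eqP; apply: contraNT xab => /box_bump_support h.
apply/mem_set => i; apply: itv_shrink (lexx _) (lexx _) (h i) _.
by rewrite invr_gt0 ltr0n.
Qed.

Lemma test_fun_box_bump (Om : set E) n a b : box a b `<=` Om -> test_fun Om (box_bump n a b).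
Proof.
move=> abOm.
pose K : set E := [set x | forall i, `[a i + n.+1%:R^-1, b i - n.+1%:R^-1]%classic (x ord0 i)].
have cK : compact K.
  by apply: (@rV_compact _ _ (fun i => `[a i + n.+1%:R^-1, b i - n.+1%:R^-1]%classic)) => i; exact: segment_compact.
have sub : closure [set x | box_bump n a b x != 0] `<=` K.
  rewrite [X in _ `<=` X](closure_id _).1; last exact: (compact_closed (@norm_hausdorff _ _) cK).
  apply: closure_subset => x /= /box_bump_support h i.
  by rewrite /= in_itv/=; exact: h.
split.
- exact/row_alg_smooth/row_alg_box_bump.
- exact: (subclosed_compact (@closed_closure _ _) cK sub).
- move=> x /sub Kx; apply: abOm => i; have := Kx i; rewrite /= in_itv/= => h.
  by apply: itv_shrink (lexx _) (lexx _) h _; rewrite invr_gt0 ltr0n.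
Qed.

Lemma compact_sub_box (K : set E) : compact K -> exists c : R, K `<=` box (fun=> - c) (fun=> c).
Proof.
move=> cK.
have /choice[M hM] : forall i : 'I_d, exists M : R, 0 <= M /\ forall x, K x -> `|x 0 i| <= M.
  move=> i; have : compact [set x 0 i | x in K].
    apply: continuous_compact => //; apply: continuous_subspaceT; exact: coord_continuous.
  move=> /compact_bounded[M [_ HM]]; exists (`|M| + 1); split; first by rewrite addr_ge0.
  move=> x Kx; apply: (HM (`|M| + 1)); last by exists x.
  by rewrite (le_lt_trans (ler_norm M))// ltrDl.
exists (\sum_i M i + 1) => x Kx i.
rewrite -ltr_norml (le_lt_trans ((hM i).2 x Kx))//.
rewrite (bigD1 i)//= -addrA ltrDl ltr_wpDl// sumr_ge0// => j _.
exact: (hM j).1.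
Qed.

Lemma test_fun_continuous (Om : set E) phi : test_fun Om phi -> continuous phi.
Proof. by move=> [sphi _ _] x; apply: differentiable_continuous; exact: (sphi [::]). Qed.

Lemma test_fun_pderiv_continuous (Om : set E) phi i : test_fun Om phi -> continuous (pderiv i phi).
Proof. by move=> [sphi _ _] x; apply: differentiable_continuous; exact: (sphi [:: i]). Qed.

Lemma pderiv_support (phi : E -> R) i x : ~ closure [set x | phi x != 0] x -> pderiv i phi x = 0.
Proof.
move=> nx; rewrite /pderiv (@near_eq_derive _ _ _ _ (cst 0)) ?derive_cst//.
have : nbhs x (~` closure [set x | phi x != 0]).
  apply: open_nbhs_nbhs; split => //; apply: closed_openC; exact: closed_closure.
apply: filterS => y /= ny; apply/eqP; apply: contra_notT ny => py.
exact: subset_closure.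
Qed.

Let L2_compact_support (Om : set E) K g : measurable Om -> compact K -> continuous g ->
  (forall x, ~ K x -> g x = 0) -> L2 Om g.
Proof.
move=> mOm cK cg gK; have mg := measurable_continuous cg.
split; first exact: measurable_funTS.
have : compact [set g x | x in K].
  by apply: continuous_compact => //; exact: continuous_subspaceT.
move=> /compact_bounded[M [_ HM]]; have {HM} HM x : K x -> `|g x| <= `|M| + 1.
  move=> Kx; apply: (HM (`|M| + 1)); last by exists x.
  by rewrite (le_lt_trans (ler_norm M))// ltrDl.
have [c Kc] := compact_sub_box cK.
have mB : measurable (box (fun=> - c) (fun=> c) : set E) by exact: measurable_box.
apply: (@le_lt_trans _ _ (\int[leb]_x ((`|M| + 1) ^+ 2 * \1_(box (fun=> - c) (fun=> c)) x)%:E)%E).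
  apply: (@le_trans _ _ (\int[leb]_x (g x ^+ 2)%:E)%E).
    apply: ge0_subset_integral => //.
    - by apply/measurable_EFinP; exact: measurable_funX.
    - by move=> x _; rewrite lee_fin sqr_ge0.
  apply: ge0_le_integral => //.
  - by move=> x _; rewrite lee_fin sqr_ge0.
  - by apply/measurable_EFinP; exact: measurable_funX.
  - by apply/measurable_EFinP; apply: measurable_funM => //; exact: measurable_indic.
  - move=> x _; rewrite lee_fin indicE; have [Kx|Kx] := pselect (K x).
      rewrite mem_set ?mulr1; last exact: Kc.
      by rewrite -(real_normK (num_real (g x))) lerXn2r ?nnegrE ?addr_ge0//; exact: HM.
    by rewrite gK// expr0n/= mulr_ge0// sqr_ge0.
under eq_integral do rewrite EFinM.
rewrite ge0_integralZl//; last by apply/measurable_EFinP; exact: measurable_indic.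
rewrite integral_indic// setIT; apply: lte_mul_pinfty; rewrite ?lee_fin ?sqr_ge0//.
exact: lebesgue_box_lty.
Qed.

Lemma L2_test_fun (Om : set E) phi : measurable Om -> test_fun Om phi -> L2 Om phi.
Proof.
move=> mOm tphi; have [_ cK _] := tphi.
apply: (L2_compact_support mOm cK (test_fun_continuous tphi)) => x nx.
by apply/eqP; apply: contra_notT nx => px; exact: subset_closure.
Qed.

Lemma L2_test_fun_pderiv (Om : set E) phi i : measurable Om -> test_fun Om phi -> L2 Om (pderiv i phi).
Proof.
move=> mOm tphi; have [_ cK _] := tphi.
apply: (L2_compact_support mOm cK (test_fun_pderiv_continuous (i := i) tphi)) => x nx.
exact: pderiv_support.
Qed.

Let box_generates : @measurable _ E = <<s [set A | exists a b, A = box a b] >>.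
Proof.
apply/seteqP; split => [A mA|]; last first.
  apply: smallest_sub; first exact: sigma_algebra_measurable.
  by move=> A [a [b ->]]; exact: measurable_box.
pose G : set (set E) := [set A | exists a b, A = box a b].
have : measurable_fun [set: g_sigma_algebraType G] (idfun : g_sigma_algebraType G -> E).
  apply: measurable_fun_rowP => i.
  apply: (measurability _ (RGenOpens.measurableE R)) => _ [_ [x [y ->]] <-].
  rewrite setTI.
  have -> : (row_coord i \o idfun) @^-1` `]x, y[%classic = \bigcup_k
     box (fun j => if j == i then x else - k%:R) (fun j => if j == i then y else k%:R).
    apply/seteqP; split => z /=; rewrite in_itv/=.
      move=> xzy.
      have [k hk] : exists k : nat, \sum_j `|z 0 j| < k%:R.
        by exists (Num.bound (\sum_j `|z 0 j|)); apply: archi_boundP; exact: sumr_ge0.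
      exists k => // j; case: eqP => [->//|_].
      rewrite -ltr_norml (le_lt_trans _ hk)// (bigD1 j)//= lerDl; exact: sumr_ge0.
    by move=> [k _ /(_ i)]; rewrite eqxx.
  apply: bigcupT_measurable => k; apply: sub_sigma_algebra.
  by eexists; eexists; reflexivity.
by move=> /(_ measurableT A mA); rewrite setTI.
Qed.

(** Bumps exhaust the boxes inside Om, and boxes generate the Borel sets. *)
Lemma du_bois_reymond_row (Om : set E) (h : E -> R) : open Om -> L2 Om h ->
  (forall phi, test_fun Om phi -> ipL2 Om h phi = 0) -> eqL2 Om h (fun=> 0).
Proof.
move=> oOm Lh h0; have mOm := measurable_open oOm.
have [F OmE hF] := open_bigcup_box oOm.
suff H p : {ae leb, forall x, F p x -> h x = 0}.
  have : {ae leb, forall x n, (if unpickle n is Some p then F p x else False) -> h x = 0}.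
    apply: ae_foralln => n; case: (unpickle n) => [p|]; last exact: aeW.
    exact: H.
  apply: filterS => x hx; rewrite [X in X x -> _]OmE => -[p _ Fx].
  by apply: (hx (pickle p)); rewrite pickleK.
have [->|[[a b] /= -> abOm]] := hF p; first exact: aeW.
have [mh _] := Lh.
have mab : measurable (box a b : set E) by exact: measurable_box.
have L1 : L2 Om (\1_(box a b)).
  split; first by apply: measurable_funTS; exact: measurable_indic.
  apply: (@le_lt_trans _ _ (\int[leb]_x (\1_(box a b) x)%:E)%E).
    have E (x : E) : ((\1_(box a b) x ^+ 2)%:E = (\1_(box a b) x : R)%:E)%E.
      by rewrite indicE; case: (_ \in _); rewrite ?expr1n ?expr0n.
    under eq_integral do rewrite E.
    by apply: ge0_subset_integral => //; apply/measurable_EFinP; exact: measurable_indic.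
  by rewrite integral_indic// setIT; exact: lebesgue_box_lty.
have hi := integrable_mulL2 mOm Lh L1.
have key c e : box c e `<=` box a b -> (\int[leb]_(x in Om) (h x * \1_(box c e) x)%:E = 0)%E.
  move=> ceab.
  pose f_ n (x : E) := (h x * box_bump n c e x)%:E.
  have mb n : measurable_fun Om (box_bump n c e).
    apply: measurable_funTS; apply: measurable_continuous.
    exact: (test_fun_continuous (test_fun_box_bump n (@subset_refl _ (box c e)))).
  have bnd n x : (`|f_ n x| <= `|h x * \1_(box a b) x|%:E)%E.
    rewrite lee_fin !normrM ler_wpM2l// indicE.
    case: (boolP (x \in box a b)) => xab.
      by rewrite normr1 ger0_norm ?box_bump_ge0 ?box_bump_le1.
    rewrite (_ : box_bump n c e x = 0)// ?normr0//.
    apply/eqP; apply: contraNT xab => /box_bump_support hx; apply/mem_set; apply: ceab => i.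
    apply: itv_shrink (lexx _) (lexx _) (hx i) _; by rewrite invr_gt0 ltr0n.
  have [] := @dominated_convergence _ _ R leb Om mOm f_
     (fun x => (h x * \1_(box c e) x)%:E) (fun x => `|h x * \1_(box a b) x|%:E).
  - by move=> n; apply/measurable_EFinP; exact: measurable_funM.
  - apply/measurable_EFinP; apply: measurable_funM => //; apply: measurable_funTS.
    by apply: measurable_indic; exact: measurable_box.
  - apply: aeW => x _; apply: cvg_EFin; first exact: nearW.
    by apply: cvgMl_tmp; exact: box_bump_cvg.
  - exact: integrable_norm hi.
  - by apply: aeW => x n _; exact: bnd.
  move=> _ _; rewrite (_ : [sequence (\int[leb]_(x in Om) f_ n x)%E]_n = cst 0%E).
    by move/cvg_lim => <- //; rewrite lim_cst.
  apply/funext => n /=.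
  have tb : test_fun Om (box_bump n c e).
    by apply: test_fun_box_bump; exact: subset_trans abOm.
  have := h0 _ tb; rewrite /ipL2 /Rintegral => /eqP; rewrite -eqe fineK; first by move/eqP.
  apply: (@integrable_fin_num _ _ _ leb Om) => //.
  apply: (le_integrable mOm _ _ hi).
    by apply/measurable_EFinP; exact: measurable_funM.
  by move=> x _; exact: bnd.
pose g x := (h x * \1_(box a b) x) * \1_Om x.
have gi : leb.-integrable setT (fun x => (g x)%:E).
  have /(integrable_mkcond _ mOm) := hi; apply: eq_integrable => // x _.
  by rewrite /g patchE [\1_Om x]indicE; case: ifP => _; rewrite ?mulr1 ?mulr0.
have gE A : measurable A -> (\int[leb]_(x in A) (g x)%:E =
    \int[leb]_(x in Om) (h x * \1_(box a b `&` A) x)%:E)%E.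
  move=> mA; rewrite integral_mkcond [RHS]integral_mkcond; apply: eq_integral => x _.
  rewrite !patchE /g !indicE in_setI.
  by case: (x \in A); case: (x \in Om); case: (x \in box a b); rewrite /= ?mulr1 ?mulr0.
have := @pi_system_eq0 R _ E leb [set A | exists a b, A = box a b] g box_generates.
have GI : setI_closed [set A : set E | exists a b, A = box a b].
  by move=> A B [a1 [b1 ->]] [a2 [b2 ->]]; rewrite box_setI; eexists; eexists; reflexivity.
move=> /(_ GI gi) G0; have {G0} : {ae leb, forall x, g x = 0}.
  apply: G0.
    by rewrite gE// setIT; exact: key.
  move=> A [c [e ->]]; rewrite gE; last exact: measurable_box.
  by rewrite box_setI; apply: key; rewrite -box_setI; exact: subIsetl.
apply: filterS => x gx xab; move: gx; rewrite /g !indicE (mem_set xab) (mem_set (abOm _ xab)).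
by rewrite !mulr1.
Qed.

End SmoothRow.

(** * Weak derivatives, the finite element space and its projections *)

Section WeakDerivatives.
Context {R : realType} {d : nat}.
Local Notation E := 'rV[R]_d.
Local Notation leb := (@lebesgue_row R d).
Variable Om : set E.
Hypothesis oOm : open Om.
Implicit Types (v w g phi psi : E -> R) (a b : R).

Let mOm : measurable Om. Proof. exact: measurable_open. Qed.

Let pderiv_lin i a b phi psi x : differentiable phi x -> differentiable psi x ->
  pderiv i (fun y => a * phi y + b * psi y) x = a * pderiv i phi x + b * pderiv i psi x.
Proof.
move=> dphi dpsi; rewrite /pderiv.
have d1 : derivable phi x (delta_mx 0 i : E) by exact: diff_derivable.
have d2 : derivable psi x (delta_mx 0 i : E) by exact: diff_derivable.
have d1a : derivable (a *: phi) x (delta_mx 0 i : E) by exact: derivableZ.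
have d2b : derivable (b *: psi) x (delta_mx 0 i : E) by exact: derivableZ.
have e1 : 'D_(delta_mx 0 i : E) (a *: phi) x = a *: 'D_(delta_mx 0 i) phi x by exact: deriveZ.
have e2 : 'D_(delta_mx 0 i : E) (b *: psi) x = b *: 'D_(delta_mx 0 i) psi x by exact: deriveZ.
by have := deriveD d1a d2b; rewrite e1 e2.
Qed.

Let foldr_pderiv_lin a b phi psi s : smooth phi -> smooth psi ->
  foldr pderiv (fun y => a * phi y + b * psi y) s =
  (fun y => a * foldr pderiv phi s y + b * foldr pderiv psi s y).
Proof.
move=> sphi spsi; elim: s => //= i s ->; apply/funext => x.
by rewrite pderiv_lin.
Qed.

Lemma test_fun_lin a b phi psi : test_fun Om phi -> test_fun Om psi ->
  test_fun Om (fun x => a * phi x + b * psi x).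
Proof.
move=> [sphi cphi phiOm] [spsi cpsi psiOm].
have sub : closure [set x | a * phi x + b * psi x != 0] `<=`
    closure [set x | phi x != 0] `|` closure [set x | psi x != 0].
  rewrite -closureU; apply: closure_subset => x /=.
  have [->|p0] := eqVneq (phi x) 0; last by left.
  have [->|q0] := eqVneq (psi x) 0; last by right.
  by rewrite !mulr0 addr0 eqxx.
split.
- move=> s x; rewrite foldr_pderiv_lin//.
  have d1 := sphi s x; have d2 := spsi s x.
  exact: (differentiableD (differentiableZ a d1) (differentiableZ b d2)).
- apply: subclosed_compact sub; first exact: closed_closure.
  exact: compactU.
- by apply: (subset_trans sub); rewrite subUset.
Qed.

Lemma weak_pderiv_unique i v g g' :
  weak_pderiv Om i v g -> weak_pderiv Om i v g' -> eqL2 Om g g'.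
Proof.
move=> [Lg gv] [Lg' g'v].
have : eqL2 Om (fun x => g x - g' x) (fun=> 0).
  apply: (du_bois_reymond_row oOm); first exact: L2B.
  move=> phi tphi; rewrite ipL2Bl//; last exact: L2_test_fun.
  by apply/eqP; rewrite subr_eq0 -eqr_opp -gv// -g'v.
by apply: filterS => x h Ox; apply/eqP; rewrite -subr_eq0; apply/eqP; exact: h.
Qed.

Lemma wpderivP i v : (exists g, weak_pderiv Om i v g) -> weak_pderiv Om i v (wpderiv Om i v).
Proof. by move=> [g hg]; exact: (xgetPex _ (ex_intro _ g hg)). Qed.

Lemma wpderiv_eq i v g : weak_pderiv Om i v g -> eqL2 Om (wpderiv Om i v) g.
Proof. by move=> vg; exact: (weak_pderiv_unique (wpderivP (ex_intro _ g vg)) vg). Qed.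

Lemma weak_pderiv_lin i a b v w g g' : L2 Om v -> L2 Om w ->
  weak_pderiv Om i v g -> weak_pderiv Om i w g' ->
  weak_pderiv Om i (fun x => a * v x + b * w x) (fun x => a * g x + b * g' x).
Proof.
move=> Lv Lw [Lg gv] [Lg' g'w]; split; first exact: L2_lin.
move=> phi tphi; rewrite !ipL2_linl//; [|exact: L2_test_fun|exact: L2_test_fun_pderiv].
by rewrite gv// g'w//; ring.
Qed.

Lemma wpderiv_ae i v v' : eqL2 Om v v' -> wpderiv Om i v = wpderiv Om i v'.
Proof.
move=> vv'; rewrite /wpderiv; congr xget; apply/seteqP; split => g [Lg h]; split => // phi tphi.
  by rewrite -h//; apply: ipL2_ae (eqL2_sym vv') (eqL2_refl _ _).
by rewrite -h//; apply: ipL2_ae vv' (eqL2_refl _ _).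
Qed.

Lemma L2_wpderiv i v : H1 Om v -> L2 Om (wpderiv Om i v).
Proof. by move=> [_ /(_ i) /wpderivP []]. Qed.

Lemma H1_lin a b v w : H1 Om v -> H1 Om w -> H1 Om (fun x => a * v x + b * w x).
Proof.
move=> [Lv dv] [Lw dw]; split; first exact: L2_lin.
move=> i; have [g gv] := dv i; have [g' g'w] := dw i.
by exists (fun x => a * g x + b * g' x); exact: weak_pderiv_lin.
Qed.

Lemma wpderiv_lin i a b v w : H1 Om v -> H1 Om w ->
  eqL2 Om (wpderiv Om i (fun x => a * v x + b * w x))
          (fun x => a * wpderiv Om i v x + b * wpderiv Om i w x).
Proof.
move=> [Lv dv] [Lw dw]; apply: wpderiv_eq; apply: weak_pderiv_lin => //.
  exact: wpderivP.
exact: wpderivP.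
Qed.

Lemma H10_lin a b v w : H10 Om v -> H10 Om w -> H10 Om (fun x => a * v x + b * w x).
Proof.
move=> [Hv av] [Hw aw]; split; first exact: H1_lin.
move=> eps e0; pose c := `|a| + `|b| + 1.
have c0 : 0 < c by rewrite ltr_wpDl// addr_ge0.
have [phi [tphi vphi dphi]] := av (eps / c) (divr_gt0 e0 c0).
have [psi [tpsi wpsi dpsi]] := aw (eps / c) (divr_gt0 e0 c0).
have [Lv _] := Hv; have [Lw _] := Hw.
have bound p q p' q' f : L2 Om p -> L2 Om q -> L2 Om p' -> L2 Om q' ->
    eqL2 Om f (fun x => a * p x + b * q x) ->
    normL2 Om (fun x => p x - p' x) < eps / c -> normL2 Om (fun x => q x - q' x) < eps / c ->
    normL2 Om (fun x => f x - (a * p' x + b * q' x)) < eps.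
  move=> Lp Lq Lp' Lq' fE h1 h2.
  have -> : normL2 Om (fun x => f x - (a * p' x + b * q' x)) =
      normL2 Om (fun x => a * (p x - p' x) + b * (q x - q' x)).
    by apply: normL2_ae; apply: filterS fE => x hx Ox; rewrite hx//; ring.
  have L1 := L2B mOm Lp Lp'; have L2_ := L2B mOm Lq Lq'.
  apply: (le_lt_trans (normL2_triangle mOm (L2Z mOm a L1) (L2Z mOm b L2_))).
  rewrite !normL2Z//.
  have -> : eps = (`|a| + `|b| + 1) * (eps / c) by rewrite -/c mulrC divfK// gt_eqF.
  have ec : 0 < eps / c by rewrite divr_gt0.
  move: (normr_ge0 a) (normr_ge0 b) h1 h2 ec.
  by move: (normL2 _ _) (normL2 _ _) (eps / c) `|a| `|b|; clear; move=> x y z s t; nra.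
exists (fun x => a * phi x + b * psi x); split.
- exact: test_fun_lin.
- by apply: (bound v w phi psi) => //; [exact: L2_test_fun|exact: L2_test_fun|exact: eqL2_refl].
- move=> i; have [sphi _ _] := tphi; have [spsi _ _] := tpsi.
  have -> : pderiv i (fun x => a * phi x + b * psi x) =
      (fun x => a * pderiv i phi x + b * pderiv i psi x).
    by apply/funext => x; rewrite pderiv_lin//; [exact: (sphi [::])|exact: (spsi [::])].
  apply: (bound (wpderiv Om i v) (wpderiv Om i w) (pderiv i phi) (pderiv i psi)).
  + exact: L2_wpderiv.
  + exact: L2_wpderiv.
  + exact: L2_test_fun_pderiv.
  + exact: L2_test_fun_pderiv.
  + exact: wpderiv_lin.
  + exact: dphi.
  + exact: dpsi.
Qed.

Lemma ipgradC v w : ipgrad Om v w = ipgrad Om w v.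
Proof. by apply: eq_bigr => i _; rewrite ipL2C. Qed.

Lemma ipgrad_ge0 v : 0 <= ipgrad Om v v.
Proof. by apply: sumr_ge0 => i _; exact: ipL2_ge0. Qed.

Lemma ipgrad_ae v v' w w' : eqL2 Om v v' -> eqL2 Om w w' -> ipgrad Om v w = ipgrad Om v' w'.
Proof. by move=> vv' ww'; apply: eq_bigr => i _; rewrite (wpderiv_ae _ vv') (wpderiv_ae _ ww'). Qed.

Lemma ipgrad_linl a b u v w : H1 Om u -> H1 Om v -> H1 Om w ->
  ipgrad Om (fun x => a * u x + b * v x) w = a * ipgrad Om u w + b * ipgrad Om v w.
Proof.
move=> Hu Hv Hw; rewrite /ipgrad !mulr_sumr -big_split/=; apply: eq_bigr => i _.
rewrite (ipL2_ae (wpderiv_lin i a b Hu Hv) (eqL2_refl _ _)).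
by rewrite ipL2_linl//; exact: L2_wpderiv.
Qed.

Lemma ipgrad0l w : ipgrad Om (fun=> 0) w = 0.
Proof.
apply: big1 => i _; have : eqL2 Om (wpderiv Om i (fun=> 0)) (fun=> 0).
  apply: wpderiv_eq; split; first exact: L2_0.
  by move=> phi _; rewrite !(ipL2_0l mOm) oppr0.
by move=> h; rewrite (ipL2_ae h (eqL2_refl _ _)) (ipL2_0l mOm).
Qed.

Lemma H1_0 : H1 Om (fun=> 0).
Proof.
split; first exact: L2_0.
move=> i; exists (fun=> 0); split; first exact: L2_0.
by move=> phi _; rewrite !(ipL2_0l mOm) oppr0.
Qed.

Lemma H1_sum (I : Type) (s : seq I) (c : I -> R) (g : I -> E -> R) :
  (forall i, H1 Om (g i)) -> H1 Om (fun x => \sum_(i <- s) c i * g i x).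
Proof.
move=> Hg; elim: s => [|i s IH].
  by under eq_fun do rewrite big_nil; exact: H1_0.
under eq_fun do rewrite big_cons -[X in _ + X]mul1r.
exact: H1_lin.
Qed.

Lemma ipgrad_suml (I : Type) (s : seq I) (c : I -> R) (g : I -> E -> R) w :
  (forall i, H1 Om (g i)) -> H1 Om w ->
  ipgrad Om (fun x => \sum_(i <- s) c i * g i x) w = \sum_(i <- s) c i * ipgrad Om (g i) w.
Proof.
move=> Hg Hw; elim: s => [|i s IH].
  by rewrite big_nil; under eq_fun do rewrite big_nil; rewrite ipgrad0l.
rewrite big_cons; under eq_fun do rewrite big_cons -[X in _ + X]mul1r.
by rewrite ipgrad_linl//; [rewrite IH mul1r|exact: H1_sum].
Qed.

Lemma ipgrad_sum2 (I J : finType) (c : I -> R) (c' : J -> R) (g : I -> E -> R) (g' : J -> E -> R) :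
  (forall i, H1 Om (g i)) -> (forall i, H1 Om (g' i)) ->
  ipgrad Om (fun x => \sum_i c i * g i x) (fun x => \sum_j c' j * g' j x) =
  \sum_i \sum_j c i * c' j * ipgrad Om (g i) (g' j).
Proof.
move=> Hg Hg'; rewrite ipgrad_suml//; last exact: H1_sum.
apply: eq_bigr => i _; rewrite ipgradC ipgrad_suml// mulr_sumr.
by apply: eq_bigr => j _; rewrite ipgradC mulrA.
Qed.

Lemma normH10_sqr v : normH10 Om v ^+ 2 = ipgrad Om v v.
Proof. by rewrite sqr_sqrtr// ipgrad_ge0. Qed.

Variables (Ks : seq 'M[R]_(d.+1, d)) (n : nat).

Let piecewise_poly_lin a b v w : piecewise_poly Ks n v -> piecewise_poly Ks n w ->
  piecewise_poly Ks n (fun x => a * v x + b * w x).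
Proof.
move=> pv pw K KKs; have [_ [c ->] vE] := pv K KKs; have [_ [c' ->] wE] := pw K KKs.
eexists; first by exists (fun al => a * c al + b * c' al); reflexivity.
apply: filterS2 vE wE => x h h' Kx; rewrite h// h'//.
rewrite !mulr_sumr -big_split/=; apply: eq_bigr => al _; ring.
Qed.

Lemma fe_space0_lin a b v w : fe_space0 Om Ks n v -> fe_space0 Om Ks n w ->
  fe_space0 Om Ks n (fun x => a * v x + b * w x).
Proof. by move=> [Hv pv] [Hw pw]; split; [exact: H10_lin|exact: piecewise_poly_lin]. Qed.

(** The element w0 makes the space nonempty, for the empty sum. *)
Lemma fe_space0_sum w0 (I : Type) (s : seq I) (c : I -> R) (g : I -> E -> R) :
  fe_space0 Om Ks n w0 -> (forall i, fe_space0 Om Ks n (g i)) ->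
  fe_space0 Om Ks n (fun x => \sum_(i <- s) c i * g i x).
Proof.
move=> S0 Sg; elim: s => [|i s IH].
  under eq_fun do rewrite big_nil.
  have := fe_space0_lin 0 0 S0 S0; congr (fe_space0 Om Ks n _).
  by apply/funext => x; rewrite !mul0r addr0.
under eq_fun do rewrite big_cons -[X in _ + X]mul1r.
exact: fe_space0_lin.
Qed.

Let pythagoras (p q : R) : 1 * (1 * p + 1 * 0) + 1 * (1 * 0 + 1 * q) = p + q.
Proof. by ring. Qed.

(** Pythagoras. *)
Lemma Ritz_projection_le Rh v : Ritz_projection Om Ks n Rh -> H10 Om v ->
  ipgrad Om (Rh v) (Rh v) <= ipgrad Om v v.
Proof.
move=> HR Hv; have [SR oR] := HR _ Hv; have [[HRv _] _] := SR; have [H1v _] := Hv.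
have o := oR _ SR.
have HD : H1 Om (v \- Rh v).
  have := H1_lin 1 (-1) H1v HRv; congr (H1 Om _).
  by apply/funext => x /=; rewrite mul1r mulN1r.
have HS := H1_lin 1 1 HD HRv.
have vE : v = (fun x => 1 * (v \- Rh v) x + 1 * Rh v x).
  by apply/funext => x /=; ring.
rewrite [leRHS](_ : _ = ipgrad Om (v \- Rh v) (v \- Rh v) + ipgrad Om (Rh v) (Rh v)).
  by rewrite lerDr ipgrad_ge0.
rewrite {1 2}vE (ipgrad_linl 1 1 HD HRv HS) (ipgradC (v \- Rh v)) (ipgradC (Rh v)).
rewrite (ipgrad_linl 1 1 HD HRv HD) (ipgrad_linl 1 1 HD HRv HRv) o (ipgradC (Rh v)) o.
exact: pythagoras.
Qed.

Lemma L2_projection_le Pih v : L2_projection Om Ks n Pih -> L2 Om v ->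
  L2 Om (Pih v) /\ normL2 Om (Pih v) <= normL2 Om v.
Proof.
move=> HP Lv; have [SP oP] := HP _ Lv; have [[LP _] _] := SP.
split => //; have o := oP _ SP.
have LD : L2 Om (v \- Pih v) by exact: L2B.
have LS := L2_lin mOm 1 1 LD LP.
have vE : v = (fun x => 1 * (v \- Pih v) x + 1 * Pih v x).
  by apply/funext => x /=; ring.
rewrite /normL2 ler_wsqrtr//.
rewrite [leRHS](_ : _ = ipL2 Om (v \- Pih v) (v \- Pih v) + ipL2 Om (Pih v) (Pih v)).
  by rewrite lerDr ipL2_ge0.
rewrite {1 2}vE (ipL2_linl mOm 1 1 LD LP LS) (ipL2C _ (v \- Pih v)) (ipL2C _ (Pih v)).
rewrite (ipL2_linl mOm 1 1 LD LP LD) (ipL2_linl mOm 1 1 LD LP LP) o (ipL2C _ (Pih v)) o.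
exact: pythagoras.
Qed.

End WeakDerivatives.

(** * Functions of time with values in L^2(Omega) *)

Section MonotoneIntegral.
Context d (X : measurableType d) {R : realType}.
Variable m : {measure set X -> \bar R}.

Lemma ge0_integral_le_ae (D : set X) (f g : X -> R) : measurable D ->
  (forall x, 0 <= f x) -> (forall x, 0 <= g x) ->
  {ae m, forall x, D x -> f x <= g x} ->
  (\int[m]_(x in D) (f x)%:E <= \int[m]_(x in D) (g x)%:E)%E.
Proof.
move=> mD f0 g0 fg.
pose f' x := Num.min (f x) (g x).
have -> : (\int[m]_(x in D) (f x)%:E = \int[m]_(x in D) (f' x)%:E)%E.
  apply: integral_ae_eq_any; case: fg => N [mN N0 hN]; exists N; split => // x /= h.
  apply: hN => /= fg; apply: h => Dx; congr EFin; rewrite /f'.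
  by rewrite min_l// fg.
rewrite integral_mkcond [leRHS]integral_mkcond.
have p0 (h : X -> R) : (forall x, 0 <= h x) -> forall x, (0 <= ((fun x => (h x)%:E) \_ D) x)%E.
  by move=> h0 x; rewrite patchE; case: ifP => _; rewrite ?lee_fin.
have f'0 x : 0 <= f' x by rewrite le_min f0 g0.
rewrite ge0_integralTE; last exact: p0.
rewrite ge0_integralTE; last exact: p0.
apply: ge_ereal_sup => _ [h hf <-]; apply: ereal_sup_ubound; exists h => // x.
apply: le_trans (hf x) _; rewrite !patchE; case: ifP => // _.
by rewrite lee_fin ge_min lexx orbT.
Qed.

End MonotoneIntegral.

Section VectorValued.
Context {R : realType} {d : nat}.
Local Notation E := 'rV[R]_d.
Local Notation mu := (@lebesgue_measure R).
Local Notation MR := (measurableTypeR R).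
Variable Om : set E.
Hypothesis mOm : measurable Om.
Import HBSimple.

Let simple_vfun_seq (s : seq (set R * (E -> R))) :
  (forall i, (i < size s)%N -> measurable (nth (set0, fun=> 0) s i).1 /\ L2 Om (nth (set0, fun=> 0) s i).2) ->
  simple_vfun Om (fun t x => \sum_(a <- s) \1_(a.1) t * a.2 x).
Proof.
move=> hs; exists (size s), (fun i => (nth (set0, fun=> 0) s i).1), (fun i => (nth (set0, fun=> 0) s i).2).
split.
- by move=> i; have [] := hs i (ltn_ord i).
- by move=> i; have [] := hs i (ltn_ord i).
- apply/funext => t; apply/funext => x.
  by rewrite (big_nth (set0, fun=> 0)) big_mkord.
Qed.

Section FiniteRank.
Variables (I : finType) (phi : I -> R -> R) (g : I -> E -> R).
Hypothesis mphi : forall p, measurable_fun [set: MR] (phi p).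
Hypothesis Lg : forall p, L2 Om (g p).

Definition finite_rank (t : R) (x : E) : R := \sum_p phi p t * g p x.

Lemma L2_finite_rank t : L2 Om (finite_rank t).
Proof. exact: L2_sum. Qed.

Lemma strongly_measurable_finite_rank O : strongly_measurable Om O finite_rank.
Proof.
have /choice[s hs] : forall p, exists s : {sfun MR >-> R}^nat, forall t : R,
    (fun k => s k t) @ \oo --> phi p t.
  move=> p; have [s hs] := @approximation_sfun _ MR R (EFin \o phi p) setT measurableT
    ((measurable_EFinP _ _).2 (mphi p)).
  exists s => t; have := hs t Logic.I.
  by move/fine_cvgP => [_].
pose tot k := [seq (s p k @^-1` [set y], fun x => y * g p x) |
   p <- enum I, y <- finmap.enum_fset (fset_set (range (s p k)))].
exists (fun k t x => \sum_(a <- tot k) \1_(a.1) t * a.2 x).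
split => [k|].
  apply: simple_vfun_seq => i ik.
  have /allpairsPdep[p [y [_ _ ->]]] := mem_nth (set0, fun=> 0) ik.
  split; last exact: L2Z.
  rewrite /= -[X in measurable X]setTI; apply: (@measurable_funPT _ _ _ _ (s p k)) => //.
have stepE k t x : \sum_(a <- tot k) \1_(a.1) t * a.2 x = \sum_p s p k t * g p x.
  rewrite /tot big_allpairs_dep big_enum/=; apply: eq_bigr => p _.
  rewrite (fimfunE (s p k)) fsbig_finite//= mulr_suml.
  by apply: eq_bigr => y _; ring.
apply: aeW => t _.
have nE k : normL2 Om (finite_rank t \- (fun x => \sum_(a <- tot k) \1_(a.1) t * a.2 x)) =
   normL2 Om (fun x => \sum_p (phi p t - s p k t) * g p x).
  congr normL2; apply/funext => x /=; rewrite stepE /finite_rank -sumrB.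
  by apply: eq_bigr => p _; rewrite mulrBl.
have sqE k : normL2 Om (fun x => \sum_p (phi p t - s p k t) * g p x) =
    Num.sqrt (\sum_p \sum_r (phi p t - s p k t) * (phi r t - s r k t) * ipL2 Om (g p) (g r)).
  by rewrite /normL2 ipL2_sum2.
have c0 p : (fun k => phi p t - s p k t) @ \oo --> (0 : R).
  by rewrite -[X in _ --> X](subrr (phi p t)); apply: cvgB; [exact: cvg_cst|exact: hs].
have cS : (fun k => \sum_p \sum_r (phi p t - s p k t) * (phi r t - s r k t) * ipL2 Om (g p) (g r))
    @ \oo --> (0 : R).
  rewrite [X in _ --> X](_ : 0 = \sum_p \sum_r 0 * 0 * ipL2 Om (g p) (g r)); last first.
    by rewrite big1// => p _; rewrite big1// => r _; rewrite mul0r mul0r.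
  apply: cvg_big => [|p _]; first exact: add_continuous.
  apply: cvg_big => [|r _]; first exact: add_continuous.
  by apply: cvgMr_tmp; apply: cvgM.
have : (fun k => Num.sqrt (\sum_p \sum_r (phi p t - s p k t) * (phi r t - s r k t) * ipL2 Om (g p) (g r)))
    @ \oo --> Num.sqrt (0 : R).
  by apply: continuous_cvg => //; exact: sqrt_continuous.
rewrite sqrtr0; apply: cvg_trans; apply: near_eq_cvg; apply: nearW => k.
by rewrite nE sqE.
Qed.

Lemma L2t_finite_rank O : measurable (O : set MR) ->
  (forall p, mu.-integrable O (fun t => (phi p t ^+ 2)%:E)) -> L2t Om O finite_rank.
Proof.
move=> mO iphi; split.
- by apply: aeW => t _; exact: L2_finite_rank.
- exact: strongly_measurable_finite_rank.
have i2 p r : mu.-integrable O (fun t => (phi p t * phi r t)%:E).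
  have i := integrable_addR mO (iphi p) (iphi r).
  apply: (le_integrable mO _ _ i).
    by apply/measurable_EFinP; apply: measurable_funTS; exact: measurable_funM.
  move=> t _; rewrite lee_fin normrM [leRHS]ger0_norm ?addr_ge0 ?sqr_ge0//.
  rewrite -(real_normK (num_real (phi p t))) -(real_normK (num_real (phi r t))).
  by move: (`|phi p t|) (`|phi r t|) => a b; nra.
have i : mu.-integrable O (fun t => (\sum_p \sum_r phi p t * phi r t * ipL2 Om (g p) (g r))%:E).
  apply: (integrable_sumR mO) => p; apply: (integrable_sumR mO) => r.
  have := integrable_scaleR mO (ipL2 Om (g p) (g r)) (i2 p r).
  by under eq_fun do rewrite mulrC.
apply: le_lt_trans (integrable_lty mO i); rewrite le_eqVlt; apply/orP; left; apply/eqP.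
by apply: eq_integral => t _; rewrite normL2_sqr ipL2_sum2.
Qed.

End FiniteRank.

(** The pairings with the approximating simple functions are Borel and converge
    almost everywhere. *)
Lemma L2t_coefficient (T : R) (W : R -> E -> R) h : L2t Om `]0, T[ W -> L2 Om h ->
  exists m : R -> R, [/\ measurable_fun [set: MR] m,
    mu.-integrable `]0, T[%classic (fun t => (m t)%:E)
    & {ae mu, forall t, `]0, T[%classic t -> ipL2 Om (W t) h = m t}].
Proof.
pose D : set R := `]0, T[%classic; rewrite -/D.
have mD : measurable (D : set MR) by exact: measurable_itv.
move=> [LW [s [ss sW]] iW] Lh.
have Ls k t : L2 Om (s k t).
  have [N [A [g [_ Lg ->]]]] := ss k.
  exact: L2_sum.
have ms k : measurable_fun [set: MR] (fun t => ipL2 Om (s k t) h).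
  have [N [A [g [mA Lg ->]]]] := ss k.
  under eq_fun do rewrite (ipL2_suml mOm)//.
  apply: measurable_sum => i; apply: measurable_funM => //.
  by apply: measurable_indic; exact: mA.
have [N [mN N0 hN]] : {ae mu, forall t, D t -> (fun k => ipL2 Om (s k t) h) @ \oo --> ipL2 Om (W t) h}.
  apply: filterS2 LW sW => t LWt sWt Dt.
  have := sWt Dt; have LWt' := LWt Dt => cv.
  apply/cvgrPdist_le => eps e0.
  have e1 : 0 < eps / (normL2 Om h + 1) by rewrite divr_gt0// ltr_wpDl// normL2_ge0.
  have /cvgr0Pnorm_le /(_ _ e1) := cv; apply: filterS => k.
  rewrite ger0_norm ?normL2_ge0// => hk.
  rewrite -(ipL2Bl mOm LWt' (Ls k t) Lh).
  apply: le_trans (ipL2_CS mOm (L2B mOm LWt' (Ls k t)) Lh) _.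
  have h0 := normL2_ge0 Om h.
  apply: (@le_trans _ _ (eps / (normL2 Om h + 1) * (normL2 Om h + 1))).
    by apply: ler_pM; rewrite ?normL2_ge0// lerDl.
  by rewrite divfK// gt_eqF// ltr_wpDl.
pose D' : set R := D `\` N.
have mD' : measurable (D' : set MR) by exact: measurableD.
have mW : measurable_fun (D' : set MR) (fun t => ipL2 Om (W t) h).
  apply: (@measurable_fun_cvg _ MR R D' (fun k t => ipL2 Om (s k t) h)).
    by move=> k; exact: measurable_funTS.
  by move=> t [Dt nNt]; apply: contrapT => nc; apply: nNt; apply: hN => /= /(_ Dt).
pose m := (fun t => ipL2 Om (W t) h) \_ D'.
have mm : measurable_fun [set: MR] m by apply/(measurable_restrictT _ mD').
have mE : {ae mu, forall t, D t -> ipL2 Om (W t) h = m t}.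
  exists N; split => // t /= ht; apply: contrapT => nNt; apply: ht => Dt.
  by rewrite /m patchE mem_set.
exists m; split => //.
pose c := normL2 Om h ^+ 2 + 1; have c0 : 0 < c by rewrite ltr_wpDl// sqr_ge0.
have i2 : mu.-integrable D (fun t => (c^-1 * m t ^+ 2)%:E).
  apply/integrableP; split.
    by apply/measurable_EFinP; apply: measurable_funTS; apply: measurable_funM => //; exact: measurable_funX.
  apply: le_lt_trans iW.
  have -> : (\int[mu]_(x in D) `|(c^-1 * m x ^+ 2)%:E| = \int[mu]_(x in D) (c^-1 * m x ^+ 2)%:E)%E.
    apply: eq_integral => t _; rewrite gee0_abs// lee_fin mulr_ge0 ?sqr_ge0// invr_ge0.
    exact: ltW.
  apply: ge0_integral_le_ae => //.
  - by move=> t; rewrite mulr_ge0 ?invr_ge0 ?(ltW c0) ?sqr_ge0.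
  - by move=> t; rewrite sqr_ge0.
  apply: filterS2 LW mE => t LWt mt Dt; rewrite -mt// ler_pdivrMl//.
  have := ipL2_CS mOm (LWt Dt) Lh; rewrite -(real_normK (num_real (ipL2 Om (W t) h))) /c.
  move: (normL2_ge0 Om (W t)) (normL2_ge0 Om h) (normr_ge0 (ipL2 Om (W t) h)).
  move: (normL2 Om (W t)) (normL2 Om h) `|ipL2 Om (W t) h| => a b r a0 b0 r0 rab.
  have : r ^+ 2 <= (a * b) ^+ 2 by rewrite lerXn2r ?nnegrE ?mulr_ge0.
  by rewrite exprMn; nra.
have muD : (mu D < +oo)%E.
  have := @lebesgue_measure_itv R `]0, T[; rewrite -/D => -> /=.
  by case: ifP => _; exact: ltry.
have i1 : mu.-integrable D (fun t => (1 : R)%:E).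
  apply/integrableP; split; first exact: measurable_cst.
  have -> : (\int[mu]_(t in D) `|(1 : R)%:E| = \int[mu]_(t in D) cst 1%:E t)%E.
    by apply: eq_integral => t _; rewrite gee0_abs.
  by rewrite (integral_cst mu mD) mul1e.
have i := integrable_addR mD i1 (integrable_scaleR mD c i2).
apply: (le_integrable mD _ _ i).
  by apply/measurable_EFinP; exact: measurable_funTS.
move=> t _; rewrite lee_fin mulVKf ?gt_eqF// [leRHS]ger0_norm ?addr_ge0 ?sqr_ge0//.
rewrite -(real_normK (num_real (m t))); move: (`|m t|) (normr_ge0 (m t)) => r r0; nra.
Qed.

Variable e : nat -> E -> R.
Hypothesis He : orthonormal_basis_L2 Om e.

(** The lemma of du Bois-Reymond for each coordinate along the basis. *)
Lemma L2t_unique (T c : R) (W W' : R -> E -> R) : 0 < T -> c != 0 ->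
  L2t Om `]0, T[ W -> L2t Om `]0, T[ W' ->
  (forall h phi, L2 Om h -> test_fun1 0 T phi ->
    \int[mu]_(t in `]0, T[) (c * ipL2 Om (W t) h * phi t) =
    \int[mu]_(t in `]0, T[) (c * ipL2 Om (W' t) h * phi t)) ->
  {ae mu, forall t, `]0, T[%classic t -> eqL2 Om (W t) (W' t)}.
Proof.
move=> T0 c0 LW LW' WW'; pose D : set R := `]0, T[%classic; rewrite -/D.
have mD : measurable (D : set MR) by exact: measurable_itv.
have Le k : L2 Om (e k) by case: He.
have key k : {ae mu, forall t, D t -> ipL2 Om (W t) (e k) = ipL2 Om (W' t) (e k)}.
  have [m [mm im mE]] := L2t_coefficient LW (Le k).
  have [m' [mm' im' mE']] := L2t_coefficient LW' (Le k).
  have : {ae mu, forall t, D t -> m t - m' t = 0}.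
    apply: du_bois_reymond; first exact: integrable_subR.
    move=> phi tphi; have [dphi _ phi0] := test_fun1_derive tphi.
    have [C phiC] : exists C : R, forall t, `|phi t| <= C.
      have h : {within `[0, T], continuous (fun t => `|phi t|)}.
        apply: continuous_subspaceT => x; apply: continuous_comp; last exact: norm_continuous.
        by apply: derivable_continuous; have [] := dphi x.
      have [a _ ha] := EVT_max (ltW T0) h.
      exists `|phi a| => t; have [tT|tT] := boolP (0 <= t <= T).
        by apply: ha; rewrite in_itv.
      by rewrite phi0 ?normr0//; apply: contra tT => /andP[? ?]; rewrite !ltW.
    have iphi (f : R -> R) : mu.-integrable D (fun t => (f t)%:E) -> mu.-integrable D (fun t => (f t * phi t)%:E).
      move=> fi; apply: (le_integrable mD _ _ (integrable_scaleR mD C fi)).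
        apply/measurable_EFinP; apply: measurable_funM.
          by have := measurable_int _ fi; move/measurable_EFinP.
        apply: measurable_funTS; apply: continuous_measurable_fun => x.
        by apply: derivable_continuous; have [] := dphi x.
      move=> t _; rewrite lee_fin !normrM mulrC ler_pM//.
      by rewrite (le_trans (phiC t))// ler_norm.
    have E1 : \int[mu]_(t in D) (c * ipL2 Om (W t) (e k) * phi t) = c * \int[mu]_(t in D) (m t * phi t).
      rewrite -(RintegralZl c mD (iphi _ im)); apply: Rintegral_ae_eq_any.
      by apply: filterS mE => t mt Dt; rewrite mt// mulrA.
    have E2 : \int[mu]_(t in D) (c * ipL2 Om (W' t) (e k) * phi t) = c * \int[mu]_(t in D) (m' t * phi t).
      rewrite -(RintegralZl c mD (iphi _ im')); apply: Rintegral_ae_eq_any.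
      by apply: filterS mE' => t mt Dt; rewrite mt// mulrA.
    under eq_Rintegral do rewrite mulrBl.
    rewrite (RintegralB mD (iphi _ im) (iphi _ im')); apply/eqP; rewrite subr_eq0.
    by apply/eqP; apply: (mulfI c0); rewrite -E1 -E2; exact: WW'.
  move=> mm'0; apply: filterS3 mE mE' mm'0 => t mt mt' mm't Dt.
  by rewrite mt// mt'//; apply/eqP; rewrite -subr_eq0; apply/eqP; exact: mm't.
have {}key : {ae mu, forall t k, D t -> ipL2 Om (W t) (e k) = ipL2 Om (W' t) (e k)}.
  exact: ae_foralln.
have [LWt _ _] := LW; have [LWt' _ _] := LW'.
apply: filterS3 key LWt LWt' => t hk Lt Lt' Dt.
apply: (eqL2_normB mOm (Lt Dt) (Lt' Dt)).
have L := L2B mOm (Lt Dt) (Lt' Dt).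
rewrite /normL2 (basis_eq0 mOm He L) ?sqrtr0// => k.
by rewrite (ipL2Bl mOm (Lt Dt) (Lt' Dt) (Le k)) hk// subrr.
Qed.

(** This identifies the representatives chosen in the definitions of the weak
    and of the fractional time derivatives. *)
Lemma weak_solution_unique (T c : R) (u : (E -> R) -> R -> R) (W W' : R -> E -> R) :
  0 < T -> c != 0 -> L2t Om `]0, T[ W -> L2t Om `]0, T[ W' ->
  (forall h, L2 Om h -> distr_deriv 0 T (u h) (fun t => c * ipL2 Om (W t) h)) ->
  (forall h, L2 Om h -> distr_deriv 0 T (u h) (fun t => c * ipL2 Om (W' t) h)) ->
  {ae mu, forall t, `]0, T[%classic t -> eqL2 Om (W t) (W' t)}.
Proof.
move=> T0 c0 LW LW' HW HW'; apply: (L2t_unique T0 c0 LW LW') => h phi Lh tphi.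
by apply: oppr_inj; rewrite -(HW h Lh phi tphi) -(HW' h Lh phi tphi).
Qed.

End VectorValued.

(** * Fractional derivatives of finite-rank functions *)

Section FiniteRankFractional.
Context {R : realType} {d : nat}.
Local Notation E := 'rV[R]_d.
Local Notation mu := (@lebesgue_measure R).
Local Notation MR := (measurableTypeR R).
Variable Om : set E.
Hypothesis mOm : measurable Om.
Variable e : nat -> E -> R.
Hypothesis He : orthonormal_basis_L2 Om e.
Variable nu : {sigma_finite_measure set MR -> \bar R}.
Hypothesis nu_fin : (nu setT < +oo)%E.
Variable al : R.
Hypotheses (al0 : 0 < al) (al1 : 2 * al < 1).
Variable T : R.
Hypothesis T0 : 0 < T.
Local Notation jump_sum := (jump_sum nu).
Local Notation frac_plus := (frac_plus nu al).
Local Notation frac_minus := (frac_minus nu al).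

Let mD (a b : R) : measurable (`]a, b[%classic : set MR).
Proof. exact: measurable_itv. Qed.

Let ae_restrict (a b : R) (P : R -> Prop) : 0 <= a -> b <= T ->
  {ae mu, forall t, `]0, T[%classic t -> P t} -> {ae mu, forall t, `]a, b[%classic t -> P t}.
Proof.
move=> a0 bT; apply: filterS => t h; rewrite /= in_itv/= => /andP[at_ tb]; apply: h.
by rewrite /= in_itv/= (le_lt_trans a0 at_) (lt_le_trans tb bT).
Qed.

Lemma integrable_mul_sqr (O : set MR) (f g : R -> R) : measurable O ->
  measurable_fun [set: MR] f -> measurable_fun [set: MR] g ->
  mu.-integrable O (fun t => (f t ^+ 2)%:E) -> mu.-integrable O (fun t => (g t ^+ 2)%:E) ->
  mu.-integrable O (fun t => (f t * g t)%:E).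
Proof.
move=> mO mf mg fi gi; have i := integrable_addR mO fi gi.
apply: (le_integrable mO _ _ i).
  by apply/measurable_EFinP; apply: measurable_funTS; exact: measurable_funM.
move=> t _; rewrite lee_fin normrM [leRHS]ger0_norm ?addr_ge0 ?sqr_ge0//.
rewrite -(real_normK (num_real (f t))) -(real_normK (num_real (g t))).
by move: (`|f t|) (`|g t|) => a b; nra.
Qed.

Let integrable_sqr1 (a b : R) (f : R -> R) : 0 <= a -> b <= T ->
  measurable_fun [set: MR] f ->
  mu.-integrable `]0, T[%classic (fun t => (f t ^+ 2)%:E) ->
  mu.-integrable `]a, b[%classic (fun t => (f t)%:E).
Proof.
move=> a0 bT mf fi.
have sub : `]a, b[%classic `<=` (`]0, T[%classic : set R).
  by move=> t; rewrite /= !in_itv/= => /andP[at_ tb]; rewrite (le_lt_trans a0 at_) (lt_le_trans tb bT).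
have i1 : mu.-integrable `]0, T[%classic (fun t => (1 : R)%:E).
  apply/integrableP; split; first exact: measurable_cst.
  have -> : (\int[mu]_(t in `]0%R, T[) `|(1 : R)%:E| = \int[mu]_(t in `]0%R, T[) cst 1%:E t)%E.
    by apply: eq_integral => t _; rewrite gee0_abs.
  rewrite (integral_cst mu (mD 0 T)) mul1e.
  have mE := @lebesgue_measure_itv R `]0, T[; rewrite [X in (X < _)%E]mE /=.
  by case: ifP => _; exact: ltry.
have i := integrable_addR (mD 0 T) i1 fi.
apply: integrableS (mD 0 T) (mD a b) sub _.
apply: (le_integrable (mD 0 T) _ _ i).
  by apply/measurable_EFinP; exact: measurable_funTS.
move=> t _; rewrite lee_fin [leRHS]ger0_norm ?addr_ge0 ?sqr_ge0//.
rewrite -(real_normK (num_real (f t))); move: (`|f t|) => r; nra.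
Qed.

Section Identification.
Variables (I : finType) (q : I -> R -> R) (g : I -> E -> R).
Hypothesis dq : forall p, is_density T (q p).
Hypothesis Lg : forall p, L2 Om (g p).

Let ipE (v : R -> E -> R) h : L2 Om h ->
  {ae mu, forall t, `]0, T[%classic t -> eqL2 Om (v t) (finite_rank (fun p => jump_sum (q p)) g t)} ->
  {ae mu, forall t, `]0, T[%classic t ->
    ipL2 Om (v t) h = jump_sum (comb q (fun p => ipL2 Om (g p) h)) t}.
Proof.
move=> Lh; apply: filterS => t ht tT; rewrite (ipL2_ae (ht tT) (eqL2_refl _ h)).
rewrite (jump_sum_comb nu_fin dq) /finite_rank ipL2_suml//.
by apply: eq_bigr => p _; rewrite mulrC.
Qed.

Let Gc := (Gamma (1 - al))^-1.

(** The candidate is a fractional derivative by RL_left_jump_sum for each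
    coefficient, and there is only one by weak_solution_unique. *)
Lemma fracD_left_finite_rank (v : R -> E -> R) :
  {ae mu, forall t, `]0, T[%classic t -> eqL2 Om (v t) (finite_rank (fun p => jump_sum (q p)) g t)} ->
  {ae mu, forall t, `]0, T[%classic t ->
    eqL2 Om (fracD_left Om al 0 T v t) (finite_rank (fun p t => Gc * frac_plus (q p) t) g t)}.
Proof.
move=> vE; set W' := finite_rank _ _.
have mf p := measurable_frac_plus nu al (dq p).
have isq p : mu.-integrable `]0, T[%classic (fun t => ((Gc * frac_plus (q p) t) ^+ 2)%:E).
  have := integrable_scaleR (mD 0 T) (Gc ^+ 2) (integrable_frac_plus_sqr nu_fin al1 (dq p)).
  by apply: eq_integrable => // t _; rewrite exprMn.
have LW' : L2t Om `]0, T[ W'.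
  apply: (L2t_finite_rank mOm _ Lg (mD 0 T) isq) => p; exact: measurable_funM.
have sol : (L2t Om `]0, T[ W' /\ forall h, L2 Om h ->
    distr_deriv 0 T (RL_left (1 - al) 0 (fun t => ipL2 Om (v t) h)) (fun t => ipL2 Om (W' t) h)).
  split => // h Lh.
  have [icomb _] := integral_frac_plus nu_fin al0 al1 T (is_density_comb dq (fun p => ipL2 Om (g p) h)).
  have WE : {ae mu, forall t, `]0, T[%classic t ->
      Gc * frac_plus (comb q (fun p => ipL2 Om (g p) h)) t = ipL2 Om (W' t) h}.
    have := frac_plus_comb nu_fin al1 dq (fun p => ipL2 Om (g p) h).
    apply: filterS => t ht tT; rewrite ht// /W' /finite_rank ipL2_suml// mulr_sumr.
    by apply: eq_bigr => p _; ring.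
  have iG := integrable_scaleR (mD 0 T) Gc icomb.
  apply: (@distr_deriv_primitive _ T 0) => //.
    apply: (integrable_ae_eq (mD 0 T) _ WE iG).
    rewrite (_ : (fun t => _) = (fun t => \sum_p Gc * frac_plus (q p) t * ipL2 Om (g p) h)); last first.
      by apply/funext => t; rewrite /W' /finite_rank ipL2_suml.
    apply: measurable_funTS; apply: measurable_sum => p.
    by apply: measurable_funM => //; exact: measurable_funM.
  move=> t /andP[t0 tT]; rewrite add0r.
  transitivity (RL_left (1 - al) 0 (jump_sum (comb q (fun p => ipL2 Om (g p) h))) t).
    rewrite /RL_left; congr (_ * _); apply: Rintegral_ae_eq_any.
    have := ae_restrict (lexx 0) (ltW tT) (ipE Lh vE).
    by apply: filterS => s hs st; rewrite hs.
  rewrite (RL_left_jump_sum nu_fin al0 al1 (is_density_comb dq _) t0).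
  have [icombt _] := integral_frac_plus nu_fin al0 al1 t (is_density_comb dq (fun p => ipL2 Om (g p) h)).
  rewrite -(RintegralZl _ (mD 0 t) icombt); apply: Rintegral_ae_eq_any.
  exact: ae_restrict (lexx 0) (ltW tT) WE.
have [LW HW] : [set w : R -> E -> R | L2t Om `]0, T[ w /\ forall h, L2 Om h ->
    distr_deriv 0 T (RL_left (1 - al) 0 (fun t => ipL2 Om (v t) h)) (fun t => ipL2 Om (w t) h) ] (fracD_left Om al 0 T v).
  by apply: xgetPex; exists W'.
apply: (@weak_solution_unique _ _ Om mOm e He T 1 (fun h => RL_left (1 - al) 0 (fun t => ipL2 Om (v t) h)) _ W' T0 (oner_neq0 R) LW LW') => h Lh.
- rewrite (_ : (fun t => 1 * _) = (fun t => ipL2 Om (fracD_left Om al 0 T v t) h)); first exact: HW.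
  by apply/funext => t; rewrite mul1r.
- rewrite (_ : (fun t => 1 * _) = (fun t => ipL2 Om (W' t) h)); first exact: sol.2.
  by apply/funext => t; rewrite mul1r.
Qed.

Lemma fracD_right_finite_rank (v : R -> E -> R) :
  (forall p, \int[nu]_a q p a = 0) ->
  {ae mu, forall t, `]0, T[%classic t -> eqL2 Om (v t) (finite_rank (fun p => jump_sum (q p)) g t)} ->
  {ae mu, forall t, `]0, T[%classic t ->
    eqL2 Om (fracD_right Om al 0 T v t) (finite_rank (fun p t => Gc * frac_minus (q p) t) g t)}.
Proof.
move=> q0 vE; set W' := finite_rank _ _.
have mf p := measurable_frac_minus nu al (dq p).
have isq p : mu.-integrable `]0, T[%classic (fun t => ((Gc * frac_minus (q p) t) ^+ 2)%:E).
  have := integrable_scaleR (mD 0 T) (Gc ^+ 2) (integrable_frac_minus_sqr nu_fin al1 (dq p)).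
  by apply: eq_integrable => // t _; rewrite exprMn.
have LW' : L2t Om `]0, T[ W'.
  apply: (L2t_finite_rank mOm _ Lg (mD 0 T) isq) => p; exact: measurable_funM.
have sol : (L2t Om `]0, T[ W' /\ forall h, L2 Om h ->
    distr_deriv 0 T (RL_right (1 - al) T (fun t => ipL2 Om (v t) h)) (fun t => - ipL2 Om (W' t) h)).
  split => // h Lh; set x := fun p => ipL2 Om (g p) h.
  have dc := is_density_comb dq x.
  have ic t : 0 <= t -> mu.-integrable `]t, T[%classic (fun s => (frac_minus (comb q x) s)%:E).
    by move=> t0; have [] := integral_frac_minus nu_fin al0 al1 dc (lexx T) t0.
  have WE : {ae mu, forall t, `]0, T[%classic t ->
      - Gc * frac_minus (comb q x) t = - ipL2 Om (W' t) h}.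
    have := frac_minus_comb nu_fin al1 dq x.
    apply: filterS => t ht tT; rewrite ht// /W' /finite_rank ipL2_suml// mulr_sumr -sumrN.
    by apply: eq_bigr => p _; rewrite /x; ring.
  have iG := integrable_scaleR (mD 0 T) (- Gc) (ic 0 (lexx 0)).
  apply: (@distr_deriv_primitive _ T (Gc * \int[mu]_(s in `]0, T[) frac_minus (comb q x) s)) => //.
    apply: (integrable_ae_eq (mD 0 T) _ WE iG).
    rewrite (_ : (fun t => _) = (fun t => - \sum_p Gc * frac_minus (q p) t * ipL2 Om (g p) h)); last first.
      by apply/funext => t; rewrite /W' /finite_rank ipL2_suml.
    apply: measurable_funTS; apply: measurableT_comp => //; apply: measurable_sum => p.
    by apply: measurable_funM => //; exact: measurable_funM.
  move=> t /andP[t0 tT].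
  transitivity (RL_right (1 - al) T (jump_sum (comb q x)) t).
    rewrite /RL_right; congr (_ * _); apply: Rintegral_ae_eq_any.
    have := ae_restrict (ltW t0) (lexx T) (ipE Lh vE).
    by apply: filterS => s hs st; rewrite hs.
  rewrite (RL_right_jump_sum nu_fin al0 al1 dc (lexx T) (ltW t0) (mass_comb nu_fin dq x q0)).
  have -> : \int[mu]_(s in `]0, t[) - ipL2 Om (W' s) h =
      - Gc * \int[mu]_(s in `]0, t[) frac_minus (comb q x) s.
    have ict : mu.-integrable `]0, t[%classic (fun s => (frac_minus (comb q x) s)%:E).
      by apply: integrableS (ic 0 (lexx 0)) => //; apply: subset_itvl; rewrite bnd_simp ltW.
    rewrite -(RintegralZl _ (mD 0 t) ict); apply/esym; apply: Rintegral_ae_eq_any.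
    exact: ae_restrict (lexx 0) (ltW tT) WE.
  have := @Rintegral_itvB R (frac_minus (comb q x)) (BRight 0) (BLeft T) t.
  have -> : \int[mu]_(s in [set` Interval (BRight 0) (BRight t)]) frac_minus (comb q x) s =
      \int[mu]_(s in `]0, t[) frac_minus (comb q x) s.
    by rewrite -Rintegral_itv_bndo_bndc//; apply: integrableS (ic 0 (lexx 0)) => //; apply: subset_itvl; rewrite bnd_simp ltW.
  move=> <-//; last by rewrite bnd_simp ltW.
  - by rewrite /Gc mulrBr mulNr.
  - exact: ic.
have N1 : -1 != 0 :> R by rewrite oppr_eq0 oner_neq0.
have [LW HW] : [set w : R -> E -> R | L2t Om `]0, T[ w /\ forall h, L2 Om h ->
    distr_deriv 0 T (RL_right (1 - al) T (fun t => ipL2 Om (v t) h)) (fun t => - ipL2 Om (w t) h) ] (fracD_right Om al 0 T v).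
  by apply: xgetPex; exists W'.
apply: (@weak_solution_unique _ _ Om mOm e He T (-1) (fun h => RL_right (1 - al) T (fun t => ipL2 Om (v t) h)) _ W' T0 N1 LW LW') => h Lh.
- rewrite (_ : (fun t => (-1) * _) = (fun t => - ipL2 Om (fracD_right Om al 0 T v t) h)); first exact: HW.
  by apply/funext => t; rewrite mulN1r.
- rewrite (_ : (fun t => (-1) * _) = (fun t => - ipL2 Om (W' t) h)); first exact: sol.2.
  by apply/funext => t; rewrite mulN1r.
Qed.

End Identification.

Section Pairing.
Variables (I J : finType) (q : I -> R -> R) (g : I -> E -> R) (r : J -> R -> R) (h : J -> E -> R).
Hypothesis dq : forall p, is_density T (q p).
Hypothesis Lg : forall p, L2 Om (g p).
Hypothesis dr : forall p, is_density T (r p).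
Hypothesis Lh : forall p, L2 Om (h p).
Hypothesis r0 : forall p, \int[nu]_a r p a = 0.

Lemma integrable_frac_plus_minus i j :
  mu.-integrable `]0, T[%classic (fun t => (frac_plus (q i) t * frac_minus (r j) t)%:E).
Proof.
apply: (integrable_mul_sqr (mD 0 T)).
- exact: (measurable_frac_plus nu al (dq i)).
- exact: (measurable_frac_minus nu al (dr j)).
- exact: (integrable_frac_plus_sqr nu_fin al1 (dq i)).
- exact: (integrable_frac_minus_sqr nu_fin al1 (dr j)).
Qed.

Lemma fracD_pairing_finite_rank (v w : R -> E -> R) :
  {ae mu, forall t, `]0, T[%classic t -> eqL2 Om (v t) (finite_rank (fun p => jump_sum (q p)) g t)} ->
  {ae mu, forall t, `]0, T[%classic t -> eqL2 Om (w t) (finite_rank (fun p => jump_sum (r p)) h t)} ->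
  fracD_pairing Om al T v w = (Gamma (1 - al)) ^- 2 * \sum_i \sum_j
    (\int[mu]_(t in `]0, T[) (frac_plus (q i) t * frac_minus (r j) t)) * ipL2 Om (g i) (h j).
Proof.
move=> vE wE; rewrite /fracD_pairing.
have lE := fracD_left_finite_rank dq Lg vE.
have rE := fracD_right_finite_rank dr Lh r0 wE.
set c := (Gamma _)^-1 in lE rE.
transitivity (\int[mu]_(t in `]0, T[) \sum_i \sum_j
   (c ^+ 2 * ipL2 Om (g i) (h j)) * (frac_plus (q i) t * frac_minus (r j) t)).
  apply: Rintegral_ae_eq_any; apply: filterS2 lE rE => t lt rt tT.
  rewrite (ipL2_ae (lt tT) (rt tT)) /finite_rank ipL2_suml//; last exact: L2_sum.
  apply: eq_bigr => i _; rewrite ipL2C ipL2_suml// mulr_sumr.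
  by apply: eq_bigr => j _; rewrite ipL2C; ring.
have iij i j := integrable_scaleR (mD 0 T) (c ^+ 2 * ipL2 Om (g i) (h j)) (integrable_frac_plus_minus i j).
rewrite (@Rintegral_sum _ _ _ mu _ (mD 0 T)); last first.
  by move=> i; apply: (integrable_sumR (mD 0 T)) => j; exact: iij.
rewrite mulr_sumr; apply: eq_bigr => i _.
rewrite (@Rintegral_sum _ _ _ mu _ (mD 0 T)); last exact: iij.
rewrite mulr_sumr; apply: eq_bigr => j _.
rewrite (RintegralZl _ (mD 0 T) (integrable_frac_plus_minus i j)) /c exprVn; ring.
Qed.

End Pairing.

(** A primitive has its integrand as weak derivative, by distr_deriv_primitive,
    and no other one, by weak_solution_unique. *)
Lemma tderiv_finite_rank (I : finType) (phi : I -> R -> R) (g : I -> E -> R) (V : R -> E -> R) :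
  (forall p, measurable_fun [set: MR] (phi p)) -> (forall p, L2 Om (g p)) ->
  (forall p, mu.-integrable `]0, T[%classic (fun t => (phi p t ^+ 2)%:E)) ->
  (forall h, L2 Om h -> forall t, 0 < t < T -> ipL2 Om (V t) h =
    ipL2 Om (V 0) h + \int[mu]_(s in `]0, t[) ipL2 Om (finite_rank phi g s) h) ->
  {ae mu, forall t, `]0, T[%classic t -> eqL2 Om (tderiv Om 0 T V t) (finite_rank phi g t)}.
Proof.
move=> mphi Lg iphi VE; set W' := finite_rank phi g.
have LW' : L2t Om `]0, T[ W' by exact: L2t_finite_rank.
have sol : weak_tderiv Om 0 T V W'.
  split => // h Lh; apply: (@distr_deriv_primitive _ T (ipL2 Om (V 0) h)) => //.
    rewrite (_ : (fun t => _) = (fun t => (\sum_p ipL2 Om (g p) h * phi p t)%:E)); last first.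
      apply/funext => t; rewrite /W' /finite_rank ipL2_suml//; congr EFin.
      by apply: eq_bigr => p _; rewrite mulrC.
    apply: (integrable_sumR (mD 0 T)) => p; apply: (integrable_scaleR (mD 0 T)).
    exact: integrable_sqr1.
  exact: VE.
have [LW HW] : [set w : R -> E -> R | L2t Om `]0, T[ w /\ forall h, L2 Om h ->
    distr_deriv 0 T (fun t => ipL2 Om (V t) h) (fun t => ipL2 Om (w t) h) ] (tderiv Om 0 T V).
  by apply: xgetPex; exists W'.
apply: (@weak_solution_unique _ _ Om mOm e He T 1 (fun h => (fun t => ipL2 Om (V t) h)) _ W' T0 (oner_neq0 R) LW LW') => h Lh.
- rewrite (_ : (fun t => 1 * _) = (fun t => ipL2 Om (tderiv Om 0 T V t) h)); first exact: HW.
  by apply/funext => t; rewrite mul1r.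
- rewrite (_ : (fun t => 1 * _) = (fun t => ipL2 Om (W' t) h)); first exact: sol.2.
  by apply/funext => t; rewrite mul1r.
Qed.

End FiniteRankFractional.

(** * Norms and pairings of finite-rank functions *)

Section FiniteRankNorms.
Context {R : realType} {d : nat}.
Local Notation E := 'rV[R]_d.
Local Notation mu := (@lebesgue_measure R).
Local Notation MR := (measurableTypeR R).
Variable Om : set E.
Hypothesis mOm : measurable Om.
Variable e : nat -> E -> R.
Hypothesis He : orthonormal_basis_L2 Om e.
Variable nu : {sigma_finite_measure set MR -> \bar R}.
Hypothesis nu_fin : (nu setT < +oo)%E.
Variable al : R.
Hypotheses (al0 : 0 < al) (al1 : 2 * al < 1).
Variables (b T : R).
Hypotheses (b0 : 0 < b) (bT : b <= T).
Variables (I : finType) (q : I -> R -> R) (g : I -> E -> R).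
Hypothesis dq : forall p, is_density b (q p).
Hypothesis q0 : forall p, \int[nu]_a q p a = 0.
Hypothesis Lg : forall p, L2 Om (g p).
Local Notation jump_sum := (jump_sum nu).
Local Notation frac_plus := (frac_plus nu al).
Local Notation frac_minus := (frac_minus nu al).

Let mD (a c : R) : measurable (`]a, c[%classic : set MR).
Proof. exact: measurable_itv. Qed.

Lemma is_density_widen (c c' : R) r : c <= c' -> is_density c r -> is_density c' r.
Proof.
move=> cc' [mr Mr rc]; split => // a; apply: contraNeq => ra.
have /andP[-> ac] : 0 <= a <= c by apply: contraNT ra => /rc ->.
by rewrite (le_trans ac).
Qed.

Let dqT p : is_density T (q p). Proof. exact: is_density_widen (dq p). Qed.

Let quad_form_scale (c : R) (A : I -> I -> R) x :
  quad_form (fun i j => c * A i j) x = c * quad_form A x.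
Proof.
rewrite /quad_form mulr_sumr; apply: eq_bigr => i _.
by rewrite mulr_sumr; apply: eq_bigr => j _; rewrite [RHS]mulrA.
Qed.

Let gram_form_scale (c : R) (A : I -> I -> R) :
  gram_form Om g (fun i j => c * A i j) = c * gram_form Om g A.
Proof.
rewrite /gram_form mulr_sumr; apply: eq_bigr => i _.
by rewrite mulr_sumr; apply: eq_bigr => j _; rewrite [RHS]mulrA.
Qed.

Definition plus_minus_form (i j : I) : R :=
  \int[mu]_(t in `]0, T[) (frac_plus (q i) t * frac_minus (q j) t).

Definition minus_minus_form (i j : I) : R :=
  \int[mu]_(t in `]0, T[) (frac_minus (q i) t * frac_minus (q j) t).

Let Rintegral_quad (f h : I -> R -> R) (x : I -> R) :
  (forall i j, mu.-integrable `]0, T[%classic (fun t => (f i t * h j t)%:E)) ->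
  \int[mu]_(t in `]0, T[) ((\sum_i x i * f i t) * (\sum_i x i * h i t)) =
  \sum_i \sum_j (\int[mu]_(t in `]0, T[) (f i t * h j t)) * (x i * x j).
Proof.
move=> ifh.
transitivity (\int[mu]_(t in `]0, T[) \sum_i \sum_j (x i * x j) * (f i t * h j t)).
  apply: eq_Rintegral => t _; rewrite mulr_suml; apply: eq_bigr => i _.
  by rewrite mulr_sumr; apply: eq_bigr => j _; ring.
have iij i j := integrable_scaleR (mD 0 T) (x i * x j) (ifh i j).
rewrite (@Rintegral_sum _ _ _ mu _ (mD 0 T)); last first.
  by move=> i; apply: (integrable_sumR (mD 0 T)) => j; exact: iij.
apply: eq_bigr => i _.
rewrite (@Rintegral_sum _ _ _ mu _ (mD 0 T)); last exact: iij.
by apply: eq_bigr => j _; rewrite (RintegralZl _ (mD 0 T) (ifh i j)) mulrC.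
Qed.

Let iMM i j : mu.-integrable `]0, T[%classic (fun t => (frac_minus (q i) t * frac_minus (q j) t)%:E).
Proof.
apply: (integrable_mul_sqr (mD 0 T)).
- exact: (measurable_frac_minus nu al (dq i)).
- exact: (measurable_frac_minus nu al (dq j)).
- exact: (integrable_frac_minus_sqr nu_fin al1 (dqT i)).
- exact: (integrable_frac_minus_sqr nu_fin al1 (dqT j)).
Qed.

Lemma plus_minus_formE x :
  quad_form plus_minus_form x = beta_const al / 2 * riesz_energy nu al (comb q x).
Proof.
have [_ <-] := frac_plus_minus_energy nu_fin al0 al1 bT (is_density_comb dq x).
rewrite /quad_form /plus_minus_form -Rintegral_quad; last first.
  by move=> i j; exact: integrable_frac_plus_minus.
apply: Rintegral_ae_eq_any.
have := frac_plus_comb nu_fin al1 dqT x; have := frac_minus_comb nu_fin al1 dqT x.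
by apply: filterS2 => t h1 h2 tT; rewrite h1// h2.
Qed.

Lemma minus_minus_form_le x :
  quad_form minus_minus_form x <= increment_const al / beta_const al * quad_form plus_minus_form x.
Proof.
rewrite plus_minus_formE /quad_form /minus_minus_form -Rintegral_quad; last exact: iMM.
have [_] := frac_minus_energy nu_fin al0 al1 (is_density_comb dqT x) (mass_comb nu_fin dq x q0).
have b00 : beta_const al != 0 by rewrite gt_eqF// beta_const_gt0.
rewrite (_ : increment_const al / beta_const al * _ =
    increment_const al / 2 * riesz_energy nu al (comb q x)); last by field.
apply: le_trans; rewrite le_eqVlt; apply/orP; left; apply/eqP.
apply: Rintegral_ae_eq_any; have := frac_minus_comb nu_fin al1 dqT x.
by apply: filterS => t h1 tT; rewrite h1// expr2.
Qed.

Lemma quad_plus_minus_ge0 x : 0 <= quad_form plus_minus_form x.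
Proof.
rewrite plus_minus_formE mulr_ge0//; first by rewrite divr_ge0// ltW// beta_const_gt0.
exact: (riesz_energy_ge0 nu_fin al0 al1 (is_density_comb dq x) (mass_comb nu_fin dq x q0)).
Qed.

(** Both sides are Gram forms of multiples of one energy, and are compared
    coordinate by coordinate. *)
Lemma integral_minus_sqr_le :
  mu.-integrable `]0, T[%classic (fun t =>
    (ipL2 Om (finite_rank (fun p => frac_minus (q p)) g t) (finite_rank (fun p => frac_minus (q p)) g t))%:E) /\
  \int[mu]_(t in `]0, T[)
    ipL2 Om (finite_rank (fun p => frac_minus (q p)) g t) (finite_rank (fun p => frac_minus (q p)) g t)
  <= increment_const al / beta_const al * gram_form Om g plus_minus_form.
Proof.
have E t : ipL2 Om (finite_rank (fun p => frac_minus (q p)) g t) (finite_rank (fun p => frac_minus (q p)) g t)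
   = \sum_i \sum_j ipL2 Om (g i) (g j) * (frac_minus (q i) t * frac_minus (q j) t).
  rewrite /finite_rank ipL2_sum2//; apply: eq_bigr => i _; apply: eq_bigr => j _; ring.
have iij i j := integrable_scaleR (mD 0 T) (ipL2 Om (g i) (g j)) (iMM i j).
have i1 i : mu.-integrable `]0, T[%classic (fun t =>
    (\sum_j ipL2 Om (g i) (g j) * (frac_minus (q i) t * frac_minus (q j) t))%:E).
  by apply: (integrable_sumR (mD 0 T)) => j; exact: iij.
split.
  have := @integrable_sumR _ _ _ mu _ (mD 0 T) _ (index_enum I) _ i1.
  by apply: eq_integrable => // t _; rewrite E.
under eq_Rintegral do rewrite E.
rewrite (@Rintegral_sum _ _ _ mu _ (mD 0 T) _ _ _ i1).
have -> : \sum_i \int[mu]_(t in `]0, T[) (\sum_j ipL2 Om (g i) (g j) * (frac_minus (q i) t * frac_minus (q j) t))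
    = gram_form Om g minus_minus_form.
  apply: eq_bigr => i _; rewrite (@Rintegral_sum _ _ _ mu _ (mD 0 T) _ _ _ (iij i)).
  by apply: eq_bigr => j _; rewrite (RintegralZl _ (mD 0 T) (iMM i j)) mulrC.
rewrite -gram_form_scale; apply: (gram_form_le mOm He Lg) => x.
by rewrite quad_form_scale; exact: minus_minus_form_le.
Qed.

(** The quotient of the constants of fourier_norm2_jump_sum and
    frac_plus_minus_energy. *)
Definition energy_ratio : R := (2 * pi)^-1 * fourier_const al / (beta_const al / 2).

Lemma energy_ratio_ge0 : 0 <= energy_ratio.
Proof.
have f0 : 0 <= fourier_const al.
  by rewrite /fourier_const fine_ge0//; apply: integral_ge0 => x _; rewrite lee_fin.
rewrite /energy_ratio !mulr_ge0// ?invr_ge0 ?mulr_ge0 ?pi_ge0 ?invr_ge0//.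
by rewrite ltW// beta_const_gt0.
Qed.

Let coefficient_ae (O : set R) (v w : R -> E -> R) h :
  {ae mu, forall t, O t -> eqL2 Om (v t) (w t)} ->
  {ae mu, forall t, O t -> ipL2 Om (v t) h = ipL2 Om (w t) h}.
Proof. by apply: filterS => t ht Ot; exact: (ipL2_ae (ht Ot) (eqL2_refl _ h)). Qed.

Let coefficientE h t : L2 Om h ->
  ipL2 Om (finite_rank (fun p => jump_sum (q p)) g t) h =
  jump_sum (comb q (fun p => ipL2 Om (g p) h)) t.
Proof.
move=> Lh; rewrite (jump_sum_comb nu_fin dq) /finite_rank ipL2_suml//.
by apply: eq_bigr => p _; rewrite mulrC.
Qed.

Let Le k : L2 Om (e k). Proof. by case: He. Qed.

Lemma gram_plus_minus_ge0 : 0 <= gram_form Om g plus_minus_form.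
Proof.
have := gram_form_le mOm He Lg (A := fun _ _ => 0) (B := plus_minus_form).
rewrite {1}/gram_form big1; last by move=> i _; rewrite big1// => j _; rewrite mul0r.
apply=> x; rewrite {1}/quad_form big1; last by move=> i _; rewrite big1// => j _; rewrite mul0r.
exact: quad_plus_minus_ge0.
Qed.

(** On functions of bounded variation the Fourier norm and the duality pairing
    are multiples of one and the same energy. *)
Lemma normHt_finite_rank (v : R -> E -> R) :
  {ae mu, forall t, `]0, b[%classic t -> eqL2 Om (v t) (finite_rank (fun p => jump_sum (q p)) g t)} ->
  normHt Om al `]0%R, b[ e v = (Num.sqrt (energy_ratio * gram_form Om g plus_minus_form))%:E.
Proof.
move=> vE; rewrite /normHt.
have E k : fourier_norm2 al `]0, b[%classic (fun t => ipL2 Om (v t) (e k)) =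
    (quad_form (fun i j => energy_ratio * plus_minus_form i j) (fun p => ipL2 Om (g p) (e k)))%:E.
  rewrite (fourier_norm2_ae al (@coefficient_ae _ _ _ (e k) vE)).
  have -> : (fun t => ipL2 Om (finite_rank (fun p => jump_sum (q p)) g t) (e k)) =
      jump_sum (comb q (fun p => ipL2 Om (g p) (e k))).
    by apply/funext => t; exact: coefficientE.
  rewrite (fourier_norm2_jump_sum nu_fin al0 al1 b0 (is_density_comb dq _) (mass_comb nu_fin dq _ q0)).
  congr EFin; set x := (fun p : I => _).
  have -> : quad_form (fun i j => energy_ratio * plus_minus_form i j) x =
      energy_ratio * quad_form plus_minus_form x.
    exact: quad_form_scale.
  rewrite plus_minus_formE mulrA /energy_ratio divfK//.
  by rewrite mulf_neq0 ?invr_neq0// gt_eqF// beta_const_gt0.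
under eq_eseriesr do rewrite E.
rewrite (gram_form_series mOm He Lg); last first.
  move=> x; rewrite (_ : quad_form _ x = energy_ratio * quad_form plus_minus_form x).
    by rewrite mulr_ge0 ?quad_plus_minus_ge0 ?energy_ratio_ge0.
  exact: quad_form_scale.
rewrite gram_form_scale.
rewrite poweR_EFin powR12_sqrt// mulr_ge0 ?energy_ratio_ge0//.
exact: gram_plus_minus_ge0.
Qed.

Let sum_norm_sqr (x : I -> R) : (\sum_p `|x p|) ^+ 2 <= #|I|%:R * \sum_p x p ^+ 2.
Proof.
rewrite expr2 mulr_suml.
apply: (@le_trans _ _ (\sum_p \sum_r ((x p ^+ 2 + x r ^+ 2) / 2))).
  apply: ler_sum => p _; rewrite mulr_sumr; apply: ler_sum => r _.
  rewrite -(real_normK (num_real (x p))) -(real_normK (num_real (x r))).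
  move: (`|x p|) (`|x r|) => s t; have := sqr_ge0 (s - t); nra.
rewrite le_eqVlt; apply/orP; left; apply/eqP.
under eq_bigr do rewrite -mulr_suml big_split/=.
rewrite -mulr_suml big_split/= exchange_big/=.
rewrite !sumr_const -[_ *+ _]mulr_natl.
have -> : #|xpredT : pred I| = #|I| by apply: eq_card.
by field.
Qed.

(** Bessel's inequality sums the Sobolev norms of the coefficients. *)
Lemma Ht_finite_rank (c : R) : 0 < c -> Ht Om al `]0, c[ e (finite_rank (fun p => jump_sum (q p)) g).
Proof.
move=> c0; have mj p := measurable_jump_sum nu (dq p).
have /choice[M hM] : forall p, exists M : R, forall a, `|q p a| <= M by move=> p; have [] := dq p.
pose M0 := \sum_p `|M p|.
have qM0 p a : `|q p a| <= M0.
  apply: le_trans (hM p a) _; apply: le_trans (ler_norm _) _.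
  by rewrite /M0 (bigD1 p)//= lerDl sumr_ge0.
have M00 : 0 <= M0 by apply: sumr_ge0.
split.
  apply: (L2t_finite_rank mOm mj Lg (mD 0 c)) => p.
  have [C jC] := jump_sum_bounded nu_fin (dq p).
  apply: measurable_bounded_integrable => //.
  - by have mE := @lebesgue_measure_itv R `]0, c[; rewrite [X in (X < _)%E]mE /=; case: ifP => _; exact: ltry.
  - by apply: measurable_funTS; exact: measurable_funX.
  - exists (C ^+ 2); split; first exact: num_real.
    move=> y Cy t _ /=; rewrite (le_trans _ (ltW Cy))// normrX.
    by rewrite lerXn2r ?nnegrE//; exact: le_trans (jC t).
have [C C0 hC] := sobolev_jump_sum al1 nu_fin c0.
pose A (i j : I) : R := (i == j)%:R * (C * M0 ^+ 2 * #|I|%:R).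
have AE x : quad_form A x = C * M0 ^+ 2 * #|I|%:R * \sum_p x p ^+ 2.
  rewrite /quad_form mulr_sumr; apply: eq_bigr => i _.
  rewrite (bigD1 i)//= big1 ?addr0; last by move=> j ji; rewrite /A eq_sym (negbTE ji) !mul0r.
  by rewrite /A eqxx mul1r expr2.
apply: (@le_lt_trans _ _ (\sum_(k <oo) (quad_form A (fun p => ipL2 Om (g p) (e k)))%:E)%E).
  apply: lee_nneseries => k _.
    move=> _.
    rewrite /sobolev_norm2; apply: adde_ge0; apply: integral_ge0 => t _; first by rewrite lee_fin sqr_ge0.
    by apply: integral_ge0 => s _; rewrite lee_fin divr_ge0 ?sqr_ge0 ?powR_ge0.
  rewrite (_ : (fun t => _) = jump_sum (comb q (fun p => ipL2 Om (g p) (e k)))); last first.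
    by apply/funext => t; exact: coefficientE.
  set x := (fun p : I => _).
  apply: le_trans (hC b _ (\sum_p `|x p| * M0) (is_density_comb dq x) _) _.
    move=> a; apply: le_trans (ler_norm_sum _ _ _) _.
    by apply: ler_sum => p _; rewrite normrM ler_wpM2l.
  rewrite lee_fin AE -mulr_suml exprMn.
  have -> : C * M0 ^+ 2 * #|I|%:R * \sum_p x p ^+ 2 = C * ((#|I|%:R * \sum_p x p ^+ 2) * M0 ^+ 2) by ring.
  by rewrite ler_wpM2l// ler_wpM2r ?sqr_ge0.
rewrite (gram_form_series mOm He Lg) ?ltry// => x.
rewrite AE !mulr_ge0 ?sqr_ge0//.
by apply: sumr_ge0 => p _; exact: sqr_ge0.
Qed.

End FiniteRankNorms.

(** * Piecewise smooth functions as jump sums *)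

Section NodalMeasure.
Context {R : realType}.
Local Notation mu := (@lebesgue_measure R).
Local Notation MR := (measurableTypeR R).
Variables (T : R) (T0 : 0 < T) (n : nat) (t : nat -> R).

(** Piecewise smooth functions with jumps at the nodes are jump sums for this
    measure. Its absolutely continuous part has total mass 1, whence the factor T
    in the densities below. *)
Definition nodal_measure : set MR -> \bar R :=
  measure_add (uniform_prob T0) (msum (fun j => @dirac _ MR (t j) R) n).

HB.instance Definition _ := Measure.on nodal_measure.

Lemma nodal_measure_fin : (nodal_measure setT < +oo)%E.
Proof.
rewrite /nodal_measure measure_addE /msum; apply: lte_add_pinfty.
  by apply: le_lt_trans (ltry 1); rewrite le_eqVlt; apply/orP; left; apply/eqP; exact: (probability_setT (uniform_prob T0)).
apply: (@le_lt_trans _ _ (\sum_(k < n) 1)%E); last by rewrite sumEFin ltry.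
by apply: lee_sum => k _; exact: (@probability_le1 _ _ _ (@dirac _ MR (t k) R)).
Qed.

Let nodal_sigma_finite : sigma_finite setT nodal_measure.
Proof.
exists (fun=> setT); first by rewrite bigcup_const.
by move=> _; split => //; exact: nodal_measure_fin.
Qed.

HB.instance Definition _ := Measure_isSigmaFinite.Build _ _ _ nodal_measure nodal_sigma_finite.

Let split_affine (a b p r s y : R) : a = s + p -> b + a = y + s + (r + p) -> b = y + r.
Proof. lra. Qed.

Let mI : measurable (`[0, T]%classic : set MR). Proof. exact: measurable_itv. Qed.

Let ge0_integral_nodal (f : R -> R) : measurable_fun [set: MR] f -> (forall x, 0 <= f x) ->
  (\int[nodal_measure]_x (f x)%:E =
   T^-1%:E * \int[mu]_(x in `[0%R, T]) (f x)%:E + (\sum_(j < n) f (t j))%:E)%E.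
Proof.
move=> mf f0; have mEf : measurable_fun [set: MR] (EFin \o f) by exact/measurable_EFinP.
have f0' (x : R) : [set: R] x -> (0 <= (f x)%:E)%E by move=> _; rewrite lee_fin.
apply: (etrans (@ge0_integral_measure_add _ _ R (uniform_prob T0)
  (msum (fun j => @dirac _ MR (t j) R) n) setT measurableT (EFin \o f) f0' mEf)).
rewrite [X in (_ + X)%E](@ge0_integral_measure_sum _ _ R (fun j => @dirac _ MR (t j) R) setT measurableT (EFin \o f) f0' mEf).
rewrite (integral_uniform T0 mEf); last by move=> x; rewrite lee_fin.
rewrite subr0; congr (_ + _)%E; rewrite -sumEFin; apply: eq_bigr => j _.
by rewrite integral_dirac// diracT mul1e.
Qed.

Lemma Rintegral_nodal (f : R -> R) (M : R) : measurable_fun [set: MR] f -> (forall x, `|f x| <= M) ->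
  \int[nodal_measure]_x f x = T^-1 * \int[mu]_(x in `[0, T]) f x + \sum_(j < n) f (t j).
Proof.
move=> mf fM; have M0 : 0 <= M by exact: le_trans (fM 0).
pose D : set R := `[0, T]%classic.
have muI : (mu D < +oo)%E.
  have mE := @lebesgue_measure_itv R `[0, T]; rewrite [X in (X < _)%E]mE /=.
  by case: ifP => _; exact: ltry.
have bI (h : R -> R) (K : R) : measurable_fun [set: MR] h -> (forall x, `|h x| <= K) ->
    mu.-integrable `[0, T]%classic (EFin \o h).
  move=> mh hK; apply: measurable_bounded_integrable => //; first exact: measurable_funTS.
  by exists K; split; [exact: num_real|move=> y Ky x _; rewrite /= (le_trans (hK x))// ltW].
have key (h : R -> R) (K : R) : measurable_fun [set: MR] h -> (forall x, 0 <= h x) -> (forall x, `|h x| <= K) ->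
    \int[nodal_measure]_x h x = T^-1 * \int[mu]_(x in `[0, T]) h x + \sum_(j < n) h (t j).
  move=> mh h0 hK; rewrite /Rintegral (ge0_integral_nodal mh h0).
  rewrite -[X in (_ * X + _)%E]fineK; first by rewrite -EFinM -EFinD.
  by apply: integrable_fin_num (bI _ _ mh hK).
have mg : measurable_fun [set: MR] (fun x => f x + M) by exact: measurable_funD.
have g0 x : 0 <= f x + M by have := fM x; rewrite ler_norml => /andP[]; lra.
have gM x : `|f x + M| <= M + M.
  by rewrite (le_trans (ler_normD _ _))// lerD// ger0_norm.
have mc : measurable_fun [set: MR] (fun _ : R => M) by exact: measurable_cst.
have cM (x : R) : `|M| <= M by rewrite ger0_norm.
have := key _ _ mg g0 gM; have := key _ _ mc (fun=> M0) cM.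
have nui := @integrable_bounded R nodal_measure nodal_measure_fin.
rewrite (RintegralD measurableT (nui _ _ mf fM) (nui _ _ mc cM)).
rewrite (RintegralD mI (bI _ _ mf fM) (bI _ _ mc cM)) big_split/= mulrDr.
exact: split_affine.
Qed.

(** A C^1 function on [a, b[, extended by zero, is the jump sum of its
    derivative and of its two jumps. *)
Definition cell_density (f f' : R -> R) (a b x : R) : R :=
  T * f' x * \1_(`]a, b[%classic) x + f a * (x == a)%:R - f b * (x == b)%:R.

Hypothesis t_inj : forall i j, (i < n)%N -> (j < n)%N -> t i = t j -> i = j.

Let sum_node (i : nat) (c : R -> R) : (i < n)%N ->
  \sum_(j < n) (c (t j) * (t j == t i)%:R) = c (t i).
Proof.
move=> ni; rewrite (bigD1 (Ordinal ni))//= eqxx mulr1 big1 ?addr0// => j ji.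
rewrite (_ : (t j == t i) = false) ?mulr0//; apply/negbTE; apply: contra ji => /eqP h.
by apply/eqP/val_inj => /=; exact: t_inj.
Qed.

Let eq_indic1 (c x : R) : (x == c)%:R = \1_[set c] x :> R.
Proof.
rewrite indicE; have [->|xc] := eqVneq x c; first by rewrite mem_set.
by rewrite memNset//=; exact/eqP.
Qed.

Section Cell.
Variables (f f' : R -> R) (i k : nat).
Hypotheses (ni : (i < n)%N) (nk : (k < n)%N).
Hypotheses (ik : t i < t k) (i0 : 0 <= t i) (kT : t k <= T).
Hypothesis cell : forall j, (j < n)%N -> ~~ (t i < t j < t k).
Hypothesis df : forall x : R, is_derive x 1 f (f' x).
Hypothesis cf' : continuous f'.

Let mf' : measurable_fun [set: MR] f'. Proof. exact: continuous_measurable_fun. Qed.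

Let meq (c : R) : measurable_fun [set: MR] (fun x : R => (x == c)%:R : R).
Proof.
rewrite (_ : (fun x => _) = \1_[set c]); first by apply: measurable_indic; exact: measurable_set1.
by apply/funext => x; exact: eq_indic1.
Qed.

Lemma is_density_cell : is_density (t k) (cell_density f f' (t i) (t k)).
Proof.
split.
- apply: measurable_funB; first apply: measurable_funD.
  + apply: measurable_funM; first exact: measurable_funM.
    by apply: measurable_indic; exact: measurable_itv.
  + by apply: measurable_funM => //; exact: meq.
  + by apply: measurable_funM => //; exact: meq.
- have h : {within `[t i, t k], continuous (fun x => `|f' x|)}.
    apply: continuous_subspaceT => x; apply: continuous_comp; first exact: cf'.
    exact: norm_continuous.
  have [c _ hc] := EVT_max (ltW ik) h.
  exists (T * `|f' c| + `|f (t i)| + `|f (t k)|) => x.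
  apply: le_trans (ler_normB _ _) _; apply: lerD; last first.
    by rewrite normrM -[leRHS]mulr1 ler_wpM2l//; case: (_ == _); rewrite ?normr1 ?normr0.
  apply: le_trans (ler_normD _ _) _; apply: lerD; last first.
    by rewrite normrM -[leRHS]mulr1 ler_wpM2l//; case: (_ == _); rewrite ?normr1 ?normr0.
  rewrite indicE; case: (boolP (x \in _)) => [|_]; last first.
    by rewrite /= mulr0 normr0 mulr_ge0// ltW.
  move=> /set_mem; rewrite /= in_itv/= => /andP[ix xk].
  rewrite mulr1 normrM (gtr0_norm T0) ler_wpM2l ?(ltW T0)//.
  by apply: hc; rewrite in_itv/= !ltW.
- move=> x; rewrite /cell_density indicE mem_setE in_itv/= => xT.
  have -> : (t i < x < t k) = false.
    by apply/negbTE; apply: contra xT => /andP[h1 h2]; rewrite (le_trans i0 (ltW h1)) ltW.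
  have -> : (x == t i) = false by apply/negbTE; apply: contra xT => /eqP ->; rewrite i0 ltW.
  have -> : (x == t k) = false.
    by apply/negbTE; apply: contra xT => /eqP ->; rewrite lexx (le_trans i0 (ltW ik)).
  by rewrite !mulr0 addr0 subr0.
Qed.

(** The jumps at the two ends switch f on and off; in between, the fundamental
    theorem of calculus applies. *)
Lemma jump_sum_cell x :
  jump_sum nodal_measure (cell_density f f' (t i) (t k)) x = if t i <= x < t k then f x else 0.
Proof.
have [mq [M qM] _] := is_density_cell.
set q := cell_density _ _ _ _ in mq qM *.
have mx : measurable_fun [set: MR] (fun a => q a * \1_(`]-oo, x]%classic) a).
  by apply: measurable_funM => //; exact: measurable_indic.
have M0 : 0 <= M by exact: le_trans (qM 0).
have bx a : `|q a * \1_(`]-oo, x]%classic) a| <= M.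
  rewrite normrM indicE; case: (_ \in _); first by rewrite /= normr1 mulr1.
  by rewrite /= normr0 mulr0.
rewrite /jump_sum (Rintegral_nodal mx bx).
have -> : \sum_(j < n) (q (t j) * \1_(`]-oo, x]%classic) (t j)) =
    f (t i) * ((t i <= x)%R)%:R - f (t k) * ((t k <= x)%R)%:R.
  rewrite -(@sum_node i (fun s => f (t i) * ((s <= x)%R)%:R))// -(@sum_node k (fun s => f (t k) * ((s <= x)%R)%:R))//.
  rewrite -sumrB; apply: eq_bigr => j _; rewrite /q /cell_density !indicE !mem_setE !in_itv/=.
  have := negbTE (cell (ltn_ord j)) => ->; rewrite mulr0 add0r mulrBl.
  by rewrite -!mulrA; congr (_ * _ - _ * _); exact: mulrC.
have I1 (y : R) : t i <= y -> y <= t k ->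
    \int[mu]_(s in `[t i, y]) (T * f' s) = T * (f y - f (t i)).
  move=> iy yk; rewrite RintegralZl//.
    by rewrite /Rintegral (integral_derive iy (fun s _ => df s) (fun s _ => @cf' s)).
  apply: continuous_compact_integrable; first exact: segment_compact.
  exact: continuous_subspaceT.
have restr (y : R) : t i <= y -> y <= t k -> (forall s : R, s < t k -> (s <= x) = (s <= y)) ->
    \int[mu]_(s in `[0, T]) (q s * \1_(`]-oo, x]%classic) s) = \int[mu]_(s in `[t i, y]) (T * f' s).
  move=> iy yk sy; rewrite Rintegral_mkcond [RHS]Rintegral_mkcond; apply: Rintegral_ae_eq_any.
  have := ae_lebesgue_neq (t i); have := ae_lebesgue_neq (t k); apply: filterS2 => s sk si _.
  rewrite !patchE !mem_setE !in_itv/= /q /cell_density (negbTE si) (negbTE sk) !mulr0 addr0 subr0.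
  rewrite !indicE !mem_setE !in_itv/=.
  have [si'|si'] := leP (t i) s; last first.
    by rewrite ltNge (ltW si')/= mulr0 mul0r; case: ifP.
  have isl : t i < s by rewrite lt_neqAle eq_sym si.
  rewrite isl (le_trans i0 si')/=.
  have [sk'|sk'] := ltP s (t k); last first.
    rewrite mulr0 mul0r (_ : (s <= y) = false); first by case: ifP.
    apply/negbTE; rewrite -ltNge (le_lt_trans yk)// lt_neqAle sk'.
    by rewrite eq_sym sk.
  rewrite (ltW (lt_le_trans sk' kT)) mulr1 (sy s sk').
  by case: ifP => _; rewrite ?mulr1 ?mulr0.
have TT (y : R) : T^-1 * (T * y) = y by rewrite mulKf// gt_eqF.
have [xi|xi] := ltP x (t i).
  rewrite (_ : Rintegral _ _ _ = 0); last first.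
    rewrite Rintegral_mkcond (_ : _ \_ _ = fun=> 0); first by rewrite Rintegral_cst// mul0r.
    apply/funext => s; rewrite patchE; case: ifP => // _.
    rewrite indicE mem_setE in_itv/=; case: leP => [sx|_]; last by rewrite mulr0.
    rewrite mulr1 /q /cell_density indicE mem_setE in_itv/=.
    have si := le_lt_trans sx xi.
    by rewrite [t i < s]ltNge (ltW si) (lt_eqF si) (lt_eqF (lt_trans si ik)) /= !mulr0 addr0 subr0.
  by rewrite [t k <= x]leNgt (lt_trans xi ik)/= !mulr0 subr0 addr0.
have [xk|xk] := ltP x (t k).
  rewrite (restr x xi (ltW xk))// (I1 x xi (ltW xk)) TT mulr1 mulr0 subr0; ring.
rewrite (restr (t k) (ltW ik) (lexx _)); last by move=> s sk; rewrite (le_trans (ltW sk) xk) (ltW sk).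
by rewrite (I1 (t k) (ltW ik) (lexx _)) TT !mulr1; ring.
Qed.

Lemma mass_cell : \int[nodal_measure]_a cell_density f f' (t i) (t k) a = 0.
Proof.
have := jump_sum_cell T; rewrite ltNge kT andbF => <-.
apply: eq_Rintegral => a _; rewrite indicE mem_setE in_itv/=.
have [_ _ h] := is_density_cell.
have [aT|aT] := leP a T; first by rewrite mulr1.
by rewrite mulr0 h// negb_and -!ltNge (le_lt_trans kT aT) orbT.
Qed.

End Cell.

Hypotheses (n0 : (0 < n)%N) (t0 : t 0%N = 0).

Let eq0_bound (a : R) : `|(a == 0)%:R| <= 1 :> R.
Proof. by case: (_ == _); rewrite ?normr1 ?normr0. Qed.

(** The unit mass at the origin represents the constant 1. *)
Lemma is_density_origin : is_density T (fun a => (a == 0)%:R).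
Proof.
split.
- rewrite (_ : (fun x => _) = \1_[set 0]); first by apply: measurable_indic; exact: measurable_set1.
  by apply/funext => x; exact: eq_indic1.
- by exists 1 => a; exact: eq0_bound.
- by move=> a; case: eqP => // ->; rewrite lexx ltW.
Qed.

Let Rintegral_origin (k : R -> R) : \int[nodal_measure]_a ((a == 0)%:R * k a) = k 0.
Proof.
have [mo _ _] := is_density_origin.
have E : (fun a : R => (a == 0)%:R * k a) = (fun a : R => k 0 * (a == 0)%:R).
  by apply/funext => a; case: eqP => [->|_]; rewrite ?mul1r ?mulr1 ?mul0r ?mulr0.
rewrite E (@Rintegral_nodal _ (`|k 0|)); last 2 first.
- exact: measurable_funM.
- by move=> a; rewrite normrM -[leRHS]mulr1 ler_wpM2l.
have -> : \sum_(j < n) (k 0 * (t j == 0)%:R) = k 0.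
  by have := @sum_node 0 (fun=> k 0) n0; rewrite t0.
rewrite (_ : Rintegral _ _ _ = 0) ?mulr0 ?add0r//.
transitivity (\int[mu]_(x in `[0, T]) (fun=> 0 : R) x); last by rewrite Rintegral_cst// mul0r.
apply: Rintegral_ae_eq_any; have := ae_lebesgue_neq (0 : R); apply: filterS => x x0 _.
by rewrite (negbTE x0) mulr0.
Qed.

Lemma jump_sum_origin x : 0 <= x -> jump_sum nodal_measure (fun a => (a == 0)%:R) x = 1.
Proof. by move=> x0; rewrite /jump_sum Rintegral_origin indicE mem_setE in_itv/= x0. Qed.

Lemma frac_plus_origin al x : frac_plus nodal_measure al (fun a => (a == 0)%:R) x = kpow al x.
Proof. by rewrite /frac_plus (Rintegral_origin (fun a => kpow al (x - a))) subr0. Qed.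

End NodalMeasure.

(** * Coercivity of the fractional pairing *)

Section Coercivity.
Context {R : realType} {d : nat}.
Local Notation E := 'rV[R]_d.
Local Notation mu := (@lebesgue_measure R).
Local Notation MR := (measurableTypeR R).
Variable al : R.
Hypotheses (al0 : 0 < al) (al1 : 2 * al < 1).

Definition start_const : R := fine (\int[mu]_t (kpow (2 * al) t * \1_(`]-oo, 1%R]%classic) t)%:E)%E.

Lemma start_const_ge0 : 0 <= start_const.
Proof.
rewrite fine_ge0//; apply: integral_ge0 => t _.
by rewrite lee_fin mulr_ge0 ?kpow_ge0// indicE; case: (_ \in _).
Qed.

(** Scaling. *)
Lemma integral_kpow_start (b : R) : 0 < b ->
  (\int[mu]_t (kpow (2 * al) t * \1_(`]-oo, b]%classic) t)%:E =
    (start_const * b `^ (1 - 2 * al))%:E)%E.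
Proof.
move=> b0; pose f (t : R) := (kpow (2 * al) t * \1_(`]-oo, b]%classic) t)%:E.
have mf : measurable_fun [set: R] f.
  apply/measurable_EFinP; apply: measurable_funM; first exact: measurable_kpow.
  by apply: measurable_indic; exact: measurable_itv.
have f0 x : (0 <= f x)%E by rewrite lee_fin mulr_ge0 ?kpow_ge0// indicE; case: (_ \in _).
rewrite -(ge0_integral_affine 0 b0 mf f0).
have -> : (\int[mu]_x f (0 + b * x)%R = (b `^ (- (2 * al)))%:E *
    \int[mu]_t (kpow (2 * al) t * \1_(`]-oo, 1%R]%classic) t)%:E)%E.
  rewrite -ge0_integralZl//.
  - apply: eq_integral => x _; rewrite /f add0r kpowM// -EFinM -mulrA; congr (_ * (_ * _))%:E.
    by rewrite !indicE !mem_setE !in_itv/= -{2}[b]mulr1 ler_pM2l.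
  - apply/measurable_EFinP; apply: measurable_funM; first exact: measurable_kpow.
    by apply: measurable_indic; exact: measurable_itv.
  - by move=> x _; rewrite lee_fin mulr_ge0 ?kpow_ge0// indicE; case: (_ \in _).
  - by rewrite lee_fin powR_ge0.
have h : (\int[mu]_t (kpow (2 * al) t * \1_(`]-oo, 1%R]%classic) t)%:E < +oo)%E.
  exact: integral_kpow_window.
have <- : (start_const%:E = \int[mu]_t (kpow (2 * al) t * \1_(`]-oo, 1%R]%classic) t)%:E)%E.
  rewrite /start_const fineK// ge0_fin_numE//; apply: integral_ge0 => t _.
  by rewrite lee_fin mulr_ge0 ?kpow_ge0// indicE; case: (_ \in _).
rewrite -!EFinM; congr EFin; rewrite mulrA mulrC; congr (_ * _).
rewrite -{1}[b]powRr1 ?(ltW b0)// -powRD//; apply/implyP => _; exact: lt0r_neq0.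
Qed.

Variable Om : set E.
Hypothesis mOm : measurable Om.
Variable e : nat -> E -> R.
Hypothesis He : orthonormal_basis_L2 Om e.
Variable nu : {sigma_finite_measure set MR -> \bar R}.
Hypothesis nu_fin : (nu setT < +oo)%E.
Variables (b T : R).
Hypotheses (b0 : 0 < b) (bT : b <= T).
Variables (I : finType) (q q' : I -> R -> R) (g : I -> E -> R).
Hypothesis dq : forall p, is_density T (q p).
Hypothesis dq' : forall p, is_density b (q' p).
Hypothesis q'0 : forall p, \int[nu]_a q' p a = 0.
Hypothesis q'E : forall p a, a < b -> q' p a = q p a.
Hypothesis Lg : forall p, L2 Om (g p).
Local Notation jump_sum := (jump_sum nu).
Local Notation frac_plus := (frac_plus nu al).
Local Notation frac_minus := (frac_minus nu al).
Local Notation G := (gram_form Om g (plus_minus_form nu al T q')).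

Let frac_minus0 p t : b <= t -> frac_minus (q' p) t = 0.
Proof.
move=> bt; rewrite /frac_minus (_ : Rintegral _ _ _ = 0) ?oppr0//.
rewrite -[RHS](mul0r (fine (nu setT))) -(Rintegral_cst nu measurableT 0).
apply: eq_Rintegral => a _.
have [ab|ba] := leP a b; first by rewrite kpow0 ?mulr0// subr_le0 (le_trans ab).
by have [_ _ ->] := dq' p; rewrite ?mul0r// negb_and -!ltNge ba orbT.
Qed.

Let frac_plusE p t : t < b -> frac_plus (q p) t = frac_plus (q' p) t.
Proof.
move=> tb; apply: eq_Rintegral => a _.
have [ta|at_] := leP t a; first by rewrite kpow0 ?mulr0// subr_le0.
by rewrite q'E// (lt_trans at_).
Qed.

Let mD (a c : R) : measurable (`]a, c[%classic : set MR).
Proof. exact: measurable_itv. Qed.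

Variables (o : R -> R) (z : E -> R).
Hypotheses (do : is_density T o) (Lz : L2 Om z).
Hypothesis jo : forall t, 0 <= t -> jump_sum o t = 1.
Hypothesis fo : forall t, frac_plus o t = kpow al t.

Let Y := finite_rank (fun p => frac_minus (q' p)) g.

Let LY t : L2 Om (Y t). Proof. exact: L2_finite_rank. Qed.

Let dq'T p : is_density T (q' p). Proof. exact: is_density_widen bT (dq' p). Qed.

Let young (k x y K : R) : 0 < K -> k * (x * y) <= K / 2 * x ^+ 2 * k ^+ 2 + (2 * K)^-1 * y ^+ 2.
Proof.
move=> K0; have := sqr_ge0 (K * x * k - y); rewrite sqrrB => h.
rewrite -(ler_pM2l (_ : 0 < 2 * K)); last by rewrite mulr_gt0.
have -> : 2 * K * (K / 2 * x ^+ 2 * k ^+ 2 + (2 * K)^-1 * y ^+ 2) = (K * x * k) ^+ 2 + y ^+ 2.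
  by field; rewrite gt_eqF.
have -> : 2 * K * (k * (x * y)) = K * x * k * y *+ 2 by ring.
by rewrite -subr_ge0; move: h; lra.
Qed.

(** The data term carries the singular kernel of a constant, which is square
    integrable because 2 al < 1. *)
Lemma initial_velocity_le (K : R) : 0 < K ->
  \int[mu]_(t in `]0, T[) (kpow al t * ipL2 Om z (Y t)) <=
  K / 2 * start_const * (b `^ (1 - 2 * al) * normL2 Om z ^+ 2) +
  (2 * K)^-1 * (increment_const al / beta_const al * G).
Proof.
move=> K0.
have i1 : mu.-integrable `]0, T[%classic (fun t => (kpow al t * ipL2 Om z (Y t))%:E).
  have E1 : (fun t => (kpow al t * ipL2 Om z (Y t))%:E) =
      (fun t => (\sum_p ipL2 Om (g p) z * (frac_plus o t * frac_minus (q' p) t))%:E).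
    apply/funext => t; congr EFin; rewrite ipL2C ipL2_suml// fo mulr_sumr.
    apply: eq_bigr => p _; move: (kpow al t) (frac_minus (q' p) t) (ipL2 Om (g p) z) => k m s.
    by ring.
  rewrite E1; apply: (integrable_sumR (mD 0 T)) => p; apply: (integrable_scaleR (mD 0 T)).
  have := @integrable_frac_plus_minus R nu nu_fin al al1 T unit I (fun=> o) q' (fun=> do) dq'T tt p.
  exact.
have [i3 le3] := integral_minus_sqr_le mOm He nu_fin al0 al1 bT dq' q'0 Lg.
pose P (t : R) := kpow (2 * al) t * \1_(`]-oo, b]%classic) t.
have P0 t : 0 <= P t by rewrite mulr_ge0 ?kpow_ge0// indicE; case: (_ \in _).
have mP : measurable_fun [set: R] P.
  by apply: measurable_funM; [exact: measurable_kpow|apply: measurable_indic; exact: measurable_itv].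
have leP' : (\int[mu]_(t in `]0%R, T[) (P t)%:E <= (start_const * b `^ (1 - 2 * al))%:E)%E.
  rewrite -integral_kpow_start//; apply: ge0_subset_integral => //.
  - by apply/measurable_EFinP.
  - by move=> t _; rewrite lee_fin.
have i2 : mu.-integrable `]0, T[%classic (fun t => (P t)%:E).
  apply/integrableP; split; first by apply/measurable_EFinP; exact: measurable_funTS.
  apply: le_lt_trans (ltry (start_const * b `^ (1 - 2 * al))).
  by apply: le_trans leP'; rewrite le_eqVlt; apply/orP; left; apply/eqP; apply: eq_integral => t _; rewrite gee0_abs ?lee_fin.
have le2 : \int[mu]_(t in `]0, T[) P t <= start_const * b `^ (1 - 2 * al).
  rewrite -lee_fin /Rintegral fineK//; exact: integrable_fin_num.
apply: (@le_trans _ _ (\int[mu]_(t in `]0, T[)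
   (K / 2 * normL2 Om z ^+ 2 * P t + (2 * K)^-1 * ipL2 Om (Y t) (Y t)))).
  apply: le_Rintegral => //.
  - apply: (integrable_addR (mD 0 T)); apply: (integrable_scaleR (mD 0 T)); [exact: i2|exact: i3].
  - move=> t _; have [tb|bt] := ltP t b.
      rewrite /P -kpow_sqr indicE mem_setE in_itv/= (ltW tb) mulr1 -normL2_sqr.
      apply: le_trans (young _ _ _ K0).
      rewrite ler_wpM2l ?kpow_ge0//; apply: le_trans (ler_norm _) _; exact: ipL2_CS.
    have Y0 h : L2 Om h -> ipL2 Om (Y t) h = 0.
      by move=> Lh; rewrite ipL2_suml// big1// => p _; rewrite frac_minus0// mul0r.
    rewrite (ipL2C _ z) !Y0// !mulr0 addr0 !mulr_ge0 ?invr_ge0 ?normL2_ge0 ?kpow_ge0//; exact: ltW.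
rewrite (RintegralD (mD 0 T) (integrable_scaleR (mD 0 T) _ i2) (integrable_scaleR (mD 0 T) _ i3)).
rewrite (RintegralZl _ (mD 0 T) i2) (RintegralZl _ (mD 0 T) i3).
apply: lerD; last by rewrite ler_wpM2l// invr_ge0 mulr_ge0// ltW.
have -> : K / 2 * start_const * (b `^ (1 - 2 * al) * normL2 Om z ^+ 2) =
   K / 2 * normL2 Om z ^+ 2 * (start_const * b `^ (1 - 2 * al)) by ring.
rewrite ler_wpM2l// mulr_ge0 ?sqr_ge0//.
by rewrite divr_ge0 ?ltW.
Qed.

Definition coercivity_const : R := 2^-1 * (Gamma (1 - al)) ^- 2.

Definition velocity_const : R :=
  coercivity_const * (increment_const al / beta_const al * start_const).

Let sum_unit (F : unit -> R) : \sum_(i : unit) F i = F tt.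
Proof. by rewrite (big_pred1 tt)//; case. Qed.

Let pairing_lower (c g0 A s : R) : 0 <= c -> s <= 2^-1 * A + 2^-1 * g0 ->
  2^-1 * c * g0 - 2^-1 * c * A <= c * (g0 - s).
Proof. by move=> c0 h; have := ler_wpM2l c0 h; lra. Qed.

(** Truncating the second argument at time b leaves the values of the first
    one after time b without effect, the kernels being causal and anticausal. *)
Lemma fracD_pairing_coercive (v w : R -> E -> R) :
  {ae mu, forall t, `]0, T[%classic t ->
     eqL2 Om (v t) (fun x => finite_rank (fun p => jump_sum (q p)) g t x - z x)} ->
  {ae mu, forall t, `]0, T[%classic t -> eqL2 Om (w t) (finite_rank (fun p => jump_sum (q' p)) g t)} ->
  coercivity_const * G - velocity_const * (b `^ (1 - 2 * al) * normL2 Om z ^+ 2)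
    <= fracD_pairing Om al T v w.
Proof.
move=> vE wE; have T0 := lt_le_trans b0 bT.
pose r (s : unit + I) := if s is inr p then q p else o.
pose h (s : unit + I) := if s is inr p then g p else (fun x => -1 * z x).
have dr s : is_density T (r s) by case: s.
have Lh s : L2 Om (h s) by case: s => //= _; exact: L2Z.
have vE' : {ae mu, forall t, `]0, T[%classic t ->
    eqL2 Om (v t) (finite_rank (fun s => jump_sum (r s)) h t)}.
  apply: filterS vE => t vt /[dup] + tT; rewrite /= in_itv/= => /andP[t0 _].
  have := vt tT; congr (eqL2 Om _ _); apply/funext => x.
  by rewrite /finite_rank big_sumType/= sum_unit/= jo ?(ltW t0)// mul1r mulN1r addrC.
rewrite (fracD_pairing_finite_rank mOm He nu_fin al0 al1 T0 dr Lh dq'T Lg q'0 vE' wE).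
have mixed i j : \int[mu]_(t in `]0, T[) (frac_plus (q i) t * frac_minus (q' j) t) =
    plus_minus_form nu al T q' i j.
  apply: eq_Rintegral => t _; have [tb|bt] := ltP t b; first by rewrite frac_plusE.
  by rewrite frac_minus0// !mulr0.
rewrite big_sumType/= sum_unit/=.
have -> : \sum_i \sum_j (\int[mu]_(t in `]0, T[) (frac_plus (q i) t * frac_minus (q' j) t)) *
    ipL2 Om (g i) (g j) = G.
  by rewrite /gram_form; apply: eq_bigr => i _; apply: eq_bigr => j _; rewrite mixed.
have -> : \sum_j (\int[mu]_(t in `]0, T[) (frac_plus o t * frac_minus (q' j) t)) *
    ipL2 Om (fun x => -1 * z x) (g j) = - \int[mu]_(t in `]0, T[) (kpow al t * ipL2 Om z (Y t)).
  have ij p : mu.-integrable `]0, T[%classic (fun t => (frac_plus o t * frac_minus (q' p) t)%:E).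
    have := @integrable_frac_plus_minus R nu nu_fin al al1 T unit I (fun=> o) q' (fun=> do) dq'T tt p.
    exact.
  transitivity (- \sum_j ipL2 Om (g j) z * \int[mu]_(t in `]0, T[) (frac_plus o t * frac_minus (q' j) t)).
    rewrite -sumrN; apply: eq_bigr => j _; rewrite ipL2Zl// (ipL2C _ z); ring.
  congr (- _).
  transitivity (\sum_j \int[mu]_(t in `]0, T[) (ipL2 Om (g j) z * (frac_plus o t * frac_minus (q' j) t))).
    by apply: eq_bigr => j _; rewrite (RintegralZl _ (mD 0 T) (ij j)).
  rewrite -(@Rintegral_sum _ _ _ mu _ (mD 0 T) _ _ _ (fun j => integrable_scaleR (mD 0 T) _ (ij j))).
  apply: eq_Rintegral => t _; rewrite ipL2C ipL2_suml// fo mulr_sumr.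
  by apply: eq_bigr => p _; ring.
have K0 : 0 < increment_const al / beta_const al.
  by rewrite divr_gt0 ?increment_const_gt0 ?beta_const_gt0.
have := initial_velocity_le K0.
rewrite addrC /velocity_const /coercivity_const.
move: (\int[mu]_(t in `]0, T[) _) (b `^ _ * _) (increment_const al / _) K0 => s B K K0.
rewrite (_ : (2 * K)^-1 * (K * G) = 2^-1 * G); last by field; rewrite gt_eqF.
rewrite (_ : K / 2 * start_const * B = 2^-1 * (K * start_const * B)); last by field.
move=> hs; apply: le_trans (pairing_lower _ hs).
  by rewrite -!mulrA.
by rewrite invr_ge0 sqr_ge0.
Qed.

End Coercivity.

(** * The dual norm on a shorter interval *)

Lemma integrable_bounded_sqr (R : realType) (f : R -> R) (M c : R) :
  measurable_fun [set: measurableTypeR R] f -> (forall t, `|f t| <= M) ->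
  (@lebesgue_measure R).-integrable `]0, c[%classic (fun t => (f t ^+ 2)%:E).
Proof.
move=> mf fM; apply: measurable_bounded_integrable.
- exact: measurable_itv.
- by have mE := @lebesgue_measure_itv R `]0, c[; rewrite [X in (X < _)%E]mE /=; case: ifP => _; exact: ltry.
- by apply: measurable_funTS; exact: measurable_funX.
- exists (M ^+ 2); split; first exact: num_real.
  move=> y My t _ /=; rewrite (le_trans _ (ltW My))// normrX.
  by rewrite lerXn2r ?nnegrE// (le_trans _ (fM t)).
Qed.

Section DualNorm.
Context {R : realType} {d : nat}.
Local Notation E := 'rV[R]_d.
Local Notation mu := (@lebesgue_measure R).
Local Notation MR := (measurableTypeR R).
Variable Om : set E.
Hypothesis mOm : measurable Om.
Variable e : nat -> E -> R.
Hypothesis He : orthonormal_basis_L2 Om e.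
Variable nu : {sigma_finite_measure set MR -> \bar R}.
Hypothesis nu_fin : (nu setT < +oo)%E.
Variable al : R.
Hypotheses (al0 : 0 < al) (al1 : 2 * al < 1).
Variables (b T : R).
Hypotheses (b0 : 0 < b) (bT : b <= T).
Variables (I : finType) (q : I -> R -> R) (g : I -> E -> R).
Hypothesis dq : forall p, is_density b (q p).
Hypothesis q0 : forall p, \int[nu]_a q p a = 0.
Hypothesis Lg : forall p, L2 Om (g p).
Local Notation jump_sum := (jump_sum nu).
Local Notation G := (gram_form Om g (plus_minus_form nu al T q)).

Let mD (a c : R) : measurable (`]a, c[%classic : set MR).
Proof. exact: measurable_itv. Qed.

(** The indicator removes the value at t = 0, so that the function equals its
    own extension by zero from ]0, b[. *)
Definition truncated (t : R) (x : E) : R :=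
  \1_(`]0, b[%classic) t * finite_rank (fun p => jump_sum (q p)) g t x.

Let phi p t := \1_(`]0, b[%classic) t * jump_sum (q p) t.

Let truncated_finite_rank : truncated = finite_rank phi g.
Proof.
apply/funext => t; apply/funext => x; rewrite /truncated /finite_rank mulr_sumr.
by apply: eq_bigr => p _; rewrite mulrA.
Qed.

Lemma jump_sum_after p t : b <= t -> jump_sum (q p) t = 0.
Proof.
move=> bt; rewrite -(q0 p); apply: eq_Rintegral => a _.
rewrite indicE mem_setE in_itv/=; have [_|ta] := leP a t; first by rewrite mulr1.
have [_ _ ->] := dq p; first by rewrite mul0r.
by rewrite negb_and -!ltNge (le_lt_trans bt ta) orbT.
Qed.

Lemma truncatedE t : `]0, T[%classic t ->
  truncated t = finite_rank (fun p => jump_sum (q p)) g t.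
Proof.
rewrite /= in_itv/= => /andP[t0 _]; apply/funext => x.
rewrite /truncated indicE mem_setE in_itv/= t0/=; case: ltP => [_|bt]; first by rewrite mul1r.
by rewrite mul0r /finite_rank big1// => p _; rewrite jump_sum_after// mul0r.
Qed.

Lemma L2t_truncated (c : R) : L2t Om `]0, c[ truncated.
Proof.
rewrite truncated_finite_rank.
have mi : measurable_fun [set: MR] (\1_(`]0, b[%classic) : R -> R).
  by apply: measurable_indic; exact: mD.
have mphi p : measurable_fun [set: MR] (phi p).
  by apply: measurable_funM => //; have := measurable_jump_sum nu (dq p); exact.
apply: (L2t_finite_rank mOm mphi Lg (mD 0 c)) => p.
have [C jC] := jump_sum_bounded nu_fin (dq p).
apply: (integrable_bounded_sqr (M := C)) => // t; rewrite /phi normrM.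
apply: le_trans (jC t); rewrite indicE; case: (_ \in _); first by rewrite normr1 mul1r.
by rewrite normr0 mul0r.
Qed.

Let Le k : L2 Om (e k). Proof. by case: He. Qed.

Lemma Ht_truncated : Ht Om al `]0, T[ e truncated.
Proof.
split; first exact: L2t_truncated.
have [_] := Ht_finite_rank mOm He nu_fin al1 dq Lg (lt_le_trans b0 bT).
have E k : sobolev_norm2 al `]0%R, T[ (fun t => ipL2 Om (truncated t) (e k)) =
    sobolev_norm2 al `]0%R, T[ (fun t => ipL2 Om (finite_rank (fun p => jump_sum (q p)) g t) (e k)).
  by apply: sobolev_norm2_ae; apply: nearW => t tT; rewrite truncatedE.
by under [in X in _ -> X]eq_eseriesr do rewrite E.
Qed.

(** A multiple of the truncated function equals its extension by zero, and is
    admissible in the supremum as soon as its norm is at most 1. *)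
Lemma dual_normHt_multiple (F : (R -> E -> R) -> R) (c : R) :
  dualHt Om al `]0, T[ e F -> 0 <= c -> c * Num.sqrt (energy_ratio al * G) <= 1 ->
  ((c * `|F truncated|)%:E <= dual_normHt Om al `]0%R, b[ e F)%E.
Proof.
move=> [Flin _] c0 cN.
have FZ : F (fun t x => c * truncated t x) = c * F truncated.
  rewrite -[RHS]addr0 -[0](subrr (F truncated)) addrA addrAC.
  rewrite -[X in _ - X]mul1r -mulrBl -(Flin _ _ _ Ht_truncated Ht_truncated).
  by congr F; apply/funext => t; apply/funext => x; rewrite mulrBl mul1r subrK.
pose gc p x := c * g p x.
have Lgc p : L2 Om (gc p) by exact: L2Z.
have Gc : gram_form Om gc (plus_minus_form nu al T q) = c ^+ 2 * G.
  rewrite /gram_form mulr_sumr; apply: eq_bigr => i _; rewrite mulr_sumr.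
  apply: eq_bigr => j _; rewrite ipL2Zl// (ipL2C _ (g i)) ipL2Zl// (ipL2C _ (g j)).
  by rewrite expr2; ring.
apply: ereal_sup_ubound.
exists (finite_rank (fun p => jump_sum (q p)) gc).
  split; first exact: Ht_finite_rank.
  have vE : {ae mu, forall t, `]0, b[%classic t ->
    eqL2 Om (finite_rank (fun p => jump_sum (q p)) gc t) (finite_rank (fun p => jump_sum (q p)) gc t)}.
    by apply: nearW => t _; exact: eqL2_refl.
  rewrite (normHt_finite_rank mOm He nu_fin al0 al1 b0 bT dq q0 Lgc vE) Gc.
  by rewrite lee_fin mulrCA sqrtrM ?sqr_ge0// sqrtr_sqr ger0_norm.
rewrite -[X in X * _](ger0_norm c0) -normrM -FZ; congr (`|F _|%:E).
apply/funext => t; apply/funext => x; rewrite /truncated mulrCA; congr (_ * _).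
by rewrite /finite_rank mulr_sumr; apply: eq_bigr => p _; rewrite mulrCA.
Qed.

Lemma dual_normHt_truncated (F : (R -> E -> R) -> R) (D : R) :
  dualHt Om al `]0, T[ e F -> dual_normHt Om al `]0, b[ e F = D%:E ->
  `|F truncated| <= Num.sqrt (energy_ratio al * G) * D.
Proof.
move=> HF FD; set N := Num.sqrt _.
have scaled c : 0 <= c -> c * N <= 1 -> c * `|F truncated| <= D.
  by move=> c0 cN; rewrite -lee_fin -FD; exact: dual_normHt_multiple.
have N0 : 0 <= N by exact: sqrtr_ge0.
have [Nz|Nn] := eqVneq N 0.
  rewrite Nz mul0r leNgt; apply/negP => F0.
  have := scaled ((`|D| + 1) / `|F truncated|).
  rewrite Nz mulr0 ler01 divr_ge0 ?addr_ge0// divfK ?gt_eqF// => /(_ isT isT) h.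
  have := ler_norm D; move: h; lra.
have Np : 0 < N by rewrite lt_neqAle eq_sym Nn.
have := scaled N^-1; rewrite invr_ge0 N0 mulVf// lexx => /(_ isT isT) h.
by rewrite -ler_pdivrMl.
Qed.

End DualNorm.

(** * Piecewise polynomials on a grid *)

Section AgreementOnClosure.
Context {R : realType}.
Local Notation mu := (@lebesgue_measure R).

Lemma ae_itv_witness (a b : R) (P : R -> Prop) : a < b ->
  {ae mu, forall s, P s} -> exists2 s, a < s < b & P s.
Proof.
move=> ab [N [mN N0 hN]]; apply: contrapT => h.
have abN : `]a, b[%classic `<=` N.
  move=> s; rewrite /= in_itv/= => sab; apply: hN => /= Ps.
  by apply: h; exists s.
have : (mu `]a, b[%classic <= mu N)%E by apply: le_measure => //; rewrite inE//; exact: measurable_itv.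
rewrite N0 leNgt => /negP; apply.
have mE := @lebesgue_measure_itv R `]a, b[; rewrite [X in (_ < X)%E]mE /= lte_fin ab.
by rewrite -EFinB lte_fin subr_gt0.
Qed.

Lemma eq_on_closure (u p : R -> R) (a b : R) : a < b ->
  (forall t, a <= t <= b -> forall eps : R, 0 < eps -> exists2 delta : R, 0 < delta &
    forall s, a <= s <= b -> `|s - t| < delta -> `|u s - u t| < eps) ->
  continuous p -> {ae mu, forall s, `]a, b[%classic s -> u s = p s} ->
  forall t, a <= t <= b -> u t = p t.
Proof.
move=> ab cu cp up t /[dup] tab /andP[at_ tb].
apply/eqP; rewrite -subr_eq0 -normr_le0; apply/ler_addgt0Pr => eps eps0; rewrite add0r.
have e2 : 0 < eps / 2 by rewrite divr_gt0.
have [d1 d10 h1] := cu t tab _ e2.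
have /cvgrPdist_lt /(_ _ e2) := cp t.
move=> /nbhs_ballP[d2 /= d20 h2].
pose dl := Num.min d1 d2.
have dl0 : 0 < dl by rewrite lt_min d10.
have lo : Num.max a (t - dl) < Num.min b (t + dl).
  rewrite lt_min !gt_max ab ltrBlDr /=; apply/and3P; split; first lra.
    by rewrite (le_lt_trans at_)// ltrDl.
  lra.
have [s] := ae_itv_witness lo up.
rewrite gt_max lt_min => /andP[/andP[as_ ts] /andP[sb st]] us.
have std : `|s - t| < dl by rewrite ltr_norml; apply/andP; split; lra.
have us' := us _; rewrite /= in_itv/= as_ sb in us'; have {}us' := us' isT.
have := h1 s; rewrite (ltW as_) (ltW sb) => /(_ isT); rewrite us' => /(_ _) h1'.
have {}h1' := h1' (lt_le_trans std _); have hd1 : dl <= d1 by rewrite ge_min lexx.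
have := h1' hd1; have := h2 s; rewrite /ball/= distrC.
move=> /(_ (lt_le_trans std _)) h; have hd2 : dl <= d2 by rewrite ge_min lexx orbT.
have := h hd2.
move: (p s) (p t) (u t) => x y z; rewrite !ltr_norml ler_norml => /andP[? ?] /andP[? ?].
by apply/andP; split; lra.
Qed.

End AgreementOnClosure.

Section PiecewisePrimitive.
Context {R : realType}.
Local Notation mu := (@lebesgue_measure R).
Local Notation MR := (measurableTypeR R).
Variables (s : nat -> R) (J : nat).
Hypothesis s0 : s 0%N = 0.
Hypothesis s_lt : forall l, (l < J)%N -> s l < s l.+1.

Lemma grid_le l k : (l <= k)%N -> (k <= J)%N -> s l <= s k.
Proof.
elim: k => [|k IH]; first by rewrite leqn0 => /eqP ->.
rewrite leq_eqVlt => /predU1P[-> //|lk kJ].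
by rewrite (le_trans (IH lk (ltnW kJ)))// ltW// s_lt.
Qed.

Lemma grid_cell t : 0 <= t -> t < s J -> exists2 l, (l < J)%N & s l <= t < s l.+1.
Proof.
move=> t0; have : s 0%N <= t by rewrite s0.
elim: J s_lt => [|k IH] slt st tk; first by rewrite ltNge st in tk.
have [kt|tk'] := leP (s k) t; first by exists k => //; rewrite kt.
have [|l lk h] := IH _ st tk'; first by move=> l lk; apply: slt; exact: ltnW.
by exists l => //; exact: ltnW.
Qed.

Lemma grid_cell_unique t l k : (l < J)%N -> (k < J)%N ->
  s l <= t < s l.+1 -> s k <= t < s k.+1 -> l = k.
Proof.
move=> lJ kJ /andP[l1 l2] /andP[k1 k2]; apply/eqP; rewrite eqn_leq; apply/andP; split.
  rewrite leqNgt; apply/negP => kl; have := grid_le kl (ltnW lJ).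
  by move=> h; have := lt_le_trans k2 (le_trans h l1); rewrite ltxx.
rewrite leqNgt; apply/negP => lk; have := grid_le lk (ltnW kJ).
by move=> h; have := lt_le_trans l2 (le_trans h k1); rewrite ltxx.
Qed.

Let integral_cell (P : {poly R}) (a b t : R) : 0 <= a -> a < b -> 0 <= t ->
  \int[mu]_(x in `]0, t[) (\1_(`[a, b[%classic) x * P^`().[x]) =
  P.[Num.min t b] - P.[Num.min t a].
Proof.
move=> a0 ab t0.
have [ta|at_] := leP t a.
  rewrite (min_l (le_trans ta (ltW ab))) subrr Rintegral_mkcond.
  rewrite (_ : _ \_ _ = fun=> 0); first by rewrite Rintegral_cst// mul0r.
  apply/funext => x; rewrite patchE; case: ifPn => // /set_mem; rewrite /= in_itv/= => /andP[_ xt].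
  by rewrite indicE mem_setE in_itv/= leNgt (lt_le_trans xt ta)/= mul0r.
have ac : a <= Num.min t b by rewrite le_min (ltW at_) ltW.
transitivity (\int[mu]_(x in `[a, Num.min t b]) P^`().[x]).
  rewrite Rintegral_mkcond [RHS]Rintegral_mkcond; apply: Rintegral_ae_eq_any.
  have := ae_lebesgue_neq a; have := ae_lebesgue_neq (Num.min t b); apply: filterS2 => x xc xa _.
  rewrite !patchE !mem_setE !in_itv/= indicE mem_setE in_itv/=.
  rewrite [x <= _]le_eqVlt (negbTE xc)/= lt_min [a <= x]le_eqVlt eq_sym (negbTE xa)/=.
  have [ax|xa'] := ltP a x; last by rewrite mul0r; case: ifP.
  rewrite (le_lt_trans a0 ax)/=; case: (x < t) => //=.
  by case: (x < b); rewrite ?mul1r ?mul0r.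
rewrite /Rintegral (integral_derive ac (fun x _ => is_derive_poly P x) _)//.
by move=> x _; apply: derivable_continuous; exact: derivable_horner.
Qed.

(** The fundamental theorem of calculus on each cell, telescoped. *)
Lemma piecewise_poly_integral (P : nat -> {poly R}) (u w : R -> R) :
  (forall l t, (l < J)%N -> s l <= t <= s l.+1 -> u t = (P l).[t]) ->
  (forall l t, (l < J)%N -> 0 < t -> s l <= t < s l.+1 -> w t = (P l)^`().[t]) ->
  forall t, 0 <= t <= s J -> \int[mu]_(x in `]0, t[) w x = u t - u 0.
Proof.
move=> uP wP t /andP[t0 tJ].
have mD : measurable (`]0, t[%classic : set MR) by exact: measurable_itv.
transitivity (\int[mu]_(x in `]0, t[) \sum_(l < J) (\1_(`[s l, s l.+1[%classic) x * (P l)^`().[x])).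
  apply: eq_Rintegral => x /set_mem; rewrite /= in_itv/= => /andP[x0 xt].
  have [l lJ lx] := grid_cell (ltW x0) (lt_le_trans xt tJ).
  rewrite (bigD1 (Ordinal lJ))//= big1 => [|k kl].
    by rewrite addr0 indicE mem_setE in_itv/= lx mul1r; exact: wP.
  rewrite indicE mem_setE in_itv/=; case: (boolP (_ <= x < _)) => [kx|_]; last by rewrite mul0r.
  by move: kl; rewrite -val_eqE/= (grid_cell_unique lJ (ltn_ord k) lx kx) eqxx.
rewrite Rintegral_sum//; last first.
  move=> l; pose Q := fun x : R => (P l)^`().[x].
  have cQ : continuous Q by move=> x; apply: derivable_continuous; exact: derivable_horner.
  have iQ : mu.-integrable `[0, t]%classic (EFin \o Q).
    apply: continuous_compact_integrable; first exact: segment_compact.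
    exact: continuous_subspaceT.
  have iQ' : mu.-integrable `]0, t[%classic (EFin \o Q).
    by apply: integrableS iQ => //; exact: subset_itv_oo_cc.
  apply: (le_integrable mD _ _ iQ').
    apply/measurable_EFinP; apply: measurable_funTS; apply: measurable_funM.
      by apply: measurable_indic; exact: measurable_itv.
    exact: continuous_measurable_fun.
  move=> x _; rewrite lee_fin normrM indicE; case: (_ \in _); first by rewrite normr1 mul1r.
  by rewrite normr0 mul0r.
have s_ge0 l : (l <= J)%N -> 0 <= s l by move=> lJ; rewrite -s0 grid_le.
transitivity (\sum_(l < J) (u (Num.min t (s l.+1)) - u (Num.min t (s l)))).
  apply: eq_bigr => l _; have lJ := ltn_ord l.
  rewrite integral_cell ?s_ge0 ?s_lt ?(ltnW lJ)//.
  have [tl|lt_] := leP t (s l).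
    by rewrite (min_l (le_trans tl (ltW (s_lt lJ)))) !subrr.
  rewrite -!(uP l)// ?lexx ?(ltW (s_lt lJ))//.
  by rewrite le_min (ltW lt_) (ltW (s_lt lJ)) ge_min lexx orbT.
rewrite -(big_mkord xpredT (fun l => u (Num.min t (s l.+1)) - u (Num.min t (s l)))).
by rewrite telescope_sumr// (min_l tJ) s0 min_r.
Qed.

End PiecewisePrimitive.

Section TimeGrid.
Context {R : realType}.
Variables (T sigma : R) (J : nat).
Hypotheses (T0 : 0 < T) (sigma1 : 1 <= sigma) (J0 : (0 < J)%N).

Let sigma0 : 0 < sigma. Proof. exact: lt_le_trans sigma1. Qed.

Let J0' : 0 < J%:R :> R. Proof. by rewrite ltr0n. Qed.

Lemma tgrid0 : tgrid T sigma J 0 = 0.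
Proof. by rewrite /tgrid mul0r powR0 ?mul0r// gt_eqF. Qed.

Lemma tgrid_max : tgrid T sigma J J = T.
Proof. by rewrite /tgrid divff ?gt_eqF// powR1 mul1r. Qed.

Lemma tgrid_lt l k : (l < k)%N -> tgrid T sigma J l < tgrid T sigma J k.
Proof.
move=> lk; rewrite /tgrid ltr_pM2r// gt0_ltr_powR// ?nnegrE ?divr_ge0//.
by rewrite ltr_pM2r ?invr_gt0// ltr_nat.
Qed.

Lemma tgrid_le l k : (l <= k)%N -> tgrid T sigma J l <= tgrid T sigma J k.
Proof. by rewrite leq_eqVlt => /predU1P[->//|/tgrid_lt/ltW]. Qed.

Lemma tgrid_ge0 l : 0 <= tgrid T sigma J l.
Proof. by rewrite -tgrid0 tgrid_le. Qed.

Lemma tgrid_le_max l : (l <= J)%N -> tgrid T sigma J l <= T.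
Proof. by rewrite -{2}tgrid_max; exact: tgrid_le. Qed.

Lemma tgrid_inj l k : tgrid T sigma J l = tgrid T sigma J k -> l = k.
Proof.
move=> h; case: (ltngtP l k) => // /tgrid_lt; by rewrite h ltxx.
Qed.

(** Grid points do not fall inside a cell. *)
Lemma tgrid_cell l k : ~~ (tgrid T sigma J l < tgrid T sigma J k < tgrid T sigma J l.+1).
Proof.
apply/negP => /andP[h1 h2]; have [kl|lk] := leqP k l.
  by have := tgrid_le kl; rewrite leNgt h1.
by have := tgrid_le lk; rewrite leNgt h2.
Qed.

End TimeGrid.

(** * Discrete functions in time *)

Section TrialFunctions.
Context {R : realType} {d : nat}.
Local Notation E := 'rV[R]_d.
Local Notation mu := (@lebesgue_measure R).
Local Notation MR := (measurableTypeR R).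
Variable Om : set E.
Hypothesis oOm : open Om.
Variables (Ks : seq 'M[R]_(d.+1, d)) (n : nat).
Variables (T sigma : R) (J : nat).
Hypotheses (T0 : 0 < T) (sigma1 : 1 <= sigma) (J0 : (0 < J)%N).
Local Notation Sh := (fe_space0 Om Ks n).
Local Notation tg := (tgrid T sigma J).

Let mOm : measurable Om. Proof. exact: measurable_open. Qed.

Let LSh v : Sh v -> L2 Om v. Proof. by move=> [[[]]]. Qed.

Definition cell_poly (m : nat) (c : nat -> E -> R) (t : R) (x : E) : R :=
  \sum_(i < m.+1) t ^+ i * c i x.

(** A trial function is polynomial on the closed cells, pointwise in time: both
    sides are continuous in time and agree almost everywhere. *)
Lemma trial_space_coef (m : nat) U : trial_space Om Ks n m T sigma J U ->
  exists c : nat -> nat -> E -> R, (forall l i, Sh (c l i)) /\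
    forall l t, (l < J)%N -> tg l <= t <= tg l.+1 -> eqL2 Om (U t) (cell_poly m (c l) t).
Proof.
move=> [[_ _ USh Ucont] Upoly].
have U0 : Sh (U 0) by apply: USh; rewrite lexx ltW.
suff /choice[c hc] : forall l, exists c : nat -> E -> R, (forall i, Sh (c i)) /\
    forall t, (l < J)%N -> tg l <= t <= tg l.+1 -> eqL2 Om (U t) (cell_poly m c t).
  by exists c; split=> [l i|l t]; [exact: (hc l).1|exact: (hc l).2].
move=> l; have [lJ|_] := ltnP l J; last by exists (fun _ => U 0).
have [c [Sc Uc]] := Upoly l.+1 lJ.
exists (fun i => c (inord i)); split => // t _ tl.
have tT s : tg l <= s <= tg l.+1 -> 0 <= s <= T.
  move=> /andP[ls sl]; rewrite (le_trans (tgrid_ge0 _ _ _ _) ls)//=.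
  by apply: le_trans sl _; exact: tgrid_le_max.
have cE s : cell_poly m (fun i => c (inord i)) s = fun x => \sum_(i < m.+1) s ^+ i * c i x.
  by apply/funext => x; apply: eq_bigr => i _; rewrite inord_val.
have Lc i : L2 Om (c i) by exact: LSh.
have LP s : L2 Om (cell_poly m (fun i => c (inord i)) s) by rewrite cE; exact: L2_sum.
have LU s : tg l <= s <= tg l.+1 -> L2 Om (U s) by move=> sl; apply: LSh; apply: USh; exact: tT.
pose h x := U t x - cell_poly m (fun i => c (inord i)) t x.
have Lh : L2 Om h by apply: L2B => //; exact: LU.
apply: (eqL2_normB mOm (LU t tl) (LP t)); rewrite /normL2 -[fun x => _]/h.
rewrite ipL2Bl//; last exact: LU.
rewrite (_ : ipL2 Om (U t) h = ipL2 Om (cell_poly m (fun i => c (inord i)) t) h) ?subrr ?sqrtr0//.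
pose u s := ipL2 Om (U s) h.
pose p := \poly_(i < m.+1) ipL2 Om (c (inord i)) h.
have pE s : ipL2 Om (cell_poly m (fun i => c (inord i)) s) h = p.[s].
  rewrite horner_poly /cell_poly ipL2_suml//.
  by apply: eq_bigr => i _; rewrite mulrC.
rewrite pE; apply: (@eq_on_closure R u (horner p) _ _ (tgrid_lt T0 sigma1 J0 (ltnSn l)) _ _ _ t tl).
- move=> s sl eps eps0.
  have h0 : 0 < normL2 Om h + 1 by rewrite ltr_wpDl ?normL2_ge0.
  have [dl dl0 hdl] := Ucont s (tT s sl) _ (divr_gt0 eps0 h0).
  exists dl => // r rl rs; rewrite /u -ipL2Bl//; [|exact: LU|exact: LU].
  have := hdl r (tT r rl) rs; rewrite ltr_pdivlMr// => hr.
  apply: le_lt_trans hr; apply: le_trans (ipL2_CS mOm _ Lh) _.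
    by apply: L2B => //; exact: LU.
  by rewrite ler_wpM2l ?normL2_ge0// lerDl.
- by move=> s; apply: derivable_continuous; exact: derivable_horner.
- apply: filterS Uc => s Us sl; have {}Us := Us sl.
  by rewrite /u -pE cE; apply: ipL2_ae => //; exact: eqL2_refl.
Qed.

End TrialFunctions.

Section PolynomialDerivative.
Context {R : realType}.

Let deriv_Xn (i : nat) (t : R) : ('X^i : {poly R})^`().[t] = t ^+ i.-1 * i%:R.
Proof. by rewrite derivXn hornerMn hornerXn mulr_natr. Qed.

Lemma deriv_poly_sum (m : nat) (a : nat -> R) (t : R) :
  (\poly_(i < m.+1) a i)^`().[t] = \sum_(i < m) t ^+ i * (i.+1%:R * a i.+1).
Proof.
rewrite poly_def raddf_sum big_ord_recl /= derivZ expr0 derivC scaler0 add0r horner_sum.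
by apply: eq_bigr => i _; rewrite derivZ hornerZ deriv_Xn /bump/= mulrCA [a _ * _]mulrC.
Qed.

(** The values of the form B along the curve t |-> (t^i)_i. *)
Definition form_poly (m : nat) (B : nat -> nat -> R) : {poly R} :=
  \sum_(i < m) \sum_(k < m) B i k *: ('X^i * 'X^k).

Lemma horner_form_poly m B t :
  (form_poly m B).[t] = \sum_(i < m) \sum_(k < m) t ^+ i * t ^+ k * B i k.
Proof.
rewrite /form_poly horner_sum; apply: eq_bigr => i _; rewrite horner_sum.
by apply: eq_bigr => k _; rewrite hornerZ hornerM !hornerXn mulrC.
Qed.

Lemma deriv_form_poly m B t : (forall i k, B i k = B k i) ->
  (form_poly m.+1 B)^`().[t] =
  2 * \sum_(i < m.+1) \sum_(k < m) t ^+ i * (t ^+ k * k.+1%:R) * B i k.+1.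
Proof.
move=> BC.
pose D i k := t ^+ i * (t ^+ k.-1 * k%:R) * B i k.
have -> : \sum_(i < m.+1) \sum_(k < m) t ^+ i * (t ^+ k * k.+1%:R) * B i k.+1 =
    \sum_(i < m.+1) \sum_(k < m.+1) D i k.
  apply: eq_bigr => i _; rewrite [RHS]big_ord_recl /D /= !mulr0 mul0r add0r.
  by apply: eq_bigr => k _; rewrite /bump.
rewrite mulr_natl mulr2n; rewrite [X in _ + X]exchange_big/= -big_split/=.
rewrite /form_poly raddf_sum horner_sum; apply: eq_bigr => i _.
rewrite raddf_sum horner_sum -big_split/=; apply: eq_bigr => k _.
rewrite /D derivZ derivM hornerZ hornerD !hornerM !deriv_Xn !hornerXn (BC k i) -mulrDl.
by rewrite mulrC addrC [X in _ + X]mulrC.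
Qed.

End PolynomialDerivative.

(** * The discrete problem tested with the truncated velocity *)

Section DiscreteVelocity.
Context {R : realType} {d : nat}.
Local Notation E := 'rV[R]_d.
Local Notation mu := (@lebesgue_measure R).
Local Notation MR := (measurableTypeR R).
Variable Om : set E.
Hypothesis oOm : open Om.
Variables (Ks : seq 'M[R]_(d.+1, d)) (n m : nat).
Variables (T sigma : R) (J : nat).
Hypotheses (T0 : 0 < T) (sigma1 : 1 <= sigma) (J0 : (0 < J)%N).
Local Notation Sh := (fe_space0 Om Ks n).
Local Notation tg := (tgrid T sigma J).
Variable e : nat -> E -> R.
Hypothesis He : orthonormal_basis_L2 Om e.
Variables (U : R -> E -> R) (c : nat -> nat -> E -> R).
Hypothesis Sc : forall l i, Sh (c l i).
Hypothesis Uc : forall l t, (l < J)%N -> tg l <= t <= tg l.+1 ->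
  eqL2 Om (U t) (cell_poly m.+1 (c l) t).

Let mOm : measurable Om. Proof. exact: measurable_open. Qed.

Let LSh v : Sh v -> L2 Om v. Proof. by move=> [[[]]]. Qed.

Let H1Sh v : Sh v -> H1 Om v. Proof. by move=> [[]]. Qed.

Local Notation index := ('I_J * 'I_m.+1)%type.
Local Notation nu := (nodal_measure T0 J.+1 tg).

Definition velocity_coef (p : index) (x : E) : R := p.2.+1%:R * c p.1 p.2.+1 x.

Definition monomial_density (p : index) : R -> R :=
  cell_density T (fun t => t ^+ p.2) (fun t => t ^+ p.2.-1 * p.2%:R) (tg p.1) (tg p.1.+1).

Definition truncated_density (j : nat) (p : index) : R -> R :=
  if (p.1 < j)%N then monomial_density p else fun=> 0.

Local Notation g := velocity_coef.
Local Notation q := monomial_density.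
Local Notation velocity := (finite_rank (fun p => jump_sum nu (q p)) g).

Lemma L2_velocity_coef p : L2 Om (g p).
Proof. exact/(L2Z mOm)/LSh. Qed.

Let tg0 : tg 0%N = 0. Proof. exact: tgrid0. Qed.

Let tg_inj i k : (i < J.+1)%N -> (k < J.+1)%N -> tg i = tg k -> i = k.
Proof. by move=> _ _; exact: tgrid_inj. Qed.

Let tgS l : tg l < tg l.+1. Proof. exact: tgrid_lt. Qed.

Let tg_max l : (l < J)%N -> tg l.+1 <= T. Proof. exact: tgrid_le_max. Qed.

Let deriv_monomial i (x : R) : is_derive x 1 (fun t : R => t ^+ i) (x ^+ i.-1 * i%:R).
Proof.
have -> : x ^+ i.-1 * i%:R = ('X^i : {poly R})^`().[x] by rewrite derivXn hornerMn hornerXn mulr_natr.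
rewrite (_ : (fun t => _) = horner ('X^i)); first exact: is_derive_poly.
by apply/funext => t; rewrite hornerXn.
Qed.

Let cont_monomial i : continuous (fun x : R => x ^+ i.-1 * i%:R).
Proof. by move=> x; apply: cvgM; [exact: exprn_continuous|exact: cvg_cst]. Qed.

Lemma is_density_monomial (p : index) : is_density (tg p.1.+1) (q p).
Proof. by apply: is_density_cell => //; exact: tgrid_ge0. Qed.

Lemma jump_sum_monomial (p : index) t :
  jump_sum nu (q p) t = if tg p.1 <= t < tg p.1.+1 then t ^+ p.2 else 0.
Proof.
have pJ := ltn_ord p.1.
apply: jump_sum_cell => //; rewrite ?ltnS ?(ltnW pJ)//.
- exact: tgrid_ge0.
- exact: tg_max.
- by move=> j _; exact: tgrid_cell.
Qed.

Lemma mass_monomial (p : index) : \int[nu]_a q p a = 0.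
Proof.
have pJ := ltn_ord p.1.
apply: mass_cell => //; rewrite ?ltnS ?(ltnW pJ)//.
- exact: tgrid_ge0.
- exact: tg_max.
- by move=> j _; exact: tgrid_cell.
Qed.

Let sum_index (F : index -> R) : \sum_p F p = \sum_(l < J) \sum_(i < m.+1) F (l, i).
Proof. by rewrite (pair_bigA _ (fun l i => F (l, i)))/=; apply: eq_bigr => -[]. Qed.

(** On a cell only the monomials of that cell survive. *)
Lemma sum_jump_sum_monomial l t (F : nat -> nat -> R) : (l < J)%N -> tg l <= t < tg l.+1 ->
  \sum_p jump_sum nu (q p) t * F p.1 p.2 = \sum_(i < m.+1) t ^+ i * F l i.
Proof.
move=> lJ lt; rewrite sum_index (bigD1 (Ordinal lJ))//= [X in _ + X]big1 => [|k kl].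
  by rewrite addr0; apply: eq_bigr => i _; rewrite jump_sum_monomial/= lt.
rewrite big1// => i _; rewrite jump_sum_monomial/=; case: ifP => kt; last by rewrite mul0r.
have s_lt k' : (k' < J)%N -> tg k' < tg k'.+1 by move=> _; exact: tgS.
move: kl; rewrite -val_eqE/=.
by rewrite (grid_cell_unique s_lt lJ (ltn_ord k) lt kt) eqxx.
Qed.

Lemma velocityE l t : (l < J)%N -> tg l <= t < tg l.+1 ->
  velocity t = fun x => \sum_(k < m.+1) (t ^+ k * k.+1%:R) * c l k.+1 x.
Proof.
move=> lJ lt; apply/funext => x.
rewrite /finite_rank (@sum_jump_sum_monomial l t (fun l i => i.+1%:R * c l i.+1 x))//.
by apply: eq_bigr => i _; rewrite mulrA.
Qed.

Let eqL2_U l t : (l < J)%N -> tg l <= t < tg l.+1 -> eqL2 Om (U t) (cell_poly m.+1 (c l) t).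
Proof. by move=> lJ /andP[lt tl]; apply: Uc => //; rewrite lt ltW. Qed.

(** The velocity is the weak derivative of U, by the fundamental theorem of
    calculus for the coefficients of U. *)
Lemma tderiv_velocity :
  {ae mu, forall t, `]0, T[%classic t -> eqL2 Om (tderiv Om 0 T U t) (velocity t)}.
Proof.
have dq p : is_density T (q p).
  by apply: is_density_widen (is_density_monomial p); exact: tg_max (ltn_ord _).
apply: (tderiv_finite_rank mOm He T0 _ L2_velocity_coef) => [p|p|h Lh t /andP[t0 tT]].
- by have := measurable_jump_sum nu (dq p); exact.
- have [M hM] := jump_sum_bounded (nodal_measure_fin T0 J.+1 tg) (dq p).
  apply: integrable_bounded_sqr hM; by have := measurable_jump_sum nu (dq p); exact.
pose P l := \poly_(i < m.+2) ipL2 Om (c l i) h.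
rewrite (@piecewise_poly_integral R tg J tg0 _ P (fun s => ipL2 Om (U s) h)).
- by rewrite addrC subrK.
- by move=> l _; exact: tgS.
- move=> l s lJ ls; rewrite horner_poly (ipL2_ae (Uc lJ ls) (eqL2_refl Om h)) /cell_poly.
  rewrite ipL2_suml//; last by move=> i; exact: LSh.
  by apply: eq_bigr => i _; rewrite mulrC.
- move=> l s lJ s0 ls; rewrite deriv_poly_sum (velocityE lJ ls) ipL2_suml//; last by move=> i; exact: LSh.
  by apply: eq_bigr => i _; rewrite mulrA.
- by rewrite tgrid_max// (ltW t0) (ltW tT).
Qed.

Variable j : nat.
Hypothesis jJ : (1 <= j <= J)%N.
Local Notation b := (tg j).
Local Notation q' := (truncated_density j).
Local Notation V := (truncated nu b q' g).

Let j_le : (j <= J)%N. Proof. by case/andP: jJ. Qed.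

Let bT : b <= T. Proof. exact: tgrid_le_max. Qed.

Let b0 : 0 < b. Proof. by rewrite -tg0; apply: tgrid_lt => //; case/andP: jJ. Qed.

Lemma is_density_truncated (p : index) : is_density b (q' p).
Proof.
rewrite /truncated_density; case: ifP => [pj|_].
  by apply: is_density_widen (is_density_monomial p); exact: tgrid_le.
by split => //; exists 0 => a; rewrite normr0.
Qed.

Lemma mass_truncated (p : index) : \int[nu]_a q' p a = 0.
Proof.
rewrite /truncated_density; case: ifP => [_|_]; first exact: mass_monomial.
by rewrite Rintegral_cst// mul0r.
Qed.

Lemma truncated_densityE (p : index) a : a < b -> q' p a = q p a.
Proof.
move=> ab; rewrite /truncated_density; case: ltnP => // jp.
have ap : a < tg p.1 by apply: lt_le_trans ab _; exact: tgrid_le.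
rewrite /q /cell_density indicE mem_setE in_itv/= ltNge (ltW ap)/=.
by rewrite (lt_eqF ap) (lt_eqF (lt_trans ap (tgS _))) !mulr0 addr0 subr0.
Qed.

Lemma velocity_truncated t : t < b ->
  velocity t = finite_rank (fun p => jump_sum nu (q' p)) g t.
Proof.
move=> tb; apply/funext => x; apply: eq_bigr => p _; congr (_ * _).
apply: eq_Rintegral => a _; have [ab|ba] := ltP a b; first by rewrite truncated_densityE.
by rewrite indicE mem_setE in_itv/= leNgt (lt_le_trans tb ba)/= !mulr0.
Qed.

Let V_lt t : 0 < t -> t < b -> V t = velocity t.
Proof.
move=> t0 tb; rewrite velocity_truncated// -(truncatedE _ (T := T) is_density_truncated mass_truncated)//.
by rewrite /= in_itv/= t0 (lt_le_trans tb).
Qed.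

Let V_ge t : b <= t -> V t = fun=> 0.
Proof.
by move=> bt; apply/funext => x; rewrite /truncated indicE mem_setE in_itv/= [t < _]ltNge bt andbF mul0r.
Qed.

Let Sh0 : Sh (fun=> 0).
Proof.
have := fe_space0_lin oOm 0 0 (Sc 0 0) (Sc 0 0); congr (fe_space0 Om Ks n _).
by apply/funext => x; rewrite !mul0r addr0.
Qed.

Lemma test_space_truncated : test_space Om Ks n m.+1 T sigma J V.
Proof.
split.
  split; first exact: (L2t_truncated mOm (nodal_measure_fin _ _ _) is_density_truncated L2_velocity_coef T).
  apply: nearW => t; rewrite /= in_itv/= => /andP[t0 tT].
  have [tb|bt] := ltP t b; last by rewrite V_ge.
  have [l lJ lt] : exists2 l, (l < J)%N & tg l <= t < tg l.+1.
    apply: (@grid_cell R tg J tg0) => //; first exact: ltW.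
    by rewrite tgrid_max.
  by rewrite V_lt// (velocityE lJ lt); exact: (fe_space0_sum oOm _ (fun k : 'I_m.+1 => t ^+ k * k.+1%:R) (Sc 0 0) (fun k => Sc l k.+1)).
move=> [//|l] /= lJ.
have [lj|jl] := ltnP l j; last first.
  exists (fun _ => fun=> 0); split => //; apply: nearW => t.
  rewrite /tcell /= in_itv/= => /andP[lt _].
  rewrite V_ge; last by apply: le_trans (ltW lt); exact: tgrid_le.
  rewrite (_ : (fun x => _) = fun=> 0); first exact: eqL2_refl.
  by apply/funext => x; rewrite big1// => i _; rewrite mulr0.
exists (fun i x => i.+1%:R * c l i.+1 x); split.
  move=> i; have := fe_space0_lin oOm i.+1%:R 0 (Sc l i.+1) Sh0.
  by congr (fe_space0 Om Ks n _); apply/funext => x; rewrite mul0r addr0.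
apply: nearW => t; rewrite /tcell /= in_itv/= => /andP[lt tl].
rewrite V_lt.
- rewrite (@velocityE l)// ?(ltW lt) ?tl//.
  rewrite (_ : (fun x => _) = fun x => \sum_(i < m.+1) t ^+ i * (i.+1%:R * c l i.+1 x)); first exact: eqL2_refl.
  by apply/funext => x; apply: eq_bigr => i _; rewrite mulrA.
- by apply: le_lt_trans lt; exact: tgrid_ge0.
- by apply: lt_le_trans tl _; exact: tgrid_le.
Qed.

(** On each cell before t_j the integrand is half the derivative of the squared
    norm of the gradient of U. *)
Lemma integral_ipgrad_truncated :
  \int[mu]_(t in `]0, T[) ipgrad Om (U t) (V t) =
  2^-1 * (ipgrad Om (U b) (U b) - ipgrad Om (U 0) (U 0)).
Proof.
transitivity (\int[mu]_(t in `]0, b[) ipgrad Om (U t) (V t)).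
  rewrite Rintegral_mkcond [RHS]Rintegral_mkcond; apply: eq_Rintegral => t _.
  rewrite !patchE !mem_setE !in_itv/=.
  have [tb|bt] := ltP t b; first by rewrite (lt_le_trans tb bT).
  rewrite andbF; case: ifP => // _; rewrite V_ge// ipgradC; exact: ipgrad0l.
pose P l : {poly R} := 2^-1 *: form_poly m.+2 (fun i k => ipgrad Om (c l i) (c l k)).
rewrite (@piecewise_poly_integral R tg j tg0 _ P (fun s => 2^-1 * ipgrad Om (U s) (U s))).
- by rewrite mulrBr.
- by move=> l _; exact: tgS.
- move=> l t lj lt; have lJ := leq_trans lj j_le.
  rewrite hornerZ horner_form_poly (ipgrad_ae (Uc lJ lt) (Uc lJ lt)) /cell_poly.
  by rewrite ipgrad_sum2// => i; exact: H1Sh.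
- move=> l t lj t0 lt; have lJ := leq_trans lj j_le.
  have tb : t < b by case/andP: lt => _ tl; apply: lt_le_trans tl _; exact: tgrid_le.
  rewrite derivZ hornerZ deriv_form_poly; last by move=> i k; exact: ipgradC.
  rewrite mulKf ?pnatr_eq0// V_lt// (velocityE lJ lt).
  rewrite (ipgrad_ae (eqL2_U lJ lt) (eqL2_refl Om _)) /cell_poly ipgrad_sum2// => i; exact: H1Sh.
- by rewrite (ltW b0) lexx.
Qed.

Variable al : R.
Hypotheses (al0 : 0 < al) (al1 : 2 * al < 1).
Local Notation G := (gram_form Om g (plus_minus_form nu al T q')).

Lemma velocity_energy_ge0 : 0 <= G.
Proof.
exact: (gram_plus_minus_ge0 mOm He (nodal_measure_fin _ _ _) al0 al1 bT is_density_truncated mass_truncated L2_velocity_coef).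
Qed.

Lemma normHt_tderiv :
  normHt Om al `]0%R, b[ e (tderiv Om 0 T U) = (Num.sqrt (energy_ratio al * G))%:E.
Proof.
apply: (normHt_finite_rank mOm He (nodal_measure_fin _ _ _) al0 al1 b0 bT is_density_truncated mass_truncated L2_velocity_coef).
apply: filterS tderiv_velocity => t Ut; rewrite /= in_itv/= => /andP[t0 tb].
by rewrite -velocity_truncated//; apply: Ut; rewrite /= in_itv/= t0 (lt_le_trans tb).
Qed.

Lemma fracD_pairing_velocity z : L2 Om z ->
  coercivity_const al * G - velocity_const al * (b `^ (1 - 2 * al) * normL2 Om z ^+ 2) <=
  fracD_pairing Om al T (fun t x => tderiv Om 0 T U t x - z x) V.
Proof.
move=> Lz.
have dq p : is_density T (q p).
  by apply: is_density_widen (is_density_monomial p); exact: tg_max (ltn_ord _).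
apply: (fracD_pairing_coercive al0 al1 mOm He (nodal_measure_fin _ _ _) b0 bT dq is_density_truncated
  mass_truncated truncated_densityE L2_velocity_coef (is_density_origin T0) Lz).
- move=> t t0; exact: jump_sum_origin.
- move=> t; exact: frac_plus_origin.
- apply: filterS tderiv_velocity => t Ut tT; have := Ut tT.
  by apply: filterS => x /= h Ox; rewrite h.
- apply: nearW => t tT; rewrite -(truncatedE _ (T := T) is_density_truncated mass_truncated)//.
  exact: eqL2_refl.
Qed.

End DiscreteVelocity.

(** * The stability estimate *)

Section Absorption.
Context {R : realType}.

Let young_half (k N D : R) : 0 < k -> N * D <= k / 2 * N ^+ 2 + D ^+ 2 / (2 * k).
Proof.
move=> k0; have := sqr_ge0 (k * N - D); rewrite sqrrB => h.
rewrite -(ler_pM2l (_ : 0 < 2 * k)); last by rewrite mulr_gt0.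
have -> : 2 * k * (k / 2 * N ^+ 2 + D ^+ 2 / (2 * k)) = (k * N) ^+ 2 + D ^+ 2.
  by field; rewrite gt_eqF.
have -> : 2 * k * (N * D) = k * N * D *+ 2 by ring.
by rewrite -subr_ge0; move: h; lra.
Qed.

Definition absorption_const (k c : R) : R := 1 + 2 * (2 / k + 2) * (2^-1 + c + (2 * k)^-1).

Lemma absorption_const_gt0 k c : 0 < k -> 0 <= c -> 0 < absorption_const k c.
Proof.
move=> k0 c0; rewrite /absorption_const ltr_wpDr// !mulr_ge0//.
  by rewrite addr_ge0// divr_ge0// ltW.
by rewrite !addr_ge0// invr_ge0 ?mulr_ge0// ltW.
Qed.

(** Young's inequality absorbs the load into the energy. *)
Lemma energy_absorption (k c N X a B D : R) : 0 < k -> 0 <= c -> 0 <= N -> 0 <= X ->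
  0 <= a -> 0 <= B -> 0 <= D ->
  k * N ^+ 2 + 2^-1 * X ^+ 2 <= 2^-1 * a ^+ 2 + c * B ^+ 2 + N * D ->
  N + X <= absorption_const k c * (a + B + D).
Proof.
move=> k0 c0 N0 X0 a0 B0 D0 h; have yh := young_half N D k0.
set s := a + B + D; have s0 : 0 <= s by rewrite !addr_ge0.
have as_ : a ^+ 2 <= s ^+ 2 by rewrite lerXn2r ?nnegrE// /s -addrA lerDl addr_ge0.
have Bs : B ^+ 2 <= s ^+ 2 by rewrite lerXn2r ?nnegrE// /s addrAC lerDr addr_ge0.
have Ds : D ^+ 2 <= s ^+ 2 by rewrite lerXn2r ?nnegrE// /s lerDr addr_ge0.
set S := (2^-1 + c + (2 * k)^-1) * s ^+ 2.
have k2 : 0 <= (2 * k)^-1 by rewrite invr_ge0 mulr_ge0// ltW.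
have hS : k / 2 * N ^+ 2 + 2^-1 * X ^+ 2 <= S.
  have h1 := ler_wpM2l c0 Bs; have h2 := ler_wpM2l k2 Ds.
  rewrite /S (mulrDl _ _ (s ^+ 2)) (mulrDl _ _ (s ^+ 2)); move: yh h h1 h2 as_; rewrite [D ^+ 2 / _]mulrC.
  rewrite (_ : k * N ^+ 2 = k / 2 * N ^+ 2 + k / 2 * N ^+ 2); last by field.
  move: (k / 2 * _) (_^-1 * D ^+ 2) (_^-1 * s ^+ 2) (c * B ^+ 2) (c * s ^+ 2) (N * D) => x1 x2 x3 x4 x5 x6.
  by lra.
have NS : N ^+ 2 <= 2 / k * S.
  rewrite -(ler_pM2l (_ : 0 < k / 2)) ?divr_gt0//.
  rewrite (_ : k / 2 * (2 / k * S) = S); last by field; rewrite gt_eqF.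
  by apply: le_trans hS; rewrite lerDl mulr_ge0 ?sqr_ge0// invr_ge0.
have XS : X ^+ 2 <= 2 * S.
  rewrite -(ler_pM2l (_ : 0 < 2^-1 :> R)) ?invr_gt0// mulKf ?pnatr_eq0//.
  by apply: le_trans hS; rewrite lerDr mulr_ge0 ?sqr_ge0// divr_ge0// ltW.
have C0 := absorption_const_gt0 k0 c0.
rewrite -(@ler_pXn2r _ 2) ?nnegrE ?addr_ge0 ?mulr_ge0// ?(ltW C0)//.
apply: (@le_trans _ _ (2 * (N ^+ 2 + X ^+ 2))).
  by have := sqr_ge0 (N - X); rewrite sqrrB sqrrD; lra.
apply: (@le_trans _ _ (2 * (2 / k + 2) * S)).
  by rewrite -mulrA ler_wpM2l// mulrDl lerD.
rewrite exprMn /S mulrA ler_wpM2r ?sqr_ge0//.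
have : 0 <= 2 * (2 / k + 2) * (2^-1 + c + (2 * k)^-1).
  rewrite !mulr_ge0//; first by rewrite addr_ge0// divr_ge0// ltW.
  by rewrite !addr_ge0// invr_ge0.
rewrite /absorption_const; move: (_ * _) => x x0; rewrite sqrrD expr1n mul1r.
by have := sqr_ge0 x; lra.
Qed.

End Absorption.

Section Constants.
Context {R : realType}.
Implicit Types al : R.

Definition coercivity_ratio al : R := coercivity_const al / (energy_ratio al + 1).

Definition stability_const al : R := absorption_const (coercivity_ratio al) (velocity_const al).

Variable al : R.
Hypotheses (al0 : 0 < al) (al1 : 2 * al < 1).

Lemma coercivity_ratio_gt0 : 0 < coercivity_ratio al.
Proof.
rewrite /coercivity_ratio /coercivity_const divr_gt0//.
  by rewrite mulr_gt0// invr_gt0 exprn_gt0// Gamma_gt0.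
by rewrite ltr_wpDl// energy_ratio_ge0.
Qed.

Lemma velocity_const_ge0 : 0 <= velocity_const al.
Proof.
rewrite /velocity_const /coercivity_const !mulr_ge0 ?start_const_ge0//.
- by rewrite invr_ge0 exprn_ge0// ltW// Gamma_gt0.
- by rewrite ltW// increment_const_gt0.
- by rewrite invr_ge0 ltW// beta_const_gt0.
Qed.

Lemma coercivity_ratio_le (G : R) : 0 <= G ->
  coercivity_ratio al * Num.sqrt (energy_ratio al * G) ^+ 2 <= coercivity_const al * G.
Proof.
move=> G0; have er0 := energy_ratio_ge0 al0 al1.
have er1 : 0 < energy_ratio al + 1 by rewrite ltr_wpDl.
rewrite (sqr_sqrtr (mulr_ge0 er0 G0)) /coercivity_ratio mulrA ler_wpM2r//.
rewrite mulrAC ler_pdivrMr// ler_wpM2l//; last by rewrite lerDl.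
by rewrite /coercivity_const mulr_ge0// ?invr_ge0// exprn_ge0// ltW// Gamma_gt0.
Qed.

End Constants.

Lemma energy_balance (R : realFieldType) (x1 x2 x3 x4 ND X a P Y : R) :
  x3 - x2 <= P -> x4 <= x3 -> P + 2^-1 * (X - Y) <= ND -> Y <= a -> x2 <= x1 ->
  x4 + 2^-1 * X <= 2^-1 * a + x1 + ND.
Proof. lra. Qed.

Theorem theorem4p1 (R : realType) (gamma T : R) (m n : nat) (rho : R)
    (hgamma : 1 < gamma < 2) (hT : 0 < T) (hm : (0 < m)%N) (hn : (0 < n)%N) :
  let gamma0 := (gamma - 1) / 2 in
  exists2 C : R, 0 < C &
    forall (d : nat) (Om : set 'rV[R]_d) (Ks : seq 'M[R]_(d.+1, d))
      (sigma : R) (J : nat) (e : nat -> 'rV[R]_d -> R)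
      (Rh Pih : ('rV[R]_d -> R) -> 'rV[R]_d -> R)
      (u0 u1 : 'rV[R]_d -> R) (f : (R -> 'rV[R]_d -> R) -> R)
      (U : R -> 'rV[R]_d -> R),
    (d = 2 \/ d = 3)%N ->
    polytopal_domain Om ->
    triangulation Om Ks ->
    shape_regular rho Ks ->
    1 <= sigma ->
    (0 < J)%N ->
    orthonormal_basis_L2 Om e ->
    Ritz_projection Om Ks n Rh ->
    L2_projection Om Ks n Pih ->
    H10 Om u0 ->
    L2 Om u1 ->
    dualHt Om gamma0 `]0, T[ e f ->
    discrete_solution Om Ks n m T sigma J gamma Rh Pih u0 u1 f U ->
    forall j : nat, (1 <= j <= J)%N ->
      let tj := tgrid T sigma J j in
      (normHt Om gamma0 `]0%R, tj[ e (tderiv Om 0 T U) +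
         (normH10 Om (U tj))%:E <=
       C%:E * ((normH10 Om u0 + tj `^ (2^-1 - gamma0) * normL2 Om u1)%:E +
               dual_normHt Om gamma0 `]0%R, tj[ e f))%E.
Proof.
case: m hm => // m _ al.
have al0 : 0 < al by rewrite /al; case/andP: hgamma => *; lra.
have al1 : 2 * al < 1 by rewrite /al; case/andP: hgamma => *; lra.
have C0 : 0 < stability_const al.
  exact: absorption_const_gt0 (coercivity_ratio_gt0 al0 al1) (velocity_const_ge0 al0 al1).
exists (stability_const al) => //.
move=> d Om Ks sigma J e Rh Pih u0 u1 f U _ [oOm _ _ _ _] _ _ sigma1 J0 He HRh HPih Hu0 Lu1 Hf.
rewrite /discrete_solution -/al => -[trialU U0E eqU] j jJ /=.
have mOm := measurable_open oOm.
have [c [Sc Uc]] := trial_space_coef oOm hT sigma1 J0 trialU.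
have [LP leP] := L2_projection_le oOm HPih Lu1.
have /andP[j0 jJ'] := jJ.
have tg0 : tgrid T sigma J 0 = 0 by exact: tgrid0.
have b0 : 0 < tgrid T sigma J j by rewrite -[X in X < _]tg0; exact: tgrid_lt.
have bT : tgrid T sigma J j <= T by exact: tgrid_le_max.
have dq := @is_density_truncated R m T sigma J hT sigma1 J0 j.
have q0 := @mass_truncated R m T sigma J hT sigma1 J0 j.
have Lg := L2_velocity_coef (m := m) (J := J) oOm Sc.
have G0 := velocity_energy_ge0 oOm m hT sigma1 J0 He Sc jJ al0 al1.
have NE := normHt_tderiv oOm hT sigma1 J0 He Sc Uc jJ al0 al1.
have pairing := fracD_pairing_velocity oOm hT sigma1 J0 He Sc Uc jJ al0 al1 LP.
have energy := integral_ipgrad_truncated oOm hT sigma1 J0 Sc Uc jJ.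
have := eqU _ (test_space_truncated oOm m hT sigma1 J0 Sc jJ).
have nu_fin := nodal_measure_fin hT J.+1 (tgrid T sigma J).
have D0 := dual_normHt_multiple mOm He nu_fin al0 al1 b0 bT dq q0 Lg Hf (lexx 0).
rewrite mul0r ler01 mul0r in D0; have {}D0 := D0 isT.
have fV D := @dual_normHt_truncated _ _ _ mOm _ He _ nu_fin _ al0 al1 _ _ b0 bT _ _ _ dq q0 Lg f D Hf.
rewrite energy NE; set V := truncated _ _ _ _ in pairing fV *.
move: (gram_form _ _ _) G0 pairing fV => G G0 pairing fV.
move ED : (dual_normHt _ _ _ _ _) D0 fV => [D| |]; first last.
- by [].
(* the bound is trivial when the dual norm is infinite *)
- by move=> _ _ _; rewrite addey// gt0_muley ?lte_fin// leey.
rewrite lee_fin => D0 /(_ D erefl) fV Veq.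
rewrite -!EFinD -EFinM lee_fin.
have B0 : 0 <= tgrid T sigma J j `^ (2^-1 - al) * normL2 Om u1.
  by rewrite mulr_ge0 ?powR_ge0 ?normL2_ge0.
apply: energy_absorption => //; try exact: sqrtr_ge0.
- exact: coercivity_ratio_gt0.
- exact: velocity_const_ge0.
have Ble : tgrid T sigma J j `^ (1 - 2 * al) * normL2 Om (Pih u1) ^+ 2 <=
    (tgrid T sigma J j `^ (2^-1 - al) * normL2 Om u1) ^+ 2.
  rewrite exprMn -[X in _ <= X * _]powR_mulrn ?powR_ge0// -powRrM.
  rewrite (_ : (2^-1 - al) * 2%:R = 1 - 2 * al); last by field.
  by rewrite ler_wpM2l ?powR_ge0// lerXn2r ?nnegrE ?normL2_ge0.
have U0le : ipgrad Om (U 0) (U 0) <= normH10 Om u0 ^+ 2.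
  by rewrite normH10_sqr (ipgrad_ae U0E U0E); exact: (Ritz_projection_le oOm HRh Hu0).
have kG := coercivity_ratio_le al0 al1 G0.
have fle := le_trans (ler_norm (f V)) fV; rewrite -Veq in fle.
have := ler_wpM2l (velocity_const_ge0 al0 al1) Ble.
rewrite -(normH10_sqr Om (U (tgrid _ _ _ _))) in fle.
exact: (energy_balance pairing kG fle U0le).
Qed.
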